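(* Let $q\equiv1\pmod 4$ be a prime power and let $c_0,c_1\in\mathbb F_q[t]$ be coprime, monic, square-free polynomials. Then $$\mathcal Z(\mathbf s;c_0,c_1)=\prod_{\substack{k\ge0\\ k\text{ even}}}L\left(\tfrac12+s_0+k\delta(\mathbf s),\chi_{c_0}\right)L\left(\tfrac12+s_1+k\delta(\mathbf s),\chi_{c_1}\right)\cdot\prod_{\substack{k\ge0\\ k\text{ odd}}}L\left(\tfrac12+s_0+k\delta(\mathbf s),\chi_{c_1}\right)L\left(\tfrac12+s_1+k\delta(\mathbf s),\chi_{c_0}\right)$$ for $\mathrm{Re}(\delta(\mathbf s))>0$, except for simple poles among $q^{1/2-s_i-k\delta(\mathbf s)}=1$ when $c_0$ or $c_1$ is $1$.
   Context: $\mathbf s=(s_0,s_1)\in\mathbb C^2$, $\delta(\mathbf s)=s_0+s_1$, $|m|=q^{\deg m}$. $\left(\frac ab\right)$ is the quadratic residue symbol on $\mathbb F_q[t]$ and $\chi_a(b)=\left(\frac ab\right)$. For a polynomial $c$ and monic irreducible $\pi$, $v_\pi(c)$ is the exponent of $\pi$ in $c$, and $c^{(\pi)}$ is the part of $c$ coprime to $\pi$. $L(s,\chi_c)=\sum_m\chi_c(m)|m|^{-s}$ (sum over monic $m$), continued meromorphically; for $c=1$ it equals $(1-q^{1-s})^{-1}$. $(a;p)_\infty=\prod_{k\ge0}(1-ap^k)$. The normalized $\pi$-parts for $\widetilde A_1$ (simple roots $\alpha_0,\alpha_1$, $\delta=\alpha_0+\alpha_1$, $\mathbf x=(x_0,x_1)$,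 $\mathbf x^\delta=x_0x_1$, $n=2$). For a weight $\omega=l_0\omega_0+l_1\omega_1$ ($l_i\ge0$), let the infinite dihedral Weyl group $W=\langle\sigma_0,\sigma_1\rangle$ act on the right on rational functions by $f\vert_\omega\sigma_i(\mathbf x)=-x_i^{2+l_i}\frac{1-u/x_i}{1-ux_i}f(\sigma_i\mathbf x)$ if $l_i$ is even and $-x_i^{1+l_i}f(\sigma_i\mathbf x)$ if $l_i$ is odd, where $\sigma_i\mathbf x$ is given by $x_i\mapsto x_i^{-1}$, $x_{1-i}\mapsto x_{1-i}x_i^2$. Set $\Delta(\mathbf x)=(x_0^2;\mathbf x^{2\delta})_\infty(x_1^2;\mathbf x^{2\delta})_\infty(\mathbf x^{2\delta};\mathbf x^{2\delta})_\infty$, $Z_\omega(\mathbf x;u)=\Delta(\mathbf x)^{-1}\sum_{\sigma\in W}1\vert_\omega\sigma(\mathbf x)$, $\widetilde Z_0(\mathbf x;u)=Z_0(\mathbf x;u)/(u^2\mathbf x^\delta;\mathbf x^{2\delta})_\infty$ and $\widetilde Z_{\omega_i}=Z_{\omega_i}$ for $i=0,1$. The multiple Dirichlet series is $\mathcal Z(\mathbf s;c_0,c_1)=\sum_{m_0,m_1}H(m_0,m_1;c_0,c_1)|m_0|^{-s_0}|m_1|^{-s_1}$ (sum over pairs of monic polynomials, $\mathrm{Re}(s_i)$ large), where $H(m_0,m_1;c_0,c_1)=\prod_{\pi}H(\pi^{k_0},\pi^{k_1};\pi^{v_\pi(c_0)},\pi^{v_\pi(c_1)})\chi_{c_0^{(\pi)}}(\pi^{k_0})\chi_{c_1^{(\pi)}}(\pi^{k_1})$,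 with $\pi^{k_i}$ the exact power of $\pi$ dividing $m_i$, and $\sum_{k_0,k_1\ge0}H(\pi^{k_0},\pi^{k_1};\pi^{v_\pi(c_0)},\pi^{v_\pi(c_1)})x_0^{k_0}x_1^{k_1}=\widetilde Z_{\omega_\pi}(\mathbf x;|\pi|^{-1/2})$, $\omega_\pi=v_\pi(c_0)\omega_0+v_\pi(c_1)\omega_1$. Equivalently, as an Euler product over monic irreducible $\pi$, $\mathcal Z(\mathbf s;c_0,c_1)=\prod_\pi\widetilde Z_{\omega_\pi}\big(|\pi|^{-s_0}\chi_{c_0^{(\pi)}}(\pi),|\pi|^{-s_1}\chi_{c_1^{(\pi)}}(\pi);|\pi|^{-1/2}\big)$. *)

(* Defs.v *)
From HB Require Import structures.
From mathcomp Require Import all_boot all_order all_algebra.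
From mathcomp Require Import complex finmap.
From mathcomp Require Import all_classical all_reals all_analysis.
From mathcomp Require Import summability.

Set Implicit Arguments.
Unset Strict Implicit.
Unset Printing Implicit Defensive.

Import Order.TTheory GRing.Theory Num.Theory.
Import numFieldNormedType.Exports.

Local Open Scope classical_set_scope.
Local Open Scope ring_scope.

(* Packing R[i] as a numClosedFieldType gives it the topology and the
   normed-module structure that MathComp-Analysis puts on any numeric field. *)
Definition Cplx (R : realType) : numClosedFieldType := R[i].

(* The indices 0 and 1 are encoded by the booleans false and true. *)
Definition coord01 (T : Type) (i : bool) (x : T * T) : T := if i then x.2 else x.1.

Section Analysis.
Variable R : realType.
Local Notation C := (Cplx R).

Definition cexp (z : C) : C :=
  ((expR (complex.Re z) * cos (complex.Im z)) +i*
   (expR (complex.Re z) * sin (complex.Im z)))%C.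

(* a ^ z, for a > 0 *)
Definition cpow (a : R) (z : C) : C := cexp (z * (ln a)%:C%C).

(* Convergence along the finite subsets of I: over the complex numbers this is
   absolute convergence. *)
Definition has_sum (I : choiceType) (f : I -> C) (l : C) : Prop :=
  partial_sum f @ totally --> l.

Section Meromorphic.
Variable V : normedModType C.
Implicit Types (f g h : V -> C) (p : V) (D : set V).

Definition holomorphic_at f p : Prop := \forall z \near p, differentiable f z.

(* f agrees with a holomorphic function near p, off the zeros of a nonzero
   holomorphic germ *)
Definition regular_at f p : Prop :=
  exists g h, [/\ holomorphic_at g p, holomorphic_at h p,
    ~ (\forall z \near p, h z = 0) &
    \forall z \near p, h z != 0 -> f z = g z].

(* Locally a quotient of holomorphic functions.  Functions are total, so the
   values at the poles are meaningless; the second clause asks for the right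
   values everywhere else, so that the poles of f are exactly the points where
   f is not holomorphic. *)
Definition meromorphic_on D f : Prop := forall p, D p ->
  (exists g h, [/\ holomorphic_at g p, holomorphic_at h p,
     ~ (\forall z \near p, h z = 0) &
     \forall z \near p, h z != 0 -> f z = g z / h z]) /\
  (regular_at f p -> holomorphic_at f p).

(* The poles of f in D lie on the hypersurfaces P i = 0, and f has order at
   most one along each of them (several may meet at the same point p). *)
Definition simple_poles_among (I : eqType) (P : I -> V -> C) D f : Prop :=
  forall p, D p -> exists J : seq I,
    [/\ uniq J, (forall i, i \in J -> P i p = 0) &
    exists g, holomorphic_at g p /\
      \forall z \near p, \prod_(i <- J) P i z != 0 ->
        f z * \prod_(i <- J) P i z = g z].

End Meromorphic.

(* The coefficients of the power series of f at the origin.  The coordinate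
   axes are avoided because the formulas for f below divide by x_0 and x_1. *)
Definition is_expansion (f : C * C -> C) (a : nat * nat -> C) : Prop :=
  \forall x \near (0 : C * C), x.1 != 0 -> x.2 != 0 ->
    has_sum (fun k : nat * nat => a k * x.1 ^+ k.1 * x.2 ^+ k.2) (f x).

Definition expansion (f : C * C -> C) : nat * nat -> C :=
  xget (fun=> 0) [set a | is_expansion f a].

Definition qpochhammer (a p : C) : C :=
  limn (fun n : nat => \prod_(k < n) (1 - a * p ^+ k) : C).

Section LocalPart.
Variables (l : nat * nat) (u : C).

Definition reflect_var (i : bool) (x : C * C) : C * C :=
  if i then (x.1 * x.2 ^+ 2, x.2^-1) else (x.1^-1, x.2 * x.1 ^+ 2).

(* Rational functions are evaluated pointwise.  In slash_one below the factors
   are evaluated at the monomials of positive real roots, so no denominator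
   vanishes when x is close to the origin and off the coordinate axes. *)
Definition slash (f : C * C -> C) (i : bool) : C * C -> C := fun x =>
  (if odd (coord01 i l) then - coord01 i x ^+ (1 + coord01 i l)
   else - coord01 i x ^+ (2 + coord01 i l) *
          ((1 - u / coord01 i x) / (1 - u * coord01 i x))) *
  f (reflect_var i x).

(* Each element of the infinite dihedral_word group W has exactly one reduced word
   in the generators, namely an alternating one. *)
Definition dihedral_word : Type := {w : seq bool | sorted (fun i j => i != j) w}.
HB.instance Definition _ := Choice.on dihedral_word.

Definition slash_one (w : dihedral_word) : C * C -> C :=
  foldl slash (fun=> 1) (val w).

Definition Delta (x : C * C) : C :=
  let p := (x.1 * x.2) ^+ 2 in
  qpochhammer (x.1 ^+ 2) p * qpochhammer (x.2 ^+ 2) p * qpochhammer p p.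

Definition Zpart (x : C * C) : C :=
  (Delta x)^-1 * (summability.sum (fun w : dihedral_word => slash_one w x) : C).

(* The normalization is only specified for l = (0,0), (1,0) and (0,1), which
   are the only weights that occur for coprime square-free c_0 and c_1. *)
Definition Zpart_normalized (x : C * C) : C :=
  if l == (0%N, 0%N)
  then Zpart x / qpochhammer (u ^+ 2 * (x.1 * x.2)) ((x.1 * x.2) ^+ 2)
  else Zpart x.

End LocalPart.

Section Arithmetic.
Variable F : finFieldType.
Implicit Types (a b c d m p : {poly F}).

Definition squarefree_poly c : Prop := forall d, d ^+ 2 %| c -> size d = 1%N.

Definition monic_irreducible : set {poly F} :=
  [set p | p \is monic /\ irreducible_poly p].

Definition pnorm m : R := #|F|%:R ^+ (size m).-1.

Definition vpoly p c : nat := \max_(k < size c | p ^+ k %| c) k.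

Definition coprime_part p c : {poly F} := c %/ p ^+ vpoly p c.

Definition legendre a p : int :=
  if p %| a then 0
  else if `[< exists b, p %| b ^+ 2 - a >] then 1 else -1.

Definition residue_symbol a b : int :=
  \big[*%R/1]_(p \in monic_irreducible) legendre a p ^+ vpoly p b.

Definition chi a b : C := (residue_symbol a b)%:~R.

Definition monic_poly : Type := {m : {poly F} | m \is monic}.
HB.instance Definition _ := Choice.on monic_poly.

Definition is_Lquadratic c (L : C -> C) : Prop :=
  meromorphic_on setT L /\
  forall s : C, 1 < complex.Re s ->
    has_sum (fun m : monic_poly => chi c (val m) * cpow (pnorm (val m)) (- s))
            (L s).

Definition Lquadratic c : C -> C := xget (fun=> 0) [set L | is_Lquadratic c L].

Definition Hlocal p (k : nat * nat) c0 c1 : C :=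
  expansion (Zpart_normalized (vpoly p c0, vpoly p c1)
                              ((pnorm p `^ (- 2^-1))%:C%C)) k.

Definition Hcoef m0 m1 c0 c1 : C :=
  \big[*%R/1]_(p \in monic_irreducible)
    (Hlocal p (vpoly p m0, vpoly p m1) c0 c1 *
     chi (coprime_part p c0) (p ^+ vpoly p m0) *
     chi (coprime_part p c1) (p ^+ vpoly p m1)).

Definition delta01 (s : C * C) : C := s.1 + s.2.

(* The meromorphic continuation to Re(delta(s)) > 0 of the multiple Dirichlet
   series; it is unique away from its poles. *)
Definition is_multiple_Dirichlet c0 c1 (Z : C * C -> C) : Prop :=
  meromorphic_on [set s : C * C | 0 < complex.Re (delta01 s)] Z /\
  exists B : R, forall s : C * C, B < complex.Re s.1 -> B < complex.Re s.2 ->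
    has_sum (fun m : monic_poly * monic_poly =>
               Hcoef (val m.1) (val m.2) c0 c1 *
               cpow (pnorm (val m.1)) (- s.1) * cpow (pnorm (val m.2)) (- s.2))
            (Z s).

(* Its zeros are the solutions of q ^ (1/2 - s_i - k delta(s)) = 1. *)
Definition polar_equation (ik : bool * nat) (s : C * C) : C :=
  1 - cpow #|F|%:R (2^-1 - coord01 ik.1 s - ik.2%:R * delta01 s).

End Arithmetic.
End Analysis.

(* Main.v *)
Require Import Defs.
From HB Require Import structures.
From mathcomp Require Import all_boot all_order all_algebra.
From mathcomp Require Import fingroup cyclic qpoly qfpoly finfield closed_field.
From mathcomp Require Import complex finmap.
From mathcomp Require Import all_classical all_reals all_analysis.
From mathcomp Require Import summability.
From mathcomp Require Import ring lra zify.
Set Implicit Arguments.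
Unset Strict Implicit.
Unset Printing Implicit Defensive.
Import Order.TTheory GRing.Theory Num.Theory.
Import numFieldNormedType.Exports.
Local Open Scope classical_set_scope.
Local Open Scope ring_scope.

(* Put X = x_0 x_1.  The dihedral group is enumerated by the integers, and the
   sum over it becomes a bilateral series with an explicit quotient of
   consecutive terms; its functional equation in u and Jacobi's triple product
   sum it in closed form, and the normalized local part is the product of the
   1 / (1 - u x_i X^k) over the (i, k) with l_(i+k) = 0.  At x_i = +-|pi|^(-s_i)
   the signs, which square to 1, combine so that this is the product of the Euler
   factors at pi of L(1/2 + s_i + k delta, chi_(c_(i+k))).  Absolute convergence
   for Re s_i > 2 allows the products over pi and over (i, k) to be interchanged.

   By reciprocity (Euler's criterion, applied at the roots of c) chi_c is
   periodic modulo c, so L(s, chi_c) is a polynomial in q^(-s) if c <> 1 and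
   1 / (1 - q^(1-s)) if c = 1.  Infinite products of such polynomials, evaluated
   at geometrically decaying arguments, converge to holomorphic functions on
   Re delta > 0; poles can only come from the denominators, and they do occur
   because the numerator does not vanish identically on the line where a given
   denominator vanishes.

   The L-functions are specified by meromorphic continuation, hence the need for
   an identity theorem; it is obtained from Goursat's bisection argument applied
   to trapezoid sums, without integration. *)

(** * The complex modulus and unordered sums *)

Section Modulus.
Variable R : realType.
Local Notation C := (Cplx R).
Implicit Types (x y z : C) (a b e r : R).

(** That a locally uniform limit of holomorphic functions of two variables is holomorphic would call
    for Cauchy's integral formula. Instead, the partial products carry bounds on their values, on
    candidate partial derivatives and on the quadratic remainder. These bounds are stable under
    sums, products and pointwise limits, and the limiting inequality is differentiability itself.
    The L-functions and the local coefficients are chosen by [xget], as some object with a given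
    property and 0 if there is none. Each therefore needs an existence proof and a uniqueness
    theorem: meromorphic continuation for [Lquadratic], power series off the axes for [expansion].
    One abstract Euler product, indexed by finitely supported exponents, serves three times: for the
    expansion of the local factors, for the L-functions and for the double series. The congruence q
    = 1 mod 4 makes (q - 1)/2 even, so reciprocity holds without a sign. Functions are total, and
    meromorphy demands holomorphy wherever a holomorphic extension exists; so a zero of the
    denominator of the continuation has to be proved a genuine singularity. *)

Definition nrm z : R := complex.Re `|z|.
(** Norms in a numeric field take values in the field itself; [nrm] and [rC] bring estimates down to
    R, where [lra] and [nra] decide them. *)
Definition rC a : C := (a%:C)%C.

Lemma nrmE z : `|z| = rC (nrm z).
Proof. by rewrite /nrm /rC RRe_real // normr_real. Qed.
Lemma rCD a b : rC (a + b) = rC a + rC b. Proof. exact: rmorphD. Qed.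
Lemma rCB a b : rC (a - b) = rC a - rC b. Proof. exact: rmorphB. Qed.
Lemma rCN a : rC (- a) = - rC a. Proof. exact: rmorphN. Qed.
Lemma rCM a b : rC (a * b) = rC a * rC b. Proof. exact: rmorphM. Qed.
Lemma rCV a : rC a^-1 = (rC a)^-1. Proof. exact: fmorphV. Qed.
Lemma rCX a n : rC (a ^+ n) = rC a ^+ n. Proof. exact: rmorphXn. Qed.
Lemma rC0 : rC 0 = 0. Proof. by []. Qed.
Lemma rC1 : rC 1 = 1. Proof. by []. Qed.
Lemma rCn n : rC n%:R = n%:R. Proof. exact: rmorph_nat. Qed.
Lemma rC_le a b : (rC a <= rC b) = (a <= b). Proof. exact: lecR. Qed.
Lemma rC_lt a b : (rC a < rC b) = (a < b). Proof. exact: ltcR. Qed.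
Lemma rC_inj : injective rC. Proof. exact: complexI. Qed.
Lemma rC_eq0 a : (rC a == 0) = (a == 0).
Proof. by rewrite -rC0 (inj_eq rC_inj). Qed.
Lemma nrm_rC a : nrm (rC a) = `|a|.
Proof. by rewrite /nrm normc_def /= expr0n addr0 sqrtr_sqr. Qed.
Lemma nrm_pos a : 0 <= a -> nrm (rC a) = a.
Proof. by move=> a0; rewrite nrm_rC ger0_norm. Qed.
Lemma nrm_ge0 z : 0 <= nrm z.
Proof. by rewrite -rC_le -nrmE rC0. Qed.
Lemma nrm0 : nrm 0 = 0. Proof. by rewrite /nrm normr0. Qed.
Lemma nrm1 : nrm 1 = 1. Proof. by rewrite /nrm normr1. Qed.
Lemma nrm_eq0 z : (nrm z == 0) = (z == 0).
Proof. by rewrite -rC_eq0 -nrmE normr_eq0. Qed.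
Lemma nrm_gt0 z : (0 < nrm z) = (z != 0).
Proof. by rewrite lt_def nrm_ge0 andbT nrm_eq0. Qed.
Lemma nrmM x y : nrm (x * y) = nrm x * nrm y.
Proof. by apply: rC_inj; rewrite rCM -!nrmE normrM. Qed.
Lemma nrmV x : nrm x^-1 = (nrm x)^-1.
Proof. by apply: rC_inj; rewrite rCV -!nrmE normfV. Qed.
Lemma nrmX x n : nrm (x ^+ n) = nrm x ^+ n.
Proof. by apply: rC_inj; rewrite rCX -!nrmE normrX. Qed.
Lemma nrmN x : nrm (- x) = nrm x.
Proof. by rewrite /nrm normrN. Qed.
Lemma nrmD x y : nrm (x + y) <= nrm x + nrm y.
Proof. by rewrite -rC_le rCD -!nrmE ler_normD. Qed.
Lemma nrmB x y : nrm (x - y) <= nrm x + nrm y.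
Proof. by rewrite -(nrmN y) nrmD. Qed.
Lemma nrm_sub x y : nrm (x - y) = nrm (y - x).
Proof. by rewrite -nrmN opprB. Qed.
Lemma nrm_subD z x y : nrm (x - y) <= nrm (x - z) + nrm (z - y).
Proof. by rewrite -[x - y](subrKA z) nrmD. Qed.
Lemma nrm_tri z x y : nrm (x - y) <= nrm (x - z) + nrm (y - z).
Proof. by rewrite (nrm_sub y); exact: nrm_subD. Qed.
Lemma nrm_subl x y : nrm x - nrm y <= nrm (x - y).
Proof. by rewrite lerBlDr; apply: le_trans (nrmD _ _); rewrite subrK. Qed.
Lemma nrm_nat n : nrm n%:R = n%:R.
Proof. by rewrite -rCn nrm_pos. Qed.
Lemma nrm_sum (I : Type) (s : seq I) (P : pred I) (F : I -> C) :
  nrm (\sum_(i <- s | P i) F i) <= \sum_(i <- s | P i) nrm (F i).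
Proof.
elim/big_rec2 : _ => [|i y1 y2 _ h]; first by rewrite nrm0.
by apply: le_trans (nrmD _ _) _; rewrite lerD2l.
Qed.
Lemma nrm_prod (I : Type) (s : seq I) (P : pred I) (F : I -> C) :
  nrm (\prod_(i <- s | P i) F i) = \prod_(i <- s | P i) nrm (F i).
Proof. by apply: (big_morph nrm nrmM nrm1). Qed.
Lemma nrm_Re z : `|complex.Re z| <= nrm z.
Proof. by rewrite -rC_le -nrmE; exact: normc_ge_Re. Qed.
Lemma nrm_Im z : `|complex.Im z| <= nrm z.
Proof.
rewrite /nrm normc_def /= -sqrtr_sqr ler_wsqrtr // lerDr sqr_ge0 //.
Qed.
Lemma cReD x y : complex.Re (x + y) = complex.Re x + complex.Re y.
Proof. by case: x y => [? ?] [? ?]. Qed.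
Lemma cImD x y : complex.Im (x + y) = complex.Im x + complex.Im y.
Proof. by case: x y => [? ?] [? ?]. Qed.
Lemma cReN x : complex.Re (- x) = - complex.Re x.
Proof. by case: x => [? ?]. Qed.
Lemma cImN x : complex.Im (- x) = - complex.Im x.
Proof. by case: x => [? ?]. Qed.
Lemma cReM x y : complex.Re (x * y) =
  complex.Re x * complex.Re y - complex.Im x * complex.Im y.
Proof. by case: x y => [? ?] [? ?]. Qed.
Lemma cImM x y : complex.Im (x * y) =
  complex.Re x * complex.Im y + complex.Im x * complex.Re y.
Proof. by case: x y => [? ?] [? ?]. Qed.
Lemma Re_nat n : complex.Re (n%:R : C) = n%:R.
Proof. by rewrite -rCn. Qed.
Lemma Im_nat n : complex.Im (n%:R : C) = 0.
Proof. by rewrite -rCn. Qed.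
Lemma C_eq x y : complex.Re x = complex.Re y -> complex.Im x = complex.Im y -> x = y.
Proof. by case: x y => [? ?] [? ?] /= -> ->. Qed.
Lemma nrm_le_ReIm z : nrm z <= `|complex.Re z| + `|complex.Im z|.
Proof.
rewrite [z]complexE; apply: le_trans (nrmD _ _) _.
rewrite nrmM cReD cImD.
have h : nrm 'i%C = 1.
  by rewrite /nrm normc_def /= expr0n expr1n add0r sqrtr1.
by rewrite h mul1r !nrm_rC /= !(mul0r, mulr0, mul1r, addr0, subr0, add0r).
Qed.

Lemma le_eps a b : (forall e, 0 < e -> a <= b + e) -> a <= b.
Proof. by move=> h; apply/ler_addgt0Pr => e /h. Qed.

Lemma posC_ex (e : C) : 0 < e -> exists2 r : R, 0 < r & e = rC r.
Proof.
move=> e0; have er : e \is Num.real by rewrite gtr0_real.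
exists (complex.Re e); last by rewrite /rC RRe_real.
by rewrite -rC_lt /rC RRe_real.
Qed.

Lemma nearCP (p : C) (P : set C) :
  (\forall z \near p, P z) <->
  exists2 r : R, 0 < r & forall z, nrm (z - p) < r -> P z.
Proof.
split.
  rewrite -nbhs_nearE nbhs_ballP => -[e /= /posC_ex[r r0 ->] h].
  exists r => // z zp; apply: h; rewrite -ball_normE /= nrmE rC_lt nrm_sub //.
move=> [r r0 h]; rewrite -nbhs_nearE nbhs_ballP; exists (rC r) => /=.
  by rewrite -rC0 rC_lt.
by move=> z; rewrite -ball_normE /= nrmE rC_lt nrm_sub; apply: h.
Qed.

Lemma nearC2P (p : C * C) (P : set (C * C)) :
  (\forall z \near p, P z) <->
  exists2 r : R, 0 < r &
    forall z : C * C, nrm (z.1 - p.1) < r -> nrm (z.2 - p.2) < r -> P z.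
Proof.
split.
  rewrite -nbhs_nearE => -[[A B] /= [/nearCP[r r0 hA] /nearCP[r' r'0 hB]] hP].
  exists (Num.min r r'); first by rewrite lt_min r0.
  move=> z'; rewrite !lt_min => /andP[h1 h1'] /andP[h2 h2'].
  by apply: (hP z'); split; [apply: hA | apply: hB].
move=> [r r0 h]; rewrite -nbhs_nearE.
exists ([set z : C | nrm (z - p.1) < r], [set z : C | nrm (z - p.2) < r]) => /=.
  by split; apply/nearCP; exists r.
by move=> z' [/= h1 h2]; apply: h.
Qed.

Lemma cvgCP (T : Type) (F : set_system T) (FF : Filter F) (f : T -> C) (l : C) :
  f @ F --> l <-> forall e, 0 < e -> \forall x \near F, nrm (f x - l) < e.
Proof.
split.
  move=> /cvgrPdist_lt h e e0.
  have e0' : 0 < rC e by rewrite -rC0 rC_lt.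
  have := h _ e0'; apply: filterS => x; by rewrite nrmE rC_lt nrm_sub.
move=> h; apply/cvgrPdist_lt => e /posC_ex[r r0 ->].
by have := h _ r0; apply: filterS => x; rewrite nrmE rC_lt nrm_sub.
Qed.

Lemma cvgnP (f : nat -> C) (l : C) :
  f @ \oo --> l <-> forall e, 0 < e -> exists N, forall n, (N <= n)%N -> nrm (f n - l) < e.
Proof.
split.
  by move=> /cvgCP h e /h [N _ hN]; exists N.
move=> h; apply/cvgCP => e /h [N hN]; by exists N.
Qed.

Lemma cvgn_unique (u : nat -> C) (l m : C) : u @ \oo --> l -> u @ \oo --> m -> l = m.
Proof. move=> h h'; exact: (cvg_unique _ h h'). Qed.

Lemma cvgn_cst (l : C) : (fun _ : nat => l) @ \oo --> l.
Proof. exact: cvg_cst. Qed.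

Lemma cvgnD (u v : nat -> C) (l m : C) : u @ \oo --> l -> v @ \oo --> m ->
  (fun n => u n + v n) @ \oo --> l + m.
Proof. by move=> hu hv; exact: (cvgD hu hv). Qed.

Lemma cvgnB (u v : nat -> C) (l m : C) : u @ \oo --> l -> v @ \oo --> m ->
  (fun n => u n - v n) @ \oo --> l - m.
Proof. by move=> hu hv; exact: (cvgB hu hv). Qed.

Lemma cvgnM (u v : nat -> C) (l m : C) : u @ \oo --> l -> v @ \oo --> m ->
  (fun n => u n * v n) @ \oo --> l * m.
Proof. by move=> hu hv; exact: (cvgM hu hv). Qed.

Lemma cvgnV (u : nat -> C) (l : C) : l != 0 -> u @ \oo --> l ->
  (fun n => (u n)^-1) @ \oo --> l^-1.
Proof. by move=> l0 hu; exact: (cvgV l0 hu). Qed.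

Lemma cvgn_prod (I : Type) (s : seq I) (P : pred I) (u : I -> nat -> C) (l : I -> C) :
  (forall i, P i -> u i @ \oo --> l i) ->
  (fun n => \prod_(i <- s | P i) u i n) @ \oo --> \prod_(i <- s | P i) l i.
Proof.
move=> h; apply: cvg_big; [exact: mul_continuous|exact: h].
Qed.

Lemma cvgn_addl (u : nat -> C) (l : C) N : u @ \oo --> l ->
  (fun n => u (N + n)%N) @ \oo --> l.
Proof.
move=> /cvgnP h; apply/cvgnP => e /h[M hM]; exists M => n Mn.
by apply: hM; apply: leq_trans (leq_addl _ _).
Qed.

Lemma expr_to0 (x b : R) : 0 <= x < 1 -> 0 < b -> exists n, x ^+ n < b.
Proof.
move=> /andP[x0 x1] b0.
have := cvg_expr (z := x); rewrite ger0_norm // => /(_ x1)/cvgrPdist_lt/(_ _ b0)[N _ hN].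
exists N; have := hN N (leqnn _); rewrite /= sub0r normrN ger0_norm ?exprn_ge0 //; apply.
Qed.

Lemma has_sumP (I : choiceType) (f : I -> C) (l : C) :
  has_sum f l <-> forall e, 0 < e -> exists A : {fset I},
    forall B : {fset I}, (A `<=` B)%fset -> nrm (\sum_(i <- B) f i - l) < e.
Proof.
have FF := @totally_filter I.
split.
  move=> /cvgCP h e /h [A _ hA]; exists A => B AB.
  by have := hA _ AB; rewrite /partial_sum /= big_seq_fsetE.
move=> h; apply/cvgCP => e /h [A hA]; exists A => // B AB /=.
by rewrite /partial_sum -(big_seq_fsetE _ _ predT); exact: hA.
Qed.

Lemma has_sum_unique (I : choiceType) (f : I -> C) l l' :
  has_sum f l -> has_sum f l' -> l = l'.
Proof. have FF := @totally_filter I; by move=> h h'; exact: (cvg_unique _ h h'). Qed.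

Lemma has_sum_sum (I : choiceType) (f : I -> C) l :
  has_sum f l -> (summability.sum f : C) = l.
Proof. have FF := @totally_filter I; by move=> h; exact: cvg_lim h. Qed.

Lemma cauchyC (f : nat -> C) :
  (forall e, 0 < e -> exists N, forall n m, (N <= n)%N -> (N <= m)%N -> nrm (f n - f m) < e) ->
  exists l : C, f @ \oo --> l.
Proof.
move=> h.
have cR (g : nat -> R) : (forall n m, `|g n - g m| <= nrm (f n - f m)) ->
    exists l : R, g @ \oo --> l.
  move=> hg; apply/cvg_ex; apply: cauchy_cvg; apply: cauchy_exP => e e0.
  have [N hN] := h _ e0; exists (g N); exists N => // n /= Nn.
  by rewrite -ball_normE /=; apply: le_lt_trans (hg _ _) _; exact: hN.
have [a ha] : exists l : R, (fun n => complex.Re (f n)) @ \oo --> l.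
  by apply: cR => n m /=; rewrite -cReN -cReD nrm_Re.
have [b hb] : exists l : R, (fun n => complex.Im (f n)) @ \oo --> l.
  by apply: cR => n m /=; rewrite -cImN -cImD nrm_Im.
exists (a +i* b)%C; apply/cvgnP => e e0.
have e2 : 0 < e / 2 by rewrite divr_gt0.
move: ha hb => /cvgrPdist_lt/(_ _ e2)[N1 _ h1] /cvgrPdist_lt/(_ _ e2)[N2 _ h2].
exists (maxn N1 N2) => n; rewrite geq_max => /andP[n1 n2].
apply: le_lt_trans (nrm_le_ReIm _) _; rewrite cReD cImD cReN cImN /=.
rewrite (splitr e) ltrD //.
  by have := h1 _ n1; rewrite /= distrC.
by have := h2 _ n2; rewrite /= distrC.
Qed.
End Modulus.

(** * Absolutely convergent unordered sums *)

Section Summation.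
Variable R : realType.
Local Notation C := (Cplx R).
Implicit Types (a b e r M : R).

Definition abs_bounded (I : choiceType) (f : I -> C) M : Prop :=
  forall A : {fset I}, \sum_(i <- A) nrm (f i) <= M.

Lemma big_fsetDI (T : nmodType) (I : choiceType) (A B : {fset I}) (f : I -> T) :
  (A `<=` B)%fset ->
  \sum_(i <- B) f i = \sum_(i <- A) f i + \sum_(i <- (B `\` A)%fset) f i.
Proof.
move=> AB; rewrite (bigID [pred i | i \in A]) /=; congr (_ + _).
  rewrite -big_filter; apply: perm_big; apply: uniq_perm.
  - by rewrite filter_uniq.
  - by [].
  - move=> i; rewrite mem_filter andb_idr // => iA; exact: (fsubsetP AB).
rewrite -big_filter; apply: perm_big; apply: uniq_perm.
- by rewrite filter_uniq.
- by [].
- by move=> i; rewrite mem_filter in_fsetD.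
Qed.

Lemma ler_sum_fsub (I : choiceType) (A B : {fset I}) (g : I -> R) :
  (forall i, 0 <= g i) -> (A `<=` B)%fset ->
  \sum_(i <- A) g i <= \sum_(i <- B) g i.
Proof.
by move=> g0 AB; rewrite (big_fsetDI _ AB) lerDl sumr_ge0.
Qed.

(** Take A with sum within e of the supremum of all finite sums: a set disjoint from A cannot add e
    or more. *)
Lemma nonneg_tail (I : choiceType) (g : I -> R) M : (forall i, 0 <= g i) ->
  (forall A : {fset I}, \sum_(i <- A) g i <= M) ->
  forall e, 0 < e -> exists A : {fset I},
    forall B : {fset I}, [disjoint A & B]%fset -> \sum_(i <- B) g i < e.
Proof.
move=> g0 hM e e0.
pose S := [set x : R | exists A : {fset I}, x = \sum_(i <- A) g i].
have hS : has_sup S.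
  split; first by exists (\sum_(i <- fset0) g i); exists fset0.
  by exists M => x [A ->].
have [_ [A ->] hA] := sup_adherent e0 hS.
exists A => B AB.
have : \sum_(i <- (A `|` B)%fset) g i <= sup S.
  by apply: sup_upper_bound => //; exists (A `|` B)%fset.
rewrite (big_fsetDI _ (fsubsetUl A B)).
have -> : ((A `|` B) `\` A = B)%fset.
  apply/fsetP => i; rewrite !inE.
  case iB : (i \in B); last by rewrite orbF andNb.
  by rewrite orbT andbT; move/fdisjointP_sym : AB => ->.
lra.
Qed.

Lemma abs_tail (I : choiceType) (f : I -> C) M : abs_bounded f M ->
  forall e, 0 < e -> exists A : {fset I},
    forall B : {fset I}, [disjoint A & B]%fset -> \sum_(i <- B) nrm (f i) < e.
Proof. by move=> h; apply: (@nonneg_tail _ _ M) => // i; exact: nrm_ge0. Qed.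

Lemma sum_fsub_dist (I : choiceType) (f : I -> C) (A B : {fset I}) e :
  (forall B : {fset I}, [disjoint A & B]%fset -> \sum_(i <- B) nrm (f i) < e) ->
  (A `<=` B)%fset ->
  nrm (\sum_(i <- B) f i - \sum_(i <- A) f i) < e.
Proof.
move=> h AB; rewrite (big_fsetDI _ AB) addrC addKr.
by apply: le_lt_trans (nrm_sum _ _ _) _; apply: h; apply/fdisjointP => i iA; rewrite !inE iA.
Qed.

(** Completeness is used along a sequence: the sums over the unions [B n], beyond which tails are
    below 1/(n+1), form a Cauchy sequence, and its limit is also that of the net of all finite
    sums. *)
Lemma abs_has_sum (I : choiceType) (f : I -> C) M :
  abs_bounded f M -> exists l : C, has_sum f l.
Proof.
move=> hM.
have e0 n : 0 < (n.+1%:R : R)^-1 by rewrite invr_gt0.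
have [A hA] := choice (fun n => abs_tail hM (e0 n)).
pose B n := (\bigcup_(k <- iota 0 n.+1) A k)%fset.
have AB k n : (k <= n)%N -> (A k `<=` B n)%fset.
  by move=> kn; apply: bigfcup_sup => //; rewrite mem_iota.
have small e : 0 < e -> exists N, N.+1%:R^-1 < e.
  move=> ee; exists (Num.truncn e^-1).
  by rewrite invf_plt ?posrE // truncnS_gt.
have [|l hl] := @cauchyC R (fun n => \sum_(i <- B n) f i).
  move=> e ee; have [N hN] := small (e / 2) (divr_gt0 ee (ltr0Sn _ 1)).
  exists N => n m Nn Nm.
  apply: le_lt_trans (nrm_tri (\sum_(i <- A N) f i) _ _) _.
  have h1 := sum_fsub_dist (hA N) (AB _ _ Nn).
  have h2 := sum_fsub_dist (hA N) (AB _ _ Nm).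
  move: (N.+1%:R^-1) hN h1 h2 => d; lra.
exists l; apply/has_sumP => e ee.
have [N1 hN1] := small (e / 3) (divr_gt0 ee (ltr0Sn _ 2)).
have /cvgnP/(_ _ (divr_gt0 ee (ltr0Sn _ 2)))[N2 hN2] := hl.
pose N := maxn N1 N2.
exists (A N1) => D AD.
have h1 := sum_fsub_dist (hA N1) AD.
have h2 := sum_fsub_dist (hA N1) (AB _ _ (leq_maxl N1 N2)).
have h3 := hN2 _ (leq_maxr N1 N2).
apply: le_lt_trans (nrm_subD (\sum_(i <- A N1) f i) _ _) _.
apply: le_lt_trans (lerD (lexx _) (nrm_subD (\sum_(i <- B N) f i) _ _)) _.
have h4 := nrm_sub (\sum_(i <- A N1) f i) (\sum_(i <- B N) f i).
rewrite -/N in h2 h3; move: (N1.+1%:R^-1) hN1 h1 h2 => d; lra.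
Qed.

Lemma has_sum_le (I : choiceType) (f : I -> C) l M :
  has_sum f l -> abs_bounded f M -> nrm l <= M.
Proof.
move=> /has_sumP h hM; apply: le_eps => e /h [A /(_ _ (fsubset_refl A)) hA].
have := nrm_subl l (\sum_(i <- A) f i); rewrite nrm_sub.
have := le_trans (nrm_sum _ _ _) (hM A); lra.
Qed.

Lemma has_sum_ext (I : choiceType) (f g : I -> C) l :
  (forall i, f i = g i) -> has_sum f l -> has_sum g l.
Proof. by move=> /funext ->. Qed.

Lemma has_sumD (I : choiceType) (f g : I -> C) l m :
  has_sum f l -> has_sum g m -> has_sum (fun i => f i + g i) (l + m).
Proof.
move=> /has_sumP hf /has_sumP hg; apply/has_sumP => e e0.
have e2 := divr_gt0 e0 (ltr0Sn R 1).
have [A hA] := hf _ e2; have [B hB] := hg _ e2.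
exists (A `|` B)%fset => D; rewrite fsubUset => /andP[/hA h1 /hB h2].
by rewrite big_split /= opprD addrACA (splitr e); apply: le_lt_trans (nrmD _ _) (ltrD h1 h2).
Qed.

Lemma has_sum0 (I : choiceType) : has_sum (fun _ : I => 0 : C) 0.
Proof.
by apply/has_sumP => e e0; exists fset0 => B _; rewrite big1 // subrr nrm0.
Qed.

Lemma has_sumZ (I : choiceType) (f : I -> C) l c :
  has_sum f l -> has_sum (fun i => c * f i) (c * l).
Proof.
move=> /has_sumP hf; apply/has_sumP => e e0.
have c1 : 0 < nrm c + 1 by rewrite ltr_wpDl ?nrm_ge0.
have [A hA] := hf _ (divr_gt0 e0 c1); exists A => B /hA.
rewrite -mulr_sumr -mulrBr nrmM ltr_pdivlMr // => h.
apply: le_lt_trans h; rewrite mulrC ler_wpM2l ?nrm_ge0 //; lra.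
Qed.

Lemma has_sumB (I : choiceType) (f g : I -> C) l m :
  has_sum f l -> has_sum g m -> has_sum (fun i => f i - g i) (l - m).
Proof.
move=> hf hg; have := has_sumD hf (has_sumZ (c := -1) hg).
by rewrite mulN1r; apply: has_sum_ext => i; rewrite mulN1r.
Qed.

Lemma has_sum_bigsum (I J : choiceType) (s : seq J) (f : J -> I -> C) l :
  (forall j, has_sum (f j) (l j)) ->
  has_sum (fun i => \sum_(j <- s) f j i) (\sum_(j <- s) l j).
Proof.
move=> h; elim: s => [|j s IH].
  by rewrite big_nil; apply: has_sum_ext (has_sum0 I) => i; rewrite big_nil.
by rewrite big_cons; apply: has_sum_ext (has_sumD (h j) IH) => i; rewrite big_cons.
Qed.

Lemma has_sum_finite (I : choiceType) (f : I -> C) (A : {fset I}) :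
  (forall i, i \notin A -> f i = 0) -> has_sum f (\sum_(i <- A) f i).
Proof.
move=> h; apply/has_sumP => e e0; exists A => B AB.
rewrite (big_fsetDI _ AB) addrC addKr big_seq big1 ?nrm0 // => i.
by rewrite in_fsetD => /andP[/h].
Qed.

Lemma abs_bounded_le (I : choiceType) (f g : I -> C) M :
  (forall i, nrm (f i) <= nrm (g i)) -> abs_bounded g M -> abs_bounded f M.
Proof. by move=> h hg A; apply: le_trans (hg A); apply: ler_sum. Qed.

(** Summation by fibres of [p]. Once K contains the image of a large finite A, the fibres over K
    miss only terms indexed outside A, whose total modulus is small. *)
Lemma has_sum_push (I J : choiceType) (f : I -> C) l M (p : I -> J) (g : J -> C) :
  abs_bounded f M -> has_sum f l ->
  (forall j, has_sum (fun i => if p i == j then f i else 0) (g j)) ->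
  has_sum g l.
Proof.
move=> hM hl hg; apply/has_sumP => e e0.
have e2 := divr_gt0 e0 (ltr0Sn R 1).
have [A hA] := abs_tail hM e2.
exists [fset p i | i in A]%fset => K AK.
have h1 := has_sumB hl (has_sum_bigsum (s := enum_fset K) hg).
rewrite nrm_sub; suff : nrm (l - \sum_(i <- K) g i) <= e / 2 by lra.
apply: (has_sum_le h1) => B.
have h i : nrm (f i - \sum_(j <- K) (if p i == j then f i else 0)) =
    if p i \in K then 0 else nrm (f i).
  case: ifPn => pK.
    rewrite (big_fsetD1 _ pK) /= eqxx big_seq big1 ?addr0 ?subrr ?nrm0 // => j.
    by rewrite !inE eq_sym => /andP[/negbTE ->].
  rewrite big_seq big1 ?subr0 // => j jK; case: eqP => // pj.
  by rewrite pj jK in pK.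
under eq_bigr do rewrite h.
pose B' := [fset i in B | p i \notin K]%fset.
suff -> : \sum_(i <- B) (if p i \in K then 0 else nrm (f i)) =
    \sum_(i <- B') nrm (f i).
  apply: ltW; apply: hA; apply/fdisjointP => i iA; rewrite !inE /= negb_and negbK.
  by rewrite (fsubsetP AK) ?orbT //; apply/imfsetP; exists i.
rewrite big_fset /= [RHS]big_mkcond; apply: eq_bigr => i _.
by case: (p i \in K).
Qed.

Lemma abs_bounded_push (I J : choiceType) (f : I -> C) M (p : I -> J) (g : J -> C) :
  abs_bounded f M ->
  (forall j, has_sum (fun i => if p i == j then f i else 0) (g j)) ->
  abs_bounded g M.
Proof.
move=> hM hg K; apply: le_eps => e e0.
(* The error e is shared equally among the finitely many fibres over K. *)
have hK : forall n : nat, 0 < e / n.+1%:R by move=> n; rewrite divr_gt0.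
have [A hA] := choice (fun j => (iffLR (has_sumP _ _) (hg j)) _ (hK #|` K|)).
pose B := (\bigcup_(j <- K) A j)%fset.
have hB j : j \in K -> nrm (g j) <= \sum_(i <- B) (if p i == j then nrm (f i) else 0) + e / (#|` K|).+1%:R.
  move=> jK; have := hA j B (bigfcup_sup _ jK isT).
  have := nrm_subl (g j) (\sum_(i <- B) (if p i == j then f i else 0)).
  rewrite nrm_sub => h1 h2.
  have h3 : nrm (\sum_(i <- B) (if p i == j then f i else 0)) <= \sum_(i <- B) (if p i == j then nrm (f i) else 0).
    apply: le_trans (nrm_sum _ _ _) _; apply: ler_sum => i _.
    by case: eqP => // _; rewrite nrm0.
  move: (e / _) h2 => d; lra.
rewrite big_seq; apply: le_trans (ler_sum _ hB) _; rewrite -big_seq big_split /= lerD //.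
  rewrite exchange_big /=; apply: le_trans (hM B); apply: ler_sum => i _.
  have [pK|pK] := boolP (p i \in K).
    rewrite (big_fsetD1 _ pK) /= eqxx big_seq big1 ?addr0 // => j.
    by rewrite !inE eq_sym => /andP[/negbTE ->].
  rewrite big_seq big1 ?nrm_ge0 // => j jK; case: eqP => // pj.
  by rewrite pj jK in pK.
rewrite big_const_seq count_predT iter_addr addr0 -[X in X <= _]mulr_natr mulrAC ler_pdivrMr //.
by rewrite ler_wpM2l ?ltW // ltr_nat.
Qed.

(** Fibres of an injection have at most one element, so this is [has_sum_push] with fibre sums [f i]
    on the image and 0 off it. *)
Lemma has_sum_inj (I J : choiceType) (f : I -> C) M l (h : J -> I) :
  injective h -> (forall i, (forall j, h j != i) -> f i = 0) ->
  abs_bounded (fun j => f (h j)) M -> has_sum (fun j => f (h j)) l ->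
  has_sum f l.
Proof.
move=> hi h0 hM hl; apply: (has_sum_push hM hl (p := h)) => i.
have [[j ji]|nj] := pselect (exists j, h j = i).
  have := @has_sum_finite _ (fun j' => if h j' == i then f (h j') else 0) [fset j]%fset.
  rewrite big_seq_fset1 ji eqxx; apply=> j'; rewrite inE => /eqP jj; case: eqP => // e1; case: jj.
  by apply: hi; rewrite ji.
rewrite h0; last by move=> j; apply/eqP => ji; apply: nj; exists j.
apply: has_sum_ext (has_sum0 J) => j.
by case: eqP => // ji; case: nj; exists j.
Qed.

Lemma has_sum_exhaust (I : choiceType) (f : I -> C) l (A : nat -> {fset I}) :
  has_sum f l -> (forall B : {fset I}, exists N, forall n, (N <= n)%N -> (B `<=` A n)%fset) ->
  (fun n => \sum_(i <- A n) f i) @ \oo --> l.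
Proof.
move=> /has_sumP h hA; apply/cvgnP => e /h [B hB].
have [N hN] := hA B; exists N => n /hN; exact: hB.
Qed.

Definition fset_iota n : {fset nat} := [fset k in iota 0 n]%fset.

Lemma sum_fset_iota (T : nmodType) n (f : nat -> T) :
  \sum_(k <- fset_iota n) f k = \sum_(k < n) f k.
Proof.
rewrite -(big_mkord predT) /index_iota subn0; apply: perm_big.
apply: uniq_perm => //; first exact: iota_uniq.
by move=> i; rewrite in_fset.
Qed.

Lemma fset_iotaP (B : {fset nat}) :
  exists N, forall n, (N <= n)%N -> (B `<=` fset_iota n)%fset.
Proof.
exists (\max_(k <- B) k).+1 => n hn; apply/fsubsetP => k kB.
rewrite in_fset mem_iota /= add0n; apply: leq_trans hn; rewrite ltnS.
exact: leq_bigmax_seq.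
Qed.

Lemma has_sum_nat (f : nat -> C) l :
  has_sum f l -> (fun n => \sum_(k < n) f k) @ \oo --> l.
Proof.
move=> h; have := has_sum_exhaust h fset_iotaP.
by under eq_fun do rewrite sum_fset_iota.
Qed.

Lemma sum_fset_nat_le (g : nat -> R) M : (forall k, 0 <= g k) ->
  (forall n, \sum_(k < n) g k <= M) ->
  forall A : {fset nat}, \sum_(k <- A) g k <= M.
Proof.
move=> g0 h A; have [N /(_ _ (leqnn _)) hN] := fset_iotaP A.
by apply: le_trans (h N); rewrite -sum_fset_iota; apply: ler_sum_fsub.
Qed.

(* Tannery's theorem *)
Lemma has_sum_dominated (I : choiceType) (f : nat -> I -> C) (g : I -> C)
    (h : I -> R) (l : nat -> C) M :
  (forall A : {fset I}, \sum_(i <- A) h i <= M) ->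
  (forall n i, nrm (f n i) <= h i) ->
  (forall i, (fun n => f n i) @ \oo --> g i) ->
  (forall n, has_sum (f n) (l n)) ->
  exists2 m : C, has_sum g m & l @ \oo --> m.
Proof.
move=> hM fh fg fl.
have h0 i : 0 <= h i by apply: le_trans (fh 0%N i); exact: nrm_ge0.
have gh i : nrm (g i) <= h i.
  apply: le_eps => e e0.
  have /cvgnP/(_ _ e0)[N /(_ _ (leqnn N))] := fg i.
  have := fh N i; have := nrm_subl (g i) (f N i); rewrite nrm_sub; lra.
have gM : abs_bounded g M by move=> A; apply: le_trans (hM A); apply: ler_sum.
have [m hm] := abs_has_sum gM; exists m => //; apply/cvgnP => e e0.
have e4 := divr_gt0 e0 (ltr0Sn R 3).
have [A hA] := nonneg_tail h0 hM e4.
have tail (k : I -> C) (s : C) : (forall i, nrm (k i) <= h i) -> has_sum k s ->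
    nrm (s - \sum_(i <- A) k i) <= e / 4.
  move=> kh /has_sumP hs; apply: le_eps => d /hs [B hB].
  have h0' := hB _ (fsubsetUr A B).
  have kA : forall B : {fset I}, [disjoint A & B]%fset -> \sum_(i <- B) nrm (k i) < e / 4.
    by move=> B' /hA; apply: le_lt_trans; apply: ler_sum.
  have h1 := sum_fsub_dist kA (fsubsetUl A B).
  have h2 := nrm_tri (\sum_(i <- (A `|` B)%fset) k i) s (\sum_(i <- A) k i).
  have h3 := nrm_sub s (\sum_(i <- (A `|` B)%fset) k i).
  have h4 := nrm_sub (\sum_(i <- A) k i) (\sum_(i <- (A `|` B)%fset) k i).
  lra.
have : (fun n => \sum_(i <- A) f n i) @ \oo --> \sum_(i <- A) g i.
  by apply: cvg_big => [|i _]; [exact: add_continuous|exact: fg].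
move=> /cvgnP/(_ _ e4)[N hN]; exists N => n /hN h1.
have h2 := tail _ _ (fh n) (fl n); have h3 := tail _ _ gh hm.
apply: le_lt_trans (nrm_subD (\sum_(i <- A) f n i) _ _) _.
apply: le_lt_trans (lerD (lexx _) (nrm_subD (\sum_(i <- A) g i) _ _)) _.
have h4 := nrm_sub (\sum_(i <- A) g i) m.
have h5 := nrm_sub (\sum_(i <- A) f n i) (l n).
lra.
Qed.

End Summation.

(** * Goursat's theorem and the identity theorem *)

Section Trapezoid.
Variable R : realType.
Local Notation C := (Cplx R).
Implicit Types (f g : C -> C) (c h p x y z : C) (a e : R).

Definition J : C := (0 +i* 1)%C.

Lemma JJ : J * J = -1.
Proof. by rewrite -expr2; exact: sqr_i. Qed.

Lemma nrmJ : nrm J = 1.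
Proof. by rewrite /nrm normc_def /= expr0n expr1n add0r sqrtr1. Qed.

(* The trapezoid rule with 2^N equal steps: being exactly additive under
   bisection, it can replace the integral in Goursat's argument. *)
Fixpoint trapezoid N f x y : C :=
  if N is N'.+1 then trapezoid N' f x ((x + y) / 2) + trapezoid N' f ((x + y) / 2) y
  else (f x + f y) / 2 * (y - x).

Lemma trapezoid_sym N f x y : trapezoid N f y x = - trapezoid N f x y.
Proof.
elim: N x y => [|N IH] x y /=; first by field.
by rewrite opprD addrC [y + x]addrC -!IH.
Qed.

Lemma trapezoidD N f g x y :
  trapezoid N (fun z => f z + g z) x y = trapezoid N f x y + trapezoid N g x y.
Proof.
elim: N x y => [|N IH] x y /=; first by field.
by rewrite !IH addrACA.
Qed.

Lemma trapezoidZ N f k x y :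
  trapezoid N (fun z => k * f z) x y = k * trapezoid N f x y.
Proof.
elim: N x y => [|N IH] x y /=; first by field.
by rewrite !IH mulrDr.
Qed.

Lemma trapezoid_affine N k l x y :
  trapezoid N (fun z => k + l * z) x y = k * (y - x) + l * (y ^+ 2 - x ^+ 2) / 2.
Proof.
by elim: N x y => [|N IH] x y /=; rewrite ?IH; field.
Qed.

Definition on_segment x y (P : C -> Prop) :=
  forall t : R, 0 <= t <= 1 -> P (x + rC t * (y - x)).

Lemma on_segment_halves x y (P : C -> Prop) : on_segment x y P ->
  on_segment x ((x + y) / 2) P /\ on_segment ((x + y) / 2) y P.
Proof.
move=> h; split=> t /andP[t0 t1].
  have := h (t / 2); rewrite rCM rCV rCn.
  rewrite (_ : x + rC t * ((x + y) / 2 - x) = x + rC t / 2 * (y - x)).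
    by apply; lra.
  by field.
have := h ((1 + t) / 2); rewrite rCM rCV rCn rCD rC1.
rewrite (_ : (x + y) / 2 + rC t * (y - (x + y) / 2) = x + (1 + rC t) / 2 * (y - x)).
  by apply; lra.
by field.
Qed.

Lemma on_segment_ends x y (P : C -> Prop) : on_segment x y P -> P x /\ P y.
Proof.
move=> h; have := h 0; have := h 1.
rewrite rC1 rC0 mul0r mul1r addr0 addrC subrK => h1 h0; split; [apply: h0|apply: h1]; lra.
Qed.

Lemma nrm_half x : nrm (x / 2) = nrm x / 2.
Proof. by rewrite nrmM nrmV nrm_nat. Qed.

Lemma trapezoid_bound N f x y M :
  on_segment x y (fun z => nrm (f z) <= M) ->
  nrm (trapezoid N f x y) <= M * nrm (y - x).
Proof.
elim: N x y => [|N IH] x y h /=.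
  rewrite nrmM nrm_half ler_wpM2r ?nrm_ge0 //.
  have [h1 h2] := on_segment_ends h; have := nrmD (f x) (f y); lra.
have [h1 h2] := on_segment_halves h.
apply: le_trans (nrmD _ _) _; apply: le_trans (lerD (IH _ _ h1) (IH _ _ h2)) _.
have -> : (x + y) / 2 - x = (y - x) / 2 by field.
have -> : y - (x + y) / 2 = (y - x) / 2 by field.
rewrite nrm_half; lra.
Qed.

(** The contour sum over the square of centre c and half-side h, run counterclockwise from the lower
    left corner. *)
Definition boundary N f c h : C :=
  trapezoid N f (c + h * (-1 - J)) (c + h * (1 - J)) +
  trapezoid N f (c + h * (1 - J)) (c + h * (1 + J)) +
  trapezoid N f (c + h * (1 + J)) (c + h * (-1 + J)) +
  trapezoid N f (c + h * (-1 + J)) (c + h * (-1 - J)).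

Definition sgnb (b : bool) : C := (-1) ^+ b.
Definition subcenter c h (b : bool * bool) : C := c + h / 2 * (sgnb b.1 + sgnb b.2 * J).

(** The outer sides are halved by the recursion of [trapezoid], and each inner side is run once in
    each direction. The identity is exact for every N, not only in a limit. *)
Lemma boundary_split N f c h :
  boundary N.+1 f c h =
  boundary N f (subcenter c h (false, false)) (h / 2) +
  boundary N f (subcenter c h (false, true)) (h / 2) +
  boundary N f (subcenter c h (true, false)) (h / 2) +
  boundary N f (subcenter c h (true, true)) (h / 2).
Proof.
rewrite /boundary /subcenter /sgnb /= !expr0 !expr1 /=.
pose P u v : C := c + h * (u + v * J).
pose T u v u' v' := trapezoid N f (P u v) (P u' v').
have sym u v u' v' : T u v u' v' = - T u' v' u v := trapezoid_sym N f _ _.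
transitivity ((T (-1) (-1) 0 (-1) + T 0 (-1) 1 (-1)) + (T 1 (-1) 1 0 + T 1 0 1 1) +
  (T 1 1 0 1 + T 0 1 (-1) 1) + (T (-1) 1 (-1) 0 + T (-1) 0 (-1) (-1))).
  by rewrite /T /P; congr ((_ + _) + (_ + _) + (_ + _) + (_ + _)); congr (trapezoid _ _ _ _); field.
transitivity ((T 0 0 1 0 + T 1 0 1 1 + T 1 1 0 1 + T 0 1 0 0) +
  (T 0 (-1) 1 (-1) + T 1 (-1) 1 0 + T 1 0 0 0 + T 0 0 0 (-1)) +
  (T (-1) 0 0 0 + T 0 0 0 1 + T 0 1 (-1) 1 + T (-1) 1 (-1) 0) +
  (T (-1) (-1) 0 (-1) + T 0 (-1) 0 0 + T 0 0 (-1) 0 + T (-1) 0 (-1) (-1))).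
  rewrite (sym 1 0 0 0) (sym 0 1 0 0) (sym (-1) 0 0 0) (sym 0 (-1) 0 0); ring.
by rewrite /T /P; congr ((_ + _ + _ + _) + (_ + _ + _ + _) + (_ + _ + _ + _) + (_ + _ + _ + _)); congr (trapezoid _ _ _ _); field.
Qed.

Lemma boundary_lin N f g c h k :
  boundary N (fun z => f z + k * g z) c h = boundary N f c h + k * boundary N g c h.
Proof.
by rewrite /boundary !trapezoidD !trapezoidZ !mulrDr; ring.
Qed.

Lemma boundary_affine N k l c h : boundary N (fun z => k + l * z) c h = 0.
Proof. by rewrite /boundary !trapezoid_affine; field. Qed.

Definition in_square c a z : Prop :=
  `|complex.Re (z - c)| <= a /\ `|complex.Im (z - c)| <= a.

(** Larger than the boundary: the whole square minus the inscribed open disc. This suffices because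
    the estimates use only the distance to the centre. *)
Definition on_boundary c a z : Prop := in_square c a z /\ a <= nrm (z - c).

Lemma boundary_edges c a (P : C -> Prop) : 0 <= a ->
  (forall z, on_boundary c a z -> P z) ->
  [/\ on_segment (c + rC a * (-1 - J)) (c + rC a * (1 - J)) P,
      on_segment (c + rC a * (1 - J)) (c + rC a * (1 + J)) P,
      on_segment (c + rC a * (1 + J)) (c + rC a * (-1 + J)) P &
      on_segment (c + rC a * (-1 + J)) (c + rC a * (-1 - J)) P].
Proof.
move=> a0 h.
have key (s t : R) : `|s| <= a -> `|t| <= a -> a = `|s| \/ a = `|t| ->
    P (c + (rC s + rC t * J)).
  move=> hs ht hst; apply: h; split; rewrite /in_square addrC addKr /J.
    by rewrite !(cReD, cImD, cReM, cImM) /= !(mulr0, mulr1, add0r, addr0, mul0r, subr0).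
  have h1 := nrm_Re (rC s + rC t * J); have h2 := nrm_Im (rC s + rC t * J).
  move: h1 h2; rewrite /J !(cReD, cImD, cReM, cImM) /= !(mulr0, mulr1, add0r, addr0, mul0r, subr0).
  by case: hst => ->.
have ta (t : R) : 0 <= t <= 1 -> `|a * (2 * t - 1)| <= a.
  move=> /andP[t0 t1]; rewrite normrM ger0_norm // ler_piMr // ler_norml; lra.
have nt (t : R) : 0 <= t <= 1 -> `|- (a * (2 * t - 1))| <= a by move=> /ta; rewrite normrN.
have aa : `|a| = a by rewrite ger0_norm.
have naa : `|- a| = a by rewrite normrN.
split=> t ht.
- have := key (a * (2 * t - 1)) (- a) (ta _ ht).
  rewrite naa lexx => /(_ isT (or_intror erefl)); congr (P _).
  by rewrite !(rCM, rCD, rCN, rCB, rC1, rCn); ring.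
- have := key a (a * (2 * t - 1)).
  rewrite aa lexx => /(_ isT (ta _ ht) (or_introl erefl)); congr (P _).
  by rewrite !(rCM, rCD, rCN, rCB, rC1, rCn); ring.
- have := key (- (a * (2 * t - 1))) a (nt _ ht).
  rewrite aa lexx => /(_ isT (or_intror erefl)); congr (P _).
  by rewrite !(rCM, rCD, rCN, rCB, rC1, rCn); ring.
- have := key (- a) (- (a * (2 * t - 1))).
  rewrite naa lexx => /(_ isT (nt _ ht) (or_introl erefl)); congr (P _).
  by rewrite !(rCM, rCD, rCN, rCB, rC1, rCn); ring.
Qed.

Lemma boundary_bound N f c a M : 0 <= a ->
  (forall z, on_boundary c a z -> nrm (f z) <= M) ->
  nrm (boundary N f c (rC a)) <= 8 * a * M.
Proof.
move=> a0 /(boundary_edges a0)[h1 h2 h3 h4]; rewrite /boundary.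
have len (z w d : C) : z - w = rC a * (d * 2) -> nrm d = 1 -> nrm (z - w) = 2 * a.
  by move=> -> dd; rewrite !nrmM nrm_nat dd nrm_pos // mul1r mulrC.
apply: le_trans (nrmD _ _) _.
apply: le_trans (lerD (nrmD _ _) (lexx _)) _.
apply: le_trans (lerD (lerD (nrmD _ _) (lexx _)) (lexx _)) _.
have := trapezoid_bound N h1; rewrite (len _ _ 1) ?nrm1 //; last by ring.
have := trapezoid_bound N h2; rewrite (len _ _ J) ?nrmJ //; last by ring.
have := trapezoid_bound N h3; rewrite (len _ _ (-1)) ?nrmN ?nrm1 //; last by ring.
have := trapezoid_bound N h4; rewrite (len _ _ (-J)) ?nrmN ?nrmJ //; last by ring.
lra.
Qed.

Lemma in_square_center c a : 0 <= a -> in_square c a c.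
Proof. by move=> a0; rewrite /in_square subrr /= !normr0. Qed.

Lemma in_square_nrm c a z : in_square c a z -> nrm (z - c) <= 2 * a.
Proof. by case=> h1 h2; apply: le_trans (nrm_le_ReIm _) _; lra. Qed.

Lemma subcenterE c a b : subcenter c (rC a) b =
  c + (rC ((-1) ^+ b.1 * (a / 2)) + rC ((-1) ^+ b.2 * (a / 2)) * J).
Proof.
by rewrite /subcenter /sgnb !(rCM, rCX, rCN, rC1, rCV, rCn); field.
Qed.

Lemma ReIm_J (s t : R) : complex.Re (rC s + rC t * J) = s /\ complex.Im (rC s + rC t * J) = t.
Proof.
by rewrite /J !(cReD, cImD, cReM, cImM) /= !(mulr0, mulr1, add0r, addr0, mul0r, subr0).
Qed.

Lemma norm_sgn_half a (b : bool) : 0 <= a -> `|(-1) ^+ b * (a / 2)| = a / 2.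
Proof. by move=> a0; rewrite normrM normrX normrN1 expr1n mul1r ger0_norm // divr_ge0. Qed.

Lemma in_subsquare c a b z : 0 <= a ->
  in_square (subcenter c (rC a) b) (a / 2) z -> in_square c a z.
Proof.
move=> a0; rewrite /in_square subcenterE opprD addrA !cReD !cImD !cReN !cImN.
have [-> ->] := ReIm_J ((-1) ^+ b.1 * (a / 2)) ((-1) ^+ b.2 * (a / 2)).
have := norm_sgn_half b.1 a0; have := norm_sgn_half b.2 a0.
move: (_ * (a / 2)) (_ * (a / 2)) => u v; move: (complex.Re z - _) (complex.Im z - _) => s t.
move=> hu hv [h1 h2]; split.
  by have := ler_normD (s - u) u; rewrite subrK; lra.
by have := ler_normD (t - v) v; rewrite subrK; lra.
Qed.

Lemma in_some_subsquare c a z : 0 <= a -> in_square c a z ->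
  exists b, in_square (subcenter c (rC a) b) (a / 2) z.
Proof.
move=> a0; rewrite /in_square => h.
exists (complex.Re (z - c) < 0, complex.Im (z - c) < 0).
move: h; rewrite subcenterE opprD addrA /=.
move: (z - c) => w; rewrite (cReD w) (cImD w) cReN cImN !(ReIm_J _ _).1 !(ReIm_J _ _).2.
move: (complex.Re w) (complex.Im w) => s t /=.
by rewrite !ler_norml => -[/andP[s1 s2] /andP[t1 t2]]; split;
  [case: (ltrP s 0) => ss /=|case: (ltrP t 0) => tt /=]; rewrite ?expr1 ?expr0 /=; lra.
Qed.

(** If P fails on a square it fails on a quarter of it; the nested failing squares shrink to a
    point, where P holds on all small squares. This replaces compactness in Goursat's theorem and in
    local boundedness, and connectedness in the meromorphic identity theorem. *)
Lemma square_bisection (P : C -> R -> Prop) c0 a0 : 0 < a0 ->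
  (forall c a, 0 < a -> (forall b, P (subcenter c (rC a) b) (a / 2)) -> P c a) ->
  (forall p, in_square c0 a0 p -> exists2 d, 0 < d &
     forall c a, 0 < a -> a < d -> in_square c a p -> P c a) ->
  P c0 a0.
Proof.
move=> a00 Psub Ploc; apply: contrapT => nP0.
have hex (ca : C * R) : exists b : bool * bool, 0 < ca.2 -> ~ P ca.1 ca.2 ->
    ~ P (subcenter ca.1 (rC ca.2) b) (ca.2 / 2).
  have [[a_gt0 nP]|h] := pselect (0 < ca.2 /\ ~ P ca.1 ca.2).
    apply: contrapT => h; apply: nP; apply: Psub => // b.
    by apply: contrapT => nb; apply: h; exists b.
  by exists (true, true) => a_gt0 nP; case: h.
have [g hg] := choice hex.
pose s n := iter n (fun ca : C * R => (subcenter ca.1 (rC ca.2) (g ca), ca.2 / 2)) (c0, a0).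
have s2 n : (s n).2 = a0 / 2 ^+ n.
  elim: n => [|n IH]; first by rewrite expr0 divr1.
  by rewrite /s iterS -/(s n) /= IH exprS invfM mulrCA mulrC.
have sp n : 0 < (s n).2 by rewrite s2 divr_gt0 // exprn_gt0.
have sP n : ~ P (s n).1 (s n).2.
  by elim: n => [|n IH] //=; apply: hg.
have nest n m z : (n <= m)%N -> in_square (s m).1 (s m).2 z -> in_square (s n).1 (s n).2 z.
  move=> nm; rewrite -(subnKC nm) addnC; elim: (m - n)%N => [|k IH] //= h.
  by apply: IH; apply: in_subsquare h; exact: ltW.
have cen n m : (n <= m)%N -> in_square (s n).1 (s n).2 (s m).1.
  by move=> /nest; apply; apply: in_square_center; exact: ltW.
have small d : 0 < d -> exists n, (s n).2 < d.
  move=> d0; have [n hn] : exists n : nat, a0 / d < n%:R.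
    by exists (Num.truncn (a0 / d)).+1; exact: truncnS_gt.
  exists n; rewrite s2 ltr_pdivrMr ?exprn_gt0 // mulrC -ltr_pdivrMr //.
  apply: lt_trans hn _; rewrite -natrX ltr_nat; exact: ltn_expl.
have [p hp] : exists p : C, (fun n => (s n).1) @ \oo --> p.
  apply: cauchyC => e e0; have [n hn] := small (e / 4) (divr_gt0 e0 (ltr0Sn _ 3)).
  exists n => m k nm nk; apply: le_lt_trans (nrm_tri (s n).1 _ _) _.
  by have := in_square_nrm (cen _ _ nm); have := in_square_nrm (cen _ _ nk); lra.
have pin n : in_square (s n).1 (s n).2 p.
  have key (r : C -> R) : (forall z w, r (z + w) = r z + r w) -> (forall z, r (- z) = - r z) -> (forall z, `|r z| <= nrm z) ->
      (forall m, (n <= m)%N -> `|r ((s m).1 - (s n).1)| <= (s n).2) -> `|r (p - (s n).1)| <= (s n).2.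
    move=> rD rN rn h; apply: le_eps => e e0.
    have /cvgnP/(_ _ e0)[N hN] := hp.
    have := hN (maxn n N) (leq_maxr _ _); have := h (maxn n N) (leq_maxl _ _).
    rewrite nrm_sub; have := rn (p - (s (maxn n N)).1); rewrite !rD !rN.
    have := ler_normD (r p - r (s (maxn n N)).1) (r (s (maxn n N)).1 - r (s n).1).
    by rewrite addrA subrK; lra.
  split; apply: key => //.
  - exact: cReD.
  - exact: cReN.
  - exact: nrm_Re.
  - by move=> m /cen[].
  - exact: cImD.
  - exact: cImN.
  - exact: nrm_Im.
  - by move=> m /cen[].
have [d d0 hd] := Ploc p (pin 0%N).
have [n hn] := small d d0.
exact: sP (hd _ _ (sp n) hn (pin n)).
Qed.

Definition cdiff f p := exists k : C, forall e, 0 < e -> exists2 d, 0 < d &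
  forall z, nrm (z - p) < d -> nrm (f z - f p - k * (z - p)) <= e * nrm (z - p).

(** Plays the role of a bound on the contour integral: the limit of the trapezoid sums is never
    formed. *)
Definition eventually_le (u : nat -> C) e := exists N, forall n, (N <= n)%N -> nrm (u n) <= e.

Lemma eventually_boundary_split f c a (e : bool * bool -> R) :
  (forall b, eventually_le (fun N => boundary N f (subcenter c (rC a) b) (rC (a / 2))) (e b)) ->
  eventually_le (fun N => boundary N f c (rC a)) (e (false, false) + e (false, true) + e (true, false) + e (true, true)).
Proof.
move=> h.
have [N1 h1] := h (false, false); have [N2 h2] := h (false, true).
have [N3 h3] := h (true, false); have [N4 h4] := h (true, true).
exists (maxn (maxn N1 N2) (maxn N3 N4)).+1 => -[//|n].
rewrite ltnS !geq_max => /andP[/andP[n1 n2] /andP[n3 n4]].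
move: (h1 _ n1) (h2 _ n2) (h3 _ n3) (h4 _ n4).
rewrite boundary_split rCM rCV rCn => g1 g2 g3 g4.
apply: le_trans (nrmD _ _) _; rewrite lerD //.
apply: le_trans (nrmD _ _) _; rewrite lerD //.
by apply: le_trans (nrmD _ _) _; rewrite lerD.
Qed.

(** The bound is taken proportional to the area of the square, so that it adds up exactly over the
    four quarters. *)
Lemma goursat f c a e : 0 < a -> (forall p, in_square c a p -> cdiff f p) ->
  0 < e -> eventually_le (fun N => boundary N f c (rC a)) e.
Proof.
move=> a0 df e0.
pose k := e / a ^+ 2.
have k0 : 0 < k by rewrite divr_gt0 // exprn_gt0.
have -> : e = k * a ^+ 2 by rewrite /k divfK // expf_neq0 // gt_eqF.
apply: (@square_bisection (fun c a => eventually_le (fun N => boundary N f c (rC a)) (k * a ^+ 2))) => //.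
  move=> c' a' a'0 /eventually_boundary_split.
  by congr (eventually_le _ _); field.
move=> p /df[l hl].
(* On a square of half-side a' containing p, |z - p| is at most 4a', and the perimeter is 8a': the
   constant 1/32 yields k/32 * 4a' * 8a' = k a'^2. The affine part of f at p has zero contour
   sum. *)
have [d d0 hd] := hl (k / 32) (divr_gt0 k0 (ltr0Sn _ 31)).
exists (d / 4) => [|c' a' a'0 a'd pin]; first by rewrite divr_gt0.
exists 0%N => N _.
have -> : boundary N f c' (rC a') = boundary N (fun z => f z - f p - l * (z - p)) c' (rC a').
  rewrite -[RHS]addr0 -[X in _ = _ + X](mulr0 1) -(boundary_affine N (f p - l * p) l c' (rC a')).
  rewrite -boundary_lin; congr (boundary _ _ _ _); apply/funext => z; ring.
have ip := in_square_nrm pin.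
apply: le_trans (boundary_bound (M := k / 32 * (4 * a')) _ (ltW a'0) _) _.
  move=> z [/in_square_nrm zc _].
  have zp : nrm (z - p) <= 4 * a' by have := nrm_tri c' z p; lra.
  have zd : nrm (z - p) < d by lra.
  by apply: le_trans (hd _ zd) _; rewrite ler_wpM2l // divr_ge0 // ltW.
by rewrite le_eqVlt; apply/orP; left; apply/eqP; field.
Qed.

(** A differentiable function is bounded near each point, and bounds on the quarters bound the
    square. *)
Lemma cdiff_bounded f c a : 0 < a -> (forall p, in_square c a p -> cdiff f p) ->
  exists M, forall z, in_square c a z -> nrm (f z) <= M.
Proof.
move=> a0 df.
apply: (@square_bisection (fun c a => exists M, forall z, in_square c a z -> nrm (f z) <= M)) => //.
  move=> c' a' a'0 /choice[M hM]; exists (\sum_b `|M b|) => z /(in_some_subsquare (ltW a'0))[b /hM h].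
  apply: le_trans h _; apply: le_trans (ler_norm _) _.
  by rewrite (bigD1 b) //= lerDl sumr_ge0.
move=> p /df[l hl]; have [d d0 hd] := hl 1 ltr01.
exists (d / 4) => [|c' a' a'0 a'd pin]; first by rewrite divr_gt0.
exists (nrm (f p) + (nrm l + 1) * d) => z /in_square_nrm zc.
have pc := in_square_nrm pin.
have zp : nrm (z - p) < d by have := nrm_tri c' z p; lra.
have h1 := hd _ zp.
have h2 := nrmD (f z - f p - l * (z - p)) (f p + l * (z - p)).
have h3 := nrmD (f p) (l * (z - p)); rewrite nrmM in h3.
have h4 : nrm l * nrm (z - p) <= nrm l * d by rewrite ler_wpM2l ?nrm_ge0 // ltW.
have h5 : f z - f p - l * (z - p) + (f p + l * (z - p)) = f z by ring.
by rewrite h5 in h2; lra.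
Qed.

Lemma differentiable_small (V : normedModType C) (r : V -> C) (p : V) :
  (forall e : R, 0 < e -> \forall z \near p, `|r z| <= rC e * `|z - p|) ->
  differentiable r p.
Proof.
move=> h.
have rp : r p = 0.
  have /nbhs_singleton := h 1 ltr01.
  by rewrite subrr normr0 mulr0 normr_le0 => /eqP.
have hE : r \o shift p = cst (r p) + \0 +o_ (0 : V) id.
  apply/eqaddoP => _ /posC_ex[e e0 ->].
  have /= := h e e0; rewrite (near_shift 0 p) subr0.
  apply: filterS => z /=; rewrite !fctE /= rp addr0 subr0 addrK //.
have dr : 'd r p = \0 :> (V -> C) by apply: diff_unique => //; exact: cst_continuous.
apply/diff_locallyP; split; rewrite dr //; exact: cst_continuous.
Qed.

Lemma differentiable_pow (V : normedModType C) (f : V -> C) n (p : V) :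
  differentiable f p -> differentiable (fun w => f w ^+ n) p.
Proof.
move=> df; elim: n => [|n IH].
  by under eq_fun do rewrite expr0; exact: differentiable_cst.
by under eq_fun do rewrite exprS; apply: differentiableM.
Qed.

Lemma differentiable_cdiff f p : differentiable f p <-> cdiff f p.
Proof.
split.
  move=> df; exists ('d f p 1) => e e0.
  have := diff_locally df => /eqaddoP.
  have e0' : 0 < rC e by rewrite -rC0 rC_lt.
  move=> /(_ _ e0')/nearCP[d d0 hd]; exists d => // z zp.
  have := hd (z - p); rewrite subr0 => /(_ zp) /=.
  rewrite !fctE /= subrK opprD addrA.
  have -> : 'd f p (z - p) = 'd f p 1 * (z - p).
    by rewrite -[in LHS](mulr1 (z - p)) -[(z - p) * 1]/((z - p) *: 1) linearZ /= mulrC.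
  by rewrite !nrmE -rCM rC_le.
move=> [k hk].
pose g := (fun z : C => f p + k * (z - p)).
have dg : differentiable g p.
  apply: differentiableD; first exact: differentiable_cst.
  apply: differentiableM; first exact: differentiable_cst.
  by apply: differentiableB => //; exact: differentiable_cst.
have -> : f = g + (fun z => f z - g z) by apply/funext => z; rewrite fctE addrC subrK.
apply: (differentiableD dg).
apply: (@differentiable_small C (fun z => f z - g z) p) => e e0.
have [d d0 hd] := hk e e0; apply/nearCP; exists d => // z /hd.
by rewrite /g opprD addrA !nrmE -rCM rC_le.
Qed.

Lemma eventually_le_mono (u : nat -> C) e e' : e <= e' -> eventually_le u e -> eventually_le u e'.
Proof. by move=> ee [N hN]; exists N => n /hN h; exact: le_trans ee. Qed.

(* Only the quarter with corner z contributes, and its boundary sum is at most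
   a constant times its side: quartering repeatedly makes it small. *)
Lemma goursat_corner f z a M (b : bool * bool) e : 0 < a ->
  (forall p, in_square z a p -> p != z -> cdiff f p) ->
  (forall p, in_square z a p -> nrm (f p) <= M) -> 0 < e ->
  eventually_le (fun N => boundary N f (subcenter z (rC a) b) (rC (a / 2))) e.
Proof.
move=> a0 df fM e0.
pose E a' e := eventually_le (fun N => boundary N f (subcenter z (rC a') b) (rC (a' / 2))) e.
have sub_in a' p : 0 < a' <= a -> in_square (subcenter z (rC a') b) (a' / 2) p -> in_square z a p.
  by move=> /andP[a'0 a'a] /(in_subsquare (ltW a'0))[h1 h2]; split; lra.
have step a' v k : 0 < a' <= a -> 0 < k -> E (a' / 2) v -> E a' (v + 3 * k).
  move=> /andP[a'0 a'a] k0 h; rewrite /E.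
  have a'2 : 0 < a' / 2 by rewrite divr_gt0.
  pose ee (b' : bool * bool) := if b' == (~~ b.1, ~~ b.2) then v else k.
  have := @eventually_boundary_split f (subcenter z (rC a') b) (a' / 2) ee.
  have H : forall b', eventually_le (fun N => boundary N f (subcenter (subcenter z (rC a') b) (rC (a' / 2)) b') (rC (a' / 2 / 2))) (ee b').
    move=> b'; rewrite /ee; case: eqP => [->|/eqP bb].
      have -> : subcenter (subcenter z (rC a') b) (rC (a' / 2)) (~~ b.1, ~~ b.2) = subcenter z (rC (a' / 2)) b.
        rewrite !subcenterE !(rCM, rCV, rCX, rCN, rC1, rCn) /=.
        by case: (b.1); case: (b.2); rewrite /= ?expr1 ?expr0; field.
      exact: h.
    apply: goursat => // [|p pin]; first by rewrite divr_gt0.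
    apply: df; first by apply: sub_in (in_subsquare (ltW a'2) pin); rewrite a'0.
    apply/eqP => pz; move: pin; rewrite pz /in_square !subcenterE.
    rewrite (_ : z - _ = - (rC ((-1) ^+ b.1 * (a' / 2) + (-1) ^+ b'.1 * (a' / 2 / 2)) + rC ((-1) ^+ b.2 * (a' / 2) + (-1) ^+ b'.2 * (a' / 2 / 2)) * J)); last by rewrite !rCD; ring.
    rewrite cReN cImN !normrN (ReIm_J _ _).1 (ReIm_J _ _).2 => -[h1 h2].
    have : b'.1 = b.1 \/ b'.2 = b.2.
      move: bb; case: b' {h1 h2} => [x y]; rewrite xpair_eqE /= => h'.
      by case: x y (b.1) (b.2) h' => [] [] [] [] //=; tauto.
    have pos (x : bool) : a' / 2 / 2 < `|(-1) ^+ x * (a' / 2) + (-1) ^+ x * (a' / 2 / 2)|.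
      rewrite -mulrDr normrM normrX normrN1 expr1n mul1r ger0_norm; last by lra.
      lra.
    by case=> bE; [move: h1|move: h2]; rewrite bE leNgt pos.
  move=> /(_ H); apply: eventually_le_mono.
  by rewrite /ee !xpair_eqE; case: (b) => [[] []] /=; lra.
have small n a' : 0 < a' <= a -> forall k, 0 < k -> E a' (8 * M * (a' / 2 ^+ n) + k).
  elim: n a' => [|n IH] a' /andP[a'0 a'a] k k0.
    exists 0%N => N _; rewrite expr0 divr1.
    apply: le_trans (boundary_bound (M := M) _ _ _) _.
    - by rewrite divr_ge0 // ltW.
    - by move=> p [/(sub_in _ _ _)]; rewrite a'0 a'a => /(_ isT)/fM.
    - have : 0 <= M by apply: le_trans (nrm_ge0 _) (fM z (in_square_center _ (ltW a0))).
      nra.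
  have /(step a' _ (k / 6)) : E (a' / 2) (8 * M * (a' / 2 / 2 ^+ n) + k / 2).
    by apply: IH; [apply/andP; split; lra|rewrite divr_gt0].
  rewrite a'0 a'a => /(_ isT); rewrite divr_gt0 // => /(_ isT).
  apply: eventually_le_mono; rewrite exprS invfM !mulrA; lra.
have M0 : 0 <= M by apply: le_trans (nrm_ge0 _) (fM z (in_square_center _ (ltW a0))).
have [n hn] : exists n, 8 * M * (a / 2 ^+ n) < e / 2.
  pose n := (Num.truncn (8 * M * a / (e / 2))).+1; exists n.
  rewrite mulrA ltr_pdivrMr ?exprn_gt0 // [_ * 2 ^+ n]mulrC -ltr_pdivrMr ?divr_gt0 //.
  by apply: lt_trans (truncnS_gt _) _; rewrite -/n -natrX ltr_nat ltn_expl.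
have := small n a _ (e / 2) (divr_gt0 e0 (ltr0Sn _ 1)).
by rewrite a0 lexx => /(_ isT); apply: eventually_le_mono; rewrite -/E; lra.
Qed.

Lemma goursat_removable f z a M e : 0 < a ->
  (forall p, in_square z a p -> p != z -> cdiff f p) ->
  (forall p, in_square z a p -> nrm (f p) <= M) -> 0 < e ->
  eventually_le (fun N => boundary N f z (rC a)) e.
Proof.
move=> a0 df fM e0.
have := @eventually_boundary_split f z a (fun=> e / 4).
move=> /(_ (fun b => goursat_corner b a0 df fM (divr_gt0 e0 (ltr0Sn _ 3)))).
by apply: eventually_le_mono; lra.
Qed.

Lemma Im_trapezoid_ge N f x y k :
  on_segment x y (fun z => k <= complex.Re (f z)) -> complex.Re (y - x) = 0 -> 0 <= complex.Im (y - x) ->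
  k * complex.Im (y - x) <= complex.Im (trapezoid N f x y).
Proof.
elim: N x y => [|N IH] x y h re0 im0 /=.
  have [h1 h2] := on_segment_ends h.
  rewrite cImM re0 mulr0 addr0 ler_wpM2r //.
  rewrite (_ : (f x + f y) / 2 = rC 2^-1 * (f x + f y)); last by rewrite rCV rCn mulrC.
  rewrite cReM cReD /=; lra.
have [h1 h2] := on_segment_halves h.
have e1 : (x + y) / 2 - x = rC 2^-1 * (y - x) by rewrite rCV rCn; field.
have e2 : y - (x + y) / 2 = rC 2^-1 * (y - x) by rewrite rCV rCn; field.
have re1 : complex.Re (rC 2^-1 * (y - x)) = 0 by rewrite cReM re0 /=; lra.
have im1 : complex.Im (rC 2^-1 * (y - x)) = 2^-1 * complex.Im (y - x) by rewrite cImM /=; lra.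
have g1 := IH _ _ h1; have g2 := IH _ _ h2; rewrite ?e1 ?e2 ?re1 ?im1 in g1 g2.
rewrite cImD; have := g1 erefl; have := g2 erefl.
have -> : 0 <= 2^-1 * complex.Im (y - x) by rewrite mulr_ge0.
by move=> /(_ isT) + /(_ isT); lra.
Qed.

(** The form dw/(w - z) is invariant under rotations about z, and the trapezoid sums inherit this
    exactly. *)
Lemma trapezoid_rot N z x y : trapezoid N (fun w => (w - z)^-1) (z + J * (x - z)) (z + J * (y - z)) =
  trapezoid N (fun w => (w - z)^-1) x y.
Proof.
elim: N x y => [|N IH] x y /=.
  have J0 : J != 0 by rewrite -nrm_eq0 nrmJ oner_eq0.
  rewrite ![z + _]addrC !addrK !invfM.
  have -> : J * (y - z) + z - (J * (x - z) + z) = J * (y - x) by ring.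
  rewrite -mulrDr; have -> (u v w : C) : J^-1 * u / v * (J * w) = (J^-1 * J) * (u / v * w) by ring.
  by rewrite mulVf ?mul1r.
have -> : (z + J * (x - z) + (z + J * (y - z))) / 2 = z + J * ((x + y) / 2 - z) by field.
by rewrite !IH.
Qed.

Lemma cReV (w : C) : complex.Re w^-1 = complex.Re w / (complex.Re w ^+ 2 + complex.Im w ^+ 2).
Proof. by case: w. Qed.

(** The integral would be 2 pi i; a lower bound is enough and holds for every N. By the quarter-turn
    invariance the four sides contribute equally, and on the right side Re 1/(w - z) is at least
    1/(2a) over a length 2a. *)
Lemma boundary_inv_ge N z a : 0 < a -> 4 <= nrm (boundary N (fun w => (w - z)^-1) z (rC a)).
Proof.
move=> a0; rewrite /boundary.
set g := fun w => _; pose h := rC a.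
have rot u v u' v' : u' = J * u -> v' = J * v ->
    trapezoid N g (z + h * u') (z + h * v') = trapezoid N g (z + h * u) (z + h * v).
  move=> -> ->; rewrite -(trapezoid_rot N z (z + h * u)) /g.
  by congr (trapezoid _ _ _ _); ring.
have j1 : -1 + J = J * (1 + J) by rewrite mulrDr JJ; ring.
have j2 : -1 - J = J * (-1 + J) by rewrite mulrDr JJ; ring.
have j3 : 1 + J = J * (1 - J) by rewrite mulrBr JJ; ring.
have j4 : 1 - J = J * (-1 - J) by rewrite mulrBr JJ; ring.
rewrite (rot _ _ _ _ j2 j4) (rot _ _ _ _ j1 j2) (rot _ _ _ _ j3 j1).
rewrite (rot _ _ _ _ j4 j3) -!(rot (-1 - J) (1 - J) (1 - J) (1 + J) j4 j3).
have key : 1 <= complex.Im (trapezoid N g (z + h * (1 - J)) (z + h * (1 + J))).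
  have len : z + h * (1 + J) - (z + h * (1 - J)) = rC 0 + rC (2 * a) * J.
    by rewrite rC0 rCM rCn /h; ring.
  have := @Im_trapezoid_ge N g (z + h * (1 - J)) (z + h * (1 + J)) (2 * a)^-1.
  rewrite len (ReIm_J _ _).1 (ReIm_J _ _).2 mulVf ?gt_eqF ?mulr_gt0 //.
  apply=> //; last by rewrite mulr_ge0 // ltW.
  move=> t /andP[t0 t1]; rewrite /g.
  have -> : z + h * (1 - J) + rC t * (z + h * (1 + J) - (z + h * (1 - J))) - z = rC a + rC (a * (2 * t - 1)) * J.
    by rewrite !(rCM, rCB, rC1, rCn, rC0) /h; ring.
  set s := 2 * t - 1.
  have s2 : s ^+ 2 <= 1 by rewrite /s; nra.
  rewrite cReV (ReIm_J _ _).1 (ReIm_J _ _).2.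
  have a2 : 0 < a ^+ 2 by rewrite exprn_gt0.
  have ha : a ^+ 2 <= a ^+ 2 + (a * s) ^+ 2 by rewrite lerDl sqr_ge0.
  rewrite ler_pdivlMr ?(lt_le_trans a2 ha) // mulrC ler_pdivrMr ?mulr_gt0 //.
  by rewrite exprMn; nra.
move: (trapezoid _ _ _ _) key => T key.
have -> : T + T + T + T = 4 * T by ring.
rewrite nrmM nrm_nat; have := nrm_Im T; have := ler_norm (complex.Im T); lra.
Qed.

(** Cauchy's formula as an inequality. The difference quotient of f at z is bounded, and
    differentiable off z, so its contour sums become negligible; what remains compares [f z] times a
    sum of modulus at least 4 with a sum of modulus at most 8M. *)
Lemma cauchy_bound f z a M : 0 < a -> (forall p, in_square z a p -> cdiff f p) ->
  (forall p, on_boundary z a p -> nrm (f p) <= M) -> nrm (f z) <= 2 * M.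
Proof.
move=> a0 df fM.
pose h w := (f w - f z) / (w - z).
have zin : in_square z a z by apply: in_square_center; exact: ltW.
have dh p : in_square z a p -> p != z -> cdiff h p.
  move=> /df/differentiable_cdiff dp pz; apply/differentiable_cdiff.
  apply: differentiableM.
    by apply: differentiableB => //; exact: differentiable_cst.
  apply: (@differentiableV _ _ (fun w : C => w - z)); last by rewrite subr_eq0.
  by apply: differentiableB => //; exact: differentiable_cst.
have [M' hM'] : exists M', forall p, in_square z a p -> nrm (h p) <= M'.
  have [M1 hM1] := cdiff_bounded a0 df.
  have [l hl] := df z zin; have [d d0 hd] := hl 1 ltr01.
  exists (Num.max (1 + nrm l) (2 * M1 / d)) => p pin; rewrite le_max.
  have [pd|pd] := ltP (nrm (p - z)) d.
    apply/orP; left; have [->|pz] := eqVneq p z.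
      by rewrite /h subrr mul0r nrm0 addr_ge0 // nrm_ge0.
    have pz0 : 0 < nrm (p - z) by rewrite nrm_gt0 subr_eq0.
    rewrite /h nrmM nrmV ler_pdivrMr //.
    have := hd _ pd; have := nrmD (f p - f z - l * (p - z)) (l * (p - z)).
    by rewrite subrK nrmM; lra.
  apply/orP; right; rewrite /h nrmM nrmV.
  have pz0 : 0 < nrm (p - z) by exact: lt_le_trans pd.
  apply: ler_pM; rewrite ?nrm_ge0 ?invr_ge0 ?nrm_ge0 //; last by rewrite lef_pV2.
  by apply: le_trans (nrmB _ _) _; have := hM1 _ pin; have := hM1 _ zin; lra.
apply: le_eps => e e0.
have [N /(_ N (leqnn N)) hN] := goursat_removable a0 dh hM' (mulr_gt0 (ltr0Sn R 3) e0).
have E : boundary N (fun w => f w / (w - z)) z (rC a) =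
    boundary N h z (rC a) + f z * boundary N (fun w => (w - z)^-1) z (rC a).
  rewrite -boundary_lin; congr (boundary _ _ _ _); apply/funext => w.
  by rewrite /h mulrBl subrK.
have fb : nrm (boundary N (fun w => f w / (w - z)) z (rC a)) <= 8 * a * (M / a).
  apply: boundary_bound; first exact: ltW.
  move=> p hp; have [_ ap] := hp; rewrite nrmM nrmV.
  have p0 : 0 < nrm (p - z) by exact: lt_le_trans ap.
  by apply: ler_pM; rewrite ?nrm_ge0 ?invr_ge0 ?nrm_ge0 ?fM // lef_pV2.
have e2 : f z * boundary N (fun w => (w - z)^-1) z (rC a) =
    boundary N (fun w => f w / (w - z)) z (rC a) - boundary N h z (rC a).
  by rewrite E addrC addKr.
have h1 := congr1 (@nrm R) e2; rewrite nrmM in h1.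
have h2 := nrmB (boundary N (fun w => f w / (w - z)) z (rC a)) (boundary N h z (rC a)).
have h3 : 4 * nrm (f z) <= nrm (f z) * nrm (boundary N (fun w => (w - z)^-1) z (rC a)).
  by rewrite mulrC ler_wpM2l ?nrm_ge0 ?boundary_inv_ge.
rewrite (_ : 8 * a * (M / a) = 8 * M) in fb; last by field; rewrite gt_eqF.
lra.
Qed.

(* f / (w - b)^n extends holomorphically across b, so its value at z is bounded
   by its values on the boundary of the square with centre z, where |w - b|
   exceeds |z - b| by a fixed factor; let n grow. *)
Lemma identity_step f z b a r : 0 < a -> 0 < r ->
  (forall p, in_square z a p -> cdiff f p) ->
  (forall w, nrm (w - b) < r -> f w = 0) -> nrm (z - b) < a / 2 -> f z = 0.
Proof.
move=> a0 r0 df fb zb.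
have [zb0|zb0] := ltP (nrm (z - b)) r; first exact: fb.
have [M0 hM0] := cdiff_bounded a0 df.
have [M [Mgt0 hM]] : exists M, 0 < M /\ forall p, in_square z a p -> nrm (f p) <= M.
  exists (Num.max 1 M0); rewrite lt_max ltr01; split=> // p /hM0 h.
  by rewrite le_max h orbT.
pose d := a - nrm (z - b).
have d0 : 0 < d by rewrite /d; lra.
have bound n : nrm (f z) <= 2 * M * (nrm (z - b) / d) ^+ n.
  have zbn : 0 < nrm (z - b) ^+ n by rewrite exprn_gt0 // (lt_le_trans r0).
  have dn : 0 < d ^+ n by rewrite exprn_gt0.
  have := @cauchy_bound (fun w => f w / (w - b) ^+ n) z a (M / d ^+ n) a0.
  rewrite nrmM nrmV nrmX => H.
  suff : nrm (f z) / nrm (z - b) ^+ n <= 2 * (M / d ^+ n).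
    rewrite ler_pdivrMr // => h; apply: le_trans h _.
    by rewrite expr_div_n le_eqVlt; apply/orP; left; apply/eqP; ring.
  apply: H => [p pin|p [pin pa]].
    have [pb|pb] := eqVneq p b.
      exists 0 => e e0; exists r => // w wp.
      rewrite pb in wp *; rewrite !fb //; last by rewrite subrr nrm0.
      by rewrite !mul0r !subrr nrm0 mulr_ge0 ?nrm_ge0 // ltW.
    apply/differentiable_cdiff; apply: differentiableM.
      by apply/differentiable_cdiff; exact: df.
    apply: (@differentiableV _ _ (fun w : C => (w - b) ^+ n)); last first.
      by rewrite expf_neq0 // subr_eq0.
    apply: (@differentiable_pow _ (fun w : C => w - b)).
    by apply: differentiableB => //; exact: differentiable_cst.
  have pb : d <= nrm (p - b).
    by have := nrm_subD b p z; have := nrm_sub b z; rewrite /d; lra.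
  rewrite nrmM nrmV nrmX ler_pM ?nrm_ge0 ?invr_ge0 ?exprn_ge0 ?nrm_ge0 ?hM //.
  rewrite lef_pV2 ?posrE ?exprn_gt0 ?(lt_le_trans d0) //.
  by rewrite lerXn2r ?nnegrE ?nrm_ge0 // ltW.
apply/eqP; rewrite -nrm_eq0; apply/negPn/negP => nz.
have fz : 0 < nrm (f z) by rewrite lt_def nz nrm_ge0.
have [||n hn] := @expr_to0 R (nrm (z - b) / d) (nrm (f z) / (2 * M)).
- rewrite divr_ge0 ?nrm_ge0 ?(ltW d0) //= ltr_pdivrMr // mul1r /d; lra.
- by rewrite divr_gt0 // mulr_gt0.
have := bound n; rewrite ltr_pdivlMr ?mulr_gt0 // in hn; nra.
Qed.

Lemma in_square_sub c a z r p : nrm (c - p) + 2 * a < r -> in_square c a z -> nrm (z - p) < r.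
Proof. by move=> h /in_square_nrm hz; have := nrm_subD c z p; lra. Qed.

Lemma identity_theorem f p r w : (forall z, nrm (z - p) < r -> cdiff f z) ->
  nrm (w - p) < r -> (\forall z \near w, f z = 0) ->
  forall z, nrm (z - p) < r -> f z = 0.
Proof.
move=> df wp /nearCP[r0 r00 hw] z zp.
pose m := Num.max (nrm (w - p)) (nrm (z - p)).
have mr : m < r by rewrite gt_max wp zp.
(* Squares of half-side a about points close to the segment from w to z stay in the disc, since the
   segment is at distance at least 4a from its edge; the segment is crossed in n steps shorter than
   a/4. *)
pose a := (r - m) / 4; have a0 : 0 < a by rewrite divr_gt0 // subr_gt0.
pose y (t : R) := w + rC t * (z - w).
have yp t : 0 <= t <= 1 -> nrm (y t - p) <= m.
  move=> /andP[t0 t1].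
  have -> : y t - p = rC (1 - t) * (w - p) + rC t * (z - p) by rewrite /y rCB rC1; ring.
  apply: le_trans (nrmD _ _) _; rewrite !nrmM !nrm_pos ?subr_ge0 //.
  have h1 : (1 - t) * nrm (w - p) <= (1 - t) * m by rewrite ler_wpM2l ?subr_ge0 // le_max lexx.
  have h2 : t * nrm (z - p) <= t * m by rewrite ler_wpM2l // le_max lexx orbT.
  lra.
have step t s : 0 <= t <= 1 -> (\forall x \near y s, f x = 0) -> nrm (y t - y s) < a / 4 ->
    \forall x \near y t, f x = 0.
  move=> ht /nearCP[r1 r10 h1] ts; apply/nearCP; exists (a / 4) => [|x xt]; first by rewrite divr_gt0.
  apply: (@identity_step f x (y s) a r1) => //.
    move=> q hq; apply: df; apply: in_square_sub hq.
    by have := nrm_subD (y t) x p; have := yp t ht; rewrite /a in xt ts *; lra.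
  by have := nrm_subD (y t) x (y s); lra.
pose n := (Num.truncn (nrm (z - w) / (a / 4))).+1.
have hn : nrm (z - w) < a / 4 * n%:R.
  have := truncnS_gt (nrm (z - w) / (a / 4)).
  have a4 : 0 < a / 4 by rewrite divr_gt0.
  by rewrite (ltr_pdivrMr _ _ a4) -/n [_ * (a / 4)]mulrC.
have n0 : (0 : R) < n%:R by rewrite ltr0n.
have ind k : (k <= n)%N -> \forall x \near y (k%:R / n%:R), f x = 0.
  elim: k => [_|k IH kn].
    by rewrite mul0r /y rC0 mul0r addr0; apply/nearCP; exists r0.
  apply: step (IH (ltnW kn)) _.
    by rewrite divr_ge0 //= ler_pdivrMr // mul1r ler_nat.
  have -> : y (k.+1%:R / n%:R) - y (k%:R / n%:R) = rC n%:R^-1 * (z - w).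
    by rewrite /y -natr1 !(rCM, rCD, rC1); ring.
  by rewrite nrmM nrm_pos ?invr_ge0 // mulrC ltr_pdivrMr.
have := ind n (leqnn _); rewrite divff ?gt_eqF // => /nbhs_singleton.
by rewrite /y rC1 mul1r addrC subrK.
Qed.
End Trapezoid.

(** * Germs of holomorphic functions on a normed space *)

Section Germs.
Variable R : realType.
Local Notation C := (Cplx R).
Variable V : normedModType C.
Implicit Types (f g h : V -> C) (p w z : V).

Lemma nearVP p (P : set V) :
  (\forall z \near p, P z) <->
  exists2 r : R, 0 < r & forall z, `|z - p| < rC r -> P z.
Proof.
split.
  rewrite -nbhs_nearE nbhs_ballP => -[e /= /posC_ex[r r0 ->] h].
  by exists r => // z zp; apply: h; rewrite -ball_normE /= distrC.
move=> [r r0 h]; rewrite -nbhs_nearE nbhs_ballP; exists (rC r) => /=.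
  by rewrite -rC0 rC_lt.
by move=> z; rewrite -ball_normE /= distrC; apply: h.
Qed.

Definition nonzero_germ f p : Prop := ~ (\forall z \near p, f z = 0).

Lemma holomorphic_near f p : holomorphic_at f p -> \forall w \near p, holomorphic_at f w.
Proof. by move=> /nearVP[r r0 h]; apply: near_join; apply/nearVP; exists r. Qed.

Lemma holomorphic_diff f p : holomorphic_at f p -> differentiable f p.
Proof. exact: nbhs_singleton. Qed.

Lemma holomorphic_cont f p : holomorphic_at f p -> {for p, continuous f}.
Proof. by move=> /holomorphic_diff; exact: differentiable_continuous. Qed.

Lemma nonzero_near f p : {for p, continuous f} -> f p != 0 -> \forall z \near p, f z != 0.
Proof.
move=> /cvgCP fc fp; have e0 : 0 < nrm (f p) by rewrite nrm_gt0.
have := fc _ e0; apply: filterS => z; apply: contraTneq => ->.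
by rewrite sub0r nrmN ltxx.
Qed.

Lemma nonzero_germ_at f p : f p != 0 -> nonzero_germ f p.
Proof. by move=> fp /nbhs_singleton f0; rewrite f0 eqxx in fp. Qed.

(** Restriction to the complex line through w and z reduces to one variable. For |t| < 2 the points
    w + t (z - w) stay within 5r of p, and the disc |t| < 2 contains both t = 0 and t = 1. *)
Lemma ball_identity f p w r : (forall z, `|z - p| < rC (8 * r) -> differentiable f z) ->
  `|w - p| < rC r -> (\forall z \near w, f z = 0) ->
  forall z, `|z - p| < rC r -> f z = 0.
Proof.
move=> df wp fw z zp.
pose phi (t : C) := f (w + t *: (z - w)).
have daff (t : C) : differentiable (fun t : C => w + t *: (z - w)) t.
  apply: differentiableD; first exact: differentiable_cst.
  by apply: differentiableZl.
have zw : `|z - w| <= rC (2 * r).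
  have -> : z - w = (z - p) - (w - p) by rewrite opprB addrA subrK.
  apply: le_trans (ler_normB _ _) _; rewrite rCM rCn mulr_natl mulr2n.
  by apply: lerD; exact: ltW.
suff : phi 1 = 0 by rewrite /phi scale1r addrC subrK.
apply: (@identity_theorem R phi 0 2 0).
- move=> t; rewrite subr0 => t2; apply/differentiable_cdiff.
  apply: (@differentiable_comp _ _ _ _ (fun t : C => w + t *: (z - w)) f) => //.
  apply: df.
  have -> : w + t *: (z - w) - p = (w - p) + t *: (z - w) by rewrite addrAC.
  apply: le_lt_trans (ler_normD _ _) _; rewrite normrZ nrmE.
  have r0 : 0 < r by rewrite -rC_lt rC0; exact: le_lt_trans (normr_ge0 _) wp.
  have h : rC (nrm t) * `|z - w| <= rC (4 * r).
    have -> : 4 * r = 2 * (2 * r) by ring.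
    rewrite rCM; apply: ler_pM => //; first by rewrite -rC0 rC_le nrm_ge0.
    by rewrite rC_le ltW.
  have := ltr_leD wp h; rewrite -rCD => /lt_trans; apply.
  by rewrite rC_lt; lra.
- by rewrite subrr nrm0.
- have /differentiable_continuous := daff 0.
  move=> hc; have : nbhs (w + 0 *: (z - w)) [set y | f y = 0] by rewrite scale0r addr0.
  by move=> /hc.
- by rewrite subr0 nrm1; lra.
Qed.

Lemma nonzero_germ_near f p : holomorphic_at f p -> nonzero_germ f p ->
  \forall w \near p, nonzero_germ f w.
Proof.
move=> /nearVP[r r0 df] nz; apply/nearVP; exists (r / 8); first by rewrite divr_gt0.
move=> w wp fw; apply: nz; apply/nearVP; exists (r / 8); first by rewrite divr_gt0.
move=> z; apply: ball_identity wp fw z => z zp; apply: df.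
by rewrite (_ : r = 8 * (r / 8)) //; field.
Qed.

Lemma holomorphicM f g p : holomorphic_at f p -> holomorphic_at g p ->
  holomorphic_at (fun z => f z * g z) p.
Proof. by move=> hf; apply: filterS2 hf => z; exact: differentiableM. Qed.

Lemma holomorphicB f g p : holomorphic_at f p -> holomorphic_at g p ->
  holomorphic_at (fun z => f z - g z) p.
Proof. by move=> hf; apply: filterS2 hf => z; exact: differentiableB. Qed.

Lemma holomorphic_cst (k : C) p : holomorphic_at (fun=> k) p.
Proof. by apply: filterE => z; exact: differentiable_cst. Qed.

Lemma holomorphicV f p : holomorphic_at f p -> f p != 0 ->
  holomorphic_at (fun z => (f z)^-1) p.
Proof.
move=> hf fp; have := nonzero_near (holomorphic_cont hf) fp.
by apply: filterS2 hf => z df fz; exact: differentiableV.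
Qed.

Lemma holomorphic_prod (I : Type) (s : seq I) (P : pred I) (f : I -> V -> C) p :
  (forall i, P i -> holomorphic_at (f i) p) ->
  holomorphic_at (fun z => \prod_(i <- s | P i) f i z) p.
Proof.
move=> hf; elim: s => [|i s IH].
  by under eq_fun do rewrite big_nil; exact: holomorphic_cst.
have -> : (fun z => \prod_(j <- i :: s | P j) f j z) = (fun z =>
    if P i then f i z * \prod_(j <- s | P j) f j z else \prod_(j <- s | P j) f j z).
  by apply/funext => z; rewrite big_cons.
case Pi: (P i); last exact: IH.
by apply: holomorphicM => //; exact: hf.
Qed.

(** If f and g differ at a point, they differ on a neighbourhood of it, where h must then vanish;
    but h has a nonzero germ at every point near p. *)
Lemma eq_off_zeros f g h p : holomorphic_at f p -> holomorphic_at g p ->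
  holomorphic_at h p -> nonzero_germ h p ->
  (\forall z \near p, h z != 0 -> f z = g z) -> \forall z \near p, f z = g z.
Proof.
move=> hf hg hh nh /near_join fg.
have hB := holomorphic_near (holomorphicB hf hg).
have := nonzero_germ_near hh nh; apply: filter_app; apply: filterS2 hB fg => z hB fg nz.
apply/eqP/negPn/negP => fgz; apply: nz.
have := nonzero_near (holomorphic_cont hB); rewrite subr_eq0 => /(_ fgz).
apply: filterS2 fg => y fg; rewrite subr_eq0.
by apply: contraNeq => /fg ->.
Qed.

(** If the product vanishes near p, then g vanishes off the zeros of f, hence everywhere near p. *)
Lemma nonzero_germM f g p : holomorphic_at f p -> holomorphic_at g p ->
  nonzero_germ f p -> nonzero_germ g p -> nonzero_germ (fun z => f z * g z) p.
Proof.
move=> hf hg nf ng fg; apply: ng.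
apply: (@eq_off_zeros g (fun=> 0) f) => //; first exact: holomorphic_cst.
apply: filterS fg => z /eqP; rewrite mulf_eq0 => /orP[->//|/eqP->//].
Qed.

Lemma nonzero_germ_prod (I : Type) (s : seq I) (P : pred I) (f : I -> V -> C) p :
  (forall i, P i -> holomorphic_at (f i) p) -> (forall i, P i -> nonzero_germ (f i) p) ->
  nonzero_germ (fun z => \prod_(i <- s | P i) f i z) p.
Proof.
move=> hf nf; elim: s => [|i s IH].
  by apply: nonzero_germ_at; rewrite big_nil oner_eq0.
have -> : (fun z => \prod_(j <- i :: s | P j) f j z) = (fun z =>
    if P i then f i z * \prod_(j <- s | P j) f j z else \prod_(j <- s | P j) f j z).
  by apply/funext => z; rewrite big_cons.
case Pi: (P i); last exact: IH.
apply: nonzero_germM => //; [exact: hf|exact: holomorphic_prod|exact: nf].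
Qed.

End Germs.

(** * The identity theorem for meromorphic functions of one variable *)

Section MeromorphicIdentity.
Variable R : realType.
Local Notation C := (Cplx R).
Implicit Types (f A b : C -> C) (p s z : C).

Lemma nearCV p (P : set C) : (\forall z \near p, P z) ->
  exists2 r : R, 0 < r & forall z, nrm (z - p) < r -> P z.
Proof. by move/nearCP. Qed.

(** On a square small enough for a single local quotient f = g/h, the relation f b = A spreads from
    one point to all others by the identity theorem applied to g b - A h. Since the four quarters of
    a square share its centre, bisection carries it from s0 to s. *)
Lemma meromorphic_identity f A b (s0 : C) :
  meromorphic_on setT f -> (forall z, holomorphic_at A z) -> (forall z, holomorphic_at b z) ->
  (\forall z \near s0, f z * b z = A z) ->
  forall s, b s != 0 -> f s = A s / b s.
Proof.
move=> mf hA hb fs0 s bs.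
pose U z := exists h : C -> C, [/\ holomorphic_at h z, nonzero_germ h z &
  \forall y \near z, h y != 0 -> f y * b y = A y].
have U0 : U s0.
  exists (fun=> 1); split; [exact: holomorphic_cst| |].
    by apply: nonzero_germ_at; rewrite oner_eq0.
  by apply: filterS fs0.
have Us : U s.
  pose a := nrm (s - s0) + 1.
  have a0 : 0 < a by rewrite ltr_wpDl ?nrm_ge0.
  have inq (z : C) : nrm (z - s0) <= a -> in_square s0 a z.
    by move=> za; split; apply: le_trans za; [exact: nrm_Re|exact: nrm_Im].
  pose Q c a := (exists2 w, in_square c a w & U w) -> forall w, in_square c a w -> U w.
  suff : Q s0 a.
    apply; last by apply: inq; rewrite /a; lra.
    by exists s0 => //; apply: inq; rewrite subrr nrm0 ltW.
  apply: (square_bisection a0).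
    move=> c a' a'0 IH [w win Uw] w' w'in.
    have [i wi] := in_some_subsquare (ltW a'0) win.
    have [j wj] := in_some_subsquare (ltW a'0) w'in.
    have cin k : in_square (subcenter c (rC a') k) (a' / 2) c.
      rewrite /in_square subcenterE opprD addrA subrr add0r cReN cImN !normrN.
      by rewrite (ReIm_J _ _).1 (ReIm_J _ _).2 !norm_sgn_half ?(ltW a'0).
    apply: (IH j) wj; exists c; first exact: cin.
    by apply: (IH i) (cin i); exists w.
  move=> p _.
  have [[g [h [hg hh nh fgh]]] _] := mf p I.
  have [r r0 hr] := nearCV (filterI (nonzero_germ_near hh nh)
    (filterI (holomorphic_near hg) (filterI (holomorphic_near hh) (near_join fgh)))).
  exists (r / 4) => [|c a' a'0 a'r pin [w win Uw] w' w'in]; first by rewrite divr_gt0.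
  have inr z : in_square c a' z -> nrm (z - p) < r.
    by move=> /in_square_nrm; have := in_square_nrm pin; have := nrm_tri c z p; lra.
  have wr := inr _ win; have w'r := inr _ w'in.
  have [nhw [hgw [hhw fghw]]] := hr _ wr.
  have [k [hk nk fk]] := Uw.
  have E : \forall z \near w, g z * b z = A z * h z.
    apply: (@eq_off_zeros _ _ _ _ (fun z => h z * k z)); [exact: holomorphicM..| |].
      exact: nonzero_germM.
    apply: filterS2 fk fghw => z fk fgh'; rewrite mulf_eq0 negb_or => /andP[hz kz].
    by rewrite -fk // fgh' // mulrAC divfK // mulrC.
  have E2 z : nrm (z - p) < r -> g z * b z - A z * h z = 0.
    apply: (@identity_theorem R (fun z => g z * b z - A z * h z) p r w) => //.
      move=> y /hr[_ [hgy [hhy _]]]; apply/differentiable_cdiff/holomorphic_diff.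
      by apply: holomorphicB; apply: holomorphicM.
    by apply: filterS E => y ->; rewrite subrr.
  have [nhw' [_ [hhw' fghw']]] := hr _ w'r.
  exists h; split=> //.
  have : \forall z \near w', nrm (z - p) < r.
    apply/nearCP; exists (r - nrm (w' - p)); first by rewrite subr_gt0.
    by move=> z hz; have := nrm_subD w' z p; lra.
  apply: filterS2 fghw' => z fz zr hz; rewrite fz //.
  have /eqP := E2 _ zr; rewrite subr_eq0 => /eqP e.
  by rewrite mulrAC e mulfK.
have [h [hh nh fh]] := Us.
have bn : \forall z \near s, b z != 0 by apply: nonzero_near => //; exact: holomorphic_cont.
have hAb : holomorphic_at (fun z => A z / b z) s by apply: holomorphicM => //; exact: holomorphicV.
have E : \forall z \near s, h z != 0 -> f z = A z / b z.
  by apply: filterS2 fh bn => z fz bz hz; rewrite -fz // mulfK.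
have [_ reg] := mf s I.
(* The regularity clause of [meromorphic_on] is what forces the right value at s itself. *)
have hf : holomorphic_at f s by apply: reg; exists (fun z => A z / b z), h.
exact: nbhs_singleton (eq_off_zeros hf hAb hh nh E).
Qed.

End MeromorphicIdentity.

(** * Infinite products and bilateral series *)

Section InfiniteProducts.
Variable R : realType.
Local Notation C := (Cplx R).
Implicit Types (a b x y z : C).

Lemma prod1D_near1 (I : Type) (s : seq I) (a : I -> C) :
  nrm (\prod_(i <- s) (1 + a i) - 1) <= expR (\sum_(i <- s) nrm (a i)) - 1.
Proof.
elim: s => [|i s IH]; first by rewrite !big_nil subrr nrm0 expR0 subrr.
rewrite !big_cons expRD; set P := \prod_(_ <- _) _ in IH *; set S := \sum_(_ <- _) _ in IH *.
have -> : (1 + a i) * P - 1 = (1 + a i) * (P - 1) + a i by ring.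
apply: le_trans (nrmD _ _) _; rewrite nrmM.
have h1 := nrmD 1 (a i); rewrite nrm1 in h1.
have h2 := expR_ge1Dx (nrm (a i)).
have h3 := nrm_ge0 (P - 1); have h4 := nrm_ge0 (a i).
have : nrm (1 + a i) * nrm (P - 1) <= (1 + nrm (a i)) * (expR S - 1) by rewrite ler_pM ?nrm_ge0.
have := expR_gt0 S; nra.
Qed.

Lemma prod1D_le (I : Type) (s : seq I) (a : I -> C) :
  nrm (\prod_(i <- s) (1 + a i)) <= expR (\sum_(i <- s) nrm (a i)).
Proof.
have := prod1D_near1 s a; have := nrm_subl (\prod_(i <- s) (1 + a i)) 1.
rewrite nrm1; lra.
Qed.

Lemma ord_split (T : Type) (idx : T) (op : Monoid.law idx) n m (f : nat -> T) : (n <= m)%N ->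
  \big[op/idx]_(k < m) f k = op (\big[op/idx]_(k < n) f k) (\big[op/idx]_(n <= k < m) f k).
Proof. by move=> nm; rewrite -!(big_mkord predT) -big_cat_nat. Qed.

Lemma small_expR (e : R) : 0 < e -> exists2 d : R, 0 < d & forall t, t <= d -> expR t - 1 < e.
Proof.
move=> e0; exists (ln (1 + e / 2)).
  by rewrite ln_gt0 // ltrDl divr_gt0.
move=> t; rewrite -ler_expR lnK ?posrE; last by rewrite addr_gt0 // divr_gt0.
lra.
Qed.

Lemma prod1D_cauchy (a : nat -> C) (M : R) : (forall n, \sum_(k < n) nrm (a k) <= M) ->
  forall e, 0 < e -> exists N, forall n m, (N <= n)%N -> (n <= m)%N ->
    nrm (\prod_(n <= k < m) (1 + a k) - 1) < e.
Proof.
move=> hM e e0; have [d d0 hd] := small_expR e0.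
have g0 k : 0 <= nrm (a k) by exact: nrm_ge0.
have [A hA] := nonneg_tail g0 (sum_fset_nat_le g0 hM) d0.
have [N hN] := fset_iotaP A; exists N => n m Nn nm.
apply: le_lt_trans (prod1D_near1 _ _) _; apply: hd.
have := hA [fset k in index_iota n m]%fset.
have -> : \sum_(i <- [fset k in index_iota n m]%fset) nrm (a i) = \sum_(n <= i < m) nrm (a i).
  apply: perm_big; apply: uniq_perm => //; first exact: iota_uniq.
  by move=> i; rewrite in_fset.
move=> h; apply: ltW; apply: h.
apply/fdisjointP => k /(fsubsetP (hN _ Nn)).
by rewrite !in_fset mem_iota mem_index_iota /= add0n => kn; rewrite leqNgt kn.
Qed.

Lemma infprod_cvg (a : nat -> C) (M : R) : (forall n, \sum_(k < n) nrm (a k) <= M) ->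
  exists l : C, (fun n => \prod_(k < n) (1 + a k)) @ \oo --> l.
Proof.
move=> hM; apply: cauchyC => e e0.
have e1 : 0 < e / 2 / expR M by rewrite !divr_gt0 // expR_gt0.
have [N hN] := prod1D_cauchy hM e1; exists N => n m Nn Nm.
have key n' m' : (N <= n')%N -> (n' <= m')%N -> nrm (\prod_(k < m') (1 + a k) - \prod_(k < n') (1 + a k)) < e / 2.
  move=> Nn' nm; rewrite (ord_split _ (fun k => 1 + a k) nm) -{2}[\prod_(k < n') _]mulr1 -mulrBr nrmM.
  have h := hN _ _ Nn' nm; rewrite ltr_pdivlMr ?expR_gt0 // in h.
  apply: le_lt_trans h; rewrite mulrC ler_wpM2l ?nrm_ge0 //.
  by apply: le_trans (prod1D_le _ _) _; rewrite ler_expR.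
apply: le_lt_trans (nrm_tri (\prod_(k < N) (1 + a k)) _ _) _.
have := key N n (leqnn _) Nn; have := key N m (leqnn _) Nm; lra.
Qed.

Lemma cvg_nrm_le (u : nat -> C) l (M : R) : u @ \oo --> l -> (forall n, nrm (u n) <= M) -> nrm l <= M.
Proof.
move=> /cvgnP h hM; apply: le_eps => e /h[N /(_ _ (leqnn N)) hN].
by have := nrm_subl l (u N); have := hM N; rewrite nrm_sub; lra.
Qed.

Lemma cvg_nrm_ge (u : nat -> C) l (M : R) : u @ \oo --> l -> (forall n, M <= nrm (u n)) -> M <= nrm l.
Proof.
move=> /cvgnP h hM; apply: le_eps => e /h[N /(_ _ (leqnn N)) hN].
by have := nrm_subl (u N) l; have := hM N; lra.
Qed.

Lemma infprod_ne0 (a : nat -> C) (M : R) l : (forall n, \sum_(k < n) nrm (a k) <= M) ->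
  (forall k, 1 + a k != 0) -> (fun n => \prod_(k < n) (1 + a k)) @ \oo --> l -> l != 0.
Proof.
move=> hM a0 hl; rewrite -nrm_gt0.
(* The tolerance is 1/2, so products of consecutive factors starting at N have modulus at least
   1/2. *)
have [N hN] := prod1D_cauchy hM (divr_gt0 (ltr0Sn R 0) (ltr0Sn R 1)).
pose c := nrm (\prod_(k < N) (1 + a k)).
have c0 : 0 < c by rewrite nrm_gt0; apply/prodf_neq0 => k _; exact: a0.
have := @cvg_nrm_ge (fun n => \prod_(k < N + n) (1 + a k)) l (c / 2) (cvgn_addl N hl).
have c2 : 0 < c / 2 by rewrite divr_gt0.
move=> h; apply: lt_le_trans c2 (h _) => n.
rewrite (ord_split _ (fun k => 1 + a k) (leq_addr n N)) nrmM ler_wpM2l ?nrm_ge0 //.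
have := hN N (N + n)%N (leqnn _) (leq_addr _ _).
set P := \prod_(_ <= _ < _) _; have := nrm_subl 1 (1 - P); rewrite subKr nrm_sub nrm1; lra.
Qed.

Definition qfactor a p (k : nat) : C := - (a * p ^+ k).

Lemma qfactor_sum a p n : nrm p < 1 -> \sum_(k < n) nrm (qfactor a p k) <= nrm a / (1 - nrm p).
Proof.
move=> p1; rewrite (eq_bigr (fun k : 'I_n => nrm a * nrm p ^+ k)); last first.
  by move=> k _; rewrite /qfactor nrmN nrmM nrmX.
rewrite -mulr_sumr ler_wpM2l ?nrm_ge0 //.
have r1' : 0 < 1 - nrm p by rewrite subr_gt0.
rewrite -(ler_pM2l r1') mulfV ?gt_eqF //.
have := subrX1 (nrm p) n; have := exprn_ge0 n (nrm_ge0 p).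
move: (nrm p ^+ n) (\sum_(i < n) _) => x y; lra.
Qed.

Lemma qp_cvg a p : nrm p < 1 -> (fun n => \prod_(k < n) (1 - a * p ^+ k) : C) @ \oo --> qpochhammer a p.
Proof.
move=> p1; have [l hl] := infprod_cvg (fun n => qfactor_sum a n p1).
by rewrite /qpochhammer (cvg_lim _ hl).
Qed.

Lemma qp_rec a p : nrm p < 1 -> qpochhammer a p = (1 - a) * qpochhammer (a * p) p.
Proof.
move=> p1; have := cvgn_addl 1 (qp_cvg (a := a) p1).
have -> : (fun n => \prod_(k < 1 + n) (1 - a * p ^+ k)) = (fun n => (1 - a) * \prod_(k < n) (1 - a * p * p ^+ k)).
  apply/funext => n; rewrite add1n big_ord_recl expr0 mulr1; congr (_ * _).
  by apply: eq_bigr => k _; rewrite /bump /= exprS mulrA.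
move=> h; apply: (cvgn_unique h); apply: cvgnM; first exact: cvgn_cst.
exact: qp_cvg.
Qed.

Lemma qp_ne0 a p : nrm p < 1 -> (forall k, 1 - a * p ^+ k != 0) -> qpochhammer a p != 0.
Proof. by move=> p1 h; apply: infprod_ne0 (fun n => qfactor_sum a n p1) h (qp_cvg p1). Qed.

Lemma qp_bound a p : nrm p < 1 -> nrm (qpochhammer a p) <= expR (nrm a / (1 - nrm p)).
Proof.
move=> p1; apply: cvg_nrm_le (qp_cvg p1) _ => n.
by apply: le_trans (prod1D_le _ (fun k : 'I_n => qfactor a p k)) _; rewrite ler_expR qfactor_sum.
Qed.

Lemma qp_near1 a p : nrm p < 1 -> nrm (qpochhammer a p - 1) <= expR (nrm a / (1 - nrm p)) - 1.
Proof.
move=> p1; apply: (@cvg_nrm_le (fun n => \prod_(k < n) (1 - a * p ^+ k) - 1)) => [|n].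
  by apply: cvgnB; [exact: qp_cvg|exact: cvgn_cst].
apply: le_trans (prod1D_near1 _ (fun k : 'I_n => qfactor a p k)) _.
by rewrite lerD2r ler_expR qfactor_sum.
Qed.

Lemma qp_to1 (a : nat -> C) p : nrm p < 1 -> a @ \oo --> (0 : C) ->
  (fun n => qpochhammer (a n) p) @ \oo --> (1 : C).
Proof.
move=> p1 /cvgnP ha; apply/cvgnP => e /small_expR[d d0 hd].
have p1' : 0 < 1 - nrm p by rewrite subr_gt0.
have [N hN] := ha _ (mulr_gt0 d0 p1'); exists N => n /hN.
rewrite subr0 => h; apply: le_lt_trans (qp_near1 _ p1) _; apply: hd.
by rewrite ler_pdivrMr // ltW.
Qed.

End InfiniteProducts.

Lemma oddS_int (n : int) : odd `|(n + 1)%R|%N = ~~ odd `|n|%N.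
Proof. by case: n => n; lia. Qed.

Lemma oppz_addr1 (m : nat) : - Posz m.+1 + 1 = - Posz m.
Proof. by lia. Qed.

Lemma odd_int_pred (n : int) : odd `|n|%N -> exists2 m, n = m + 1 & odd `|m|%N = false.
Proof. by move=> o; exists (n - 1); lia. Qed.

(** * Sums over the integers *)

Section IntSums.
Variable R : realType.
Local Notation C := (Cplx R).

Lemma has_sum_shift (f : int -> C) M l : abs_bounded f M -> has_sum f l ->
  has_sum (fun n => f (n + 1)) l.
Proof.
move=> hM hl; apply: (@has_sum_inj R int int (fun n => f (n + 1)) M l (fun n => n - 1)).
- exact: addIr.
- by move=> i /(_ (i + 1)); rewrite addrK eqxx.
- by move=> A; under eq_bigr do rewrite subrK.
- by apply: has_sum_ext hl => n; rewrite subrK.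
Qed.

Lemma has_sum_opp (f : int -> C) M l : abs_bounded f M -> has_sum f l ->
  has_sum (fun n => f (- n)) l.
Proof.
move=> hM hl; apply: (@has_sum_inj R int int (fun n => f (- n)) M l -%R).
- exact: oppr_inj.
- by move=> i /(_ (- i)); rewrite opprK eqxx.
- by move=> A; under eq_bigr do rewrite opprK.
- by apply: has_sum_ext hl => n; rewrite opprK.
Qed.

Lemma sum_half_le n : \sum_(k < n) (2^-1 : R) ^+ k <= 2.
Proof.
suff -> : \sum_(k < n) (2^-1 : R) ^+ k = 2 - 2 * 2^-1 ^+ n by rewrite gerBl mulr_ge0 // exprn_ge0.
by elim: n => [|n IH]; rewrite ?big_ord0 ?big_ord_recr /= ?IH ?exprS ?expr0; field.
Qed.

Lemma int_geom (A : {fset int}) : \sum_(n <- A) (2^-1 : R) ^+ `|n|%N <= 4.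
Proof.
have g0 n : 0 <= (2^-1 : R) ^+ n by rewrite exprn_ge0 // invr_ge0.
pose P := [fset n in A | (0 <= n)]%fset; pose Q := [fset n in A | (n < 0)]%fset.
have -> : \sum_(n <- A) (2^-1 : R) ^+ `|n|%N =
    \sum_(n <- P) (2^-1 : R) ^+ `|n|%N + \sum_(n <- Q) (2^-1 : R) ^+ `|n|%N.
  rewrite (bigID (fun n : int => 0 <= n)) /= !big_fset /=; congr (_ + _).
  by apply: eq_bigl => n; rewrite ltNge.
have half (B : {fset int}) : {in B &, injective (fun n : int => `|n|%N)} ->
    \sum_(n <- B) (2^-1 : R) ^+ `|n|%N <= 2.
  move=> inj; rewrite -(big_imfset (h := fun n : int => `|n|%N) _ imfset_key (fun k => (2^-1 : R) ^+ k) inj) /=.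
  exact: (sum_fset_nat_le g0 (fun n => sum_half_le n)).
have -> : (4 : R) = 2 + 2 by ring.
apply: lerD; apply: half => n m; rewrite !inE /= => /andP[_ n0] /andP[_ m0] e.
  by rewrite -(gez0_abs n0) -(gez0_abs m0) e.
by apply: oppr_inj; rewrite -(ltz0_abs n0) -(ltz0_abs m0) e.
Qed.

Lemma int_abs_bounded (f : int -> C) (K : R) : 0 <= K ->
  (forall n, nrm (f n) <= K * 2^-1 ^+ `|n|%N) -> abs_bounded f (K * 4).
Proof.
move=> K0 h A; apply: le_trans (ler_sum _ (fun n _ => h n)) _.
by rewrite -mulr_sumr ler_wpM2l // int_geom.
Qed.
End IntSums.

(** * Gaussian binomial coefficients *)

Section Jacobi.
Variable R : realType.
Local Notation C := (Cplx R).
Variable P : C.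
Hypothesis P1 : nrm P < 1.
Hypothesis P0 : forall k, 1 - P ^+ k.+1 != 0.

(** This is (P; P)_n, without division by powers of 1 - P; the quotient [qbin] is the Gaussian
    binomial coefficient. *)
Definition qfact n : C := \prod_(k < n) (1 - P ^+ k.+1).
Definition qbin n j : C := if (j <= n)%N then qfact n / (qfact j * qfact (n - j)) else 0.

Lemma qfact_ne0 n : qfact n != 0.
Proof. by apply/prodf_neq0 => k _; exact: P0. Qed.

Lemma qfactS n : qfact n.+1 = qfact n * (1 - P ^+ n.+1).
Proof. by rewrite /qfact big_ord_recr. Qed.

Lemma qbin0 n : qbin n 0 = 1.
Proof. by rewrite /qbin /= subn0 /qfact big_ord0 mul1r divff // qfact_ne0. Qed.

Lemma qbin_pascal n j : (j <= n)%N -> qbin n.+1 j.+1 = qbin n j.+1 + P ^+ (n - j) * qbin n j.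
Proof.
move=> jn; rewrite /qbin ltnS jn subSS.
have n0 := qfact_ne0 n; have j0 := qfact_ne0 j; have s0 := P0 j.
case: ltngtP jn => // [jn _|-> _].
  have [m nm] : exists m, (n - j)%N = m.+1 by exists (n - j).-1; rewrite prednK // subn_gt0.
  have -> : (n - j.+1 = m)%N by rewrite subnS nm.
  rewrite nm !qfactS.
  have m0 := qfact_ne0 m; have sm := P0 m.
  have -> : n.+1 = (m.+1 + j.+1)%N by rewrite -nm; lia.
  rewrite exprD; move: (P ^+ m.+1) (P ^+ j.+1) sm s0 => x y sm s0.
  by field; rewrite j0 m0 sm s0.
rewrite subnn !qfactS expr0 /qfact !big_ord0 -/(qfact n).
by field; rewrite (P0 n) n0.
Qed.

(** Cauchy's q-binomial theorem. The inner product is (-y)^j P^(j(j-1)/2), kept in product form so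
    that it matches the terms of the bilateral series. *)
Lemma qbinomial n (y : C) :
  \sum_(j < n.+1) qbin n j * \prod_(k < j) (- (y * P ^+ k)) = \prod_(k < n) (1 - y * P ^+ k).
Proof.
pose b j := \prod_(k < j) (- (y * P ^+ k)).
elim: n => [|n IH]; first by rewrite big_ord1 !big_ord0 qbin0 mulr1.
rewrite [RHS]big_ord_recr /= -IH big_ord_recl qbin0 big_ord0 mul1r.
have -> : \sum_(i < n.+1) qbin n.+1 (bump 0 i) * \prod_(k < bump 0 i) (- (y * P ^+ k)) =
   \sum_(i < n.+1) qbin n i.+1 * b i.+1 + \sum_(i < n.+1) - (y * P ^+ n) * (qbin n i * b i).
  rewrite -big_split; apply: eq_bigr => i _ /=; rewrite /bump /= add1n -/(b _).
  have ii : (i <= n)%N by rewrite -ltnS.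
  rewrite qbin_pascal // mulrDl; congr (_ + _).
  have e : P ^+ n = P ^+ (n - i) * P ^+ i by rewrite -exprD subnK.
  by rewrite /b big_ord_recr /= e; ring.
rewrite -mulr_sumr addrA.
have -> : 1 + \sum_(i < n.+1) qbin n i.+1 * b i.+1 = \sum_(j < n.+1) qbin n j * b j.
  rewrite [RHS]big_ord_recl qbin0 /b big_ord0 mul1r; congr (_ + _).
  by rewrite big_ord_recr /= {2}/qbin ltnn mul0r addr0; apply: eq_bigr => i _.
by rewrite -/(b _) mulrBr mulr1 mulNr mulrC.
Qed.
End Jacobi.

(** * The bilateral series over the dihedral group *)

Section Bilateral.
Variable R : realType.
Local Notation C := (Cplx R).
Implicit Types (v y : C) (gen : bool -> bool).

(* The quotient of consecutive terms of the dihedral sum, for an even (b = true)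
   or odd coordinate of the weight. *)
Definition refl_factor (b : bool) (v y : C) : C :=
  if b then - (y * (y - v)) / (1 - v * y) else - y ^+ 2.

Definition half_term gen v y p n : C :=
  \prod_(k < n) refl_factor (gen (odd k)) v (y * p ^+ k).

(** Negative indices exchange the two coordinates, so that [bilateral_opp] reduces them to positive
    ones. The predicate [gen] selects the coordinates of even weight. *)
Definition bilateral gen (x0 x1 : C) v (n : int) : C :=
  match n with
  | Posz n => half_term gen v x0 (x0 * x1) n
  | Negz n => half_term (fun b => gen (~~ b)) v x1 (x0 * x1) n.+1
  end.

(** This is the theta term (-1)^n x_0^(2n) X^(n(n-1)) of Jacobi's triple product. *)
Definition gauss (x0 x1 : C) (n : int) : C := bilateral xpred0 x0 x1 0 n.

Definition point (x0 x1 : C) (n : int) : C := x0 * (x0 * x1) ^ n.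

Lemma bilateral_opp gen (x0 x1 : C) v n :
  bilateral gen x0 x1 v (- n) = bilateral (fun b => gen (~~ b)) x1 x0 v n.
Proof.
have E (gen' : bool -> bool) : (fun b => gen' (~~ ~~ b)) = gen' by apply/funext => b; rewrite negbK.
case: n => [[|n]|n]; rewrite /bilateral mulrC //=.
  by rewrite /half_term !big_ord0.
by rewrite E.
Qed.

Section Fixed.
Variables x0 x1 : C.
Hypotheses (x0_neq0 : x0 != 0) (x1_neq0 : x1 != 0).
Hypotheses (x0_small : nrm x0 <= 4^-1) (x1_small : nrm x1 <= 4^-1).
Local Notation X := (x0 * x1).
Local Notation z := (point x0 x1).

Lemma X_neq0 : X != 0. Proof. by rewrite mulf_neq0. Qed.

Lemma X_small : nrm X <= 16^-1.
Proof.
rewrite nrmM; apply: le_trans (_ : 4^-1 * 4^-1 <= _); first by rewrite ler_pM ?nrm_ge0.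
by lra.
Qed.

Lemma X_lt1 : nrm X < 1. Proof. by have := X_small; lra. Qed.

Lemma X2_lt1 : nrm (X ^+ 2) < 1.
Proof. by rewrite nrmX expr_lt1 ?nrm_ge0 // X_lt1. Qed.

Lemma pointS n : z (n + 1) = z n * X.
Proof. have X0 := X_neq0; rewrite /point expfzDr // expr1z; ring. Qed.

Lemma point_neq0 n : z n != 0.
Proof. by rewrite /point mulf_neq0 // expfz_neq0 // X_neq0. Qed.

Lemma point_opp n : z (- n) = X / point x1 x0 n.
Proof.
rewrite /point [x1 * x0]mulrC -invr_expz.
have h : X ^ n != 0 by rewrite expfz_neq0 // X_neq0.
by field; rewrite h x1_neq0.
Qed.

Lemma gaussS n : gauss x0 x1 (n + 1) = - z n ^+ 2 * gauss x0 x1 n.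
Proof.
case: n => n.
  by rewrite -PoszD addn1 /gauss /= /half_term big_ord_recr /= mulrC.
have -> : Negz n + 1 = - Posz n by rewrite NegzE -addn1 PoszD; lia.
rewrite /gauss bilateral_opp /= /half_term [in RHS]big_ord_recr /= [x1 * x0]mulrC.
have -> : z (Negz n) = (x1 * X ^+ n)^-1.
  by rewrite NegzE point_opp /point [x1 * x0]mulrC -exprnP exprSr; field; rewrite x0_neq0 x1_neq0 expf_neq0 ?X_neq0.
have h : x1 * X ^+ n != 0 by rewrite mulf_neq0 ?expf_neq0 ?X_neq0.
move: (x1 * X ^+ n) h => w w0; rewrite /half_term; move: (\prod_(_ < _) _) => q.
by field.
Qed.

Lemma small_mul y (n : nat) : nrm y <= 4^-1 -> nrm (y * X ^+ n) <= 4^-1.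
Proof.
move=> y1; rewrite nrmM nrmX.
have : nrm X ^+ n <= 1 by rewrite exprn_ile1 ?nrm_ge0 // ltW // X_lt1.
have := nrm_ge0 y; have : 0 <= nrm X ^+ n by rewrite exprn_ge0 ?nrm_ge0.
nra.
Qed.

Lemma denom_neq0 v y : nrm v <= 1 -> nrm y <= 4^-1 -> 1 - v * y != 0.
Proof.
move=> v1 y1; rewrite -nrm_gt0; have := nrm_subl 1 (v * y).
rewrite nrm1 nrmM; have := nrm_ge0 v; have := nrm_ge0 y; nra.
Qed.

(** The radius 1/4 is chosen for this: the even factor is at most (1/4)(5/4)/(3/4) = 5/12, so every
    bilateral series is dominated by powers of 1/2. *)
Lemma refl_factor_le b v y : nrm v <= 1 -> nrm y <= 4^-1 -> nrm (refl_factor b v y) <= 2^-1.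
Proof.
move=> v1 y1; have y0 := nrm_ge0 y; have v0 := nrm_ge0 v; rewrite /refl_factor; case: b.
  rewrite nrmM nrmV nrmN nrmM ler_pdivrMr; last by rewrite nrm_gt0 denom_neq0.
  have h1 := nrm_subl 1 (v * y); rewrite nrm1 nrmM in h1.
  have h2 := nrmB y v; have h3 := nrm_ge0 (y - v).
  nra.
rewrite nrmN nrmX; nra.
Qed.

Lemma half_term_le gen v y n : nrm v <= 1 -> nrm y <= 4^-1 ->
  nrm (half_term gen v y X n) <= 2^-1 ^+ n.
Proof.
move=> v1 y1; rewrite /half_term nrm_prod -[n in leRHS]card_ord -prodr_const.
by apply: ler_prod => k _; rewrite nrm_ge0 refl_factor_le // small_mul.
Qed.

Lemma bilateral_le gen v n : nrm v <= 1 -> nrm (bilateral gen x0 x1 v n) <= 2^-1 ^+ `|n|%N.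
Proof. by move=> v1; case: n => n; rewrite /bilateral; apply: half_term_le. Qed.

Lemma bilateral_abs gen v : nrm v <= 1 -> abs_bounded (bilateral gen x0 x1 v) 4.
Proof.
move=> v1; rewrite -[4]mul1r; apply: int_abs_bounded => // n.
by rewrite mul1r bilateral_le.
Qed.

Lemma X2_pow_neq1 k : 1 - (X ^+ 2) ^+ k.+1 != 0.
Proof.
rewrite subr_eq0 eq_sym; apply/eqP => e; have := congr1 (@nrm R) e.
rewrite nrmX nrm1; have := X2_lt1; have := nrm_ge0 (X ^+ 2) => h1 h2.
have h3 : nrm (X ^+ 2) ^+ k.+1 < 1 by rewrite exprn_ilt1.
by lra.
Qed.

(* The q-binomial theorem in the base X^2, recentred; Jacobi's triple product is
   its limit. *)
Lemma jacobi_finite N :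
  \sum_(j < N.*2.+1) qbin (X ^+ 2) N.*2 j * gauss x0 x1 (Posz j - Posz N) =
  (\prod_(k < N) (1 - x0 ^+ 2 * (X ^+ 2) ^+ k)) * \prod_(k < N) (1 - x1 ^+ 2 * (X ^+ 2) ^+ k).
Proof.
have X0 := X_neq0; have X2_1 := X2_lt1.
set P := X ^+ 2.
have P0 : P != 0 by rewrite expf_neq0.
pose y := x0 ^+ 2 / P ^+ N.
have gE j : gauss x0 x1 (Posz j - Posz N) = gauss x0 x1 (- Posz N) * \prod_(k < j) (- (y * P ^+ k)).
  elim: j => [|j IH]; first by rewrite sub0r big_ord0 mulr1.
  rewrite -addn1 PoszD addrAC gaussS IH addn1 big_ord_recr /=.
  suff -> : z (Posz j - Posz N) ^+ 2 = y * P ^+ j by ring.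
  rewrite /point expfzDr // -invr_expz -!exprnP /y /P -!exprM.
  by rewrite [(2 * j)%N]mulnC [(2 * N)%N]mulnC !exprM; field; rewrite expf_neq0.
have P_1 := X2_pow_neq1.
rewrite (eq_bigr (fun j : 'I__ => gauss x0 x1 (- Posz N) * (qbin P N.*2 j * \prod_(k < j) (- (y * P ^+ k))))); last first.
  by move=> j _; rewrite gE mulrCA.
rewrite -mulr_sumr qbinomial //.
rewrite -addnn (ord_split _ (fun k => 1 - y * P ^+ k) (leq_addr N N)) mulrA mulrC; congr (_ * _).
  rewrite -{1}[N]add0n big_addn addnK big_mkord; apply: eq_bigr => k _.
  by rewrite exprD /y; field; rewrite expf_neq0.
rewrite /gauss bilateral_opp /= /half_term [x1 * x0]mulrC -(big_mkord predT (fun k => 1 - y * P ^+ k)).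
rewrite big_nat_rev /= add0n big_mkord -big_split; apply: eq_bigr => k _ /=.
have e : P ^+ N = P ^+ (N - k.+1) * P ^+ k.+1 by rewrite -exprD subnK.
have PE : P ^+ k = (X ^+ k) ^+ 2 by rewrite -!exprM mulnC.
have xk : X ^+ k != 0 by rewrite expf_neq0.
have xm : P ^+ (N - k.+1) != 0 by rewrite expf_neq0.
rewrite /y e [P ^+ k.+1]exprS PE /P; move: (X ^+ k) xk (_ ^+ (N - k.+1)) xm => w w0 w' w'0.
by field; rewrite w0 w'0 x0_neq0 x1_neq0.
Qed.

Definition triple : C :=
  qpochhammer (x0 ^+ 2) (X ^+ 2) * qpochhammer (x1 ^+ 2) (X ^+ 2) * qpochhammer (X ^+ 2) (X ^+ 2).

Lemma expR_le_inv (t : R) : t < 1 -> expR t <= (1 - t)^-1.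
Proof.
move=> t1; have t1' : 0 < 1 - t by rewrite subr_gt0.
rewrite -[expR t]invrK -expRN lef_pV2 ?posrE ?expR_gt0 //.
by have := expR_ge1Dx (- t); lra.
Qed.

Lemma qfact_near1 n : nrm (qfact (X ^+ 2) n - 1) <= 2^-1.
Proof.
have X2 := X_small; have X0 := nrm_ge0 X.
have -> : qfact (X ^+ 2) n = \prod_(k < n) (1 + qfactor (X ^+ 2) (X ^+ 2) k).
  by apply: eq_bigr => k _; rewrite /qfactor exprS.
apply: le_trans (prod1D_near1 _ _) _.
have P4 : nrm (X ^+ 2) <= 4^-1 by rewrite nrmX; nra.
have h : \sum_(i < n) nrm (qfactor (X ^+ 2) (X ^+ 2) i) <= 3^-1.
  apply: le_trans (qfactor_sum _ _ X2_lt1) _; rewrite ler_pdivrMr; lra.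
have := expR_le_inv (_ : (3^-1 : R) < 1); have : expR (\sum_(i < n) nrm (qfactor (X ^+ 2) (X ^+ 2) i)) <= expR 3^-1 by rewrite ler_expR.
have -> : (1 - 3^-1 : R)^-1 = 3 / 2 by field.
by move=> h1 /(_ ltac:(lra)) h2; lra.
Qed.

(** A bound independent of n and j, as dominated convergence requires: numerators are at most 3/2
    and denominators at least 1/4 in modulus. *)
Lemma qbin_le n j : nrm (qbin (X ^+ 2) n j) <= 6.
Proof.
rewrite /qbin; case: ifP => _; last by rewrite nrm0.
have up k : nrm (qfact (X ^+ 2) k) <= 3 / 2.
  by have := qfact_near1 k; have := nrm_subl (qfact (X ^+ 2) k) 1; rewrite nrm1; lra.
have lo k : 2^-1 <= nrm (qfact (X ^+ 2) k).
  by have := qfact_near1 k; have := nrm_subl 1 (qfact (X ^+ 2) k); rewrite nrm_sub nrm1; lra.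
rewrite nrmM nrmV nrmM.
have h1 := lo j; have h2 := lo (n - j)%N; have h3 := up n.
by rewrite ler_pdivrMr; nra.
Qed.

Lemma qfact_cvg : (fun n => qfact (X ^+ 2) n) @ \oo --> qpochhammer (X ^+ 2) (X ^+ 2).
Proof.
have -> : (fun n => qfact (X ^+ 2) n) = (fun n => \prod_(k < n) (1 - X ^+ 2 * (X ^+ 2) ^+ k)).
  by apply/funext => n; apply: eq_bigr => k _; rewrite exprS.
exact: qp_cvg X2_lt1.
Qed.

(** In the recentred finite identity the coefficient of a fixed theta term is a central Gaussian
    binomial, which tends to the inverse of (P; P) infinite, where P = X^2; the limit is exchanged
    with the sum by domination. *)
Lemma jacobi_triple : has_sum (gauss x0 x1) triple.
Proof.
have P1 := X2_lt1; set P := X ^+ 2 in P1 *.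
set L := qpochhammer P P.
have L0 : L != 0.
  by apply: qp_ne0 => // k; rewrite -exprS; exact: X2_pow_neq1.
pose f N (n : int) := if (`|n| <= N)%N then qbin P N.*2 `|(n + Posz N)%R|%N * gauss x0 x1 n else 0.
pose l N := (\prod_(k < N) (1 - x0 ^+ 2 * P ^+ k)) * \prod_(k < N) (1 - x1 ^+ 2 * P ^+ k).
have fl N : has_sum (f N) (l N).
  have fE j : f N (Posz j - Posz N) = if (j < N.*2.+1)%N then qbin P N.*2 j * gauss x0 x1 (Posz j - Posz N) else 0.
    rewrite /f subrK absz_nat.
    have -> : (`|(Posz j - Posz N)%R| <= N)%N = (j < N.*2.+1)%N by apply/idP/idP; lia.
    by [].
  apply: (@has_sum_inj R int nat (f N) (\sum_(k < N.*2.+1) nrm (f N (Posz k - Posz N))) (l N) (fun j : nat => Posz j - Posz N)).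
  - by move=> i j /addIr[].
  - move=> i hi; rewrite /f; case: ifP => // iN.
    have := hi `|(i + Posz N)%R|%N; have -> : Posz `|(i + Posz N)%R|%N - Posz N = i by lia.
    by rewrite eqxx.
  - apply: sum_fset_nat_le => [k|n]; first exact: nrm_ge0.
    have [nN|nN] := leqP n N.*2.+1.
      rewrite (ord_split _ (fun k => nrm (f N (Posz k - Posz N))) nN) lerDl sumr_ge0 // => k _; exact: nrm_ge0.
    rewrite (ord_split _ (fun k => nrm (f N (Posz k - Posz N))) (ltnW nN)) /= [X in _ + X <= _]big_nat [X in _ + X <= _]big1 ?addr0 // => k /andP[k1 _].
    by rewrite fE ltnNge k1 nrm0.
  - have := @has_sum_finite R nat (fun j => f N (Posz j - Posz N)) (fset_iota N.*2.+1).
    rewrite sum_fset_iota /l -(jacobi_finite N).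
    have -> : \sum_(k < N.*2.+1) f N (Posz k - Posz N) =
      \sum_(j < N.*2.+1) qbin P N.*2 j * gauss x0 x1 (Posz j - Posz N).
      by apply: eq_bigr => k _; rewrite fE ltn_ord.
    apply=> j; rewrite in_fset mem_iota /= add0n fE; by case: ifP.
have [||||m hm lm] := @has_sum_dominated R int f (fun n => L^-1 * gauss x0 x1 n)
   (fun n => 6 * 2^-1 ^+ `|n|%N) l (6 * 4).
- by move=> A; rewrite -mulr_sumr ler_wpM2l // int_geom.
- move=> N n; rewrite /f; case: ifP => _; last by rewrite nrm0 mulr_ge0 // exprn_ge0.
  by rewrite nrmM ler_pM ?nrm_ge0 ?qbin_le // bilateral_le // nrm0.
- move=> n.
  have sub (phi : nat -> nat) : (forall N, (`|n| <= N)%N -> (N - `|n| <= phi N)%N) ->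
      (fun N => qfact P (phi N)) @ \oo --> L.
    move=> hphi; have /cvgnP h := qfact_cvg; apply/cvgnP => e /h[N0 hN0].
    exists (N0 + `|n|)%N => N hN; apply: hN0; have := hphi N; lia.
  have : (fun N => qfact P N.*2 / (qfact P `|(n + Posz N)%R|%N * qfact P (N.*2 - `|(n + Posz N)%R|%N)%N) * gauss x0 x1 n) @ \oo --> L / (L * L) * gauss x0 x1 n.
    apply: cvgnM; last exact: cvgn_cst.
    apply: cvgnM; first by apply: sub => N; lia.
    apply: cvgnV; first by rewrite mulf_neq0.
    by apply: cvgnM; apply: sub => N; lia.
  have -> : L / (L * L) = L^-1 by field.
  move=> /cvgnP h; apply/cvgnP => e /h[N0 hN0]; exists (maxn N0 `|n|)%N => N.
  rewrite geq_max => /andP[/hN0 + nN]; rewrite /f nN /qbin.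
  by have -> : (`|(n + Posz N)%R|%N <= N.*2)%N by lia.
- exact: fl.
have lm2 : l @ \oo --> qpochhammer (x0 ^+ 2) P * qpochhammer (x1 ^+ 2) P.
  by apply: cvgnM; exact: qp_cvg.
have e := cvgn_unique lm lm2.
have := has_sumZ (c := L) hm; rewrite e mulrC; apply: has_sum_ext => n.
by rewrite mulrA mulfV // mul1r.
Qed.

Lemma telescope_int (b : int -> C) M : abs_bounded b M -> has_sum (fun n => b n - b (n + 1)) 0.
Proof.
move=> hM; have [l hl] := abs_has_sum hM.
by have := has_sumB hl (has_sum_shift hM hl); rewrite subrr.
Qed.

Lemma point_small (n : nat) : nrm (z (Posz n)) <= 4^-1.
Proof. by rewrite /point -exprnP small_mul. Qed.

Lemma point_opp_small (n : nat) : nrm (X / z (- Posz n)) <= 4^-1.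
Proof.
have -> : X / z (- Posz n) = x1 * X ^+ n.
  rewrite point_opp /point [x1 * x0]mulrC -exprnP; have h : X ^+ n != 0 by rewrite expf_neq0 // X_neq0.
  by field; rewrite h x0_neq0 x1_neq0.
exact: small_mul.
Qed.

Lemma qp_le (a p : C) : nrm a <= 2^-1 -> nrm p <= 2^-1 -> nrm (qpochhammer a p) <= expR 1.
Proof.
move=> a1 p1; apply: le_trans (qp_bound _ _) _; first by lra.
by rewrite ler_expR ler_pdivrMr; lra.
Qed.

Local Opaque qpochhammer.

(* As functions of n, even_term and odd_term satisfy the recurrence of the bilateral
   series, and their sums over n satisfy S(v) = (1 - v^2 X) S(v X), respectively
   S(v) = S(v X^2): this reduces them to v = 0, where all theta factors are 1. *)
Definition even_term v n : C := gauss x0 x1 n * (qpochhammer (v * z n) X * qpochhammer (v * X / z n) X).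

Lemma even_termS v n : 1 - v * z n != 0 -> even_term v (n + 1) = refl_factor true v (z n) * even_term v n.
Proof.
move=> h; have z0 := point_neq0 n; rewrite /even_term gaussS pointS /refl_factor.
rewrite (qp_rec (v * z n) X_lt1) (qp_rec (v * X / (z n * X)) X_lt1).
have -> : v * X / (z n * X) = v / z n by field; rewrite z0 x0_neq0 x1_neq0.
rewrite [v / z n * X]mulrAC [v * (z n * X)]mulrA.
move: (qpochhammer _ _) (qpochhammer _ _) => a b.
by field; rewrite z0 h.
Qed.

Lemma even_term_nat v (n : nat) : nrm v <= 1 ->
  even_term v n = even_term v 0 * half_term xpredT v x0 X n.
Proof.
move=> v1; elim: n => [|n IH]; first by rewrite /half_term big_ord0 mulr1.
rewrite -addn1 PoszD even_termS ?denom_neq0 ?point_small // IH addn1 /half_term big_ord_recr.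
by rewrite mulrCA; congr (_ * _); rewrite mulrC.
Qed.

Definition odd_term e v n : C := gauss x0 x1 n *
  if odd `|n|%N (+) e then qpochhammer (v * z n) (X ^+ 2) * qpochhammer (v * X ^+ 2 / z n) (X ^+ 2)
  else qpochhammer (v * X * z n) (X ^+ 2) * qpochhammer (v * X / z n) (X ^+ 2).

Lemma odd_termS e v n : 1 - v * z n != 0 ->
  odd_term e v (n + 1) = refl_factor (odd `|n|%N (+) e) v (z n) * odd_term e v n.
Proof.
move=> h; have z0 := point_neq0 n; have X0 := X_neq0; rewrite /odd_term gaussS pointS /refl_factor oddS_int addNb.
case: (odd _ (+) e) => /=.
  rewrite (qp_rec (v * z n) X2_lt1) (qp_rec (v * X / (z n * X)) X2_lt1).
  have -> : v * X / (z n * X) = v / z n by field; rewrite z0 x0_neq0 x1_neq0.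
  have -> : v * X * (z n * X) = v * z n * X ^+ 2 by ring.
  have -> : v / z n * X ^+ 2 = v * X ^+ 2 / z n by ring.
  move: (qpochhammer _ _) (qpochhammer _ _) => a b.
  by field; rewrite z0 h.
have -> : v * (z n * X) = v * X * z n by ring.
have -> : v * X ^+ 2 / (z n * X) = v * X / z n by field; rewrite z0 x0_neq0 x1_neq0.
by move: (qpochhammer _ _ * _) => a; ring.
Qed.

Lemma odd_term_nat e v (n : nat) : nrm v <= 1 ->
  odd_term e v n = odd_term e v 0 * half_term (fun b => b (+) e) v x0 X n.
Proof.
move=> v1; elim: n => [|n IH]; first by rewrite /half_term big_ord0 mulr1.
rewrite -addn1 PoszD odd_termS ?denom_neq0 ?point_small // IH addn1 /half_term big_ord_recr.
by rewrite mulrCA; congr (_ * _); rewrite mulrC.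
Qed.

Lemma gauss0 : gauss x0 x1 0 = 1.
Proof. by rewrite /gauss /= /half_term big_ord0. Qed.

Lemma point0 : z 0 = x0. Proof. by rewrite /point expr0z mulr1. Qed.

Lemma even_term_0 v : even_term v 0 = qpochhammer (v * x0) X * qpochhammer (v * x1) X.
Proof.
rewrite /even_term gauss0 mul1r point0.
by have -> : v * X / x0 = v * x1 by field.
Qed.

Lemma odd_term_0 e v : odd_term e v 0 =
  if e then qpochhammer (v * x0) (X ^+ 2) * qpochhammer (v * X * x1) (X ^+ 2)
  else qpochhammer (v * X * x0) (X ^+ 2) * qpochhammer (v * x1) (X ^+ 2).
Proof.
rewrite /odd_term gauss0 mul1r point0 /=.
have -> : v * X / x0 = v * x1 by field.
by have -> : v * X ^+ 2 / x0 = v * X * x1 by field.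
Qed.
End Fixed.

Local Opaque qpochhammer.

Lemma gauss_opp (x0 x1 : C) n : gauss x0 x1 (- n) = gauss x1 x0 n.
Proof. by rewrite /gauss bilateral_opp. Qed.

Lemma even_term_opp (x0 x1 : C) v n : x0 != 0 -> x1 != 0 -> even_term x0 x1 v (- n) = even_term x1 x0 v n.
Proof.
move=> a0 b0; rewrite /even_term gauss_opp (point_opp a0 b0).
have z0 := @point_neq0 x1 x0 b0 a0 n.
have -> : v * (x0 * x1 / point x1 x0 n) = v * (x1 * x0) / point x1 x0 n by ring.
have -> : v * (x0 * x1) / (x0 * x1 / point x1 x0 n) = v * point x1 x0 n.
  by field; rewrite z0 a0 b0.
have -> : x0 * x1 = x1 * x0 by rewrite mulrC.
by rewrite [X in _ * X]mulrC.
Qed.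

Lemma odd_term_opp (x0 x1 : C) e v n : x0 != 0 -> x1 != 0 -> odd_term x0 x1 e v (- n) = odd_term x1 x0 (~~ e) v n.
Proof.
move=> a0 b0; rewrite /odd_term gauss_opp (point_opp a0 b0) abszN addbN.
have z0 := @point_neq0 x1 x0 b0 a0 n.
have -> : v * (x0 * x1 / point x1 x0 n) = v * (x1 * x0) / point x1 x0 n by ring.
have -> : v * (x0 * x1) / (x0 * x1 / point x1 x0 n) = v * point x1 x0 n.
  by field; rewrite z0 a0 b0.
have -> : v * (x0 * x1) * (x0 * x1 / point x1 x0 n) = v * (x1 * x0) ^+ 2 / point x1 x0 n by ring.
have -> : v * (x0 * x1) ^+ 2 / (x0 * x1 / point x1 x0 n) = v * (x1 * x0) * point x1 x0 n.
  by field; rewrite z0 a0 b0.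
have -> : x0 * x1 = x1 * x0 by rewrite mulrC.
by case: (odd _ (+) e) => /=; rewrite [X in _ * X]mulrC.
Qed.

Section Sums.
Variables x0 x1 : C.
Hypotheses (x0_neq0 : x0 != 0) (x1_neq0 : x1 != 0).
Hypotheses (x0_small : nrm x0 <= 4^-1) (x1_small : nrm x1 <= 4^-1).
Local Notation X := (x0 * x1).
Local Notation z := (point x0 x1).

Lemma even_termE v n : nrm v <= 1 ->
  even_term x0 x1 v n = even_term x0 x1 v 0 * bilateral xpredT x0 x1 v n.
Proof.
move=> v1; case: n => n; first exact: even_term_nat.
rewrite NegzE (even_term_opp _ _ x0_neq0 x1_neq0) bilateral_opp (even_term_nat x1_neq0 x0_neq0 x1_small x0_small _ v1).
by rewrite -(even_term_opp _ _ x0_neq0 x1_neq0) oppr0.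
Qed.

Lemma odd_termE e v n : nrm v <= 1 ->
  odd_term x0 x1 e v n = odd_term x0 x1 e v 0 * bilateral (fun b => b (+) e) x0 x1 v n.
Proof.
move=> v1; case: n => n; first exact: odd_term_nat.
rewrite NegzE (odd_term_opp _ _ _ x0_neq0 x1_neq0) bilateral_opp (odd_term_nat x1_neq0 x0_neq0 x1_small x0_small _ _ v1).
rewrite -(odd_term_opp _ _ _ x0_neq0 x1_neq0) oppr0; congr (_ * half_term _ _ _ _ _).
by apply/funext => b; rewrite addbN addNb.
Qed.

Definition Kq : R := expR 1 * expR 1.

Lemma Kq0 : 0 < Kq. Proof. by rewrite mulr_gt0 ?expR_gt0. Qed.

Lemma nrm_mul_small (a b : C) (r : R) : nrm a <= 1 -> nrm b <= r -> nrm (a * b) <= r.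
Proof. by move=> h1 h2; rewrite nrmM; have := nrm_ge0 a; have := nrm_ge0 b; nra. Qed.

Lemma X_half : nrm X <= 2^-1.
Proof. by have := X_small x0_small x1_small; lra. Qed.

Lemma X2_half : nrm (X ^+ 2) <= 2^-1.
Proof. by rewrite nrmX; have := X_half; have := nrm_ge0 X; nra. Qed.

Lemma even_term_le v n : nrm v <= 1 -> nrm (even_term x0 x1 v n) <= Kq * 2^-1 ^+ `|n|%N.
Proof.
move=> v1; rewrite even_termE // nrmM ler_pM ?nrm_ge0 ?bilateral_le //.
have h (x : C) : nrm x <= 4^-1 -> nrm (v * x) <= 2^-1.
  by move=> x4; apply: nrm_mul_small v1 _; lra.
by rewrite even_term_0 // nrmM ler_pM ?nrm_ge0 // qp_le ?h ?X_half.
Qed.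

Lemma odd_term_le e v n : nrm v <= 1 -> nrm (odd_term x0 x1 e v n) <= Kq * 2^-1 ^+ `|n|%N.
Proof.
move=> v1; rewrite odd_termE // nrmM ler_pM ?nrm_ge0 ?bilateral_le //.
have h (x : C) : nrm x <= 4^-1 -> nrm (v * x) <= 2^-1.
  by move=> x4; apply: nrm_mul_small v1 _; lra.
have h' (x : C) : nrm x <= 4^-1 -> nrm (v * X * x) <= 2^-1.
  move=> x4; rewrite -mulrA h // mulrC; apply: le_trans x4.
  by rewrite nrmM; have := X_half; have := nrm_ge0 x; nra.
by rewrite odd_term_0 //; case: e; rewrite nrmM ler_pM ?nrm_ge0 // qp_le ?h ?h' ?X2_half.
Qed.

(** The functional equation in v holds for the bilateral sums and not term by term: the terms differ
    by b n - b (n + 1) for a summable b. *)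
Lemma telescope_even v : nrm v <= 1 -> has_sum (fun n => even_term x0 x1 v n - (1 - v ^+ 2 * X) * even_term x0 x1 (v * X) n) 0.
Proof.
move=> v1; have X1 := X_half; have X0 := X_neq0 x0_neq0 x1_neq0.
have vX1 : nrm (v * X) <= 1 by apply: nrm_mul_small => //; lra.
pose B n := even_term x0 x1 (v * X) n.
(* The telescoping certificate: the quotient of b n by the term at v X is rational in z n, which
   makes the identity below a matter of [field] after one unfolding of each q-product. *)
pose b n := v * ((v * X - X / z n) * B n).
have bS n : b (n + 1) = - (v * ((v * X - z n) * B n)).
  rewrite /b /B /even_term gaussS // pointS //.
  have z0 := @point_neq0 x0 x1 x0_neq0 x1_neq0 n.
  rewrite (qp_rec (v * X * z n) (X_lt1 x0_small x1_small)) (qp_rec (v * X * X / (z n * X)) (X_lt1 x0_small x1_small)).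
  have -> : v * X * X / (z n * X) = v * X / z n by field; rewrite z0 x0_neq0 x1_neq0.
  have -> : v * X / z n * X = v * X * X / z n by ring.
  have -> : v * X * z n * X = v * X * (z n * X) by ring.
  move: (qpochhammer _ _) (qpochhammer _ _) => c d.
  by field; rewrite z0 x0_neq0 x1_neq0.
have d n : even_term x0 x1 v n - (1 - v ^+ 2 * X) * B n = b n - b (n + 1).
  rewrite bS opprK /b /B /even_term.
  have z0 := @point_neq0 x0 x1 x0_neq0 x1_neq0 n.
  rewrite (qp_rec (v * z n) (X_lt1 x0_small x1_small)) (qp_rec (v * X / z n) (X_lt1 x0_small x1_small)).
  have -> : v * X / z n * X = v * X * X / z n by ring.
  have -> : v * z n * X = v * X * z n by ring.
  move: (qpochhammer _ _) (qpochhammer _ _) => c e.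
  by field; rewrite z0.
apply: has_sum_ext (fun n => esym (d n)) _.
apply: (@telescope_int b (2 * Kq * 4)); apply: int_abs_bounded.
  by rewrite mulr_ge0 // ltW // Kq0.
have key (w y : C) (n : int) : nrm w <= 2^-1 -> nrm y <= 4^-1 -> nrm (v * ((w - y) * B n)) <= Kq * 2^-1 ^+ `|n|%N.
  move=> w1 y1; apply: nrm_mul_small => //; rewrite /B.
  apply: nrm_mul_small; first by have := nrmB w y; lra.
  exact: even_term_le.
have vX2 : nrm (v * X) <= 2^-1 by exact: nrm_mul_small.
(* The factor X / z n is small only for n <= 0; for positive indices the alternative form [bS],
   which involves z n instead, is bounded. *)
move=> [[|n]|n].
- have := key (v * X) (X / z (- Posz 0)) 0 vX2 (point_opp_small x0_neq0 x1_neq0 x0_small x1_small 0).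
  rewrite oppr0 /b => h; apply: le_trans h _; rewrite expr0; have := Kq0; lra.
- have -> : Posz n.+1 = Posz n + 1 by rewrite -PoszD addn1.
  have kn := key _ _ (Posz n) vX2 (point_small x0_small x1_small n).
  rewrite bS nrmN; apply: le_trans kn _.
  have -> : `|(Posz n + 1)%R|%N = n.+1 by lia.
  rewrite absz_nat exprS; have := Kq0; have : 0 <= (2^-1 : R) ^+ n by rewrite exprn_ge0.
  by nra.
- rewrite NegzE; apply: le_trans (key _ _ _ vX2 (point_opp_small x0_neq0 x1_neq0 x0_small x1_small n.+1)) _.
  have := Kq0; have : 0 <= (2^-1 : R) ^+ `|(- Posz n.+1)%R|%N by rewrite exprn_ge0.
  by nra.
Qed.

(** At an even n the two q-products have the same arguments at n and at n + 1, so only the theta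
    term changes. *)
Lemma odd_term_even v n : odd `|n|%N = false ->
  odd_term x0 x1 false v (n + 1) = - z n ^+ 2 * odd_term x0 x1 false v n.
Proof.
move=> h; have z0 := @point_neq0 x0 x1 x0_neq0 x1_neq0 n.
rewrite /odd_term gaussS // pointS // oddS_int h /=.
have -> : v * (z n * X) = v * X * z n by ring.
have -> : v * X ^+ 2 / (z n * X) = v * X / z n by field; rewrite z0 x0_neq0 x1_neq0.
by move: (qpochhammer _ _ * _) => a; ring.
Qed.

Lemma telescope_odd v : nrm v <= 1 ->
  has_sum (fun n => odd_term x0 x1 false v n - odd_term x0 x1 false (v * X ^+ 2) n) 0.
Proof.
move=> v1; have X1 := X_half; have X2 := X2_half; have X0 := X_neq0 x0_neq0 x1_neq0.
have P1 := X2_lt1 x0_small x1_small.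
have vP1 : nrm (v * X ^+ 2) <= 1 by apply: nrm_mul_small => //; lra.
pose E n := odd_term x0 x1 false (v * X ^+ 2) n.
pose d n := odd_term x0 x1 false v n - E n.
(* The telescoping certificate depends on the parity: at odd n it is expressed at n - 1, so that
   every q-product in it is taken at an even index. *)
pose b n := if odd `|n|%N then v * X * z (n - 1) * E (n - 1) else v * X * (v * X - (z n)^-1) * E n.
have oddP := odd_int_pred.
have step n : odd `|n|%N = false -> d n = b n - b (n + 1).
  move=> o; rewrite /b o oddS_int o addrK /d /E /odd_term o /=.
  have z0 := @point_neq0 x0 x1 x0_neq0 x1_neq0 n.
  rewrite (qp_rec (v * X * z n) P1) (qp_rec (v * X / z n) P1).
  have -> : v * X ^+ 2 * X * z n = v * X * z n * X ^+ 2 by ring.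
  have -> : v * X ^+ 2 * X / z n = v * X / z n * X ^+ 2 by ring.
  move: (qpochhammer _ _) (qpochhammer _ _) => c e.
  by field.
have dE n : d n = b n - b (n + 1).
  case o : (odd `|n|%N); last exact: step.
  have [m -> om] := oddP n o.
  have z0 := @point_neq0 x0 x1 x0_neq0 x1_neq0 m.
  have -> : d (m + 1) = - z m ^+ 2 * d m by rewrite /d /E !odd_term_even // mulrBr.
  rewrite (step m om) /b oddS_int om /= !addrK oddS_int oddS_int om /=.
  rewrite /E /odd_term !oddS_int om /= !gaussS // !pointS //.
  have -> : v * X ^+ 2 * X / (z m * X * X) = v * X / z m by field; rewrite z0 x0_neq0 x1_neq0.
  have -> : v * X ^+ 2 * X * (z m * X * X) = v * X ^+ 2 * X * z m * X ^+ 2 by ring.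
  rewrite (qp_rec (v * X ^+ 2 * X * z m) P1) (qp_rec (v * X / z m) P1).
  have -> : v * X / z m * X ^+ 2 = v * X ^+ 2 * X / z m by ring.
  move: (qpochhammer _ _) (qpochhammer _ _) => c e.
  by field; rewrite z0 x0_neq0 x1_neq0.
have K0 := Kq0.
have half0 n : 0 <= (2^-1 : R) ^+ n by rewrite exprn_ge0.
have dle n : nrm (d n) <= 2 * Kq * 2^-1 ^+ `|n|%N.
  have := nrmB (odd_term x0 x1 false v n) (E n); have := @odd_term_le false v n v1.
  have := @odd_term_le false _ n vP1; rewrite -/(E n) /d; lra.
have even_np (m : nat) : ~~ odd m -> nrm (b (- Posz m)) <= Kq * 2^-1 ^+ m.
  move=> om; rewrite /b abszN absz_nat (negbTE om).
  have -> : v * X * (v * X - (z (- Posz m))^-1) = v * (v * X * X - X / z (- Posz m)) by ring.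
  rewrite -mulrA; apply: nrm_mul_small => //.
  have h := @odd_term_le false _ (- Posz m) vP1; rewrite abszN absz_nat in h.
  apply: nrm_mul_small h.
  have h1 := point_opp_small x0_neq0 x1_neq0 x0_small x1_small m.
  have h2 : nrm (v * X * X) <= 2^-1.
    by apply: (nrm_mul_small _ X1); apply: nrm_mul_small => //; lra.
  have := nrmB (v * X * X) (X / z (- Posz m)); lra.
have odd_pos (m : nat) : ~~ odd m -> nrm (b (Posz m + 1)) <= Kq * 2^-1 ^+ m.
  move=> om; rewrite /b oddS_int absz_nat om addrK.
  have h := @odd_term_le false _ (Posz m) vP1; rewrite absz_nat in h.
  apply: nrm_mul_small h.
  have h2 := point_small x0_small x1_small m.
  have : nrm (v * X) <= 1 by apply: nrm_mul_small => //; lra.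
  move=> /nrm_mul_small => /(_ (z m) 4^-1 h2); lra.
apply: has_sum_ext (fun n => esym (dE n)) _.
apply: (telescope_int (M := 8 * Kq * 4)); apply: int_abs_bounded.
  by rewrite mulr_ge0 // ltW.
have K2 m : 0 <= Kq * 2^-1 ^+ m by rewrite mulr_ge0 // ltW.
have K2S m : Kq * 2^-1 ^+ m = 2 * (Kq * 2^-1 ^+ m.+1) by rewrite exprS; field.
(* Even n <= 0 and odd n > 0 are bounded directly. Each remaining index follows from its predecessor
   by b (n + 1) = b n - d n. *)
move=> [m|m].
  rewrite absz_nat; case om : (odd m).
    case: m om => // m /= om; have := odd_pos m om; rewrite -PoszD addn1.
    by have := K2S m; have := K2 m.+1; lra.
  case: m om => [|m] om.
    by have := even_np 0%N isT; rewrite oppr0; have := K2 0%N; lra.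
  have dm := dE (Posz m); have -> : Posz m.+1 = Posz m + 1 by rewrite -PoszD addn1.
  have -> : b (Posz m + 1) = b m - d m by rewrite dm; ring.
  move: om => /= /negbFE om.
  case: m om dm => // m om dm.
  have := odd_pos m om; rewrite -PoszD addn1 => h1; have h2 := dle (Posz m.+1).
  have := nrmB (b (Posz m.+1)) (d (Posz m.+1)); rewrite absz_nat in h2.
  have h3 := K2S m; have h4 := K2S m.+1; have h5 := K2 m.+2.
  by lra.
rewrite NegzE abszN absz_nat; case om : (odd m.+1); last first.
  by have := even_np m.+1 (negbT om); have := K2 m.+1; lra.
have dm := dE (- Posz m.+2); have e := oppz_addr1 m.+1.
have h1 := even_np m.+2 _; rewrite /= -/(odd m.+1) om in h1.
rewrite e in dm; have -> : b (- Posz m.+1) = b (- Posz m.+2) - d (- Posz m.+2) by rewrite dm; ring.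
have h2 := dle (- Posz m.+2); rewrite abszN absz_nat in h2.
have := nrmB (b (- Posz m.+2)) (d (- Posz m.+2)); have h3 := K2S m.+1; have h4 := K2 m.+2.
by have := h1 isT; lra.
Qed.

Lemma abs_even_term v : nrm v <= 1 -> abs_bounded (even_term x0 x1 v) (Kq * 4).
Proof. by move=> v1; apply: int_abs_bounded => [|n]; [rewrite ltW // Kq0|exact: even_term_le]. Qed.

Lemma abs_odd_term e v : nrm v <= 1 -> abs_bounded (odd_term x0 x1 e v) (Kq * 4).
Proof. by move=> v1; apply: int_abs_bounded => [|n]; [rewrite ltW // Kq0|exact: odd_term_le]. Qed.

Lemma nrm_powX v (N : nat) : nrm v <= 1 -> nrm (v * X ^+ N) <= 1.
Proof.
move=> v1; apply: nrm_mul_small => //; rewrite nrmX exprn_ile1 ?nrm_ge0 //.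
by have := X_half; lra.
Qed.

Lemma cvg_powX v (w : C) : (fun N => v * X ^+ N * w) @ \oo --> (0 : C).
Proof.
have h : (fun N => X ^+ N) @ \oo --> (0 : C).
  apply/cvgnP => e e0; have X1 := X_half.
  have [|N hN] := @expr_to0 R (nrm X) e _ e0; first by rewrite nrm_ge0; lra.
  exists N => n Nn; rewrite subr0 nrmX; apply: le_lt_trans hN.
  by apply: ler_wiXn2l => //; [exact: nrm_ge0|lra].
have := cvgnM (cvgnM (@cvgn_cst R v) h) (@cvgn_cst R w).
by rewrite mulr0 mul0r.
Qed.

Lemma qp_powX v (w p : C) : nrm p < 1 -> (fun N => qpochhammer (v * X ^+ N * w) p) @ \oo --> (1 : C).
Proof. by move=> p1; apply: qp_to1 => //; exact: cvg_powX. Qed.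

Lemma sum_even_term u : nrm u <= 1 ->
  has_sum (even_term x0 x1 u) (qpochhammer (u ^+ 2 * X) (X ^+ 2) * triple x0 x1).
Proof.
move=> u1; have X1 := X_lt1 x0_small x1_small; have X2 := X2_lt1 x0_small x1_small.
have [S hS] := choice (fun N => abs_has_sum (abs_even_term (nrm_powX N u1))).
have Srec N : S N = (1 - u ^+ 2 * X * (X ^+ 2) ^+ N) * S N.+1.
  have := has_sumB (hS N) (has_sumZ (c := 1 - (u * X ^+ N) ^+ 2 * X) (hS N.+1)).
  have tel := telescope_even (nrm_powX N u1).
  have eN : u * X ^+ N.+1 = u * X ^+ N * X by rewrite exprSr mulrA.
  rewrite eN => h; have := has_sum_unique tel h => /esym/eqP; rewrite subr_eq0 => /eqP ->.
  by congr (_ * _); rewrite exprAC; ring.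
have Sprod N : S 0%N = (\prod_(k < N) (1 - u ^+ 2 * X * (X ^+ 2) ^+ k)) * S N.
  elim: N => [|N IH]; first by rewrite big_ord0 mul1r.
  by rewrite big_ord_recr /= -mulrA -Srec.
have [||||m hm Sm] := @has_sum_dominated R int (fun N => even_term x0 x1 (u * X ^+ N)) (gauss x0 x1)
   (fun n => Kq * 2^-1 ^+ `|n|%N) S (Kq * 4).
- by move=> A; rewrite -mulr_sumr; apply: ler_wpM2l; [exact: ltW Kq0|exact: int_geom].
- by move=> N n; exact: even_term_le (nrm_powX N u1).
- move=> n; suff : (fun N => even_term x0 x1 (u * X ^+ N) n) @ \oo --> gauss x0 x1 n * (1 * 1).
    by rewrite !mulr1.
  apply: cvgnM; first exact: cvgn_cst.
  apply: cvgnM; first exact: qp_powX.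
  have -> : (fun N => qpochhammer (u * X ^+ N * X / z n) X) = (fun N => qpochhammer (u * X ^+ N * (X / z n)) X).
    by apply/funext => N; congr (qpochhammer _ X); ring.
  exact: qp_powX.
- exact: hS.
have mE := has_sum_unique hm (jacobi_triple x0_neq0 x1_neq0 x0_small x1_small).
rewrite mE in Sm.
have lim := cvgnM (qp_cvg (a := u ^+ 2 * X) X2) Sm.
have lim2 : (fun _ : nat => S 0%N) @ \oo --> qpochhammer (u ^+ 2 * X) (X ^+ 2) * triple x0 x1.
  by move: lim; apply: cvg_trans; apply: near_eq_cvg; apply: filterE => N; rewrite -Sprod.
rewrite -(cvgn_unique (@cvgn_cst R (S 0%N)) lim2).
by have := hS 0%N; rewrite expr0 mulr1.
Qed.

Lemma sum_odd_term u : nrm u <= 1 -> has_sum (odd_term x0 x1 false u) (triple x0 x1).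
Proof.
move=> u1; have X1 := X_lt1 x0_small x1_small; have X2 := X2_lt1 x0_small x1_small.
have [S hS] := choice (fun N : nat => abs_has_sum (abs_odd_term false (nrm_powX N.*2 u1))).
have Srec N : S N = S N.+1.
  have := has_sumB (hS N) (hS N.+1).
  have tel := telescope_odd (nrm_powX N.*2 u1).
  have eN : u * X ^+ N.+1.*2 = u * X ^+ N.*2 * X ^+ 2 by rewrite doubleS -addn2 exprD mulrA.
  rewrite eN => h; have := has_sum_unique tel h => /esym/eqP; rewrite subr_eq0 => /eqP //.
have SE N : S N = S 0%N by elim: N => // N <-.
have [||||m hm Sm] := @has_sum_dominated R int (fun N => odd_term x0 x1 false (u * X ^+ N.*2)) (gauss x0 x1)
   (fun n => Kq * 2^-1 ^+ `|n|%N) S (Kq * 4).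
- by move=> A; rewrite -mulr_sumr; apply: ler_wpM2l; [exact: ltW Kq0|exact: int_geom].
- by move=> N n; exact: odd_term_le (nrm_powX _ u1).
- move=> n; suff : (fun N => odd_term x0 x1 false (u * X ^+ N.*2) n) @ \oo --> gauss x0 x1 n * (1 * 1).
    by rewrite !mulr1.
  apply: cvgnM; first exact: cvgn_cst.
  have dbl (f : nat -> C) (l : C) : f @ \oo --> l -> (fun N => f N.*2) @ \oo --> l.
    move=> /cvgnP h; apply/cvgnP => e /h[N0 hN0]; exists N0 => N hN.
    by apply: hN0; rewrite -addnn; apply: leq_trans hN (leq_addr _ _).
  have q (w : C) : (fun N => qpochhammer (u * X ^+ N.*2 * w) (X ^+ 2)) @ \oo --> (1 : C).
    by apply: (dbl (fun N => qpochhammer (u * X ^+ N * w) (X ^+ 2))); exact: qp_powX.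
  have q2 (f : nat -> C) w : (forall N, f N = u * X ^+ N.*2 * w) ->
      (fun N => qpochhammer (f N) (X ^+ 2)) @ \oo --> (1 : C).
    by move=> /funext ->; exact: q.
  case: (odd _ (+) false); apply: cvgnM.
  - exact: q.
  - by apply: (q2 _ (X ^+ 2 / z n)) => N; ring.
  - by apply: (q2 _ (X * z n)) => N; ring.
  - by apply: (q2 _ (X / z n)) => N; ring.
- exact: hS.
have mE := has_sum_unique hm (jacobi_triple x0_neq0 x1_neq0 x0_small x1_small).
have S0 : (fun _ : nat => S 0%N) @ \oo --> triple x0 x1.
  by rewrite -mE; move: Sm; apply: cvg_trans; apply: near_eq_cvg; apply: filterE => N; rewrite SE.
rewrite -(cvgn_unique (@cvgn_cst R (S 0%N)) S0).
by have := hS 0%N; rewrite expr0 mulr1.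
Qed.

Lemma qp_small_neq0 (a p : C) : nrm a <= 2^-1 -> nrm p < 1 -> qpochhammer a p != 0.
Proof.
move=> a1 p1; apply: qp_ne0 => // k; rewrite -nrm_gt0.
have h := nrm_subl 1 (a * p ^+ k); rewrite nrm1 in h; apply: lt_le_trans h.
have : nrm (a * p ^+ k) <= 2^-1; last by lra.
rewrite mulrC; apply: nrm_mul_small => //; rewrite nrmX exprn_ile1 ?nrm_ge0 //; exact: ltW.
Qed.

Lemma has_sum_divl (I : choiceType) (f g : I -> C) (k l : C) : k != 0 ->
  (forall i, f i = k * g i) -> has_sum f l -> has_sum g (l / k).
Proof.
move=> k0 fg /(has_sumZ (c := k^-1)); rewrite mulrC; apply: has_sum_ext => i.
by rewrite fg mulKf.
Qed.

Lemma small4 u (x : C) : nrm u <= 1 -> nrm x <= 4^-1 -> nrm (u * x) <= 2^-1.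
Proof. by move=> u1 x4; apply: nrm_mul_small => //; lra. Qed.

Lemma bilateral_sum_even u : nrm u <= 1 ->
  has_sum (bilateral xpredT x0 x1 u) (qpochhammer (u ^+ 2 * X) (X ^+ 2) * triple x0 x1 /
    (qpochhammer (u * x0) X * qpochhammer (u * x1) X)).
Proof.
move=> u1; have X1 := X_lt1 x0_small x1_small.
apply: (has_sum_divl _ _ (sum_even_term u1)).
  by rewrite mulf_neq0 // qp_small_neq0 // small4.
by move=> n; rewrite (even_termE _ u1) (even_term_0 _ x0_neq0).
Qed.

Lemma bilateral_sum_odd0 u : nrm u <= 1 ->
  has_sum (bilateral id x0 x1 u) (triple x0 x1 /
    (qpochhammer (u * X * x0) (X ^+ 2) * qpochhammer (u * x1) (X ^+ 2))).
Proof.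
move=> u1; have X2 := X2_lt1 x0_small x1_small.
apply: (has_sum_divl _ _ (sum_odd_term u1)).
  rewrite mulf_neq0 // qp_small_neq0 // small4 //.
  by have := nrm_powX 1 u1; rewrite expr1.
move=> n; rewrite (odd_termE _ _ u1) (odd_term_0 _ x0_neq0); congr (_ * bilateral _ _ _ _ _).
by apply/funext => b; rewrite addbF.
Qed.
End Sums.

Lemma triple_sym (x0 x1 : C) : triple x0 x1 = triple x1 x0.
Proof. by rewrite /triple (mulrC x1 x0) [qpochhammer (x0 ^+ 2) _ * _]mulrC. Qed.

Lemma bilateral_sum_odd1 (x0 x1 : C) u : x0 != 0 -> x1 != 0 -> nrm x0 <= 4^-1 -> nrm x1 <= 4^-1 ->
  nrm u <= 1 ->
  has_sum (bilateral negb x0 x1 u) (triple x0 x1 /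
    (qpochhammer (u * x0) ((x0 * x1) ^+ 2) * qpochhammer (u * (x0 * x1) * x1) ((x0 * x1) ^+ 2))).
Proof.
move=> a0 b0 a4 b4 u1.
have := has_sum_opp (bilateral_abs b4 a4 id u1) (bilateral_sum_odd0 b0 a0 b4 a4 u1).
have -> : x1 * x0 = x0 * x1 by rewrite mulrC.
rewrite triple_sym [X in _ / X]mulrC; apply: has_sum_ext => n.
by rewrite bilateral_opp.
Qed.
End Bilateral.

Lemma cvg_half : (fun n => n./2) @ \oo --> \oo.
Proof.
by apply/cvgnyPge => A; exists A.*2 => // n /= hn; rewrite -(doubleK A) half_leq.
Qed.

Lemma cvg_uphalf : uphalf @ \oo --> \oo.
Proof.
by apply/cvgnyPge => A; exists A.*2 => // n /= hn; rewrite -(uphalf_double A) uphalf_leq.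
Qed.

(** * The local parts *)

Section DihedralSum.
Variable R : realType.
Local Notation C := (Cplx R).

(** Words are indexed by their last letter: in [foldl slash] it is the last letter whose factor is
    evaluated at x itself. *)
Fixpoint alternating (i : bool) n : seq bool :=
  if n is n'.+1 then rcons (alternating (~~ i) n') i else [::].

Lemma last_alternating i n x : last x (alternating i n.+1) = i.
Proof. by rewrite /= last_rcons. Qed.

Lemma size_alternating i n : size (alternating i n) = n.
Proof. by elim: n i => //= n IH i; rewrite size_rcons IH. Qed.

Lemma sorted_alternating i n : sorted (fun i j => i != j) (alternating i n).
Proof.
elim: n i => // -[|n] IH i //.
have := IH (~~ i); have := last_alternating (~~ i) n i.
change (alternating i n.+2) with (rcons (alternating (~~ i) n.+1) i).
move: (alternating (~~ i) n.+1) => [|a s] /=; first by case: (i).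
by rewrite rcons_path => -> ->; case: (i).
Qed.

Lemma alternatingP (w : seq bool) : sorted (fun i j => i != j) w ->
  w = alternating (last false w) (size w).
Proof.
elim/last_ind: w => // s i IH; rewrite last_rcons size_rcons /= => ss.
congr rcons; case: s IH ss => [|a s] // IH.
rewrite [sorted _ _]/= rcons_path => /andP[/IH {1}-> /=].
by case: (last a s) i => [] [].
Qed.

Definition word_of_int (n : int) : dihedral_word :=
  match n with
  | Posz n => exist _ (alternating false n) (sorted_alternating false n)
  | Negz n => exist _ (alternating true n.+1) (sorted_alternating true n.+1)
  end.

Lemma word_of_int_inj : injective word_of_int.
Proof.
move=> [n|n] [m|m] /(congr1 val) /= e; have := congr1 size e.
- by rewrite !size_alternating => ->.
- rewrite size_rcons !size_alternating => nm; rewrite nm /= in e.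
  by have := congr1 (last false) e; rewrite !last_rcons.
- rewrite size_rcons !size_alternating => nm; rewrite -nm /= in e.
  by have := congr1 (last false) e; rewrite !last_rcons.
- by rewrite !size_rcons !size_alternating => -[->].
Qed.

Lemma word_of_int_surj (w : dihedral_word) : exists n, word_of_int n = w.
Proof.
case: w => w ws; have e := alternatingP ws.
case: w ws e => [|a s] ws e.
  by exists (Posz 0); apply: val_inj.
case: (last false (a :: s)) e => e.
  by exists (Negz (size s)); apply: val_inj; rewrite /= e.
by exists (Posz (size s).+1); apply: val_inj; rewrite /= e.
Qed.

Definition general (l : nat * nat) (b : bool) : bool := coord01 b l == 0%N.

Lemma slash_factor (l : nat * nat) (u : C) f i (x : C * C) : (l.1 <= 1)%N -> (l.2 <= 1)%N ->
  coord01 i x != 0 ->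
  slash l u f i x = refl_factor (general l i) u (coord01 i x) * f (reflect_var i x).
Proof.
move=> l1 l2; rewrite /slash /general /refl_factor.
have : (coord01 i l <= 1)%N by case: i.
move: (coord01 i l) (coord01 i x) => [|[|//]] y _ y0 /=; last by [].
by congr (_ * _); rewrite addn0 mulrA; congr (_ / _); field.
Qed.

(** A reflection in x_i preserves X = x_0 x_1 and sends the other coordinate to x_i X; hence the
    k-th factor of the word is evaluated at x_i X^k. *)
Lemma foldl_slash (l : nat * nat) (u : C) n i (x : C * C) : (l.1 <= 1)%N -> (l.2 <= 1)%N ->
  x.1 != 0 -> x.2 != 0 ->
  foldl (slash l u) (fun=> 1) (alternating i n) x =
  half_term (fun b => general l (i (+) b)) u (coord01 i x) (x.1 * x.2) n.
Proof.
move=> l1 l2; elim: n i x => [|n IH] i x x0 x1; first by rewrite /half_term big_ord0.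
rewrite /= foldl_rcons slash_factor //; last by case: (i).
have e1 : (reflect_var i x).1 != 0.
  by rewrite /reflect_var; case: (i); rewrite /= ?mulf_neq0 ?invr_eq0 ?expf_neq0.
have e2 : (reflect_var i x).2 != 0.
  by rewrite /reflect_var; case: (i); rewrite /= ?mulf_neq0 ?invr_eq0 ?expf_neq0.
have e3 : (reflect_var i x).1 * (reflect_var i x).2 = x.1 * x.2.
  by rewrite /reflect_var; case: (i) => /=; field.
have e4 : coord01 (~~ i) (reflect_var i x) = coord01 i x * (x.1 * x.2).
  by rewrite /reflect_var; case: (i) => /=; ring.
rewrite IH // e3 e4 /half_term big_ord_recl /= addbF expr0 mulr1; congr (_ * _).
apply: eq_bigr => k _; rewrite /bump /= add1n exprS mulrA; congr (refl_factor _ _ _).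
  by rewrite addNb addbN.
by rewrite !mulrA.
Qed.

Lemma dihedral_sum (l : nat * nat) (u : C) (x : C * C) s : (l.1 <= 1)%N -> (l.2 <= 1)%N ->
  x.1 != 0 -> x.2 != 0 -> nrm x.1 <= 4^-1 -> nrm x.2 <= 4^-1 -> nrm u <= 1 ->
  has_sum (bilateral (general l) x.1 x.2 u) s -> has_sum (fun w => slash_one l u w x) s.
Proof.
move=> l1 l2 x0 x1 x04 x14 u1 hs.
have E n : slash_one l u (word_of_int n) x = bilateral (general l) x.1 x.2 u n.
  by case: n => n; rewrite /slash_one foldl_slash.
apply: (@has_sum_inj R _ int (fun w => slash_one l u w x) 4 s word_of_int).
- exact: word_of_int_inj.
- by move=> w hw; have [n nw] := word_of_int_surj w; have := hw n; rewrite nw eqxx.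
- by move=> A; under eq_bigr do rewrite E; exact: bilateral_abs.
- by apply: has_sum_ext hs => n; rewrite E.
Qed.

(* In weight l the factor 1 - u x_i X^k occurs for the (i, k) with l_(i+k) = 0,
   the index being modulo 2. *)
Definition local_term (l : nat * nat) (u : C) (x : C * C) (j : bool * nat) : C :=
  if general l (j.1 (+) odd j.2) then u * coord01 j.1 x * (x.1 * x.2) ^+ j.2 else 0.

Definition local_denominator l u x : C :=
  if l == (0%N, 0%N) then qpochhammer (u * x.1) (x.1 * x.2) * qpochhammer (u * x.2) (x.1 * x.2)
  else if l == (1%N, 0%N) then
    qpochhammer (u * (x.1 * x.2) * x.1) ((x.1 * x.2) ^+ 2) * qpochhammer (u * x.2) ((x.1 * x.2) ^+ 2)
  else qpochhammer (u * x.1) ((x.1 * x.2) ^+ 2) * qpochhammer (u * (x.1 * x.2) * x.2) ((x.1 * x.2) ^+ 2).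

Definition admissible (l : nat * nat) := l \in [:: (0, 0); (1, 0); (0, 1)]%N.

Local Opaque qpochhammer.

Lemma mul_cancel (t q d : C) : t != 0 -> q != 0 -> t^-1 * (q * t / d) / q = d^-1.
Proof. by move=> t0 q0; rewrite [q * t]mulrC -(mulrA t) mulKf // mulrAC mulfV ?mul1r. Qed.

Lemma Zpart_formula l (u : C) (x : C * C) : admissible l ->
  x.1 != 0 -> x.2 != 0 -> nrm x.1 <= 4^-1 -> nrm x.2 <= 4^-1 -> nrm u <= 1 ->
  Zpart_normalized l u x = (local_denominator l u x)^-1.
Proof.
move=> hl x0 x1 x04 x14 u1.
have X1 := X_lt1 x04 x14; have X2 := X2_lt1 x04 x14; have X0 := X_neq0 x0 x1.
have half (y : C) : nrm y <= 4^-1 -> nrm (u * y) <= 2^-1 by exact: small4.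
have tri0 : triple x.1 x.2 != 0.
  have h (a : C) : nrm a <= 2^-1 -> qpochhammer a ((x.1 * x.2) ^+ 2) != 0.
    by move=> ha; exact: qp_small_neq0.
  have sq (a : C) : nrm a <= 4^-1 -> nrm (a ^+ 2) <= 2^-1.
    by move=> ha; rewrite nrmX; have := nrm_ge0 a; nra.
  rewrite /triple !mulf_neq0 // h ?sq // ?(X2_half x04 x14).
  by rewrite nrmM; move: (nrm_ge0 x.1) (nrm_ge0 x.2) x04 x14; nra.
have DE : Delta x = triple x.1 x.2 by [].
have l1 : (l.1 <= 1)%N by move: hl; rewrite /admissible !inE => /or3P[] /eqP ->.
have l2 : (l.2 <= 1)%N by move: hl; rewrite /admissible !inE => /or3P[] /eqP ->.
have ZE s : has_sum (bilateral (general l) x.1 x.2 u) s -> Zpart l u x = (triple x.1 x.2)^-1 * s.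
  move=> hs; rewrite /Zpart DE; congr (_ * _); apply: has_sum_sum.
  exact: dihedral_sum.
move: hl; rewrite /admissible !inE => /or3P[] /eqP le; rewrite /Zpart_normalized /local_denominator le /=.
- have g : general l = xpredT by apply/funext => b; rewrite le /general; case: b.
  have := bilateral_sum_even x0 x1 x04 x14 u1; rewrite -g => /ZE; rewrite le => ->.
  have q0 : qpochhammer (u ^+ 2 * (x.1 * x.2)) ((x.1 * x.2) ^+ 2) != 0.
    apply: qp_small_neq0 => //; apply: nrm_mul_small (X_half x04 x14).
    by rewrite nrmX exprn_ile1 ?nrm_ge0.
  exact: mul_cancel.
- have g : general l = id by apply/funext => b; rewrite le /general; case: b.
  have := bilateral_sum_odd0 x0 x1 x04 x14 u1; rewrite -g => /ZE; rewrite le => ->.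
  by rewrite mulKf.
- have g : general l = negb by apply/funext => b; rewrite le /general; case: b.
  have := bilateral_sum_odd1 x0 x1 x04 x14 u1; rewrite -g => /ZE; rewrite le => ->.
  by rewrite mulKf.
Qed.

Lemma prod_parity (f : nat -> C) n :
  \prod_(k < n) f k = (\prod_(k < uphalf n) f k.*2) * \prod_(k < n./2) f k.*2.+1.
Proof.
elim: n => [|n IH]; first by rewrite !big_ord0 mulr1.
rewrite big_ord_recr IH /= uphalf_half; have := odd_double_half n.
case: (odd n) => /= nE; rewrite ?add1n ?add0n !big_ord_recr /=.
  by rewrite -mulrA; congr (_ * (_ * f _)); rewrite -{1}nE.
by rewrite mulrAC; congr (_ * f _ * _); rewrite -{1}nE.
Qed.

(** In the weights (1,0) and (0,1) the factors at even and at odd k come from different coordinates: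
    the single product over k interleaves two q-products in base X^2. *)
Lemma cvg_parity (f g : nat -> C) (a b : C) :
  (fun n => \prod_(k < n) f k) @ \oo --> a -> (fun n => \prod_(k < n) g k) @ \oo --> b ->
  (fun n => \prod_(k < n) (if odd k then g k./2 else f k./2)) @ \oo --> a * b.
Proof.
move=> fa gb; have := cvgnM (cvg_comp _ _ cvg_uphalf fa) (cvg_comp _ _ cvg_half gb).
apply: cvg_trans; apply: near_eq_cvg; apply: filterE => n /=.
rewrite [RHS](prod_parity (fun k => if odd k then g k./2 else f k./2)) /=; congr (_ * _); apply: eq_bigr => k _ /=.
  by rewrite odd_double doubleK.
by rewrite odd_double /= uphalf_double.
Qed.

Lemma local_denominator_cvg l (u : C) (x : C * C) : admissible l ->
  nrm x.1 <= 4^-1 -> nrm x.2 <= 4^-1 ->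
  (fun n => \prod_(k < n) ((1 - local_term l u x (false, nat_of_ord k)) * (1 - local_term l u x (true, nat_of_ord k)))) @ \oo -->
  local_denominator l u x.
Proof.
move=> hl x04 x14; have X1 := X_lt1 x04 x14; have X2 := X2_lt1 x04 x14.
have Xp k : (x.1 * x.2) ^+ k = ((x.1 * x.2) ^+ 2) ^+ k./2 * (if odd k then x.1 * x.2 else 1).
  rewrite -exprM mul2n -{1}(odd_double_half k) exprD mulrC.
  by case: (odd k); rewrite ?expr1 ?expr0.
move: hl; rewrite /admissible !inE => /or3P[] /eqP ->; rewrite /local_denominator /local_term /general /=.
- have := cvgnM (qp_cvg (a := u * x.1) X1) (qp_cvg (a := u * x.2) X1).
  apply: cvg_trans; apply: near_eq_cvg; apply: filterE => n.
  rewrite -big_split; apply: eq_bigr => k _ /=.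
  by rewrite /coord01; case: (odd k).
- have := @cvg_parity (fun k => 1 - u * x.2 * ((x.1 * x.2) ^+ 2) ^+ k)
    (fun k => 1 - u * (x.1 * x.2) * x.1 * ((x.1 * x.2) ^+ 2) ^+ k) _ _
    (qp_cvg (a := u * x.2) X2) (qp_cvg (a := u * (x.1 * x.2) * x.1) X2).
  rewrite [qpochhammer (u * x.2) _ * _]mulrC; apply: cvg_trans; apply: near_eq_cvg; apply: filterE => n.
  apply: eq_bigr => k _ /=; rewrite (Xp k); case: (odd k) => /=.
    by rewrite subr0 mulr1; congr (1 - _); ring.
  by rewrite subr0 mul1r mulr1.
- have := @cvg_parity (fun k => 1 - u * x.1 * ((x.1 * x.2) ^+ 2) ^+ k)
    (fun k => 1 - u * (x.1 * x.2) * x.2 * ((x.1 * x.2) ^+ 2) ^+ k) _ _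
    (qp_cvg (a := u * x.1) X2) (qp_cvg (a := u * (x.1 * x.2) * x.2) X2).
  apply: cvg_trans; apply: near_eq_cvg; apply: filterE => n.
  apply: eq_bigr => k _ /=; rewrite (Xp k); case: (odd k) => /=.
    by rewrite subr0 mul1r; congr (1 - _); ring.
  by rewrite subr0 mulr1 mulr1.
Qed.

End DihedralSum.

(** * Euler products *)

Section NetProducts.
Variable R : realType.
Local Notation C := (Cplx R).

(** The limit may be zero. The inequality is not strict so that it survives passage to a limit, as
    in [has_prod_iterated]. *)
Definition has_prod (I : choiceType) (f : I -> C) (l : C) : Prop :=
  forall e : R, 0 < e -> exists A : {fset I}, forall B : {fset I}, (A `<=` B)%fset ->
    nrm (\prod_(i <- B) f i - l) <= e.

Lemma has_prod_unique (I : choiceType) (f : I -> C) l l' : has_prod f l -> has_prod f l' -> l = l'.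
Proof.
move=> h h'; apply/eqP; rewrite -subr_eq0 -nrm_eq0 eq_le nrm_ge0 andbT; apply: le_eps => e e0.
have e2 := divr_gt0 e0 (ltr0Sn R 1); have [A hA] := h _ e2; have [B hB] := h' _ e2.
have := hA _ (fsubsetUl A B); have := hB _ (fsubsetUr A B).
move: (\prod_(i <- (A `|` B)%fset) f i) => P h1 h2; have := nrm_tri P l l'.
by rewrite (nrm_sub l P) (nrm_sub l' P); lra.
Qed.

Lemma has_prod_ext (I : choiceType) (f g : I -> C) l : (forall i, f i = g i) -> has_prod f l -> has_prod g l.
Proof. by move=> fg h e /h[A hA]; exists A => B /hA; under eq_bigr do rewrite fg. Qed.

Lemma has_prod_exhaust (I : choiceType) (f : I -> C) l (A : nat -> {fset I}) :
  (forall B : {fset I}, exists N, forall n, (N <= n)%N -> (B `<=` A n)%fset) ->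
  has_prod f l -> (fun n => \prod_(i <- A n) f i) @ \oo --> l.
Proof.
move=> hA h; apply/cvgnP => e e0; have [B hB] := h _ (divr_gt0 e0 (ltr0Sn R 1)).
by have [N hN] := hA B; exists N => n /hN /hB; move: (nrm _) => y; lra.
Qed.

Lemma has_prod_swap (I J : choiceType) (f : I * J -> C) l :
  has_prod f l -> has_prod (fun x : J * I => f (x.2, x.1)) l.
Proof.
move=> h e /h[A hA]; exists [fset (x.2, x.1) | x in A]%fset => B /fsubsetP AB.
have := hA [fset (x.2, x.1) | x in B]%fset; rewrite big_imfset /=; last first.
  by move=> [a b] [a' b'] _ _ [-> ->].
apply; apply/fsubsetP => -[a b] xA; apply/imfsetP; exists (b, a) => //=.
by apply: AB; apply/imfsetP; exists (a, b).
Qed.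

(** For a finite B the inner products are approximated along finite sets [T n] common to all i in B
    and large enough for the rectangle over B and [T n] to contain A; then n tends to infinity. *)
Lemma has_prod_iterated (I J : choiceType) (f : I * J -> C) (g : I -> C) l :
  has_prod f l -> (forall i, has_prod (fun j => f (i, j)) (g i)) -> has_prod g l.
Proof.
move=> h hg e e_gt0; have [A hA] := h _ e_gt0.
exists [fset x.1 | x in A]%fset => B /fsubsetP AB.
have en n : 0 < (n.+1%:R : R)^-1 by rewrite invr_gt0.
pose K n i := projT1 (choice (fun i => hg i _ (en n))) i.
have hK n i := projT2 (choice (fun i => hg i _ (en n))) i.
pose T n := ((\bigcup_(i <- B) K n i) `|` [fset x.2 | x in A])%fset.
have cv : (fun n => \prod_(i <- B) \prod_(j <- T n) f (i, j)) @ \oo --> \prod_(i <- B) g i.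
  rewrite big_seq; under eq_fun do rewrite big_seq.
  apply: cvgn_prod => i iB; apply/cvgnP => d d0.
  have [N _ hN] := near_infty_natSinv_lt (PosNum d0); exists N => n Nn.
  apply: le_lt_trans (hN n Nn); apply: hK; apply: fsubset_trans (fsubsetUl _ _).
  exact: bigfcup_sup.
apply: (@cvg_nrm_le _ (fun n => \prod_(i <- B) \prod_(j <- T n) f (i, j) - l)).
  exact: (cvgnB cv (@cvgn_cst R l)).
move=> n; have := hA [fset ((i, j) : (I * J)%type) | i in B, j in T n]%fset.
rewrite big_imfset2 /=; last by move=> [i j] [i' j'] _ _ /= [-> ->].
apply; apply/fsubsetP => -[i j] xA; apply/imfset2P; exists i; rewrite ?inE; last first.
  by exists j => //; rewrite inE; apply/orP; right; apply/imfsetP; exists (i, j).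
by apply: AB; apply/imfsetP; exists (i, j).
Qed.

End NetProducts.

(** * An abstract Euler product *)

Section EulerProduct.
Variable R : realType.
Local Notation C := (Cplx R).
Variables (I P E : choiceType) (e0 : E) (v : I -> P -> E) (one : I) (upd : P -> E -> I -> I).
Hypothesis v_inj : forall i j, (forall p, v i p = v j p) -> i = j.
Hypothesis v_one : forall p, v one p = e0.
Hypothesis v_upd : forall p e i p', v (upd p e i) p' = if p' == p then e else v i p'.
Hypothesis v_fin : forall i, exists S : {fset P}, forall p, p \notin S -> v i p = e0.
Variables (f : I -> C) (h : P -> E -> C) (s : P -> C) (b : P -> R) (M : R).
Hypothesis f_one : f one = 1.
Hypothesis f_upd : forall p e i, v i p = e0 -> f (upd p e i) = h p e * f i.
Hypothesis h_bound : forall p (A : {fset E}), e0 \notin A -> \sum_(e <- A) nrm (h p e) <= b p.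
Hypothesis b_bound : forall S : {fset P}, \sum_(p <- S) b p <= M.
Hypothesis h_sum : forall p, has_sum (h p) (s p).

(** The elements supported on S with components in A: the finite sets over which a multiplicative
    sum factors, and into which every finite subset of I can be enlarged. *)
Fixpoint box (A : P -> {fset E}) (S : seq P) : seq I :=
  if S is p :: S' then [seq upd p e i | e <- A p, i <- box A S'] else [:: one].

Lemma box_outside A S i p : i \in box A S -> p \notin S -> v i p = e0.
Proof.
elim: S i => [|p' S IH] i /=; first by rewrite inE => /eqP ->.
case/allpairsP => -[e j] /= [_ jS ->]; rewrite inE negb_or => /andP[pp pS].
by rewrite v_upd (negbTE pp) IH.
Qed.

Lemma box_uniq A S : uniq S -> uniq (box A S).
Proof.
elim: S => //= p S IH /andP[pS uS]; apply: allpairs_uniq; [exact: fset_uniq|exact: IH|].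
move=> x y /allpairsP[[e i] /= [_ iS ->]] /allpairsP[[e' i'] /= [_ iS' ->]] ee.
have E1 p' : v (upd p e i) p' = v (upd p e' i') p' by rewrite ee.
have := E1 p; rewrite !v_upd eqxx => ->; congr (_, _).
apply: v_inj => p'; have := E1 p'; rewrite !v_upd; case: eqP => // -> _.
by rewrite (box_outside iS pS) (box_outside iS' pS).
Qed.

Lemma mem_box A S i : uniq S -> (forall p, p \in S -> v i p \in A p) ->
  (forall p, p \notin S -> v i p = e0) -> i \in box A S.
Proof.
elim: S i => [|p S IH] i /= uS iA i0.
  by rewrite inE; apply/eqP/v_inj => p; rewrite i0 // v_one.
case/andP: uS => pS uS.
have -> : i = upd p (v i p) (upd p e0 i).
  by apply: v_inj => p'; rewrite !v_upd; case: eqP => // ->.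
apply: allpairs_f; first by apply: iA; rewrite inE eqxx.
apply: IH => // p' p'S; rewrite v_upd; case: eqP => pp //; subst.
- by rewrite p'S in pS.
- by apply: iA; rewrite inE p'S orbT.
- by apply: i0; rewrite inE negb_or p'S andbT; apply/eqP.
Qed.

Lemma box_sum (T : comPzSemiRingType) (g : I -> T) (k : P -> E -> T) A S : uniq S ->
  g one = 1 -> (forall p e i, v i p = e0 -> g (upd p e i) = k p e * g i) ->
  \sum_(i <- box A S) g i = \prod_(p <- S) \sum_(e <- A p) k p e.
Proof.
move=> uS g1 gM; elim: S uS => [|p S IH] /= uS; first by rewrite big_seq1 big_nil.
case/andP: uS => pS /IH {}IH; rewrite big_cons -IH mulr_suml big_allpairs_dep /=.
apply: eq_bigr => e _; rewrite mulr_sumr big_seq [RHS]big_seq.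
by apply: eq_bigr => i iS; rewrite gM // (box_outside iS).
Qed.

Lemma h_e0 p : h p e0 = 1.
Proof.
rewrite -[LHS]mulr1 -f_one -f_upd ?v_one //; congr f; apply: v_inj => p'.
by rewrite v_upd v_one; case: eqP.
Qed.

Lemma h_fsum_le p (A : {fset E}) : \sum_(e <- A) nrm (h p e) <= 1 + b p.
Proof.
apply: le_trans (_ : \sum_(e <- (e0 |` A)%fset) nrm (h p e) <= _).
  by apply: ler_sum_fsub => [e|]; [exact: nrm_ge0|exact: fsubsetUr].
rewrite (big_fsetD1 e0) ?fset1U1 //= h_e0 nrm1 lerD2l h_bound //.
by rewrite !inE eqxx.
Qed.

Lemma supports (B : {fset I}) : exists S : {fset P}, forall i p, i \in B -> p \notin S -> v i p = e0.
Proof.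
have [S hS] := choice v_fin; exists (\bigcup_(i <- B) S i)%fset => i p iB pS.
apply: hS; apply: contra pS; apply: fsubsetP; exact: bigfcup_sup.
Qed.

Lemma sub_box (B : {fset I}) (S : {fset P}) A :
  (forall i p, i \in B -> p \notin S -> v i p = e0) ->
  (forall i p, i \in B -> v i p \in A p) ->
  (B `<=` [fset i in box A S])%fset.
Proof.
move=> BS BA; apply/fsubsetP => i iB; rewrite in_fset.
by apply: mem_box => [||p] //; [move=> p _; exact: BA|exact: BS].
Qed.

Lemma box_fset (T : nmodType) (g : I -> T) A (S : {fset P}) :
  \sum_(i <- [fset i in box A S]%fset) g i = \sum_(i <- box A S) g i.
Proof.
apply: perm_big; apply: uniq_perm => //; first exact: box_uniq.
by move=> i; rewrite in_fset.
Qed.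

(** Over a box the sum of the moduli is a product of local sums, each at most 1 + b p <= exp (b
    p). *)
Lemma euler_abs_bounded : abs_bounded f (expR M).
Proof.
move=> B; have [S BS] := supports B.
pose A p := [fset v i p | i in B]%fset.
apply: le_trans (_ : \sum_(i <- [fset i in box A S]%fset) nrm (f i) <= _).
  apply: ler_sum_fsub => [i|]; first exact: nrm_ge0.
  by apply: sub_box => // i p iB; apply/imfsetP; exists i.
rewrite box_fset (@box_sum _ (fun i => nrm (f i)) (fun p e => nrm (h p e))) ?fset_uniq ?f_one ?nrm1 //; last first.
  by move=> p e i /f_upd ->; rewrite nrmM.
apply: le_trans (_ : expR (\sum_(p <- S) b p) <= _); last by rewrite ler_expR.
rewrite expR_sum; apply: ler_prod => p _; rewrite sumr_ge0 => [|? _]; last exact: nrm_ge0.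
by apply: le_trans (h_fsum_le _ _) _; rewrite expR_ge1Dx.
Qed.

(** For fixed S the local sums are approximated along boxes that always contain B; all box sums are
    within e of l, and so is their limit, the product of the local values over S. The index sets
    used are exponent functions, monic polynomials and pairs of monic polynomials. *)
Lemma euler_product : exists2 l, has_sum f l & has_prod s l.
Proof.
have [l hl] := abs_has_sum euler_abs_bounded; exists l => // e e_gt0.
have [B hB] := (iffLR (has_sumP _ _) hl) _ e_gt0.
have [S0 BS0] := supports B; exists S0 => S S0S.
have en n : 0 < (n.+1%:R : R)^-1 by rewrite invr_gt0.
have hA n p := (iffLR (has_sumP (h p) (s p)) (h_sum (p := p))) _ (en n).
pose A' n := projT1 (choice (hA n)).
pose A n p := (A' n p `|` [fset v i p | i in B])%fset.
have cvS : (fun n => \prod_(p <- S) \sum_(e <- A n p) h p e) @ \oo --> \prod_(p <- S) s p.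
  apply: cvgn_prod => p _; apply/cvgnP => d d0.
  have [N _ hN] := near_infty_natSinv_lt (PosNum d0); exists N => n Nn.
  by apply: lt_trans (hN n Nn); apply: (projT2 (choice (hA n))); exact: fsubsetUl.
apply: (@cvg_nrm_le _ (fun n => \prod_(p <- S) \sum_(e <- A n p) h p e - l)).
  exact: (cvgnB cvS (@cvgn_cst R l)).
move=> n; rewrite -(@box_sum _ f h) ?fset_uniq // -box_fset; apply/ltW/hB.
apply: sub_box => [i p iB pS|i p iB]; last by rewrite in_fsetU; apply/orP; right; apply/imfsetP; exists i.
by apply: (BS0 i) => //; apply: contra pS; exact: fsubsetP.
Qed.

End EulerProduct.

(** * Power series expansion of the local factors *)

Section LocalExpansion.
Variable R : realType.
Local Notation C := (Cplx R).

Lemma geometric_le (r : R) n : 0 <= r <= 2^-1 -> \sum_(k < n) r ^+ k <= 2.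
Proof.
move=> /andP[r0 r1].
have : (1 - r) * \sum_(k < n) r ^+ k <= 1.
  by rewrite -[1 - r]opprB mulNr -subrX1 opprB gerBl exprn_ge0.
have : 0 <= \sum_(k < n) r ^+ k by apply: sumr_ge0 => k _; rewrite exprn_ge0.
nra.
Qed.

Lemma geometric_fset_le (r : R) (A : {fset nat}) : 0 <= r <= 2^-1 -> 0%N \notin A ->
  \sum_(k <- A) r ^+ k <= 2 * r.
Proof.
move=> /andP[r0 r1] A0.
rewrite (eq_big_seq (fun k => if k == 0%N then 0 else r ^+ k)); last first.
  by move=> k kA; case: eqP => // k0; rewrite -k0 kA in A0.
apply: sum_fset_nat_le => [k|[|n]]; first by case: eqP => // _; rewrite exprn_ge0.
  by rewrite big_ord0 mulr_ge0.
rewrite big_ord_recl add0r [leLHS](_ : _ = r * \sum_(k < n) r ^+ k).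
  by rewrite mulrC ler_wpM2r // geometric_le // r0.
by rewrite mulr_sumr; apply: eq_bigr => k _; rewrite exprS.
Qed.

Lemma geometric_has_sum (t : C) : nrm t <= 2^-1 -> has_sum (fun k => t ^+ k) (1 - t)^-1.
Proof.
move=> t1; have t0 := nrm_ge0 t.
have ab : abs_bounded (fun k => t ^+ k) 2.
  move=> A; apply: sum_fset_nat_le => [k|n]; first exact: nrm_ge0.
  by under eq_bigr do rewrite nrmX; rewrite geometric_le // t0.
have [l hl] := abs_has_sum ab; have e := has_sum_nat hl.
suff -> : (1 - t)^-1 = l by [].
apply: cvgn_unique e; apply/cvgnP => d d0.
have n0 : 1 - t != 0 by rewrite -nrm_gt0; have := nrm_subl 1 t; rewrite nrm1; lra.
have [N hN] : exists N, nrm t ^+ N < d * nrm (1 - t).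
  by apply: expr_to0; rewrite ?mulr_gt0 ?nrm_gt0 // t0; lra.
exists N => n Nn; rewrite (_ : _ - _ = - (t ^+ n / (1 - t))).
  rewrite nrmN nrmM nrmV ltr_pdivrMr ?nrm_gt0 // nrmX; apply: le_lt_trans hN.
  by apply: ler_wiXn2l => //; lra.
apply: (mulIf n0); rewrite mulrBl mulVf // mulNr divfK // mulrC.
by rewrite -[1 - t]opprB mulNr -subrX1 opprB addrC addKr.
Qed.

Definition fset_boolnat n : {fset bool * nat} :=
  [fset j in [seq (b, k) | k <- iota 0 n, b <- [:: false; true]]]%fset.

Lemma fset_boolnatP (B : {fset bool * nat}) :
  exists N, forall n, (N <= n)%N -> (B `<=` fset_boolnat n)%fset.
Proof.
have [N hN] := fset_iotaP [fset j.2 | j in B]%fset; exists N => n /hN /fsubsetP h.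
apply/fsubsetP => -[b k] kB; rewrite in_fset.
have /h : k \in [fset j.2 | j in B]%fset by apply/imfsetP; exists (b, k).
rewrite in_fset => kn; apply/allpairsP; exists (k, b); split => //=.
by case: b {kB}.
Qed.

Lemma big_fset_boolnat (T : Type) (idx : T) (op : Monoid.com_law idx) n (f : bool * nat -> T) :
  \big[op/idx]_(j <- fset_boolnat n) f j =
  \big[op/idx]_(k < n) op (f (false, nat_of_ord k)) (f (true, nat_of_ord k)).
Proof.
rewrite (perm_big [seq (b, k) | k <- iota 0 n, b <- [:: false; true]]) /=.
  rewrite big_flatten big_map -(big_mkord predT (fun k => op (f (false, k)) (f (true, k)))) /index_iota subn0.
  by apply: eq_bigr => k _; rewrite !big_cons big_nil Monoid.mulm1.
apply: uniq_perm; [exact: fset_uniq| |by move=> j; rewrite in_fset].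
suff : uniq [seq (b, k) | k <- iota 0 n, b <- [:: false; true]] by [].
by rewrite allpairs_uniq ?iota_uniq // => -[k b] [k' b'] _ _ /= [-> ->].
Qed.

Lemma sum_fset_boolnat_le (g : bool * nat -> R) M : (forall j, 0 <= g j) ->
  (forall n, \sum_(k < n) (g (false, nat_of_ord k) + g (true, nat_of_ord k)) <= M) ->
  forall A : {fset bool * nat}, \sum_(j <- A) g j <= M.
Proof.
move=> g0 h A; have [N /(_ _ (leqnn _)) hN] := fset_boolnatP A.
by apply: le_trans (h N); rewrite -big_fset_boolnat; apply: ler_sum_fsub.
Qed.

Section Monomials.
Variable J : choiceType.

Definition exponents : choiceType := {fsfun J -> nat with 0%N}.

Definition monomial (t : J -> C) (a : exponents) : C := \prod_(j <- finsupp a) t j ^+ a j.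

Lemma monomialE t (a : exponents) (S : {fset J}) : (finsupp a `<=` S)%fset ->
  monomial t a = \prod_(j <- S) t j ^+ a j.
Proof.
move=> aS; rewrite [RHS](bigID [pred j | j \in finsupp a]) /= [X in _ * X]big1 ?mulr1; last first.
  by move=> j /fsfun_dflt ->.
rewrite -big_filter; apply: perm_big; apply: uniq_perm; rewrite ?filter_uniq // => j.
by rewrite mem_filter andb_idr // => /(fsubsetP aS).
Qed.

Lemma monomial_upd t j e (a : exponents) : a j = 0%N ->
  monomial t [fsfun a with j |-> e] = t j ^+ e * monomial t a.
Proof.
move=> aj; pose S := (j |` finsupp a)%fset.
rewrite (@monomialE _ a S) ?fsubsetUr // (@monomialE _ _ S); last first.
  apply/fsubsetP => j'; rewrite mem_finsupp fsfun_withE !inE.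
  by case: (j' =P j) => //= _ h; rewrite mem_finsupp.
have jS : j \in S by exact: fset1U1.
have D (F : J -> C) : \prod_(i <- S) F i = F j * \prod_(i <- (S `\ j)%fset) F i.
  exact: big_fsetD1.
rewrite !D fsfun_with aj expr0 mul1r; congr (_ * _).
rewrite big_seq [RHS]big_seq; apply: eq_bigr => j'; rewrite !inE => /andP[/negbTE jj _].
by rewrite fsfun_withE jj.
Qed.

Lemma monomial0 t : monomial t [fsfun] = 1.
Proof. by rewrite /monomial finsupp0 big_seq_fset0. Qed.

(** Multiplying out infinitely many geometric series is the abstract Euler product with J as the set
    of primes and natural numbers as components. *)
Lemma geometric_product (t : J -> C) M : (forall j, nrm (t j) <= 2^-1) ->
  (forall A : {fset J}, \sum_(j <- A) 2 * nrm (t j) <= M) ->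
  abs_bounded (monomial t) (expR M) /\
  exists2 s, has_sum (monomial t) s & has_prod (fun j => (1 - t j)^-1) s.
Proof.
move=> t1 S.
have upd (j : J) e (a : exponents) j' : [fsfun a with j |-> e] j' = if j' == j then e else a j'.
  by rewrite fsfun_withE.
have inj (a a' : exponents) : (forall j, a j = a' j) -> a = a' by move/fsfunP.
have one j : ([fsfun] : exponents) j = 0%N by rewrite fsfun0E.
have fin (a : exponents) : exists S : {fset J}, forall j, j \notin S -> a j = 0%N.
  by exists (finsupp a) => j /fsfun_dflt.
have bd j (A : {fset nat}) : 0%N \notin A -> \sum_(e <- A) nrm (t j ^+ e) <= 2 * nrm (t j).
  by move=> A0; under eq_bigr do rewrite nrmX; rewrite geometric_fset_le // nrm_ge0 t1.
have fu (j : J) e (a : exponents) : a j = 0%N -> monomial t [fsfun a with j |-> e] = t j ^+ e * monomial t a.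
  by move=> aj; rewrite monomial_upd.
have hs j := geometric_has_sum (t1 j).
split; first exact: (euler_abs_bounded inj one upd fin (monomial0 _) fu bd S).
exact: (euler_product inj one upd fin (monomial0 _) fu bd S hs).
Qed.

End Monomials.

(** The bidegree in (x_0, x_1) of a monomial when the variable (i, k) takes the value x_i X^k. *)
Definition total_degree (a : exponents (bool * nat)%type) : nat * nat :=
  (\sum_(j <- finsupp a) a j * (j.2 + ~~ j.1), \sum_(j <- finsupp a) a j * (j.2 + j.1))%N.

Lemma monomial_split (w : bool * nat -> C) (x : C * C) (a : exponents (bool * nat)%type) :
  monomial (fun j => w j * (coord01 j.1 x * (x.1 * x.2) ^+ j.2)) a =
  monomial w a * (x.1 ^+ (total_degree a).1 * x.2 ^+ (total_degree a).2).
Proof.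
rewrite /monomial /total_degree /= -!prodrXr -!big_split /=.
apply: eq_bigr => -[b k] _ /=; rewrite exprMn; congr (_ * _).
by rewrite ![(a _ * _)%N]mulnC !exprM -exprMn; congr (_ ^+ _); case: b => /=;
  rewrite ?addn0 addn1 exprMn exprS; ring.
Qed.

Lemma total_degree_eq0 (a : exponents (bool * nat)%type) : (total_degree a == (0, 0)%N) = (a == [fsfun]).
Proof.
apply/eqP/eqP => [[h1 h2]|->]; last by rewrite /total_degree finsupp0 !big_seq_fset0.
apply/fsfunP => j; rewrite fsfun0E; have [/[dup] js|/fsfun_dflt //] := boolP (j \in finsupp a).
rewrite mem_finsupp -lt0n => aj; move: h1 h2; rewrite !(big_fsetD1 _ js) /=.
by case: j js aj => [[] k] _ aj; rewrite /= ?addn1 !mulnS; move: aj; case: (a _).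
Qed.

Section Coefficients.
Variables (l : nat * nat) (u : C).
Hypothesis u1 : nrm u <= 1.

Definition weight (j : bool * nat) : C := if general l (j.1 (+) odd j.2) then u else 0.

Lemma local_termE (x : C * C) j : local_term l u x j = weight j * (coord01 j.1 x * (x.1 * x.2) ^+ j.2).
Proof. by rewrite /local_term /weight; case: ifP => _; rewrite ?mul0r // mulrA. Qed.

Lemma local_term_le (x : C * C) (b : bool) k : nrm x.1 <= 4^-1 -> nrm x.2 <= 4^-1 ->
  nrm (local_term l u x (b, k)) <= nrm (coord01 b x) * (2^-1) ^+ k.
Proof.
move=> x0 x1; rewrite local_termE !nrmM nrmX.
have w1 : nrm (weight (b, k)) <= 1 by rewrite /weight; case: ifP => _ //; rewrite nrm0.
rewrite -[leRHS]mul1r ler_pM ?mulr_ge0 ?exprn_ge0 ?nrm_ge0 // ler_wpM2l ?nrm_ge0 //.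
rewrite lerXn2r ?nnegrE ?nrm_ge0 ?invr_ge0 // nrmM.
by move: (nrm_ge0 x.1) (nrm_ge0 x.2); nra.
Qed.

Lemma local_term_half (x : C * C) j : nrm x.1 <= 4^-1 -> nrm x.2 <= 4^-1 ->
  nrm (local_term l u x j) <= 2^-1.
Proof.
move=> x0 x1; case: j => b k; apply: le_trans (local_term_le _ _ x0 x1) _.
have h : nrm (coord01 b x) <= 4^-1 by case: b.
have : (2^-1 : R) ^+ k <= 1 by rewrite exprn_ile1 //; lra.
have : 0 <= (2^-1 : R) ^+ k by rewrite exprn_ge0.
by move: ((2^-1 : R) ^+ k) (nrm_ge0 (coord01 b x)) h => y; nra.
Qed.

Lemma local_term_sum (x : C * C) : nrm x.1 <= 4^-1 -> nrm x.2 <= 4^-1 ->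
  forall A : {fset bool * nat}, \sum_(j <- A) 2 * nrm (local_term l u x j) <= 4 * (nrm x.1 + nrm x.2).
Proof.
move=> x0 x1; apply: sum_fset_boolnat_le => [j|n]; first by rewrite mulr_ge0 ?nrm_ge0.
apply: le_trans (_ : \sum_(k < n) (2 * (nrm x.1 + nrm x.2)) * (2^-1) ^+ k <= _).
  apply: ler_sum => k _; have := local_term_le false k x0 x1; have := local_term_le true k x0 x1.
  by rewrite /=; lra.
rewrite -mulr_sumr; have := @geometric_le 2^-1 n; move: (\sum_(k < n) _) => y.
have h : (0 <= (2^-1 : R) <= 2^-1)%R by apply/andP; split => //; rewrite invr_ge0.
move=> /(_ h); move: (nrm_ge0 x.1) (nrm_ge0 x.2); nra.
Qed.

(** The Euler product only provides some limit s of the products of inverses. Multiplied by the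
    limit of the products of the 1 - t_j it gives 1, which identifies s and shows that the
    denominator is nonzero. *)
Lemma local_product (x : C * C) : admissible l -> nrm x.1 <= 4^-1 -> nrm x.2 <= 4^-1 ->
  [/\ abs_bounded (monomial (local_term l u x)) (expR (4 * (nrm x.1 + nrm x.2))),
      has_sum (monomial (local_term l u x)) (local_denominator l u x)^-1 &
      has_prod (fun j => (1 - local_term l u x j)^-1) (local_denominator l u x)^-1].
Proof.
move=> hl x0 x1; have t1 := fun j => local_term_half j x0 x1.
have [ab [s hs1 hs2]] := geometric_product t1 (local_term_sum x0 x1).
suff -> : (local_denominator l u x)^-1 = s by [].
have n0 j : 1 - local_term l u x j != 0.
  by rewrite -nrm_gt0; have := nrm_subl 1 (local_term l u x j); rewrite nrm1; have := t1 j; lra.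
have cs : (fun n => \prod_(j <- fset_boolnat n) (1 - local_term l u x j)^-1) @ \oo --> s.
  exact: has_prod_exhaust fset_boolnatP hs2.
have cd := local_denominator_cvg (u := u) hl x0 x1.
have := cvgnM cd cs => c1.
have E1 : local_denominator l u x * s = 1.
  apply: cvgn_unique c1 _; apply: cvg_trans (@cvgn_cst R 1).
  apply: near_eq_cvg; apply: filterE => n.
  rewrite -[X in _ = X * _](big_fset_boolnat _ n (fun j => 1 - local_term l u x j)) -big_split /=.
  by rewrite big1 // => j _; rewrite mulfV.
have d0 : local_denominator l u x != 0.
  by apply/eqP => d0; have := E1; rewrite d0 mul0r => /esym/eqP; rewrite oner_eq0.
by apply: (mulfI d0); rewrite mulfV.
Qed.

(** Only finitely many monomials have a given bidegree, but an unordered sum spares their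
    enumeration. *)
Definition local_coef (k : nat * nat) : C :=
  summability.sum (fun a : exponents (bool * nat)%type => if total_degree a == k then monomial weight a else 0).

Lemma local_coef_has_sum k : admissible l ->
  has_sum (fun a : exponents (bool * nat)%type => if total_degree a == k then monomial weight a else 0) (local_coef k).
Proof.
(* Summability is read off the product at this single point: on monomials of bidegree k the power of
   x is the constant 4^-(k_0 + k_1), which is divided out. *)
move=> hl; pose x : C * C := (4^-1, 4^-1).
have x4 : nrm (4^-1 : C) <= 4^-1 by rewrite nrmV nrm_nat.
have [ab _ _] := local_product (x := x) hl x4 x4.
have ab' : abs_bounded (fun a : exponents (bool * nat)%type => if total_degree a == k then monomial (local_term l u x) a else 0) (expR (4 * (nrm x.1 + nrm x.2))).
  by apply: abs_bounded_le ab => a; case: eqP => // _; rewrite nrm0 nrm_ge0.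
have [s /(has_sumZ (c := 4 ^+ k.1 * 4 ^+ k.2)) hs] := abs_has_sum ab'.
suff h : has_sum (fun a : exponents (bool * nat)%type => if total_degree a == k then monomial weight a else 0)
    (4 ^+ k.1 * 4 ^+ k.2 * s) by rewrite /local_coef (has_sum_sum h).
apply: has_sum_ext hs => a; case: eqP => [ak|_]; last by rewrite mulr0.
have -> : local_term l u x = fun j => weight j * (coord01 j.1 x * (x.1 * x.2) ^+ j.2).
  by apply/funext => j; rewrite local_termE.
rewrite monomial_split ak mulrCA -[RHS]mulr1; congr (_ * _).
by rewrite mulrACA -!exprMn mulfV ?pnatr_eq0 // !expr1n mulr1.
Qed.

Lemma local_coef0 : admissible l -> local_coef (0, 0)%N = 1.
Proof.
move=> hl; have h := local_coef_has_sum (k := (0, 0)%N) hl.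
have h' : has_sum (fun a : exponents (bool * nat)%type => if total_degree a == (0, 0)%N then monomial weight a else 0)
   (\sum_(a <- [fset ([fsfun] : exponents (bool * nat)%type)]%fset) (if total_degree a == (0, 0)%N then monomial weight a else 0)).
  by apply: has_sum_finite => a; rewrite inE -total_degree_eq0 => /negbTE ->.
rewrite (has_sum_unique h h') big_seq_fset1 ifT ?monomial0 //.
by rewrite total_degree_eq0.
Qed.

Lemma local_expansion (x : C * C) : admissible l -> nrm x.1 <= 4^-1 -> nrm x.2 <= 4^-1 ->
  abs_bounded (fun k => local_coef k * (x.1 ^+ k.1 * x.2 ^+ k.2)) (expR (4 * (nrm x.1 + nrm x.2))) /\
  has_sum (fun k => local_coef k * (x.1 ^+ k.1 * x.2 ^+ k.2)) (local_denominator l u x)^-1.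
Proof.
move=> hl x0 x1; have [ab hs _] := local_product hl x0 x1.
have fib k : has_sum (fun a : exponents (bool * nat)%type => if total_degree a == k then monomial (local_term l u x) a else 0)
    (local_coef k * (x.1 ^+ k.1 * x.2 ^+ k.2)).
  rewrite mulrC; apply: has_sum_ext (has_sumZ (c := x.1 ^+ k.1 * x.2 ^+ k.2) (local_coef_has_sum (k := k) hl)) => a.
  case: eqP => [ak|_]; last by rewrite mulr0.
  have -> : local_term l u x = fun j => weight j * (coord01 j.1 x * (x.1 * x.2) ^+ j.2).
    by apply/funext => j; rewrite local_termE.
  by rewrite monomial_split ak mulrC.
split; [exact: abs_bounded_push ab fib | exact: has_sum_push ab hs fib].
Qed.

End Coefficients.
End LocalExpansion.

(** * Uniqueness of power series expansions off the axes *)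

Section ExpansionUniqueness.
Variable R : realType.
Local Notation C := (Cplx R).

Definition fset_square n : {fset nat * nat} :=
  [fset k in [seq (i, j) | i <- iota 0 n, j <- iota 0 n]]%fset.

Lemma fset_squareP (A : {fset nat * nat}) : exists n, (A `<=` fset_square n)%fset.
Proof.
have [N1 /(_ _ (leq_maxl _ _)) h1] := fset_iotaP [fset k.1 | k in A]%fset.
have [N2 /(_ _ (leq_maxr _ _)) h2] := fset_iotaP [fset k.2 | k in A]%fset.
exists (maxn N1 N2); apply/fsubsetP => -[i j] kA; rewrite in_fset.
have /(fsubsetP (h1 N2)) : i \in [fset k.1 | k in A]%fset by apply/imfsetP; exists (i, j).
have /(fsubsetP (h2 N1)) : j \in [fset k.2 | k in A]%fset by apply/imfsetP; exists (i, j).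
by rewrite !in_fset => jn i_n; apply/allpairsP; exists (i, j); split.
Qed.

Lemma half_power_sum (A : {fset nat * nat}) : \sum_(k <- A) (2^-1 : R) ^+ (k.1 + k.2) <= 4.
Proof.
have [n An] := fset_squareP A; apply: le_trans (ler_sum_fsub _ An) _ => [k|].
  by rewrite exprn_ge0.
rewrite (perm_big [seq (i, j) | i <- iota 0 n, j <- iota 0 n]); last first.
  apply: uniq_perm; [exact: fset_uniq| |by move=> j; rewrite in_fset].
  by apply: allpairs_uniq; rewrite ?iota_uniq // => -[k b] [k' b'] _ _ /= [-> ->].
rewrite big_allpairs_dep.
pose S : R := \sum_(i <- iota 0 n) 2^-1 ^+ i.
rewrite [leLHS](_ : _ = S * S); last first.
  by rewrite /S big_distrlr; apply: eq_bigr => i _; apply: eq_bigr => j _; rewrite exprD.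
rewrite /S; have -> : \sum_(i <- iota 0 n) (2^-1 : R) ^+ i = \sum_(i < n) 2^-1 ^+ i.
  by rewrite -(big_mkord predT) /index_iota subn0.
have h : (0 <= (2^-1 : R) <= 2^-1)%R by apply/andP; split => //; rewrite invr_ge0.
have := geometric_le n h; have : 0 <= \sum_(k < n) (2^-1 : R) ^+ k by apply: sumr_ge0 => k _; rewrite exprn_ge0.
move: (\sum_(k < n) _) => y; nra.
Qed.

Lemma has_sum_bounded (I : choiceType) (f : I -> C) l : has_sum f l -> exists K, forall i, nrm (f i) <= K.
Proof.
move=> /has_sumP /(_ _ ltr01) [A hA]; exists (2 + \sum_(i <- A) nrm (f i)) => i.
have s0 : 0 <= \sum_(i <- A) nrm (f i) by apply: sumr_ge0 => j _; exact: nrm_ge0.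
have [iA|iA] := boolP (i \in A).
  have : nrm (f i) <= \sum_(i <- A) nrm (f i).
    rewrite (big_fsetD1 _ iA) /= lerDl; apply: sumr_ge0 => j _; exact: nrm_ge0.
  by move: (\sum_(i <- A) _) => y; lra.
have h1 := hA _ (fsubset_refl A); have h2 := hA _ (fsubsetU1 i A).
rewrite big_fsetU1 //= in h2.
have := nrm_tri l (f i + \sum_(i <- A) f i) (\sum_(i <- A) f i).
rewrite addrK; move: h1 h2 s0; move: (\sum_(i <- A) nrm _) (nrm (f i)) (nrm (_ - l)) (nrm (_ - l)) => y a b c.
lra.
Qed.

(** The axes being excluded, one variable cannot be set to 0. Let (i, j) be the lexicographically
    least index with c nonzero and substitute x = (t^(j+1), t): the exponent (j+1) k_0 + k_1 takes
    its least value on the support of c at (i, j) alone. Dividing by this power and letting t tend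
    to 0 gives c (i, j) = 0. *)
Lemma expansion_eq0 (c : nat * nat -> C) (r : R) : 0 < r ->
  (forall x : C * C, nrm x.1 < r -> nrm x.2 < r -> x.1 != 0 -> x.2 != 0 ->
     has_sum (fun k => c k * x.1 ^+ k.1 * x.2 ^+ k.2) 0) ->
  forall k, c k = 0.
Proof.
move=> r0 hc; apply: contrapT => /existsNP[[i0 j0] /eqP c0].
pose P i := `[< exists j, c (i, j) != 0 >].
have exP : exists i, P i by exists i0; apply/asboolP; exists j0.
pose i := ex_minn exP; have [iP imin] : P i /\ forall i', P i' -> (i <= i')%N.
  by rewrite /i; case: ex_minnP.
have exQ : exists j, c (i, j) != 0 by case/asboolP: iP => j cj; exists j.
pose j := ex_minn exQ; have [cij jmin] : c (i, j) != 0 /\ forall j', c (i, j') != 0 -> (j <= j')%N.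
  by rewrite /j; case: ex_minnP.
pose e (k : nat * nat) := (j.+1 * k.1 + k.2)%N.
have emin k : c k != 0 -> k != (i, j) -> (e (i, j) < e k)%N.
  case: k => i' j' ck kne; rewrite /e /=.
  have ii' : (i <= i')%N by apply: imin; apply/asboolP; exists j'.
  have [ie|ne] := eqVneq i i'; last by have : (i < i')%N; [rewrite ltn_neqAle ne | nia].
  subst i'; have := jmin _ ck; rewrite leq_eqVlt => /orP[/eqP jj|]; last by lia.
  by rewrite -jj eqxx in kne.
move: (nrm_gt0 (c (i, j))); rewrite cij => /idP; apply/negP; rewrite -leNgt.
pose rho := Num.min (r / 2) 1.
have rho0 : 0 < rho by rewrite lt_min ltr01 divr_gt0.
have rho1 : rho <= 1 by rewrite ge_min lexx orbT.
have rhor : rho < r by rewrite gt_min ltr_pdivrMr // ltr_pMr // ltr1n.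
have nrho : nrm (rC rho) = rho by rewrite nrm_pos ?ltW.
have rn0 : rC rho != 0 by rewrite rC_eq0 gt_eqF.
have [K hK] : exists K, forall k, nrm (c k) * rho ^+ (k.1 + k.2) <= K.
  have nr : nrm (rC rho) < r by rewrite nrho.
  have [K hK] := has_sum_bounded (hc (rC rho, rC rho) nr nr rn0 rn0).
  by exists K => k; have := hK k; rewrite /= !nrmM !nrmX nrho exprD mulrA.
have K0 : 0 <= K by apply: le_trans (hK (0, 0)%N); rewrite mulr_ge0 ?exprn_ge0 ?nrm_ge0 // ltW.
(* Halving the radius rho, where the terms are bounded by K, gains the factor 2^-(k_0 + k_1), whose
   sum is at most 4. *)
pose t0 := rho / 2; have t00 : 0 < t0 by rewrite divr_gt0.
pose m := (e (i, j)).+1.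
have bound t : 0 < t <= t0 -> nrm (c (i, j)) <= 4 * K / t0 ^+ m * t.
  move=> /andP[tp tt0].
  have tr : t < r by rewrite /t0 in tt0; lra.
  have t1 : t <= 1 by rewrite /t0 in tt0; lra.
  have nt : nrm (rC t) = t by rewrite nrm_pos ?ltW.
  have tn0 : rC t != 0 by rewrite rC_eq0 gt_eqF.
  have hs : has_sum (fun k => c k * (rC t ^+ j.+1) ^+ k.1 * rC t ^+ k.2) 0.
    apply: (hc (rC t ^+ j.+1, rC t)) => //=; rewrite ?expf_neq0 // ?nrmX nt //.
    by apply: le_lt_trans tr; rewrite exprS ler_piMr ?exprn_ile1 // ltW.
  have hE k : c k * (rC t ^+ j.+1) ^+ k.1 * rC t ^+ k.2 = c k * rC t ^+ e k.
    by rewrite -mulrA -exprM -exprD.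
  have {}hs : has_sum (fun k => c k * rC t ^+ e k) 0 by apply: has_sum_ext hs.
  have hf : has_sum (fun k => if k == (i, j) then c k * rC t ^+ e k else 0) (c (i, j) * rC t ^+ e (i, j)).
    have := @has_sum_finite R _ (fun k => if k == (i, j) then c k * rC t ^+ e k else 0) [fset (i, j)]%fset.
    by rewrite big_seq_fset1 eqxx; apply=> k; rewrite inE => /negbTE ->.
  have := has_sum_le (M := 4 * K / t0 ^+ m * t ^+ m) (has_sumB hf hs).
  rewrite subr0 nrmM nrmX nt => h.
  have te : 0 < t ^+ e (i, j) by rewrite exprn_gt0.
  have tE : 4 * K / t0 ^+ m * t * t ^+ e (i, j) = 4 * K / t0 ^+ m * t ^+ m.
    by rewrite -[LHS]mulrA -exprS.
  rewrite -(ler_pM2r te) tE; apply: h => A.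
  apply: le_trans (_ : \sum_(k <- A) (K / t0 ^+ m * t ^+ m) * 2^-1 ^+ (k.1 + k.2) <= _); last first.
    rewrite -mulr_sumr; have := half_power_sum A; move: (\sum_(k <- A) _) => y y4.
    have : 0 <= K / t0 ^+ m * t ^+ m by rewrite !mulr_ge0 ?invr_ge0 ?exprn_ge0 // ltW.
    have -> : 4 * K / t0 ^+ m * t ^+ m = K / t0 ^+ m * t ^+ m * 4 by ring.
    by move=> ?; rewrite ler_wpM2l.
  apply: ler_sum => k _.
  have rhs0 : 0 <= K / t0 ^+ m * t ^+ m * 2^-1 ^+ (k.1 + k.2).
    by rewrite !mulr_ge0 ?invr_ge0 ?exprn_ge0 // ?invr_ge0 // ltW.
  case: eqP => [_|/eqP kij]; first by rewrite subrr nrm0.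
  rewrite sub0r nrmN nrmM nrmX nt.
  have [->|ck] := eqVneq (c k) 0; first by rewrite nrm0 mul0r.
  have me : (m <= e k)%N by exact: emin.
  have h1 : t ^+ e k <= t0 ^+ e k / t0 ^+ m * t ^+ m.
    rewrite -(subnK me) !exprD mulfK ?expf_neq0 ?gt_eqF //.
    by have := ltW tp; have := ltW t00 => h3 h4; rewrite ler_wpM2r ?exprn_ge0 // lerXn2r ?nnegrE.
  have h2 : t0 ^+ e k <= rho ^+ (k.1 + k.2) * 2^-1 ^+ (k.1 + k.2).
    rewrite -exprMn -/t0; apply: ler_wiXn2l; [exact: ltW|by rewrite /t0; lra|].
    by rewrite /e leq_add2r leq_pmull.
  apply: le_trans (ler_wpM2l (nrm_ge0 _) h1) _.
  have d0 : 0 <= t ^+ m / t0 ^+ m by rewrite mulr_ge0 ?invr_ge0 ?exprn_ge0 // ltW.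
  have -> : nrm (c k) * (t0 ^+ e k / t0 ^+ m * t ^+ m) = nrm (c k) * t0 ^+ e k * (t ^+ m / t0 ^+ m) by ring.
  have -> : K / t0 ^+ m * t ^+ m * 2^-1 ^+ (k.1 + k.2) = K * 2^-1 ^+ (k.1 + k.2) * (t ^+ m / t0 ^+ m) by ring.
  rewrite ler_wpM2r //; apply: le_trans (ler_wpM2l (nrm_ge0 _) h2) _.
  by rewrite mulrA ler_wpM2r ?exprn_ge0 // invr_ge0.
apply: le_eps => d d0; rewrite add0r.
pose Q := 4 * K / t0 ^+ m.
have Q0 : 0 <= Q by rewrite !mulr_ge0 ?invr_ge0 ?exprn_ge0 // ltW.
have := bound (Num.min t0 (d / (Q + 1))).
rewrite lt_min t00 divr_gt0 ?ltr_wpDl //= ge_min lexx => /(_ isT) /le_trans; apply.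
apply: le_trans (_ : Q * (d / (Q + 1)) <= _).
  by rewrite ler_wpM2l // ge_min lexx orbT.
rewrite mulrCA ger_pMr // ler_pdivrMr ?ltr_wpDl // mul1r; lra.
Qed.

Lemma expansion_unique (f : C * C -> C) a b : is_expansion f a -> is_expansion f b -> a = b.
Proof.
move=> /nearC2P[r r0 ha] /nearC2P[r' r'0 hb]; apply/funext => k; apply/eqP; rewrite -subr_eq0; apply/eqP.
apply: (@expansion_eq0 (fun k => a k - b k) (Num.min r r')); first by rewrite lt_min r0.
move=> x; rewrite !lt_min => /andP[h1 h1'] /andP[h2 h2'] x1 x2.
have s1 : has_sum (fun k => a k * x.1 ^+ k.1 * x.2 ^+ k.2) (f x) by apply: ha; rewrite ?subr0.
have s2 : has_sum (fun k => b k * x.1 ^+ k.1 * x.2 ^+ k.2) (f x) by apply: hb; rewrite ?subr0.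
have := has_sumB s1 s2; rewrite subrr; apply: has_sum_ext => k'.
by rewrite !mulrBl.
Qed.

Lemma local_is_expansion l (u : C) : admissible l -> nrm u <= 1 ->
  is_expansion (Zpart_normalized l u) (local_coef l u).
Proof.
move=> hl u1; apply/nearC2P; exists 4^-1; first by rewrite invr_gt0.
move=> x; rewrite !subr0 => /ltW h1 /ltW h2 x1 x2.
rewrite Zpart_formula //; have [_] := local_expansion u1 hl h1 h2.
by apply: has_sum_ext => k; rewrite mulrA.
Qed.

Lemma expansion_local l (u : C) : admissible l -> nrm u <= 1 ->
  expansion (Zpart_normalized l u) = local_coef l u.
Proof.
move=> hl u1; apply: (@expansion_unique (Zpart_normalized l u)).
  by apply: xgetPex; exists (local_coef l u); exact: local_is_expansion.
exact: local_is_expansion.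
Qed.
End ExpansionUniqueness.

(** * The quadratic residue symbol over a finite field *)

Section Valuations.
Variable F : finFieldType.
Implicit Types (a b c d m p : {poly F}).

Lemma fsbig_on (T : choiceType) (Q : comNzRingType) (A : set T) (r : seq T) (f : T -> Q) : uniq r ->
  (forall i, i \in r -> A i) -> (forall i, A i -> i \notin r -> f i = 1) ->
  \big[*%R/1]_(i \in A) f i = \prod_(i <- r) f i.
Proof.
move=> ur rA f1; rewrite (fsbigE r) // big_seq_cond [RHS]big_seq; apply: eq_bigl => i.
by rewrite andb_idr // => /rA Ai; rewrite inE.
Qed.

Lemma irr_size p : monic_irreducible p -> (1 < size p)%N.
Proof. by move=> [_ []]. Qed.

Lemma irr_neq0 p : monic_irreducible p -> p != 0.
Proof. by move=> [/monic_neq0]. Qed.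

Lemma dvdp_eq_monic p p' : monic_irreducible p -> monic_irreducible p' -> (p %| p') = (p == p').
Proof.
move=> [mp [sp ip]] [mp' [sp' ip']]; apply/idP/eqP => [pp|->]; last exact: dvdpp.
apply/eqP; rewrite -eqp_monic //; apply: ip' => //.
by rewrite neq_ltn sp orbT.
Qed.

Lemma irr_coprime p c : monic_irreducible p -> coprimep p c = ~~ (p %| c).
Proof. by move=> [_ ip]; exact: irreducible_poly_coprime. Qed.

Lemma irr_dvd_mul p a b : monic_irreducible p -> (p %| a * b) = (p %| a) || (p %| b).
Proof.
move=> ip; have [pa|pa] := boolP (p %| a); first by rewrite dvdp_mulr.
by rewrite mulrC Gauss_dvdpl // irr_coprime.
Qed.

Lemma pexp_size p c k : monic_irreducible p -> c != 0 -> p ^+ k %| c -> (k < size c)%N.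
Proof.
move=> ip c0 /(dvdp_leq c0); apply: leq_trans.
have := size_exp p k; have := irr_size ip; move: (size p) => n.
have : size (p ^+ k) != 0%N by rewrite size_poly_eq0 expf_neq0 // irr_neq0.
move: (size _) => s; nia.
Qed.

Lemma vpolyP p c k : monic_irreducible p -> c != 0 -> (p ^+ k %| c) = (k <= vpoly p c)%N.
Proof.
move=> ip c0; apply/idP/idP => [pk|].
  by have := pexp_size ip c0 pk => kc; apply: (leq_bigmax_cond (Ordinal kc)).
suff h : p ^+ vpoly p c %| c by move=> kv; apply: dvdp_trans h; apply: dvdp_exp2l.
have c1 : (0 < size c)%N by rewrite size_poly_gt0.
rewrite /vpoly (@bigop.bigmax_eq_arg _ (Ordinal c1)) /=; last by rewrite expr0 dvd1p.
by case: arg_maxnP => //=; rewrite expr0 dvd1p.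
Qed.

Lemma vpoly_eq p c k : monic_irreducible p -> c != 0 -> p ^+ k %| c -> ~~ (p ^+ k.+1 %| c) ->
  vpoly p c = k.
Proof. by move=> ip c0; rewrite !vpolyP // -ltnNge ltnS => h1 h2; apply/eqP; rewrite eqn_leq h1 h2. Qed.

Lemma vpoly_split p c : monic_irreducible p -> c != 0 ->
  c = coprime_part p c * p ^+ vpoly p c /\ ~~ (p %| coprime_part p c).
Proof.
move=> ip c0; have h : p ^+ vpoly p c %| c by rewrite vpolyP.
have e : c = coprime_part p c * p ^+ vpoly p c by rewrite /coprime_part divpK.
split=> //; apply/negP => pc.
have : p ^+ (vpoly p c).+1 %| c by rewrite [X in _ %| X]e exprS dvdp_mul.
by rewrite vpolyP // ltnn.
Qed.

Lemma vpoly_unique p a k : monic_irreducible p -> a != 0 -> ~~ (p %| a) -> vpoly p (a * p ^+ k) = k.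
Proof.
move=> ip a0 pa; have pk : p ^+ k != 0 by rewrite expf_neq0 // irr_neq0.
apply: vpoly_eq => //; [by rewrite mulf_neq0|by rewrite dvdp_mull|].
by rewrite exprS dvdp_mul2r.
Qed.

Lemma vpolyM p a b : monic_irreducible p -> a != 0 -> b != 0 -> vpoly p (a * b) = (vpoly p a + vpoly p b)%N.
Proof.
move=> ip a0 b0; have [ea pa] := vpoly_split ip a0; have [eb pb] := vpoly_split ip b0.
have na : coprime_part p a != 0 by apply: contraNneq pa => ->; rewrite dvdp0.
have nb : coprime_part p b != 0 by apply: contraNneq pb => ->; rewrite dvdp0.
by rewrite {1}ea {1}eb mulrACA -exprD vpoly_unique ?mulf_neq0 // irr_dvd_mul // negb_or pa.
Qed.

Lemma vpoly_eq0 p c : monic_irreducible p -> c != 0 -> ~~ (p %| c) -> vpoly p c = 0%N.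
Proof. by move=> ip c0 pc; rewrite -[c]mulr1 -(expr0 p) vpoly_unique. Qed.

Lemma vpoly_gt0 p c : monic_irreducible p -> c != 0 -> (0 < vpoly p c)%N = (p %| c).
Proof. by move=> ip c0; rewrite -vpolyP // expr1. Qed.

Lemma vpoly1 p : monic_irreducible p -> vpoly p 1 = 0%N.
Proof.
move=> ip; apply: vpoly_eq0; rewrite ?oner_neq0 // dvdp1 neq_ltn (irr_size ip) orbT //.
Qed.

Lemma vpoly_irr p p' : monic_irreducible p -> monic_irreducible p' -> vpoly p p' = (p == p').
Proof.
move=> ip ip'; case: eqP => [<-|/eqP pp].
  by rewrite -[X in vpoly _ X]mul1r -[X in _ * X]expr1 vpoly_unique ?oner_neq0 // dvdp1 neq_ltn (irr_size ip) orbT.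
by rewrite (vpoly_eq0 ip (irr_neq0 ip')) // dvdp_eq_monic.
Qed.

Lemma irr_factor m : m \is monic -> m != 1 -> exists2 p, monic_irreducible p & p %| m.
Proof.
move: {2}(size m) (leqnn (size m)) => n; elim: n m => [|n IH] m sm mm m1.
  by have := monic_neq0 mm; rewrite -size_poly_gt0 lt0n -leqn0 sm.
have s1 : (1 < size m)%N.
  rewrite ltn_neqAle size_poly_gt0 monic_neq0 // andbT eq_sym.
  by apply: contraNneq m1 => /eqP/size_poly1P[k k0 mk]; move: mm; rewrite mk monicE lead_coefC => /eqP ->.
have [im|nim] := pselect (irreducible_poly m); first by exists m.
have [d [d1 dm nd]] : exists d, [/\ size d != 1%N, d %| m & ~~ (d %= m)].
  apply: contrapT => h; apply: nim; split=> // d d1 dm.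
  by apply: contrapT => /negP hd; apply: h; exists d.
have d0 : d != 0 by apply: contraTneq dm => ->; rewrite dvd0p monic_neq0.
have sd : (size d < size m)%N by rewrite ltn_neqAle dvdp_leq ?monic_neq0 // andbT dvdp_size_eqp.
pose d' := (lead_coef d)^-1 *: d.
have l0 : (lead_coef d)^-1 != 0 by rewrite invr_eq0 lead_coef_eq0.
have md : d' \is monic by rewrite monicE lead_coefZ mulVf ?lead_coef_eq0.
have [] := IH d' _ md; rewrite ?size_scale //; first by rewrite -ltnS; exact: leq_trans sd sm.
  by apply: contra d1 => /eqP h; rewrite -(size_scale d l0) -/d' h size_poly1.
by move=> p ip pd; exists p => //; apply: dvdp_trans dm; rewrite -(dvdpZr p d l0).
Qed.

Lemma monic_div p m : monic_irreducible p -> m \is monic -> p %| m ->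
  exists2 m', m' \is monic & m = m' * p /\ (size m' < size m)%N.
Proof.
move=> ip mm pm; have e : m = m %/ p * p by rewrite divpK.
have mp : p \is monic by case: ip.
exists (m %/ p); first by move: mm; rewrite {1}e monicMr.
split=> //; have := irr_size ip; have q0 : m %/ p != 0 by apply: contraTneq (monic_neq0 mm) => q0; rewrite e q0 mul0r eqxx.
have -> : size m = (size (m %/ p) + size p).-1 by rewrite {1}e size_mul // (irr_neq0 ip).
have : (0 < size (m %/ p)%R)%N by rewrite size_poly_gt0.
by move: (size p) (size _) => x y; lia.
Qed.

Lemma monic_ind (P : {poly F} -> Prop) : P 1 ->
  (forall p m, monic_irreducible p -> m \is monic -> P m -> P (m * p)) ->
  forall m, m \is monic -> P m.
Proof.
move=> P1 PM m; move: {2}(size m) (leqnn (size m)) => n; elim: n m => [|n IH] m sm mm.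
  by have := monic_neq0 mm; rewrite -size_poly_gt0 lt0n -leqn0 sm.
have [->//|m1] := eqVneq m 1; have [p ip pm] := irr_factor mm m1.
have [m' mm' [e s]] := monic_div ip mm pm.
by rewrite e; apply: PM => //; apply: IH => //; rewrite -ltnS; exact: leq_trans s sm.
Qed.

Lemma vpoly_inj m m' : m \is monic -> m' \is monic ->
  (forall p, monic_irreducible p -> vpoly p m = vpoly p m') -> m = m'.
Proof.
move=> mm; move: m mm m'; apply: monic_ind => [m' mm' h|p m ip mm IH m' mm' h].
  have [->//|m1] := eqVneq m' 1; have [p ip pm] := irr_factor mm' m1.
  by have := vpoly_gt0 ip (monic_neq0 mm'); rewrite -h // vpoly1 // pm.
have pm' : p %| m'.
  have mp0 : m * p != 0 by rewrite mulf_neq0 ?(irr_neq0 ip) // monic_neq0.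
  by rewrite -(vpoly_gt0 ip (monic_neq0 mm')) -h // (vpoly_gt0 ip mp0) dvdp_mull.
have [m1 mm1 [e _]] := monic_div ip mm' pm'; rewrite e; congr (_ * _); apply: IH => // p' ip'.
have := h p' ip'; rewrite e !vpolyM ?monic_neq0 ?irr_neq0 //; first exact: addIn.
  by case: ip.
by case: ip.
Qed.

Lemma irr_divisors m : m \is monic -> exists S : {fset {poly F}},
  (forall p, p \in S -> monic_irreducible p) /\ (forall p, monic_irreducible p -> p %| m -> p \in S).
Proof.
move: m; apply: monic_ind => [|p m ip mm [S [S1 S2]]].
  exists fset0; split=> [p|p ip]; first by rewrite inE.
  by rewrite dvdp1 => /eqP; have := irr_size ip; move=> + h; rewrite h.
exists (p |` S)%fset; split=> p'; first by rewrite !inE => /orP[/eqP ->|/S1].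
move=> ip'; rewrite irr_dvd_mul // => /orP[/(S2 _ ip') h|]; first by rewrite inE h orbT.
by rewrite dvdp_eq_monic // => /eqP ->; rewrite !inE eqxx.
Qed.

End Valuations.

(** * Multiplicativity and values of the residue symbol *)

Section Symbols.
Variable F : finFieldType.
Implicit Types (a b c d m p : {poly F}).

Lemma residue_symbolE a m (r : seq {poly F}) : m \is monic -> uniq r ->
  (forall p, p \in r -> monic_irreducible p) -> (forall p, monic_irreducible p -> p %| m -> p \in r) ->
  residue_symbol a m = \prod_(p <- r) legendre a p ^+ vpoly p m.
Proof.
move=> mm ur r1 r2; apply: fsbig_on => // p ip pr.
have pm : ~~ (p %| m) by apply/negP => /(r2 _ ip) h; rewrite h in pr.
by rewrite (vpoly_eq0 ip (monic_neq0 mm)).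
Qed.

Lemma residue_symbol1 a : residue_symbol a 1 = 1.
Proof. by rewrite /residue_symbol fsbig1 // => p ip; rewrite vpoly1. Qed.

Lemma residue_symbolM a m m' : m \is monic -> m' \is monic ->
  residue_symbol a (m * m') = residue_symbol a m * residue_symbol a m'.
Proof.
move=> mm mm'; have mmm : m * m' \is monic by rewrite monicMl.
have [S [S1 S2]] := irr_divisors mmm.
have h1 p : monic_irreducible p -> p %| m -> p \in S by move=> ip pm; apply: S2; rewrite // dvdp_mulr.
have h2 p : monic_irreducible p -> p %| m' -> p \in S by move=> ip pm; apply: S2; rewrite // dvdp_mull.
rewrite (@residue_symbolE _ _ S) ?fset_uniq // (@residue_symbolE _ m S) ?fset_uniq // (@residue_symbolE _ m' S) ?fset_uniq //.
rewrite -big_split /= big_seq [RHS]big_seq; apply: eq_bigr => p /S1 ip.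
by rewrite vpolyM ?monic_neq0 // exprD.
Qed.

Lemma residue_symbol_irr a p : monic_irreducible p -> residue_symbol a p = legendre a p.
Proof.
move=> ip; rewrite (@residue_symbolE _ _ [:: p]) //; first by rewrite big_seq1 vpoly_irr // eqxx expr1.
- by case: ip.
- by move=> p'; rewrite inE => /eqP ->.
- by move=> p' ip'; rewrite dvdp_eq_monic // inE.
Qed.

Lemma legendre_cases a p : [\/ legendre a p = 0, legendre a p = 1 | legendre a p = -1].
Proof.
rewrite /legendre; case: ifP => _; first by constructor.
by case: ifP => _; [constructor 2|constructor 3].
Qed.

Lemma residue_symbol_cases a m : m \is monic ->
  [\/ residue_symbol a m = 0, residue_symbol a m = 1 | residue_symbol a m = -1].
Proof.
move: m; apply: monic_ind => [|p m ip mm IH]; first by rewrite residue_symbol1; constructor 2.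
have mp : p \is monic by case: ip.
rewrite residue_symbolM // (residue_symbol_irr a ip).
case: IH => ->; case: (legendre_cases a p) => ->;
 rewrite ?mul0r ?mulr0 ?mul1r ?mulN1r ?opprK ?oppr0; by constructor.
Qed.

End Symbols.

(** * Euler's criterion *)

Section EulerCriterion.
Variable k : finFieldType.

Lemma euler_criterion (y : k) : odd #|k| -> y != 0 ->
  y ^+ #|k|.-1./2 = if `[< exists b, b ^+ 2 = y >] then 1 else -1.
Proof.
move=> oQ y0; set N := #|k|.-1; have Q1 : (1 < #|k|)%N by exact: finNzRing_gt1.
have NE : N = (N./2 * 2)%N.
  by rewrite muln2 -[LHS]odd_double_half /N -subn1 oddB ?oQ // ltnW.
have x1 (x : k) : x != 0 -> x ^+ N = 1.
  by move=> x0; apply: (mulfI x0); rewrite -exprS prednK ?expf_card ?mulr1 // ltnW.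
have : (y ^+ N./2) ^+ 2 == 1 by rewrite -exprM -NE x1.
rewrite sqrf_eq1; case: asboolP => [[b by_] _|nb].
  by rewrite -by_ -exprM mulnC -NE x1 //; apply: contraNneq y0 => b0; rewrite -by_ b0 expr0n.
move=> /orP[/eqP yh|/eqP //]; case: nb.
(* Write y = x^n with x a generator of the units, of order N: from y^(N/2) = 1 it follows that N
   divides n N/2, so n is even and y is a square. *)
have /cyclicP[x xG] := field_unit_group_cyclic [set: {unit k}]%G.
have ox : #[x]%g = N by rewrite orderE -xG card_finField_unit.
have yu : y \is a GRing.unit by rewrite unitfE.
have : FinRing.Unit yu \in <[x]>%g by rewrite -xG inE.
case/cycleP => n yn; have yE : y = val x ^+ n by rewrite -FinRing.val_unitX -yn.
have : (x ^+ (n * N./2))%g = 1%g.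
  by apply: val_inj; rewrite FinRing.val_unitX exprM -yE yh.
move/eqP; rewrite -order_dvdn ox [X in (X %| _)%N]NE mulnC.
have h0 : (0 < N./2)%N.
  rewrite half_gt0 /N; move: oQ Q1; case: #|k| => [|[|[|n']]] //.
rewrite dvdn_pmul2r // dvdn2 => en.
by exists (val x ^+ n./2); rewrite -exprM muln2 yE -[in RHS](odd_double_half n) (negbTE en).
Qed.
End EulerCriterion.

Section Legendre.
Variable F : finFieldType.
Hypothesis oq : odd #|F|.
Variable p : {poly F}.
Hypothesis ip : monic_irreducible p.

Let mi : monic_irreducible_poly p := (proj2 ip, proj1 ip).
Let k : finFieldType := {poly %/ p with mi}.
Let phi (a : {poly F}) : k := in_qpoly p a.

Let phiM a b : phi (a * b) = phi a * phi b.
Proof. exact: in_qpolyM. Qed.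
Let phi1 : phi 1 = 1.
Proof. exact: in_qpoly1. Qed.
Let phiX a n : phi (a ^+ n) = phi a ^+ n.
Proof. by elim: n => [|n IH]; rewrite ?expr0 // !exprS phiM IH. Qed.
Let phiD a b : phi (a + b) = phi a + phi b.
Proof. exact: in_qpolyD. Qed.
Let phiB a b : phi (a - b) = phi a - phi b.
Proof. by apply/eqP; rewrite eq_sym subr_eq -phiD subrK. Qed.
Let phi_eq0 a : (phi a == 0) = (p %| a).
Proof.
rewrite /dvdp -val_eqE /= (mk_monicE mi).
by rewrite -Pdiv.IdomainMonic.modpE //; case: ip.
Qed.
Let phi_surj (y : k) : phi (val y) = y.
Proof. by apply: val_inj; exact/in_qpoly_small/size_mk_monic. Qed.
Let card_k : #|k| = (#|F| ^ (size p).-1)%N.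
Proof. exact: card_qfpoly. Qed.
Let odd_k : odd #|k|.
Proof. by rewrite card_k oddX oq orbT. Qed.

(** Euler's criterion in the residue field of p, stated as a divisibility so that it can be
    evaluated at a root of p in an extension field. *)
Lemma legendre_poly a : p %| a ^+ (#|F| ^ (size p).-1).-1./2 - (legendre a p)%:~R.
Proof.
have Q1 : (2 < #|k|)%N.
  by move: odd_k (finNzRing_gt1 k); case: #|k| => [|[|[|n]]].
rewrite -card_k /legendre; case: ifP => pa.
  by rewrite subr0 dvdp_exp // half_gt0; case: #|k| Q1 => [|[]].
have y0 : phi a != 0 by rewrite phi_eq0 pa.
have := euler_criterion odd_k y0.
have -> : (exists b, b ^+ 2 = phi a) = (exists b, p %| b ^+ 2 - a).
  apply/propext; split=> [[b ba]|[b]].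
    by exists (val b); rewrite -phi_eq0 phiB phiX phi_surj ba subrr.
  by rewrite -phi_eq0 phiB subr_eq0 => /eqP ba; exists (phi b); rewrite -phiX.
rewrite -phi_eq0 phiB phiX => ->; case: ifP => _; rewrite ?intr1 ?phi1 ?subrr //.
have -> : phi (-1)%:~R = -1 by rewrite mulrNz -[- _]sub0r phiB phi1 (eqP (_ : phi 0 == 0)) ?sub0r // phi_eq0 dvdp0.
by rewrite subrr.
Qed.

(** The exponent is smaller than the number of units of the residue field, so they cannot all be
    roots of X^h - 1; at a unit that is not, Euler's criterion leaves only the value -1. *)
Lemma nonresidue_poly : exists b, p %| b ^+ (#|F| ^ (size p).-1).-1./2 + 1.
Proof.
set h := _./2.
have Q1 : (2 < #|k|)%N.
  by move: odd_k (finNzRing_gt1 k); case: #|k| => [|[|[|n]]].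
have h0 : (0 < h)%N by rewrite half_gt0 -card_k; case: #|k| Q1 => [|[]].
have hQ : (h < #|k|.-1)%N.
  rewrite /h -card_k; move: Q1; case: #|k| => [|[|[|n]]] // _ /=.
  by rewrite !ltnS; have := odd_double_half n; rewrite -muln2; lia.
have [b b0 bh] : exists2 b : k, b != 0 & b ^+ h != 1.
  apply: contrapT => hb.
  have rt : all (root ('X^h - 1%:P)) [seq y <- enum k | y != 0].
    apply/allP => y; rewrite mem_filter => /andP[y0 _]; rewrite rootE !hornerE.
    by apply/negP => /negP yh; apply: hb; exists y => //; rewrite -subr_eq0.
  have := max_poly_roots _ rt (filter_uniq _ (enum_uniq k)).
  rewrite -size_poly_eq0 size_XnsubC // => /(_ isT).
  have -> : size [seq y <- enum k | y != 0] = #|k|.-1.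
    rewrite -(cardC1 (0 : k)) cardE /enum_mem -filter_predI; congr (size _).
    by apply: eq_filter => y; rewrite !inE andbT.
  by rewrite ltnS leqNgt hQ.
exists (val b); rewrite -phi_eq0 phiD phiX phi_surj phi1 /h -card_k.
have := euler_criterion odd_k b0; rewrite /h -card_k in bh.
by case: ifP => _ bE; rewrite bE ?eqxx // in bh *; rewrite addNr.
Qed.

End Legendre.

(** * Quadratic reciprocity by evaluation at roots *)

Section Reciprocity.
Variable F : finFieldType.
Hypothesis hq : (#|F| = 1 %[mod 4])%N.
Local Notation q := #|F|.
Variables (K : closedFieldType) (emb : {rmorphism F -> K}).
Implicit Types (a b c m p : {poly F}) (r : seq K).

Definition half_card := q.-1./2.
Local Notation h := half_card.

Lemma half_cardP : odd q /\ q = (h.*2).+1 /\ ~~ odd h.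
Proof.
have q1 : (0 < q)%N by apply/card_gt0P; exists 0.
have e := divn_eq q 4; rewrite hq modn_small // in e.
have e' : q = ((q %/ 4).*2.*2).+1 by rewrite {1}e addn1 -[4%N]/(2 * 2)%N mulnA !muln2.
have hE : h = (q %/ 4).*2 by rewrite /half_card e' /= doubleK -e'.
by rewrite hE odd_double -e' e' /= odd_double.
Qed.

Definition ev m (x : K) : K := (map_poly emb m).[x].

Lemma evM m m' x : ev (m * m') x = ev m x * ev m' x.
Proof. by rewrite /ev rmorphM hornerM. Qed.
Lemma evD m m' x : ev (m + m') x = ev m x + ev m' x.
Proof. by rewrite /ev rmorphD hornerD. Qed.
Lemma evN m x : ev (- m) x = - ev m x.
Proof. by rewrite /ev rmorphN hornerN. Qed.
Lemma evXn m n x : ev (m ^+ n) x = ev m x ^+ n.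
Proof. by rewrite /ev rmorphXn horner_exp. Qed.
Lemma ev1 x : ev 1 x = 1.
Proof. by rewrite /ev rmorph1 hornerC. Qed.
Lemma evX x : ev 'X x = x.
Proof. by rewrite /ev map_polyX hornerX. Qed.
Lemma evZ (n : int) x : ev n%:~R x = n%:~R.
Proof. by rewrite /ev rmorph_int -[n%:~R](rmorph_int (@polyC K)) hornerC. Qed.

Lemma ev_dvd p m x : p %| m -> ev p x = 0 -> ev m x = 0.
Proof. by move=> /dvdpP[m' ->]; rewrite evM => ->; rewrite mulr0. Qed.

Lemma frob_pow (x y : K) : (x + y) ^+ q = x ^+ q + y ^+ q.
Proof.
have [p pp pF] := finPcharP F.
apply: exprDn_pchar; rewrite (card_pprimeChar pF) pnatX; apply/orP; left.
by rewrite pnatE // inE /=; exact: rmorph_pchar pF.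
Qed.

Lemma frob_powX n (x y : K) : (x + y) ^+ (q ^ n) = x ^+ (q ^ n) + y ^+ (q ^ n).
Proof. by elim: n x y => [|n IH] x y; rewrite ?expn0 // expnS !exprM frob_pow IH. Qed.

Lemma frob_inj n : injective (fun x : K => x ^+ (q ^ n)).
Proof.
move=> x y /= e; have := frob_powX n (x - y) y; rewrite subrK e => /eqP.
rewrite -{1}[y ^+ _]add0r (inj_eq (addIr _)) eq_sym expf_eq0 => /andP[_].
by rewrite subr_eq0 => /eqP.
Qed.

Lemma ev_frob n m (x : K) : ev m (x ^+ (q ^ n)) = ev m x ^+ (q ^ n).
Proof.
elim/poly_ind: m => [|m c IH].
  by have [oq _] := half_cardP; rewrite /ev rmorph0 !horner0 expr0n expn_eq0; move: oq; case: q.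
have cE : emb c ^+ (q ^ n) = emb c.
  by elim: n {IH} => [|n IH]; rewrite ?expn0 ?expr1 // expnS exprM -rmorphXn expf_card.
have E (y : K) : ev (m * 'X + c%:P) y = ev m y * y + emb c.
  by rewrite evD evM evX /ev map_polyC hornerC.
by rewrite !E IH frob_powX exprMn cE.
Qed.

Section Orbit.
Variables (p : {poly F}) (theta : K).
Hypothesis (ip : monic_irreducible p) (pt : ev p theta = 0).
Local Notation d := (size p).-1.

Lemma ev_eq0 m : (ev m theta == 0) = (p %| m).
Proof.
apply/idP/idP => [/eqP mt|/ev_dvd/(_ pt) ->//]; apply: contraT => pm.
have := pm; rewrite -irr_coprime // => /Bezout_eq1_coprimepP[[u w] /= e].
have := ev1 theta; rewrite -e evD !evM pt mt !mulr0 addr0 => /eqP.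
by rewrite eq_sym oner_eq0.
Qed.

(** A period e0 < d would fix theta, hence all polynomials in theta of degree below d, under the
    q^e0-th power map: X^(q^e0) - X would have q^d distinct roots. *)
Lemma orbit_uniq : uniq [seq theta ^+ (q ^ i) | i <- iota 0 d].
Proof.
have [oq _] := half_cardP.
rewrite map_inj_in_uniq ?iota_uniq // => i j; rewrite !mem_iota /= !add0n.
wlog ij : i j / (i <= j)%N => [hw id jd e|id jd e].
  by case: (leqP i j) => ij; [exact: hw|apply/esym/hw => //; exact: ltnW].
move: ij; rewrite leq_eqVlt => /orP[/eqP //|ij]; exfalso.
pose e0 := (j - i)%N; have e00 : (0 < e0)%N by rewrite subn_gt0.
have e0d : (e0 < d)%N by apply: leq_ltn_trans jd; exact: leq_subr.
have te : theta ^+ (q ^ e0) = theta.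
  apply: (@frob_inj i); rewrite /= -exprM -expnD subnK //; exact: ltnW.
pose rs := map (fun b : {poly_d F} => ev (val b) theta) (enum {poly_d F}).
have q2 : (2 < q)%N.
  by have := finNzRing_gt1 F; move: oq; case: q => [|[|[|n]]].
have qe : (1 < q ^ e0)%N.
  by rewrite -[1%N](expn0 q) ltn_exp2l // ltnW.
have p0 : ('X^(q ^ e0) - 'X : {poly K}) != 0.
  by rewrite -size_poly_eq0 size_polyDl ?size_polyN ?size_polyXn ?size_polyX.
have rr : all (root ('X^(q ^ e0) - 'X)) rs.
  apply/allP => _ /mapP[b _ ->]; rewrite rootE !hornerE -ev_frob te subrr //.
have ru : uniq rs.
  rewrite map_inj_in_uniq ?enum_uniq // => b b' _ _ bb; apply: val_inj => /=.
  have : ev (val b - val b') theta == 0 by rewrite evD evN bb subrr.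
  rewrite ev_eq0 => pb; apply/eqP; rewrite -subr_eq0; apply: contraT => bn0.
  have := dvdp_leq bn0 pb; rewrite leqNgt.
  suff -> : (size (val b - val b')%R < size p)%N by [].
  apply: leq_ltn_trans (size_polyD _ _) _; rewrite size_polyN gtn_max.
  have sp : ((size p).-1 < size p)%N by have := irr_size ip; case: (size p).
  by apply/andP; split; apply: leq_ltn_trans (size_npoly _) sp.
have := max_poly_roots p0 rr ru.
rewrite size_polyDl ?size_polyN ?size_polyXn ?size_polyX // size_map -cardE card_npoly ltnS.
by rewrite (leq_exp2l _ _ (ltnW q2)) leqNgt e0d.
Qed.

Lemma orbit_prod : map_poly emb p = \prod_(x <- [seq theta ^+ (q ^ i) | i <- iota 0 d]) ('X - x%:P).
Proof.
have mp : map_poly emb p \is monic by rewrite map_monic; case: ip.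
rewrite [LHS](@all_roots_prod_XsubC _ _ [seq theta ^+ (q ^ i) | i <- iota 0 d]).
- by rewrite (monicP mp) scale1r.
- by rewrite size_map_poly size_map size_iota prednK // ltnW // (irr_size ip).
- apply/allP => _ /mapP[i _ ->]; rewrite rootE -/(ev p _) ev_frob pt expr0n expn_eq0.
  by have [oq _] := half_cardP; move: oq; case: q.
- by rewrite uniq_rootsE orbit_uniq.
Qed.

(** The value of m at the i-th conjugate of theta is the q^i-th power of its value at theta, and h
    (1 + q + ... + q^(d-1)) = (q^d - 1)/2. *)
Lemma orbit_norm m : \prod_(x <- [seq theta ^+ (q ^ i) | i <- iota 0 d]) ev m x ^+ h =
  ev m theta ^+ (q ^ d).-1./2.
Proof.
rewrite big_map; under eq_bigr do rewrite ev_frob -exprM.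
rewrite prodrXr; congr (_ ^+ _).
have -> : iota 0 d = index_iota 0 d by rewrite /index_iota subn0.
rewrite -big_distrl /= big_mkord.
have [_ [qE _]] := half_cardP.
have q1 : q.-1 = h.*2 by rewrite {1}qE.
by rewrite predn_exp q1 -doubleMl doubleK mulnC.
Qed.

End Orbit.

(** With r the roots of c, this is multiplicative in m and depends on m only modulo c, both by
    inspection; reciprocity identifies it with the symbol of c over m. *)
Definition symbol r m : K := \prod_(x <- r) ev m x ^+ h.

Lemma symbolM r m m' : symbol r (m * m') = symbol r m * symbol r m'.
Proof. by rewrite -big_split; apply: eq_bigr => x _; rewrite evM exprMn. Qed.

Lemma symbol1 r : symbol r 1 = 1.
Proof. by rewrite /symbol big1 // => x _; rewrite ev1 expr1n. Qed.

Lemma closed_root p : monic_irreducible p -> exists x, ev p x = 0.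
Proof.
move=> ip; have /closed_rootP[x /eqP px] : size (map_poly emb p) != 1%N; last by exists x.
by rewrite size_map_poly neq_ltn (irr_size ip) orbT.
Qed.

Section Symbol.
Variables (c : {poly F}) (r : seq K).
Hypothesis cr : map_poly emb c = \prod_(x <- r) ('X - x%:P).

Lemma symbol_mod m b : symbol r (m + b * c) = symbol r m.
Proof.
rewrite /symbol big_seq [RHS]big_seq; apply: eq_bigr => x xr; congr (_ ^+ _).
rewrite evD evM [ev c x](_ : _ = 0) ?mulr0 ?addr0 // /ev cr.
by apply/eqP; rewrite -[_ == 0]/(root _ _) root_prod_XsubC.
Qed.

(** By Euler's criterion and the orbit of theta, the symbol of c over p is the product of (y - x)^h
    over the roots y of p and x of c; [symbol] is the same product with the differences reversed. *)
Lemma symbol_irr p : monic_irreducible p -> symbol r p = (legendre c p)%:~R.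
Proof.
move=> ip; have [oq [qE eh]] := half_cardP; have [theta pt] := closed_root ip.
have -> : (legendre c p)%:~R = ev c theta ^+ (q ^ (size p).-1).-1./2.
  have /eqP := ev_dvd (legendre_poly oq ip c) pt.
  by rewrite evD evN evXn evZ subr_eq0 => /eqP.
rewrite -orbit_norm /symbol.
(* Here q = 1 mod 4 enters: h is even, so the order in the difference does not matter. *)
have swap (x y : K) : (x - y) ^+ h = (y - x) ^+ h.
  by rewrite -opprB exprNn -signr_odd (negbTE eh) mul1r.
under eq_bigr do rewrite /ev (orbit_prod ip pt) horner_prod -prodrXl.
rewrite exchange_big /=; apply: eq_bigr => y _.
rewrite /ev cr horner_prod -prodrXl; apply: eq_bigr => x _.
by rewrite !hornerXsubC swap.
Qed.

Lemma symbolE m : m \is monic -> symbol r m = (residue_symbol c m)%:~R.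
Proof.
move: m; apply: monic_ind => [|p m ip mm IH]; first by rewrite symbol1 residue_symbol1.
by rewrite symbolM residue_symbolM ?(residue_symbol_irr c ip) ?IH ?symbol_irr ?intrM //; case: ip.
Qed.

End Symbol.

Lemma two_neq0 : (2 : K) != 0.
Proof.
have [p pp pF] := finPcharP F; have pK := rmorph_pchar emb pF.
rewrite -(dvdn_pcharf pK) dvdn_prime2 //; apply: contraTneq (half_cardP.1) => p2.
have := finNzRing_gt1 F; have -> := card_pprimeChar pF; move: (logn _ _) => e.
by rewrite p2 oddX /= orbF; case: e.
Qed.

(** Symbols are integers but are compared through their images in K, where 0, 1 and -1 stay distinct
    because the characteristic is odd. *)
Lemma sign_inj (x y : int) : [\/ x = 0, x = 1 | x = -1] -> [\/ y = 0, y = 1 | y = -1] ->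
  x%:~R = y%:~R :> K -> x = y.
Proof.
have o := oner_neq0 K; have t := two_neq0.
case=> ->; case=> -> //; rewrite ?mulrNz ?mulr1z ?mulr0z => e; exfalso.
- by move: o; rewrite -e eqxx.
- by move: o; rewrite -[1]opprK -e oppr0 eqxx.
- by move: o; rewrite e eqxx.
- by move: t; rewrite -[2%:R]/(1 + 1) {2}e addrN eqxx.
- by move: o; rewrite -[1]opprK e oppr0 eqxx.
- by move: t; rewrite -[2%:R]/(1 + 1) -{2}e addrN eqxx.
Qed.

End Reciprocity.

(** * Periodicity and vanishing of quadratic character sums *)

Section QuadraticSums.
Variable F : finFieldType.
Hypothesis hq : (#|F| = 1 %[mod 4])%N.
Variable c : {poly F}.
Hypotheses (c_monic : c \is monic) (c_sqfree : squarefree_poly c) (c_neq1 : c != 1).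
Implicit Types (a b m p : {poly F}).
Local Notation D := (size c).-1.

(** Adding c to the remainder gives a monic representative of the class of b, to which the lemmas on
    monic arguments apply. *)
Definition periodic_symbol b : int := residue_symbol c (b %% c + c).
Local Notation G := periodic_symbol.

Lemma rep_monic b : b %% c + c \is monic.
Proof.
have s : (size (b %% c)%R < size c)%N by rewrite ltn_modp monic_neq0.
by rewrite monicE lead_coefDr // -monicE.
Qed.

Lemma size_c : (1 < size c)%N.
Proof. by have [p ip /(dvdp_leq (monic_neq0 c_monic))] := irr_factor c_monic c_neq1; apply: leq_trans (irr_size ip). Qed.

Lemma periodic_mod b : G (b %% c) = G b.
Proof. by rewrite /G modp_small // ltn_modp monic_neq0. Qed.

Lemma c_split : exists p c', [/\ monic_irreducible p, c' \is monic, c = c' * p & ~~ (p %| c')].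
Proof.
have [p ip pc] := irr_factor c_monic c_neq1; have [c' mc' [e _]] := monic_div ip c_monic pc.
exists p, c'; split => //; apply/negP => /dvdpP[d dE]; have := c_sqfree (d := p).
rewrite e dE -mulrA -expr2 dvdp_mull // => /(_ isT) s1; by have := irr_size ip; rewrite s1.
Qed.

(** Periodicity is reciprocity. Since c = c' p with p not dividing c', there is a class b0 that is a
    nonresidue modulo p and 1 modulo c'; multiplication by it changes the sign of the character. *)
Lemma periodic_symbolP : (forall m, m \is monic -> residue_symbol c m = G m) /\
  exists2 b0, coprimep c b0 & forall b, G (b0 * b) = - G b.
Proof.
have [K [emb _]] := countable_algebraic_closure F.
have [p [c' [ip mc' cE pc']]] := c_split.
have [theta pt] := closed_root emb ip.
have [r' r'E] := closed_field_poly_normal (map_poly emb c').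
have {}r'E : map_poly emb c' = \prod_(x <- r') ('X - x%:P).
  by rewrite r'E (monicP _) ?scale1r // map_monic.
pose r0 := [seq theta ^+ (#|F| ^ i) | i <- iota 0 (size p).-1].
pose r := r0 ++ r'.
have rE : map_poly emb c = \prod_(x <- r) ('X - x%:P).
  by rewrite big_cat /= -r'E -(orbit_prod hq ip pt) cE rmorphM mulrC.
have sG b : symbol emb r b = (G b)%:~R.
  by rewrite {1}(divp_eq b c) addrC (symbol_mod rE) -[LHS](symbol_mod rE _ 1) mul1r (symbolE hq rE) // rep_monic.
have sgn b := residue_symbol_cases c (rep_monic b).
split=> [m mm|].
  apply: (sign_inj hq emb); [exact: residue_symbol_cases|exact: sgn|].
  by rewrite -(symbolE hq rE) // sG.
have [b1 pb1] := nonresidue_poly (half_cardP hq).1 ip.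
have cop : coprimep p c' by rewrite irr_coprime.
have /Bezout_eq1_coprimepP[[u w] /= uw] := cop.
have b1t : ev emb b1 theta ^+ (#|F| ^ (size p).-1).-1./2 = -1.
  by have /eqP := ev_dvd pb1 pt; rewrite evD evXn ev1 addr_eq0 => /eqP.
(* Chinese remainders from u p + w c' = 1: modulo p this is b1, modulo c' it is 1. *)
pose b0 := b1 * w * c' + u * p.
exists b0.
  rewrite cE coprimepMl; apply/andP; split.
    rewrite (_ : b0 = (b1 * w - w) * c' + 1); last by rewrite -uw /b0; ring.
    by rewrite coprimep_addl_mul coprimep1.
  rewrite (_ : b0 = (u - b1 * u) * p + b1); last first.
    have e1 : b1 = b1 * (u * p + w * c') by rewrite uw mulr1.
    by rewrite /b0 {3}e1; ring.
  rewrite coprimep_addl_mul irr_coprime //; apply/negP => /ev_dvd/(_ pt) e0.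
  move: b1t; rewrite e0 expr0n; case: (_ == _) => /eqP; rewrite eq_sym ?oppr_eq0 ?oner_eq0 //.
  by rewrite eq_sym -subr_eq0 opprK -[1 + 1]/2%:R (negbTE (two_neq0 hq emb)).
have s0 : symbol emb r b0 = -1.
  rewrite /symbol big_cat /= [X in _ * X]big1_seq ?mulr1; last first.
    move=> x /= xr'; have cx : ev emb c' x = 0.
      by apply/eqP; rewrite -[_ == 0]/(root _ _) r'E root_prod_XsubC.
    have := ev1 emb x; rewrite -uw !evD !evM cx !mulr0 !addr0 add0r => ->.
    by rewrite expr1n.
  rewrite -b1t -(orbit_norm hq) big_seq [RHS]big_seq; apply: eq_bigr => x xr.
  congr (_ ^+ _); have px : ev emb p x = 0.
    by apply/eqP; rewrite -[_ == 0]/(root _ _) (orbit_prod hq ip pt) root_prod_XsubC.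
  have := ev1 emb x; rewrite -uw !evD !evM px !mulr0 add0r addr0 => e1.
  by rewrite -mulrA e1 mulr1.
move=> b; apply: (sign_inj hq emb); [exact: sgn| |].
  by rewrite /G; case: (sgn b) => ->; rewrite ?oppr0 ?opprK; constructor.
by rewrite mulrNz -!sG symbolM s0 mulN1r.
Qed.

(** Multiplication by b0 permutes the classes modulo c and negates every term, so the sum equals its
    opposite. *)
Lemma periodic_sum0 : \sum_(b : {poly_D F}) G (val b) = 0.
Proof.
have [_ [b0 cb0 Gb0]] := periodic_symbolP.
have sD x : (size (x %% c)%R <= D)%N.
  by rewrite -ltnS prednK ?ltn_modp ?monic_neq0 // size_poly_gt0 monic_neq0.
pose f (b : {poly_D F}) : {poly_D F} := npolyp D ((b0 * val b) %% c).
have vf (b : {poly_D F}) : val (f b) = (b0 * val b) %% c by rewrite /f /= npolypK.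
have fi : injective f.
  move=> b b' /(congr1 val); rewrite !vf => e; apply: val_inj => /=.
  have : c %| b0 * (val b - val b').
    by rewrite /dvdp mulrBr modpD modpN e addrN.
  rewrite Gauss_dvdpr // => cb; apply/eqP; rewrite -subr_eq0; apply: contraT => bn0.
  have := dvdp_leq bn0 cb; rewrite leqNgt.
  suff -> : (size (val b - val b')%R < size c)%N by [].
  apply: leq_ltn_trans (size_polyD _ _) _; rewrite size_polyN gtn_max.
  have sp : ((size c).-1 < size c)%N by have := size_c; case: (size c).
  by apply/andP; split; apply: leq_ltn_trans (size_npoly _) sp.
have : \sum_(b : {poly_D F}) G (val b) = - \sum_(b : {poly_D F}) G (val b).
  rewrite {1}(reindex_inj fi) -sumrN; apply: eq_bigr => b _.
  by rewrite vf periodic_mod Gb0.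
by move/eqP; rewrite -addr_eq0 -mulr2n mulrn_eq0 => /eqP.
Qed.

(** For n >= deg c, translation by any b of degree below deg c permutes the monic polynomials of
    degree n. Averaging over all b turns the inner sum into a complete sum modulo c. *)
Lemma monic_sum0 n : (D <= n)%N -> \sum_(a : {poly_n F}) residue_symbol c ('X^n + val a) = 0.
Proof.
move=> Dn; have [GE _] := periodic_symbolP.
have mX (a : {poly_n F}) : 'X^n + val a \is monic.
  by rewrite monicE addrC lead_coefDr ?lead_coefXn // size_polyXn ltnS size_npoly.
under eq_bigr do rewrite GE //.
set S := \sum_(a : {poly_n F}) _.
have sD x : (size (x %% c)%R <= D)%N.
  by rewrite -ltnS prednK ?ltn_modp ?monic_neq0 // size_poly_gt0 monic_neq0.
have tr (b : {poly_D F}) : S = \sum_(a : {poly_n F}) G ('X^n + val a + val b).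
  rewrite /S (reindex_inj (addIr (npolyp n (val b)))); apply: eq_bigr => a _ /=.
  by rewrite npolypK ?addrA // (leq_trans (size_npoly b)).
have : \sum_(b : {poly_D F}) S = 0.
  rewrite (eq_bigr _ (fun (b : {poly_D F}) _ => tr b)).
  rewrite exchange_big big1 //= => a _.
  rewrite -[RHS]periodic_sum0 [RHS](reindex_inj (addrI (npolyp D (('X^n + val a) %% c)))).
  apply: eq_bigr => b _ /=; rewrite npolypK // -periodic_mod modpD -[X in _ = G (_ + X)](@modp_small _ _ c) //.
  by apply: leq_ltn_trans (size_npoly _) _; have := size_c; case: (size c).
rewrite sumr_const => /eqP; rewrite mulrn_eq0 => /orP[|/eqP //].
by rewrite card_npoly expn_eq0; have := finNzRing_gt1 F; case: #|F|.
Qed.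

End QuadraticSums.

(** * Quadratic L-functions *)

Section ComplexExponential.
Variable R : realType.
Local Notation C := (Cplx R).

Lemma cexpD (z w : C) : cexp (z + w) = cexp z * cexp w.
Proof.
rewrite /cexp cReD cImD expRD cosD sinD.
by apply: C_eq; rewrite ?cReM ?cImM /=; ring.
Qed.

Lemma cexp0 : cexp 0 = 1 :> C.
Proof. by rewrite /cexp /= expR0 cos0 sin0 mulr1 mulr0. Qed.

Lemma cexp_neq0 (z : C) : cexp z != 0.
Proof.
apply/eqP => z0; have := cexpD z (- z); rewrite addrN cexp0 z0 mul0r => /eqP.
by rewrite oner_eq0.
Qed.

Lemma cexpMn (z : C) n : cexp (n%:R * z) = cexp z ^+ n.
Proof.
elim: n => [|n IH]; first by rewrite mul0r cexp0 expr0.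
by rewrite -natr1 mulrDl mul1r cexpD IH exprSr.
Qed.

Lemma cexp_rC (x : R) : cexp (rC x) = rC (expR x).
Proof. by rewrite /cexp /= cos0 sin0 mulr1 mulr0. Qed.

Lemma nrm_cexp (z : C) : nrm (cexp z) = expR (complex.Re z).
Proof.
rewrite /nrm normc_def /= !exprMn -mulrDr cos2Dsin2 mulr1 sqrtr_sqr ger0_norm //; exact: expR_ge0.
Qed.

Lemma derive_small (f : R -> R) (k e : R) : is_derive (0 : R) (1 : R) f k -> 0 < e ->
  exists2 d, 0 < d & forall h, `|h| < d -> `|f h - f 0 - k * h| <= e * `|h|.
Proof.
move=> [df <-] e0; have /cvgrPdist_lt/(_ _ e0)/nbhs_ballP[d /= d0 hd] := df.
exists d => // h hd'; have [->|h0] := eqVneq h 0.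
  by rewrite mulr0 subr0 subrr normr0 mulr0.
have /= := hd h; rewrite -ball_normE /= sub0r normrN => /(_ hd' h0) hh.
have -> : f h - f 0 - 'D_1 f 0 * h = - (('D_1 f 0 - h^-1 *: (f (h *: 1 + 0) - f 0)) * h).
  rewrite addr0 -[h *: 1]/(h * 1) mulr1 -[h^-1 *: _]/(h^-1 * _) mulrBl mulrAC mulVf // mul1r; ring.
by rewrite normrN normrM ler_wpM2r // ltW.
Qed.

(** By the addition formula only the behaviour at 0 matters. There the real and imaginary remainders
    are at most 4 and 5 times e1 |w|, whence the factor 10 in the choice of e1. *)
Lemma differentiable_cexp (p : C) : differentiable (@cexp R) p.
Proof.
apply/differentiable_cdiff; exists (cexp p) => e e0.
pose N := nrm (cexp p) + 1.
have N0 : 0 < N by rewrite ltr_wpDl ?nrm_ge0.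
have [e1 [e10 e11 e12]] : exists e1, [/\ 0 < e1, e1 <= 1 & e1 <= e / N / 10].
  exists (Num.min 1 (e / N / 10)).
  by rewrite lt_min ltr01 !divr_gt0 // !ge_min !lexx orbT.
have [d1 d10 h1] := derive_small (is_derive_expR 0) e10.
have [d2 d20 h2] := derive_small (is_derive_sin 0) e10.
have [d3 d30 h3] := derive_small (is_derive_cos 0) e10.
exists (Num.min (Num.min d1 e1) (Num.min d2 d3)); first by rewrite !lt_min d10 e10 d20.
move=> z; rewrite !lt_min => /andP[/andP[z1 ze] /andP[z2 z3]].
have -> : cexp z - cexp p - cexp p * (z - p) = cexp p * (cexp (z - p) - 1 - (z - p)).
  by rewrite {1}(_ : z = p + (z - p)) ?cexpD; [ring|rewrite addrC subrK].
move: (z - p) z1 z2 z3 ze => w w1 w2 w3 we.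
suff hw : nrm (cexp w - 1 - w) <= 10 * e1 * nrm w.
  rewrite nrmM; apply: le_trans (ler_wpM2l (nrm_ge0 _) hw) _.
  rewrite mulrA ler_wpM2r ?nrm_ge0 //.
  move: e12; rewrite ler_pdivlMr // ler_pdivlMr // => h; apply: le_trans h.
  by rewrite mulrC [e1 * 10]mulrC ler_wpM2l ?mulr_ge0 ?ltW // ltrDl.
have xw := nrm_Re w; have yw := nrm_Im w.
have := h1 _ (le_lt_trans xw w1); have := h2 _ (le_lt_trans yw w2); have := h3 _ (le_lt_trans yw w3).
rewrite expR0 cos0 sin0 !oppr0 mul0r !subr0 addr0 !mul1r => hc hs he.
apply: le_trans (nrm_le_ReIm _) _; rewrite !cReD !cImD !cReN !cImN /= oppr0 addr0.
move: (expR (complex.Re w)) (cos (complex.Im w)) (sin (complex.Im w)) hc hs he xw yw.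
move: (complex.Re w) (complex.Im w) => x y E c s hc hs he xw yw.
have x1 : `|x| <= e1 by apply: le_trans xw (ltW we).
have y1 : `|y| <= e1 by apply: le_trans yw (ltW we).
have E3 : `|E - 1| <= 2 * `|x|.
  have -> : E - 1 = (E - 1 - x) + x by ring.
  apply: le_trans (ler_normD _ _) _; have := normr_ge0 x; nra.
have E4 : `|E| <= 3.
  have -> : E = (E - 1) + 1 by ring.
  apply: le_trans (ler_normD _ _) _; rewrite normr1; lra.
have hc' : `|c - 1| <= e1 * nrm w by apply: le_trans hc _; apply: ler_wpM2l => //; exact: ltW.
have hs' : `|s - y| <= e1 * nrm w by apply: le_trans hs _; apply: ler_wpM2l => //; exact: ltW.
have he' : `|E - 1 - x| <= e1 * nrm w by apply: le_trans he _; apply: ler_wpM2l => //; exact: ltW.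
have A1 : `|E * c - 1 - x| <= 4 * e1 * nrm w.
  have -> : E * c - 1 - x = (E - 1 - x) + E * (c - 1) by ring.
  apply: le_trans (ler_normD _ _) _; rewrite normrM.
  have := ler_pM (normr_ge0 _) (normr_ge0 _) E4 hc'; lra.
have A2 : `|E * s - y| <= 5 * e1 * nrm w.
  have -> : E * s - y = E * (s - y) + (E - 1) * y by ring.
  apply: le_trans (ler_normD _ _) _; rewrite !normrM.
  have := ler_pM (normr_ge0 _) (normr_ge0 _) E4 hs'.
  have : `|E - 1| <= 2 * e1 by apply: le_trans E3 _; lra.
  move=> E5; have := ler_pM (normr_ge0 _) (normr_ge0 _) E5 yw; lra.
have t0 : 0 <= e1 * nrm w by rewrite mulr_ge0 ?nrm_ge0 // ltW.
by apply: le_trans (lerD A1 A2) _; lra.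
Qed.

End ComplexExponential.

Section PowerOfQ.
Variable R : realType.
Local Notation C := (Cplx R).
Variable q : R.
Hypothesis q1 : 1 < q.

Definition qpow (w : C) : C := cpow q (- w).

Lemma lnq0 : 0 < ln q. Proof. exact: ln_gt0. Qed.

Lemma cpow_nat n (z : C) : cpow (q ^+ n) z = cpow q z ^+ n.
Proof.
rewrite /cpow -cexpMn lnXn ?(lt_trans ltr01) //; congr cexp.
have -> : ((ln q *+ n)%:C%C : C) = n%:R * rC (ln q) by rewrite -rCn -rCM mulr_natl.
by rewrite mulrCA.
Qed.

Lemma qpowD (z w : C) : qpow (z + w) = qpow z * qpow w.
Proof. by rewrite /qpow /cpow opprD mulrDl cexpD. Qed.

Lemma qpowMn (z : C) n : qpow (n%:R * z) = qpow z ^+ n.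
Proof. by rewrite /qpow /cpow -cexpMn; congr cexp; ring. Qed.

Lemma qpow_neq0 (w : C) : qpow w != 0.
Proof. exact: cexp_neq0. Qed.

Lemma nrm_qpow (w : C) : nrm (qpow w) = expR (- complex.Re w * ln q).
Proof. by rewrite /qpow /cpow nrm_cexp -[(ln q)%:C%C]/(rC _) cReM cReN /= mulr0 subr0. Qed.

(** Identifies the denominator 1 - q Y of the zeta factor at 1/2 + w with the polar equation q^(1/2
    - w) = 1. *)
Lemma cpow_half (w : C) : cpow q (2^-1 - w) = rC q * qpow (2^-1 + w).
Proof.
have q0 : 0 < q := lt_trans ltr01 q1.
have -> : rC q = cpow q 1 by rewrite /cpow mul1r cexp_rC lnK.
rewrite /qpow /cpow -cexpD -mulrDl.
have -> : 1 + - (2^-1 + w) = 2^-1 - w :> C by field.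
by [].
Qed.

Lemma differentiable_qpow (w : C) : differentiable qpow w.
Proof.
have -> : qpow = @cexp R \o (fun w : C => w * (- (ln q)%:C%C)).
  by apply/funext => z; rewrite /qpow /cpow /= mulNr mulrN.
apply: differentiable_comp; last exact: differentiable_cexp.
by apply: differentiableM => //; exact: differentiable_cst.
Qed.

End PowerOfQ.

(** * Sums over monic polynomials *)

Section MonicSums.
Variables (R : realType) (F : finFieldType).
Local Notation C := (Cplx R).
Local Notation q := (#|F|%:R : R).
Implicit Types (c : {poly F}).

Lemma q_gt1 : 1 < q.
Proof. by rewrite ltr1n; exact: finNzRing_gt1. Qed.

Lemma monic_of_proof n (a : {poly_n F}) : 'X^n + val a \is monic.
Proof. by rewrite monicE addrC lead_coefDr ?lead_coefXn // size_polyXn ltnS size_npoly. Qed.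

Definition monic_of n (a : {poly_n F}) : monic_poly F := exist (fun m : {poly F} => m \is monic) _ (monic_of_proof a).

Definition degree (m : monic_poly F) : nat := (size (val m)).-1.

Lemma size_monic (m : monic_poly F) : size (val m) = (degree m).+1.
Proof. by rewrite /degree prednK // size_poly_gt0 monic_neq0 // (valP m). Qed.

Lemma degree_monic_of n (a : {poly_n F}) : degree (monic_of a) = n.
Proof. by rewrite /degree /= size_polyDl ?size_polyXn // ltnS size_npoly. Qed.

Lemma monic_of_inj n : injective (@monic_of n).
Proof. by move=> a b /(congr1 val) /= /addrI ab; apply: val_inj. Qed.

Lemma monic_of_surj n (m : monic_poly F) : degree m = n -> exists a : {poly_n F}, monic_of a = m.
Proof.
move=> mn; have sm : size (val m) = n.+1 by rewrite size_monic mn.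
have sa : (size (val m - 'X^n)%R <= n)%N.
  apply/leq_sizeP => j; rewrite leq_eqVlt => /orP[/eqP <-|nj]; rewrite coefB coefXn.
    have := valP m; rewrite monicE lead_coefE -/(degree m) mn => /eqP ->.
    by rewrite eqxx subrr.
  by rewrite nth_default ?sm // gtn_eqF // subr0.
exists (NPoly sa); apply: val_inj => /=; by rewrite addrC subrK.
Qed.

Definition monics n : {fset monic_poly F} := [fset monic_of a | a in enum {poly_n F}]%fset.

Lemma in_monics n m : (m \in monics n) = (degree m == n).
Proof.
apply/imfsetP/eqP => [[a _ ->]|/monic_of_surj[a <-]]; first exact: degree_monic_of.
by exists a => //=; rewrite mem_enum.
Qed.

Lemma sum_monics (T : nmodType) n (f : monic_poly F -> T) :
  \sum_(m <- monics n) f m = \sum_(a : {poly_n F}) f (monic_of a).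
Proof.
rewrite (perm_big [seq monic_of a | a <- enum {poly_n F}]); first by rewrite big_map big_enum.
apply: uniq_perm; first exact: fset_uniq.
  by rewrite map_inj_uniq ?enum_uniq //; exact: monic_of_inj.
move=> m; rewrite in_monics; apply/eqP/mapP => [/monic_of_surj[a <-]|[a _ ->]]; last exact: degree_monic_of.
by exists a; rewrite ?mem_enum.
Qed.

(** There are q^n monic polynomials of degree n, so the sum is dominated by a geometric series of
    ratio q r. *)
Lemma monic_abs_bounded (f : monic_poly F -> C) (r : R) : 0 <= r -> q * r < 1 ->
  (forall m, nrm (f m) <= r ^+ degree m) -> abs_bounded f (1 - q * r)^-1.
Proof.
move=> r0 qr fr A.
have qr0 : 0 <= q * r by rewrite mulr_ge0.
pose N := (\max_(m <- A) degree m).+1.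
have bnd n : \sum_(m <- A | degree m == n) nrm (f m) <= (q * r) ^+ n.
  have -> : (q * r) ^+ n = \sum_(m <- monics n) r ^+ n.
    rewrite sum_monics sumr_const card_npoly exprMn -[RHS]mulr_natr natrX mulrC //.
  apply: le_trans (_ : \sum_(m <- A | degree m == n) r ^+ n <= _).
    by apply: ler_sum => m /eqP mn; rewrite -mn fr.
  rewrite -big_filter; apply: le_trans (_ : \sum_(m <- [fset m in A | degree m == n]%fset) r ^+ n <= _).
    rewrite (perm_big [fset m in A | degree m == n]%fset) //; apply: uniq_perm; rewrite ?filter_uniq // => m.
    by rewrite mem_filter !inE andbC.
  apply: ler_sum_fsub => [_|]; first by rewrite exprn_ge0.
  by apply/fsubsetP => m; rewrite !inE in_monics => /andP[].
apply: le_trans (_ : \sum_(n < N) (q * r) ^+ n <= _).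
  apply: le_trans (ler_sum _ (fun (i : 'I_N) _ => bnd i)).
  rewrite (exchange_big_dep xpredT) //= big_seq [leRHS]big_seq; apply: ler_sum => m mA.
  have mN : (degree m < N)%N by rewrite ltnS; exact: leq_bigmax_seq.
  rewrite (bigD1 (Ordinal mN)) /= ?eqxx // lerDl sumr_ge0 // => *; exact: nrm_ge0.
rewrite -[X in _ <= X]mul1r ler_pdivlMr ?subr_gt0 // mulrC.
by rewrite -[1 - _]opprB mulNr -subrX1 opprB gerBl exprn_ge0.
Qed.

Lemma monic_has_sum (f : monic_poly F -> C) (r : R) l : 0 <= r -> q * r < 1 ->
  (forall m, nrm (f m) <= r ^+ degree m) ->
  has_sum f l -> has_sum (fun n => \sum_(a : {poly_n F}) f (monic_of a)) l.
Proof.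
move=> r0 qr fr hl; apply: (has_sum_push (monic_abs_bounded r0 qr fr) hl (p := degree)) => n.
rewrite -sum_monics.
have := @has_sum_finite R _ (fun m => if degree m == n then f m else 0) (monics n).
rewrite (eq_big_seq f); last by move=> m; rewrite in_monics => ->.
by apply=> m; rewrite in_monics => /negbTE ->.
Qed.

End MonicSums.

(** * The L-function as a rational function of q^(-s) *)

Section LSeries.
Variables (R : realType) (F : finFieldType).
Local Notation C := (Cplx R).
Local Notation q := (#|F|%:R : R).
Hypothesis hq : (#|F| = 1 %[mod 4])%N.
Implicit Types (c : {poly F}).
Local Notation Y := (@qpow R q).

Lemma nrm_chi c (m : {poly F}) : m \is monic -> nrm (chi R c m) <= 1.
Proof.
by move=> mm; rewrite /chi; case: (residue_symbol_cases c mm) => ->;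
  rewrite ?mulrNz ?mulr1z ?mulr0z ?nrmN ?nrm1 ?nrm0.
Qed.

Lemma cpow_pnorm (m : monic_poly F) (s : C) : cpow (pnorm R (val m)) (- s) = Y s ^+ degree m.
Proof. by rewrite /pnorm (cpow_nat (q_gt1 R F)). Qed.

(** The coefficient of Y^n is the sum of chi_c over the monic polynomials of degree n; for c <> 1 it
    vanishes from n = deg c on, by [monic_sum0], hence the truncation. *)
Definition numerator c : {poly C} :=
  if c == 1 then 1 else \poly_(n < (size c).-1) \sum_(a : {poly_n F}) chi R c ('X^n + val a).

Definition denominator c : {poly C} := if c == 1 then 1 - q%:C%C *: 'X else 1.

Definition Lfun c (s : C) : C := (numerator c).[Y s] / (denominator c).[Y s].

Lemma qY_lt1 (s : C) : 1 < complex.Re s -> q * nrm (Y s) < 1.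
Proof.
move=> s1; rewrite nrm_qpow; have l0 := lnq0 (q_gt1 R F).
have qE : q = expR (ln q) by rewrite lnK // posrE (lt_trans ltr01) // q_gt1.
rewrite {1}qE -expRD -[X in _ < X]expR0 ltr_expR; move: (ln q) l0 => l l0; move: (complex.Re s) s1 => x x1.
have x1' : 0 < x - 1 by rewrite subr_gt0.
have := mulr_gt0 l0 x1'; lra.
Qed.

Lemma chi_1 (m : {poly F}) : m \is monic -> chi R 1 m = 1.
Proof.
move: m; apply: monic_ind => [|p m ip mm]; first by rewrite /chi residue_symbol1.
have mp : p \is monic by case: ip.
rewrite /chi residue_symbolM // (residue_symbol_irr _ ip) intrM => ->; rewrite mul1r.
rewrite /legendre dvdp1 gtn_eqF ?(irr_size ip) // ifT //; apply/asboolP; exists 1; by rewrite expr1n subrr dvdp0.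
Qed.

Lemma L_has_sum c s : c \is monic -> squarefree_poly c -> 1 < complex.Re s ->
  has_sum (fun m : monic_poly F => chi R c (val m) * cpow (pnorm R (val m)) (- s)) (Lfun c s).
Proof.
move=> cm csq s1; have qY := qY_lt1 s1.
pose f (m : monic_poly F) := chi R c (val m) * Y s ^+ degree m.
suff h : has_sum f (Lfun c s) by apply: has_sum_ext h => m; rewrite cpow_pnorm.
have fr m : nrm (f m) <= nrm (Y s) ^+ degree m.
  by rewrite nrmM nrmX ler_piMl ?exprn_ge0 ?nrm_ge0 // nrm_chi // (valP m).
have [l hl] := abs_has_sum (monic_abs_bounded (nrm_ge0 _) qY fr).
suff <- : l = Lfun c s by [].
have hs := has_sum_nat (monic_has_sum (nrm_ge0 _) qY fr hl).
have fE n (a : {poly_n F}) : f (monic_of a) = chi R c ('X^n + val a) * Y s ^+ n.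
  by rewrite /f degree_monic_of.
rewrite /Lfun /numerator /denominator; case: eqP => c1.
  have qYn : nrm (rC q * Y s) < 1.
    by rewrite nrmM nrm_pos // ler0n.
  have d0 : 1 - rC q * Y s != 0.
    by rewrite -nrm_gt0; have := nrm_subl 1 (rC q * Y s); rewrite nrm1; lra.
  rewrite !hornerE /=; apply: cvgn_unique hs _; apply/cvgnP => e e0.
  have [N hN] : exists N, nrm (rC q * Y s) ^+ N < e * nrm (1 - rC q * Y s).
    by apply: expr_to0; rewrite ?nrm_ge0 // mulr_gt0 ?nrm_gt0.
  exists N => n Nn.
  have -> : \sum_(k < n) \sum_(a : {poly_k F}) f (monic_of a) = \sum_(k < n) (rC q * Y s) ^+ k.
    apply: eq_bigr => k _; rewrite (eq_bigr (fun=> Y s ^+ k)); last first.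
      by move=> a _; rewrite fE c1 chi_1 ?mul1r //; exact: monic_of_proof.
    by rewrite sumr_const card_npoly exprMn -rCX -natrX rCn mulr_natl.
  rewrite (_ : _ - _ = - ((rC q * Y s) ^+ n / (1 - rC q * Y s))).
    rewrite nrmN nrmM nrmV ltr_pdivrMr ?nrm_gt0 // nrmX; apply: le_lt_trans hN.
    by apply: ler_wiXn2l => //; rewrite ?nrm_ge0 // ltW.
  apply: (mulIf d0); rewrite mulrBl mulVf // mulNr divfK // mulrC.
  by rewrite -[1 - _]opprB mulNr -subrX1 opprB addrC addKr.
rewrite hornerC divr1 horner_poly.
have c1' : c != 1 by apply/eqP.
apply: cvgn_unique hs _; apply/cvgnP => e e0; exists (size c).-1 => n Dn.
rewrite (ord_split _ (fun k => \sum_(a : {poly_k F}) f (monic_of a)) Dn) /=.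
rewrite [X in _ + X - _]big_nat_cond [X in _ + X - _]big1 ?addr0; last first.
  move=> k /andP[/andP[Dk _] _].
  under eq_bigr do rewrite fE.
  rewrite -mulr_suml /chi -(rmorph_sum (intr : int -> C)) /=.
  by rewrite (monic_sum0 hq cm csq c1' Dk) mul0r.
rewrite (_ : _ - _ = 0) ?nrm0 //; apply/eqP; rewrite subr_eq0; apply/eqP.
by apply: eq_bigr => k _; rewrite mulr_suml; apply: eq_bigr => a _; rewrite fE.
Qed.

(** Constant term 1 is what makes the infinite products converge when the arguments tend to 0. *)
Lemma numerator0 c : c \is monic -> (numerator c)`_0 = 1.
Proof.
move=> cm; rewrite /numerator; case: eqP => [_|/eqP c1]; first by rewrite coef1.
rewrite coef_poly; have [p ip /(dvdp_leq (monic_neq0 cm))] := irr_factor cm c1.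
have := irr_size ip; case: (size c) => [|[|d]] //= h1 h2; [by have := leq_trans h1 h2|by have := leq_trans h1 h2|]. rewrite (big_pred1 (0 : {poly_0 F})) /=.
  by rewrite expr0 addr0 /chi residue_symbol1.
move=> a; rewrite /= -val_eqE /=; apply/esym/eqP.
by apply/eqP; rewrite -size_poly_leq0 size_npoly.
Qed.

Lemma denominator0 c : (denominator c)`_0 = 1.
Proof.
by rewrite /denominator; case: ifP => _; rewrite ?coef1 // coefB coefZ coefX coef1 mulr0 subr0.
Qed.

Lemma holomorphic_horner (V : normedModType C) (p : {poly C}) (f : V -> C) v :
  holomorphic_at f v -> holomorphic_at (fun w => p.[f w]) v.
Proof.
move=> hf; elim/poly_ind: p => [|p k IH].
  by under eq_fun do rewrite horner0; exact: holomorphic_cst.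
have -> : (fun w => (p * 'X + k%:P).[f w]) = (fun w => p.[f w] * f w - (fun=> - k) w).
  by apply/funext => w; rewrite hornerMXaddC opprK.
apply: holomorphicB; last exact: holomorphic_cst.
exact: holomorphicM.
Qed.

Lemma holomorphic_Y (s : C) : holomorphic_at Y s.
Proof. by apply: filterE => z; exact: differentiable_qpow. Qed.

(* Along a line, Y takes infinitely many values near every point. *)
Lemma horner_Y_germ (p : {poly C}) (w k t0 : C) : p != 0 -> k != 0 ->
  nonzero_germ (fun t : C => p.[Y (w + k * t)]) t0.
Proof.
move=> p0 k0 /nearCP[r r0 h].
have l0 := lnq0 (q_gt1 R F).
pose d (n : nat) : R := r * nrm k / 2 / n.+1%:R.
have d0 n : 0 < d n by rewrite !divr_gt0 ?mulr_gt0 ?nrm_gt0.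
pose x n := Y (w + k * t0) * Y (rC (d n)).
have xroot n : root p (x n).
  apply/rootP; rewrite /x -qpowD -addrA.
  have -> : k * t0 + rC (d n) = k * (t0 + rC (d n) / k) by field.
  apply: h; rewrite addrAC subrr add0r nrmM nrmV nrm_pos ?ltW //.
  rewrite ltr_pdivrMr ?nrm_gt0 // /d -mulrA -[X in _ < X]mulr1 ltr_pM2l ?mulr_gt0 ?nrm_gt0 //.
  rewrite -invfM invf_lt1 ?ltr0n // -natrM ltr1n; lia.
have xinj : injective x.
  move=> n n' /(mulfI (qpow_neq0 _ _)) /(congr1 (@nrm R)); rewrite !nrm_qpow => /expR_inj.
  move=> /(mulIf (lt0r_neq0 l0)) /oppr_inj; rewrite /d /=.
  have c0 : r * nrm k / 2 != 0 by rewrite gt_eqF // !divr_gt0 ?mulr_gt0 ?nrm_gt0.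
  by move=> /(mulfI c0) /invr_inj /eqP; rewrite eqr_nat => /eqP [].
have : (size [seq x n | n <- iota 0 (size p)] < size p)%N.
  apply: max_poly_roots p0 _ _; first by apply/allP => _ /mapP[n _ ->].
  by rewrite map_inj_uniq ?iota_uniq.
by rewrite size_map size_iota ltnn.
Qed.

Lemma denominator_neq0 c : denominator c != 0.
Proof. by apply/eqP => d0; have := denominator0 c; rewrite d0 coef0 => /eqP; rewrite eq_sym oner_eq0. Qed.

Lemma horner_germ (p : {poly C}) (s : C) : p != 0 -> nonzero_germ (fun t : C => p.[Y t]) s.
Proof.
move=> p0; have := @horner_Y_germ p 0 1 s p0 (oner_neq0 _).
by under eq_fun do rewrite add0r mul1r.
Qed.

Lemma holomorphic_pY (p : {poly C}) (s : C) : holomorphic_at (fun t : C => p.[Y t]) s.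
Proof. exact/holomorphic_horner/holomorphic_Y. Qed.

Lemma meromorphic_Lfun c : meromorphic_on setT (Lfun c).
Proof.
move=> s _; split.
  exists (fun t => (numerator c).[Y t]), (fun t => (denominator c).[Y t]); split.
  - exact: holomorphic_pY.
  - exact: holomorphic_pY.
  - exact/horner_germ/denominator_neq0.
  - exact: filterE.
move=> [g [h [hg hh nh fg]]].
have [d0|d0] := eqVneq (denominator c).[Y s] 0; last first.
  by apply: holomorphicM; [exact: holomorphic_pY|apply: holomorphicV => //; exact: holomorphic_pY].
have c1 : c = 1.
  by apply/eqP; move: d0; rewrite /denominator; case: ifP => // _ /eqP; rewrite hornerC oner_eq0.
(* A holomorphic extension g across a zero of the denominator would satisfy this, which is absurd at
   s. *)
have : \forall z \near s, g z * (denominator c).[Y z] = 1.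
  apply: (@eq_off_zeros _ _ _ _ (fun z => h z * (denominator c).[Y z])).
  - by apply: holomorphicM => //; exact: holomorphic_pY.
  - exact: holomorphic_cst.
  - by apply: holomorphicM => //; exact: holomorphic_pY.
  - by apply: nonzero_germM => //; [exact: holomorphic_pY|exact/horner_germ/denominator_neq0].
  apply: filterS fg => z fz; rewrite mulf_eq0 negb_or => /andP[/fz <- dz].
  by rewrite /Lfun /numerator c1 eqxx hornerC mul1r mulVf // -c1.
by move=> /nbhs_singleton; rewrite d0 mulr0 => /eqP; rewrite eq_sym oner_eq0.
Qed.

Lemma denominator_Re c (s : C) : 1 < complex.Re s -> (denominator c).[Y s] != 0.
Proof.
move=> s1; rewrite /denominator; case: ifP => _; last by rewrite hornerC oner_neq0.
rewrite !hornerE -nrm_gt0; have := nrm_subl 1 (rC q * Y s).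
by rewrite nrm1 nrmM nrm_pos ?ler0n //; have := qY_lt1 s1; lra.
Qed.

(** [Lfun] shows that the choice by [xget] has a candidate; any candidate agrees with it near s = 2,
    hence wherever the denominator is nonzero. *)
Lemma LquadraticE c (s : C) : c \is monic -> squarefree_poly c -> (denominator c).[Y s] != 0 ->
  Lquadratic (R := R) c s = Lfun c s.
Proof.
move=> cm csq; move: s.
have [mL hL] : is_Lquadratic c (Lquadratic (R := R) c).
  by apply: xgetPex; exists (Lfun c); split; [exact: meromorphic_Lfun|move=> s; exact: L_has_sum].
apply: (meromorphic_identity (s0 := 2) mL (holomorphic_pY _) (holomorphic_pY _)).
apply/nearCP; exists 1 => // z z2.
have z1 : 1 < complex.Re z.
  have := nrm_Re (z - 2); rewrite cReD cReN Re_nat => h.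
  have := le_lt_trans h z2; rewrite ltr_norml => /andP[]; lra.
rewrite (has_sum_unique (hL _ z1) (L_has_sum cm csq z1)) /Lfun mulfVK //.
exact: denominator_Re.
Qed.

End LSeries.

(** * Holomorphic infinite products *)

Section Jets.
Variable R : realType.
Local Notation C := (Cplx R).
Local Notation V := (C * C)%type.
Implicit Types (f g P Q : V -> C) (U : set V).

Lemma differentiable_fst (p : V) : differentiable (fun z : V => z.1) p.
Proof.
have := @linear_differentiable C V C fst; apply => x; exact: cvg_fst.
Qed.

Lemma differentiable_snd (p : V) : differentiable (fun z : V => z.2) p.
Proof.
have := @linear_differentiable C V C snd; apply => x; exact: cvg_snd.
Qed.

Definition dist (s t : V) : R := nrm (t.1 - s.1) + nrm (t.2 - s.2).

Lemma dist_ge0 s t : 0 <= dist s t.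
Proof. by rewrite addr_ge0 ?nrm_ge0. Qed.

Lemma quadratic_differentiable f (P Q : C) p r K : 0 < r -> 0 <= K ->
  (forall t : V, nrm (t.1 - p.1) < r -> nrm (t.2 - p.2) < r ->
     nrm (f t - f p - (P * (t.1 - p.1) + Q * (t.2 - p.2))) <= K * dist p t ^+ 2) ->
  differentiable f p.
Proof.
move=> r0 K0 h.
pose l (t : V) := f p + (P * (t.1 - p.1) + Q * (t.2 - p.2)).
have dl : differentiable l p.
  apply: differentiableD; first exact: differentiable_cst.
  apply: differentiableD.
    apply: differentiableM; first exact: differentiable_cst.
    by apply: differentiableB; [exact: differentiable_fst|exact: differentiable_cst].
  apply: differentiableM; first exact: differentiable_cst.
  by apply: differentiableB; [exact: differentiable_snd|exact: differentiable_cst].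
have -> : f = (fun t => f t - l t) + l by apply/funext => t; rewrite fctE subrK.
apply: differentiableD => //; apply: differentiable_small => e e0.
pose d := Num.min r (e / (4 * K + 1)).
have K1 : 0 < 4 * K + 1 by rewrite ltr_wpDl // mulr_ge0.
apply/nearC2P; exists d; first by rewrite lt_min r0 divr_gt0.
move=> t; rewrite !lt_min => /andP[t1 e1] /andP[t2 e2].
have := h t t1 t2; rewrite -addrA -opprD -/(l t) => ht.
rewrite prod_normE /= !nrmE; set a := nrm (t.1 - p.1) in t1 e1 ht *.
set b := nrm (t.2 - p.2) in t2 e2 ht *.
have -> : Num.max (rC a) (rC b) = rC (Num.max a b).
  by rewrite !maxEle rC_le; case: ifP.
rewrite -rCM rC_le; apply: le_trans ht _.
rewrite /dist -/a -/b.
have a0 : 0 <= a by exact: nrm_ge0.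
have b0 : 0 <= b by exact: nrm_ge0.
have [m [m0 am bm mE me]] : exists m, [/\ 0 <= m, a <= m, b <= m, Num.max a b = m & m < e / (4 * K + 1)].
  by exists (Num.max a b); split; rewrite ?le_max ?a0 ?lexx ?orbT // gt_max e1.
rewrite mE; rewrite ltr_pdivlMr // in me.
have : (a + b) ^+ 2 <= 4 * m ^+ 2 by nra.
move=> h1; apply: le_trans (ler_wpM2l K0 h1) _; nra.
Qed.

(** P and Q are candidate partial derivatives. Every clause is a non-strict inequality between
    values at one or two points of U, so it passes to pointwise limits. *)
Definition jet U f P Q A B K := forall s t, U s -> U t ->
  [/\ nrm (f s) <= A, nrm (P s) <= B /\ nrm (Q s) <= B,
      nrm (f t - f s) <= B * dist s t &
      nrm (f t - f s - (P s * (t.1 - s.1) + Q s * (t.2 - s.2))) <= K * dist s t ^+ 2].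

Variables (U : set V) (tau : R).
Hypothesis (tau0 : 0 < tau).

(* The weights (1, tau, tau^2) make this norm submultiplicative. *)
Definition jet_norm f P Q N := exists A B K, [/\ 0 <= A, 0 <= B, 0 <= K,
  A + B * tau + K * tau ^+ 2 <= N & jet U f P Q A B K].

Lemma jet_norm_ge0 f P Q N : jet_norm f P Q N -> 0 <= N.
Proof.
move=> [A [B [K [A0 B0 K0 + _]]]]; apply: le_trans.
by rewrite !addr_ge0 // mulr_ge0 // ?exprn_ge0 // ltW.
Qed.

Lemma jet_norm_le f P Q N N' : N <= N' -> jet_norm f P Q N -> jet_norm f P Q N'.
Proof. by move=> NN [A [B [K [A0 B0 K0 h j]]]]; exists A, B, K; split=> //; exact: le_trans NN. Qed.

Lemma jet_norm_eq f P Q f' P' Q' N : f =1 f' -> P =1 P' -> Q =1 Q' ->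
  jet_norm f P Q N -> jet_norm f' P' Q' N.
Proof. by move=> /funext -> /funext -> /funext ->. Qed.

Lemma jet_cst k : jet_norm (fun=> k) (fun=> 0) (fun=> 0) (nrm k).
Proof.
exists (nrm k), 0, 0; rewrite !mul0r !addr0; split=> //; rewrite ?nrm_ge0 //.
by move=> s t _ _; rewrite subrr !mul0r addr0 subr0 nrm0; split.
Qed.

Lemma jet_add f P Q N f' P' Q' N' : jet_norm f P Q N -> jet_norm f' P' Q' N' ->
  jet_norm (fun s => f s + f' s) (fun s => P s + P' s) (fun s => Q s + Q' s) (N + N').
Proof.
move=> [A [B [K [A0 B0 K0 h j]]]] [A' [B' [K' [A'0 B'0 K'0 h' j']]]].
exists (A + A'), (B + B'), (K + K'); split; rewrite ?addr_ge0 //.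
  by rewrite !mulrDl; lra.
move=> s t Us Ut; have [j1 [j2 j3] j4 j5] := j s t Us Ut; have [i1 [i2 i3] i4 i5] := j' s t Us Ut.
split; [|split| |].
- exact: le_trans (nrmD _ _) (lerD j1 i1).
- exact: le_trans (nrmD _ _) (lerD j2 i2).
- exact: le_trans (nrmD _ _) (lerD j3 i3).
- by rewrite opprD addrACA mulrDl; exact: le_trans (nrmD _ _) (lerD j4 i4).
rewrite [leRHS]mulrDl; apply: le_trans (lerD j5 i5).
rewrite [X in nrm X](_ : _ = (f t - f s - (P s * (t.1 - s.1) + Q s * (t.2 - s.2))) +
  (f' t - f' s - (P' s * (t.1 - s.1) + Q' s * (t.2 - s.2)))); [exact: nrmD|ring].
Qed.

Lemma jet_mul f P Q N f' P' Q' N' : jet_norm f P Q N -> jet_norm f' P' Q' N' ->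
  jet_norm (fun s => f s * f' s) (fun s => f s * P' s + P s * f' s)
    (fun s => f s * Q' s + Q s * f' s) (N * N').
Proof.
move=> [A [B [K [A0 B0 K0 h j]]]] [A' [B' [K' [A'0 B'0 K'0 h' j']]]].
exists (A * A'), (A * B' + B * A'), (A * K' + B * B' + K * A').
have t0 := ltW tau0.
split; rewrite ?addr_ge0 ?mulr_ge0 //.
  apply: le_trans (ler_pM _ _ h h'); rewrite ?addr_ge0 ?mulr_ge0 ?exprn_ge0 //.
  rewrite -subr_ge0.
  (* The product of the norms exceeds the norm of the product by its terms of order 3 and 4 in tau,
     which are nonnegative. *)
  have -> : (A + B * tau + K * tau ^+ 2) * (A' + B' * tau + K' * tau ^+ 2) -
    (A * A' + (A * B' + B * A') * tau + (A * K' + B * B' + K * A') * tau ^+ 2) =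
    (B * K' + K * B') * tau ^+ 3 + K * K' * tau ^+ 4 by ring.
  by rewrite ?addr_ge0 ?mulr_ge0 ?exprn_ge0 // addr_ge0 ?mulr_ge0.
move=> s t Us Ut; have [j1 [j2 j3] j4 j5] := j s t Us Ut; have [i1 [i2 i3] i4 i5] := j' s t Us Ut.
have [jt _ _ _] := j t t Ut Ut.
have mul (x y : C) a b : nrm x <= a -> nrm y <= b -> nrm (x * y) <= a * b.
  by move=> xa yb; rewrite nrmM ler_pM ?nrm_ge0.
split; [exact: mul|split| |].
- by apply: le_trans (nrmD _ _) (lerD _ _); exact: mul.
- by apply: le_trans (nrmD _ _) (lerD _ _); exact: mul.
- have -> : f t * f' t - f s * f' s = f t * (f' t - f' s) + (f t - f s) * f' s by ring.
  rewrite [leRHS]mulrDl; apply: le_trans (nrmD _ _) (lerD _ _).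
    by rewrite -mulrA; exact: mul.
  by rewrite mulrAC; exact: mul.
set x := t.1 - s.1; set y := t.2 - s.2.
have lin : nrm (P' s * x + Q' s * y) <= B' * dist s t.
  by rewrite /dist -/x -/y [leRHS]mulrDr; apply: le_trans (nrmD _ _) (lerD _ _); exact: mul.
have -> : f t * f' t - f s * f' s - ((f s * P' s + P s * f' s) * x + (f s * Q' s + Q s * f' s) * y) =
   f t * (f' t - f' s - (P' s * x + Q' s * y)) + (f t - f s) * (P' s * x + Q' s * y) +
   (f t - f s - (P s * x + Q s * y)) * f' s by ring.
rewrite [leRHS]mulrDl; apply: le_trans (nrmD _ _) (lerD _ _).
  rewrite [leRHS]mulrDl; apply: le_trans (nrmD _ _) (lerD _ _); first by rewrite -mulrA; exact: mul.
  by rewrite expr2 mulrACA; exact: mul.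
by rewrite mulrAC; exact: mul.
Qed.

Fixpoint abs_horner (p : seq C) (N : R) : R :=
  if p is c :: p' then abs_horner p' N * N + nrm c else 0.

Lemma abs_horner_ge0 p N : 0 <= N -> 0 <= abs_horner p N.
Proof. by move=> N0; elim: p => //= c p IH; rewrite addr_ge0 ?mulr_ge0 ?nrm_ge0. Qed.

Lemma abs_horner_le p N N' : 0 <= N -> N <= N' -> abs_horner p N <= abs_horner p N'.
Proof.
move=> N0 NN; elim: p => //= c p IH; rewrite lerD2r.
by rewrite ler_pM // abs_horner_ge0.
Qed.

Lemma jet_horner (p : seq C) f P Q N : jet_norm f P Q N ->
  exists P' Q', jet_norm (fun s => horner_rec p (f s)) P' Q' (abs_horner p N).
Proof.
move=> jf; elim: p => [|c p [P' [Q' IH]]] /=.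
  by exists (fun=> 0), (fun=> 0); have := jet_cst 0; rewrite nrm0.
by eexists; eexists; exact: (jet_add (jet_mul IH jf) (jet_cst c)).
Qed.

Section InfiniteProduct.
Variables (a Pa Qa : nat -> V -> C) (eps : nat -> R) (M : R).
Hypothesis ja : forall k, jet_norm (a k) (Pa k) (Qa k) (eps k).
Hypothesis epsM : forall n, \sum_(k < n) eps k <= M.

Definition partial_prod n s : C := \prod_(k < n) (1 + a k s).

Fixpoint partial_deriv (D : nat -> V -> C) n s : C :=
  if n is m.+1 then partial_prod m s * D m s + partial_deriv D m s * (1 + a m s) else 0.

Lemma partial_deriv_step D k s : partial_deriv D k.+1 s - partial_deriv D k s =
  partial_prod k s * D k s + partial_deriv D k s * a k s.
Proof. by rewrite /=; ring. Qed.

(** Submultiplicativity of the norm together with 1 + eps <= exp eps. *)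
Lemma partial_jet n : jet_norm (partial_prod n) (partial_deriv Pa n) (partial_deriv Qa n)
  (expR (\sum_(k < n) eps k)).
Proof.
elim: n => [|n IH].
  rewrite big_ord0 expR0; have := jet_cst 1; rewrite nrm1; apply: jet_norm_eq => // s.
  by rewrite /partial_prod big_ord0.
have j1 := jet_mul IH (jet_add (jet_cst 1) (ja n)); rewrite nrm1 in j1.
apply: (@jet_norm_le _ _ _ (expR (\sum_(k < n) eps k) * (1 + eps n))).
  by rewrite big_ord_recr /= expRD ler_wpM2l ?expR_ge0 // expR_ge1Dx.
apply: jet_norm_eq j1 => s /=; rewrite ?add0r //.
by rewrite /partial_prod big_ord_recr.
Qed.

Lemma eps_ge0 k : 0 <= eps k. Proof. exact: jet_norm_ge0 (ja k). Qed.

Lemma jet_deriv_le f P Q N s : jet_norm f P Q N -> U s -> nrm (P s) <= N / tau /\ nrm (Q s) <= N / tau.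
Proof.
move=> [A [B [K [A0 B0 K0 h j]]]] Us; have [_ [h1 h2] _ _] := j s s Us Us.
have BN : B <= N / tau.
  rewrite ler_pdivlMr //; apply: le_trans h.
  have : 0 <= K * tau ^+ 2 by rewrite mulr_ge0 ?exprn_ge0 // ltW.
  by move: (K * _) (B * tau) => x y; lra.
by split; [exact: le_trans BN|exact: le_trans BN].
Qed.

Lemma telescope_cvg (u : nat -> C) (L : R) : (forall n, \sum_(k < n) nrm (u k.+1 - u k) <= L) ->
  exists l : C, u @ \oo --> l.
Proof.
move=> uL; have [l hl] := abs_has_sum (sum_fset_nat_le (fun k => nrm_ge0 (u k.+1 - u k)) uL).
exists (u 0%N + l); have := cvgnD (@cvgn_cst R (u 0%N)) (has_sum_nat hl).
apply: cvg_trans; apply: near_eq_cvg; apply: filterE => n.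
rewrite -(big_mkord predT (fun k => u k.+1 - u k)) telescope_sumr // addrC subrK //.
Qed.

(** The increment of a formal derivative is the derivative of [partial_prod k] times [a k], hence at
    most exp M / tau * eps k, which is summable. *)
Lemma partial_cvg s : U s -> [/\ exists l : C, (fun n => partial_prod n s) @ \oo --> l,
  exists l : C, (fun n => partial_deriv Pa n s) @ \oo --> l &
  exists l : C, (fun n => partial_deriv Qa n s) @ \oo --> l].
Proof.
move=> Us; split.
- apply: (@infprod_cvg R (fun k => a k s) M) => n; apply: le_trans (epsM n); apply: ler_sum => k _.
  have [A [B [K [A0 B0 K0 h j]]]] := ja k; have [h1 _ _ _] := j s s Us Us.
  apply: le_trans h1 (le_trans _ h).
  by rewrite -addrA lerDl addr_ge0 // mulr_ge0 // ?exprn_ge0 // ltW.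
all: apply: (@telescope_cvg _ (expR M / tau * M)) => n;
  apply: le_trans (_ : \sum_(k < n) expR M / tau * eps k <= _);
  last by rewrite -mulr_sumr ler_wpM2l // divr_ge0 ?expR_ge0 // ltW.
all: apply: ler_sum => k _; have [] := jet_deriv_le (jet_mul (partial_jet k) (ja k)) Us => h1 h2;
  rewrite partial_deriv_step.
1: apply: le_trans h1 _.
2: apply: le_trans h2 _.
all: rewrite mulrAC ler_wpM2r ?eps_ge0 // ler_wpM2r ?invr_ge0 ?(ltW tau0) //.
all: by rewrite ler_expR.
Qed.

(** The quadratic estimate holds for all partial products with one constant, and their derivatives
    converge, so it holds in the limit; the limit is thus differentiable without any differentiation
    of a limit. *)
Lemma infprod_quadratic : exists f : V -> C,
  (forall s, U s -> (fun n => \prod_(k < n) (1 + a k s)) @ \oo --> f s) /\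
  forall s, U s -> exists P Q : C, forall t, U t ->
    nrm (f t - f s - (P * (t.1 - s.1) + Q * (t.2 - s.2))) <= expR M / tau ^+ 2 * dist s t ^+ 2.
Proof.
pose f s : C := limn (fun n => partial_prod n s).
have fl s : U s -> (fun n => partial_prod n s) @ \oo --> f s.
  by move=> /partial_cvg[[l hl] _ _]; rewrite /f (cvg_lim _ hl).
exists f; split=> // s Us; have [_ [P hP] [Q hQ]] := partial_cvg Us.
exists P, Q => t Ut.
have := cvgnB (cvgnB (fl t Ut) (fl s Us))
  (cvgnD (cvgnM hP (@cvgn_cst R (t.1 - s.1))) (cvgnM hQ (@cvgn_cst R (t.2 - s.2)))).
move=> /cvg_nrm_le; apply=> n.
have [A [B [K [A0 B0 K0 h j]]]] := partial_jet n; have [_ _ _ hn] := j s t Us Ut.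
apply: le_trans hn _; rewrite ler_wpM2r ?exprn_ge0 ?dist_ge0 //.
rewrite ler_pdivlMr ?exprn_gt0 //; apply: le_trans (_ : expR (\sum_(k < n) eps k) <= _).
  apply: le_trans h; rewrite lerDr addr_ge0 // mulr_ge0 // ltW //.
by rewrite ler_expR.
Qed.

End InfiniteProduct.
End Jets.

(** * Products of polynomials at geometrically decaying arguments *)

Section ProductFamily.
Variable R : realType.
Local Notation C := (Cplx R).
Local Notation V := (C * C)%type.
Variables (kappa : C) (L : seq {poly C}).
Hypothesis L0 : forall p, p \in L -> p`_0 = 1.
Implicit Types (Q : bool * nat -> {poly C}) (s : V).

Definition argument (j : bool * nat) s : C := kappa * coord01 j.1 s * (s.1 * s.2) ^+ j.2.

Definition euler_factor Q k s : C :=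
  (Q (false, k)).[argument (false, k) s] * (Q (true, k)).[argument (true, k) s].

Definition Phi Q s : C := limn (fun n => \prod_(k < n) euler_factor Q k s : C).

Lemma horner_behead (p : {poly C}) z : p \in L -> p.[z] = 1 + z * horner_rec (behead p) z.
Proof.
move=> /L0; rewrite /horner; case: (polyseq p) => [|a l] /= a1.
  by move/eqP: a1; rewrite eq_sym oner_eq0.
by rewrite a1 addrC mulrC.
Qed.

Lemma choose_radius (x y : R) : 0 <= x -> 0 <= y -> x * y < 1 ->
  exists2 t, 0 < t & (x + t + t) * (y + t + t) < 1.
Proof.
move=> x0 y0 xy; pose d := (1 - x * y) / (4 * (x + y + 2)).
have s0 : 0 < 4 * (x + y + 2) by rewrite mulr_gt0 // ltr_wpDl // addr_ge0.
have d0 : 0 < d by rewrite divr_gt0 // subr_gt0.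
exists (Num.min 1 d); first by rewrite lt_min ltr01.
have [t [[t0 t1 td] ->]] : exists t, [/\ 0 < t, t <= 1 & t <= d] /\ Num.min 1 d = t.
  by exists (Num.min 1 d); split=> //; rewrite lt_min ltr01 d0 !ge_min !lexx orbT.
move: td; rewrite ler_pdivlMr // => td; nra.
Qed.

(** Near p the argument of the factor (i, k) decays like th^k in jet norm with th < 1, so the
    factors differ from 1 by a geometric series of jets, uniformly on a neighbourhood. *)
Lemma family_local Q (p : V) : (forall j, Q j \in L) -> nrm (p.1 * p.2) < 1 ->
  exists r K M, [/\ 0 < r, 0 <= K,
   forall s : V, nrm (s.1 - p.1) < r -> nrm (s.2 - p.2) < r ->
     (fun n => \prod_(k < n) euler_factor Q k s) @ \oo --> Phi Q s /\
     forall n, \sum_(k < n) nrm (euler_factor Q k s - 1) <= M &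
   exists A B : C, forall t : V, nrm (t.1 - p.1) < r -> nrm (t.2 - p.2) < r ->
     nrm (Phi Q t - Phi Q p - (A * (t.1 - p.1) + B * (t.2 - p.2))) <= K * dist p t ^+ 2].
Proof.
(* Two copies of tau are added to each modulus: one for the size of the neighbourhood, one for the
   derivative 1 of a coordinate, which the jet norm weights by tau. *)
move=> QL; rewrite nrmM => pp; have [tau tau0 th1] := choose_radius (nrm_ge0 _) (nrm_ge0 _) pp.
pose U : set V := [set s | nrm (s.1 - p.1) < tau /\ nrm (s.2 - p.2) < tau].
set N1 := nrm p.1 + tau + tau in th1; set N2 := nrm p.2 + tau + tau in th1.
have N10 : 0 <= N1 by rewrite !addr_ge0 ?nrm_ge0 // ltW.
have N20 : 0 <= N2 by rewrite !addr_ge0 ?nrm_ge0 // ltW.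
pose th := N1 * N2; have th0 : 0 <= th by rewrite mulr_ge0.
have j1 : jet_norm U tau (fun s => s.1) (fun=> 1) (fun=> 0) N1.
  exists (nrm p.1 + tau), 1, 0; split; rewrite ?addr_ge0 ?nrm_ge0 ?mul1r ?mul0r ?addr0 ?(ltW tau0) //.
  move=> s t [s1 _] _; rewrite nrm0 nrm1 !mul1r !mul0r addr0 subrr nrm0; split=> //.
    by rewrite -[s.1](subrK p.1) addrC; apply: le_trans (nrmD _ _) _; rewrite lerD2l ltW.
  by rewrite /dist lerDl nrm_ge0.
have j2 : jet_norm U tau (fun s => s.2) (fun=> 0) (fun=> 1) N2.
  exists (nrm p.2 + tau), 1, 0; split; rewrite ?addr_ge0 ?nrm_ge0 ?mul1r ?mul0r ?addr0 ?(ltW tau0) //.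
  move=> s t [_ s1] _; rewrite nrm0 nrm1 !mul1r !mul0r add0r subrr nrm0; split=> //.
    by rewrite -[s.2](subrK p.2) addrC; apply: le_trans (nrmD _ _) _; rewrite lerD2l ltW.
  by rewrite /dist lerDr nrm_ge0.
have jX k : exists A B, jet_norm U tau (fun s => (s.1 * s.2) ^+ k) A B (th ^+ k).
  elim: k => [|k [A [B IH]]].
    by exists (fun=> 0), (fun=> 0); have := jet_cst U tau 1; rewrite nrm1.
  rewrite exprS; do 2 eexists.
  by apply: (jet_norm_eq _ _ _ (jet_mul tau0 (jet_mul tau0 j1 j2) IH)); [move=> s; rewrite exprS|..].
pose Mz := nrm kappa * (N1 + N2).
have Mz0 : 0 <= Mz by exact: (mulr_ge0 (nrm_ge0 _) (addr_ge0 N10 N20)).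
have jz j : exists A B, jet_norm U tau (argument j) A B (Mz * th ^+ j.2).
  case: j => b k; have [A [B jk]] := jX k.
  have [A' [B' jb]] : exists A' B', jet_norm U tau (coord01 b) A' B' (N1 + N2).
    by case: b; [exists (fun=> 0), (fun=> 1); apply: jet_norm_le j2; rewrite lerDr|
                 exists (fun=> 1), (fun=> 0); apply: jet_norm_le j1; rewrite lerDl].
  by eexists; eexists; exact: (jet_mul tau0 (jet_mul tau0 (jet_cst U tau kappa) jb) jk).
(* One constant serves all factors because L is finite: it bounds (Q_j(z) - 1)/z. *)
pose S := \sum_(q <- L) abs_horner (behead q) Mz.
have S0 : 0 <= S by apply: sumr_ge0 => q _; exact: abs_horner_ge0.
have thk k : 0 <= th ^+ k by rewrite exprn_ge0.
have thk1 k : th ^+ k <= 1 by rewrite exprn_ile1 // ltW.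
pose E := Mz * S; have E0 : 0 <= E by rewrite mulr_ge0.
have jq j : exists A B, jet_norm U tau (fun s => (Q j).[argument j s] - 1) A B (E * th ^+ j.2).
  have [A [B j0]] := jz j; have [A' [B' j0']] := jet_horner tau0 (behead (Q j)) j0.
  have := jet_mul tau0 j0 j0' => jm; do 2 eexists.
  apply: jet_norm_le (jet_norm_eq _ _ _ jm); [|by move=> s; rewrite horner_behead // addrC addKr|by []..].
  rewrite /E [leRHS]mulrAC; apply: (ler_wpM2l (mulr_ge0 Mz0 (thk _))).
  apply: le_trans (_ : abs_horner (behead (Q j)) Mz <= _).
    by apply: abs_horner_le; [exact: mulr_ge0 Mz0 (thk _)|exact: ler_piMr].
  rewrite /S (big_rem (Q j)) //= lerDl; apply: sumr_ge0 => q _; exact: abs_horner_ge0.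
have jf k : exists A B, jet_norm U tau (fun s => euler_factor Q k s - 1) A B ((E + E + E * E) * th ^+ k).
  have [A [B j0]] := jq (false, k); have [A' [B' j0']] := jq (true, k).
  do 2 eexists; apply: jet_norm_le (jet_norm_eq _ _ _ (jet_add (jet_add j0 j0') (jet_mul tau0 j0 j0'))); [|by move=> s; rewrite /euler_factor /=; ring|by []..].
  rewrite /= mulrACA [(E + E + _) * _]mulrDl [(E + E) * _]mulrDl lerD2l; apply: (ler_wpM2l (mulr_ge0 E0 E0)).
  exact: ler_piMr.
have [A hA] := choice jf; have [B hB] := choice hA.
pose eps k := (E + E + E * E) * th ^+ k.
pose M := (E + E + E * E) / (1 - th).
have eM n : \sum_(k < n) eps k <= M.
  rewrite -mulr_sumr /M; apply: (ler_wpM2l (addr_ge0 (addr_ge0 E0 E0) (mulr_ge0 E0 E0))).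
  rewrite -[leRHS]mul1r ler_pdivlMr ?subr_gt0 // mulrC.
  by rewrite -[1 - _]opprB mulNr -subrX1 opprB gerBl.
have [f [hf1 hf2]] := infprod_quadratic tau0 hB eM.
have fP s : U s -> (fun n => \prod_(k < n) euler_factor Q k s) @ \oo --> Phi Q s /\ f s = Phi Q s.
  move=> Us; have h : (fun n => \prod_(k < n) euler_factor Q k s) @ \oo --> f s.
    have := hf1 s Us; apply: cvg_trans; apply: near_eq_cvg; apply: filterE => n.
    by apply: eq_bigr => k _; rewrite addrC subrK.
  by have fE : Phi Q s = f s by [exact: cvg_lim h]; rewrite fE.
have Up : U p by split; rewrite subrr nrm0.
exists tau, (expR M / tau ^+ 2), M; split=> //; first by rewrite divr_ge0 ?expR_ge0 ?exprn_ge0 // ltW.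
  move=> s s1 s2; have Us : U s by split.
  split; first exact: (fP s Us).1.
  move=> n; apply: le_trans (eM n); apply: ler_sum => k _.
  have [A1 [B1 [K1 [A0 B0 K0 h j]]]] := hB k; have [h1 _ _ _] := j s s Us Us.
  apply: le_trans h1 (le_trans _ h).
  by rewrite -addrA lerDl addr_ge0 // mulr_ge0 // ?exprn_ge0 // ltW.
have [A1 [B1 h]] := hf2 p Up; exists A1, B1 => t t1 t2; have Ut : U t by split.
by rewrite -(fP t Ut).2 -(fP p Up).2; exact: h.
Qed.

Lemma Phi_cvg Q s : (forall j, Q j \in L) -> nrm (s.1 * s.2) < 1 ->
  (fun n => \prod_(k < n) euler_factor Q k s) @ \oo --> Phi Q s.
Proof.
move=> QL s1; have [r [K [M [r0 _ h _]]]] := family_local QL s1.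
by have [] := h s; rewrite ?subrr ?nrm0.
Qed.

Lemma Phi_differentiable Q s : (forall j, Q j \in L) -> nrm (s.1 * s.2) < 1 ->
  differentiable (Phi Q) s.
Proof.
move=> QL s1; have [r [K [M [r0 K0 _ [A [B h]]]]]] := family_local QL s1.
exact: quadratic_differentiable r0 K0 h.
Qed.

Lemma Phi_sum Q s : (forall j, Q j \in L) -> nrm (s.1 * s.2) < 1 ->
  exists M, forall n, \sum_(k < n) nrm (euler_factor Q k s - 1) <= M.
Proof.
move=> QL s1; have [r [K [M [r0 _ h _]]]] := family_local QL s1.
by exists M; have [] := h s; rewrite ?subrr ?nrm0.
Qed.

Lemma Phi_neq0 Q s : (forall j, Q j \in L) -> nrm (s.1 * s.2) < 1 ->
  (forall j, (Q j).[argument j s] != 0) -> Phi Q s != 0.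
Proof.
move=> QL s1 Q0; have [M hM] := Phi_sum QL s1.
apply: (@infprod_ne0 R (fun k => euler_factor Q k s - 1) M) => // [k|].
  by rewrite addrC subrK mulf_neq0.
have := Phi_cvg QL s1; apply: cvg_trans; apply: near_eq_cvg; apply: filterE => n.
by apply: eq_bigr => k _; rewrite addrC subrK.
Qed.

(** The terms [euler_factor Q k s - 1] are summable, so beyond some index they have modulus below 1
    and neither factor can vanish. *)
Lemma Phi_eventually Q s : (forall j, Q j \in L) -> nrm (s.1 * s.2) < 1 ->
  exists N, forall j, (N <= j.2)%N -> (Q j).[argument j s] != 0.
Proof.
move=> QL s1; have [M hM] := Phi_sum QL s1.
have g0 k : 0 <= nrm (euler_factor Q k s - 1) by exact: nrm_ge0.
have [A hA] := nonneg_tail g0 (sum_fset_nat_le g0 hM) (@ltr01 R).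
have [N hN] := fset_iotaP A; exists N => -[b k] /= Nk.
have kA : k \notin A.
  apply/negP => /(fsubsetP (hN _ (leqnn N))); rewrite in_fset mem_iota add0n => /andP[_].
  by rewrite ltnNge Nk.
have := hA [fset k]%fset; rewrite big_seq_fset1 => h.
have : nrm (euler_factor Q k s - 1) < 1.
  by apply: h; apply/fdisjointP => i iA; rewrite inE; apply: contraNneq kA => <-.
apply: contraTneq => b0; rewrite /euler_factor.
by case: b b0 => ->; rewrite ?mul0r ?mulr0 sub0r nrmN nrm1 ltxx.
Qed.

Lemma PhiM Q Q1 Q2 s : (forall j, Q1 j \in L) -> (forall j, Q2 j \in L) ->
  nrm (s.1 * s.2) < 1 -> (forall j, Q j = Q1 j * Q2 j) -> Phi Q s = Phi Q1 s * Phi Q2 s.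
Proof.
move=> QL1 QL2 s1 QE; have := cvgnM (Phi_cvg QL1 s1) (Phi_cvg QL2 s1) => h.
apply: cvg_lim => //; apply: cvg_trans h; apply: near_eq_cvg; apply: filterE => n.
rewrite -big_split; apply: eq_bigr => k _.
by rewrite /euler_factor !QE !hornerM mulrACA.
Qed.

Lemma Phi_finite Q n s : (forall j, (n <= j.2)%N -> Q j = 1) ->
  Phi Q s = \prod_(k < n) euler_factor Q k s.
Proof.
move=> Q1; apply: cvg_lim => //; apply/cvgnP => e e0; exists n => m nm.
rewrite (ord_split _ (fun k => euler_factor Q k s) nm) big_nat_cond big1 /=; first by rewrite mulr1 subrr nrm0.
by move=> k /andP[/andP[nk _] _]; rewrite /euler_factor !Q1 // !hornerC mulr1.
Qed.

End ProductFamily.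

(** * The meromorphic continuation *)

Section Continuation.
Variables (R : realType) (F : finFieldType).
Local Notation C := (Cplx R).
Local Notation V := (C * C)%type.
Local Notation q := (#|F|%:R : R).
Local Notation Y := (@qpow R q).
Hypothesis hq : (#|F| = 1 %[mod 4])%N.
Variables c0 c1 : {poly F}.
Hypotheses (c0_monic : c0 \is monic) (c1_monic : c1 \is monic).
Hypotheses (c0_sqfree : squarefree_poly c0) (c1_sqfree : squarefree_poly c1).
Implicit Types (s p v : V) (j : bool * nat) (S : pred (bool * nat)) (Q : bool * nat -> {poly C}).

Definition factor_poly j : {poly F} := if j.1 (+) odd j.2 then c1 else c0.

Definition polys : seq {poly C} :=
  [:: 1; numerator R c0; numerator R c1; denominator R c0; denominator R c1].

Lemma polys0 (f : {poly C}) : f \in polys -> f`_0 = 1.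
Proof.
rewrite /polys !inE => /or4P[/eqP ->|/eqP ->|/eqP ->|/orP[/eqP ->|/eqP ->]];
  by rewrite ?coef1 ?numerator0 ?denominator0.
Qed.

(** Factors outside S become 1, so that subproducts are again infinite products over the same finite
    list of polynomials. *)
Definition mask S Q j := if S j then Q j else 1.
Definition num j := numerator R (factor_poly j).
Definition den j := denominator R (factor_poly j).

Lemma mask_num S j : mask S num j \in polys.
Proof.
rewrite /mask /num /factor_poly; case: (S j); last by rewrite /polys in_cons eqxx.
by case: (_ (+) _); rewrite /polys !in_cons eqxx ?orbT.
Qed.
Lemma mask_den S j : mask S den j \in polys.
Proof.
rewrite /mask /den /factor_poly; case: (S j); last by rewrite /polys in_cons eqxx.
by case: (_ (+) _); rewrite /polys !in_cons eqxx ?orbT.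
Qed.

Definition coords s : V := (Y s.1, Y s.2).
Definition domain : set V := [set s | 0 < complex.Re (delta01 s)].
Definition shift_arg j s : C := 2^-1 + coord01 j.1 s + j.2%:R * delta01 s.

Lemma argumentE j s : argument (Y 2^-1) j (coords s) = Y (shift_arg j s).
Proof.
by rewrite /argument /shift_arg !qpowD qpowMn /delta01 qpowD; case: j => -[] k.
Qed.

Lemma domain_lt1 s : domain s -> nrm ((coords s).1 * (coords s).2) < 1.
Proof.
rewrite /domain /= -qpowD nrm_qpow -[X in _ -> _ < X]expR0 ltr_expR => h.
by rewrite mulNr oppr_lt0; exact: mulr_gt0 h (lnq0 (q_gt1 R F)).
Qed.

Lemma domain_near p : domain p -> \forall s \near p, domain s.
Proof.
rewrite /domain /= /delta01 cReD => p0; apply/nearC2P.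
exists ((complex.Re p.1 + complex.Re p.2) / 2); first by rewrite divr_gt0.
move=> s s1 s2; have h1 := le_lt_trans (nrm_Re _) s1; have h2 := le_lt_trans (nrm_Re _) s2.
rewrite /= cReD; move: h1 h2 p0; rewrite !cReD !cReN !ltr_norml => /andP[h1 _] /andP[h2 _].
move: (complex.Re s.1) (complex.Re s.2) (complex.Re p.1) (complex.Re p.2) h1 h2 => a b c d.
lra.
Qed.

Lemma differentiable_coords s : differentiable coords s.
Proof.
apply: differentiable_pair.
  by apply: (@differentiable_comp _ _ _ _ fst Y); [exact: differentiable_fst|exact: differentiable_qpow].
by apply: (@differentiable_comp _ _ _ _ snd Y); [exact: differentiable_snd|exact: differentiable_qpow].
Qed.

Definition PhiS Q s := Phi (Y 2^-1) Q (coords s).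

Lemma holomorphic_PhiS Q p : (forall j, Q j \in polys) -> domain p -> holomorphic_at (PhiS Q) p.
Proof.
move=> QL /domain_near; apply: filterS => s ds.
apply: (@differentiable_comp _ _ _ _ coords (Phi (Y 2^-1) Q)); first exact: differentiable_coords.
exact: (Phi_differentiable (Y 2^-1) polys0 QL (domain_lt1 ds)).
Qed.

Lemma PhiS_neq0 Q s : (forall j, Q j \in polys) -> domain s ->
  (forall j, (Q j).[Y (shift_arg j s)] != 0) -> PhiS Q s != 0.
Proof.
move=> QL ds Q0; apply: (Phi_neq0 polys0 QL (domain_lt1 ds)) => j.
by rewrite argumentE.
Qed.

Lemma euler_factorE Q k s : euler_factor (Y 2^-1) Q k (coords s) =
  (Q (false, k)).[Y (shift_arg (false, k) s)] * (Q (true, k)).[Y (shift_arg (true, k) s)].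
Proof. by rewrite /euler_factor !argumentE. Qed.

Lemma PhiS_eq0 Q s j : (forall j, Q j \in polys) -> domain s ->
  (Q j).[Y (shift_arg j s)] = 0 -> PhiS Q s = 0.
Proof.
move=> QL ds Q0; have h := Phi_cvg (kappa := Y 2^-1) polys0 QL (domain_lt1 ds).
apply: cvgn_unique h _; apply/cvgnP => e e0; exists j.2.+1 => n jn.
rewrite (bigD1 (Ordinal jn)) //= euler_factorE.
move: (\prod_(_ < _ | _) _) => P {jn}.
by case: j Q0 => -[] k /= ->; rewrite ?mul0r ?mulr0 ?mul0r subrr nrm0.
Qed.

Lemma maskM S Q j : mask predT Q j = mask S Q j * mask (predC S) Q j.
Proof. by rewrite /mask /=; case: (S j); rewrite ?mul1r ?mulr1. Qed.

Lemma PhiS_split S Q s : (forall S j, mask S Q j \in polys) -> domain s ->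
  PhiS (mask predT Q) s = PhiS (mask S Q) s * PhiS (mask (predC S) Q) s.
Proof.
move=> QL ds; apply: (PhiM (Y 2^-1) polys0 (QL S) (QL _) (domain_lt1 ds)) => j; exact: maskM.
Qed.

Lemma line_near p v (P : set V) : (\forall s \near p, P s) ->
  \forall t \near (0 : C), P (p.1 + v.1 * t, p.2 + v.2 * t).
Proof.
move=> /nearC2P[r r0 h]; pose m := nrm v.1 + nrm v.2 + 1.
have m0 : 0 < m by rewrite ltr_wpDl // addr_ge0 ?nrm_ge0.
apply/nearCP; exists (r / m); first by rewrite divr_gt0.
move=> t; rewrite subr0 ltr_pdivlMr // => tm.
have n1 := nrm_ge0 v.1; have n2 := nrm_ge0 v.2; have nt := nrm_ge0 t.
by apply: h; rewrite /= addrC addKr nrmM; apply: le_lt_trans tm; rewrite /m; nra.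
Qed.

Lemma shift_arg_line j p v t : shift_arg j (p.1 + v.1 * t, p.2 + v.2 * t) =
  shift_arg j p + (coord01 j.1 v + j.2%:R * delta01 v) * t.
Proof. by rewrite /shift_arg /delta01 /=; case: j => -[] k /=; ring. Qed.

(** Only the first N factors can vanish at p, and the rest of the product is nonzero near p. Along
    the line each of these factors is a nonzero germ, because its argument moves with nonzero slope
    unless its polynomial is 1. *)
Lemma PhiS_line_germ Q p v : (forall S j, mask S Q j \in polys) -> domain p ->
  (forall j, Q j != 1 -> coord01 j.1 v + j.2%:R * delta01 v != 0) ->
  nonzero_germ (fun t : C => PhiS (mask predT Q) (p.1 + v.1 * t, p.2 + v.2 * t)) 0.
Proof.
move=> QL dp vQ.
have [N hN] := Phi_eventually (Y 2^-1) polys0 (QL predT) (domain_lt1 dp).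
pose S j := (j.2 < N)%N.
have tail0 : PhiS (mask (predC S) Q) p != 0.
  apply: PhiS_neq0 => // j; rewrite /mask /= /S -leqNgt; case: ifP => [/hN|_].
    by rewrite argumentE.
  by rewrite hornerC oner_neq0.
have near0 := nonzero_near (holomorphic_cont (holomorphic_PhiS (QL (predC S)) dp)) tail0.
have fin s : PhiS (mask S Q) s = \prod_(k < N) ((Q (false, nat_of_ord k)).[Y (shift_arg (false, nat_of_ord k) s)] *
    (Q (true, nat_of_ord k)).[Y (shift_arg (true, nat_of_ord k) s)]).
  rewrite /PhiS (@Phi_finite _ _ _ N); last by move=> j; rewrite /mask /S ltnNge => ->.
  by apply: eq_bigr => k _; rewrite euler_factorE /mask /S /= ltn_ord.
pose fac j (t : C) := (Q j).[Y (shift_arg j p + (coord01 j.1 v + j.2%:R * delta01 v) * t)].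
have hfac j : holomorphic_at (fac j) 0.
  apply: holomorphic_horner; apply: filterE => t.
  apply: (@differentiable_comp _ _ _ _ (fun t => shift_arg j p + (coord01 j.1 v + j.2%:R * delta01 v) * t) Y).
    apply: differentiableD; first exact: differentiable_cst.
    by apply: differentiableM => //; exact: differentiable_cst.
  exact: differentiable_qpow.
have gfac j : nonzero_germ (fac j) 0.
  have [Q1|Q1] := eqVneq (Q j) 1.
    by apply: nonzero_germ_at; rewrite /fac Q1 hornerC oner_neq0.
  apply: (horner_Y_germ hq); last exact: vQ.
  apply/eqP => Q0; have := polys0 (QL predT j); rewrite /mask /= Q0 coef0 => /eqP.
  by rewrite eq_sym oner_eq0.
have gp : nonzero_germ (fun t => \prod_(k < N) (fac (false, nat_of_ord k) t * fac (true, nat_of_ord k) t)) 0.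
  apply: nonzero_germ_prod => k _; first exact: holomorphicM.
  exact: nonzero_germM.
move=> h; apply: gp.
apply: filterS3 h (line_near v near0) (line_near v (domain_near dp)) => t h1 h2 dt.
move: h1; rewrite (PhiS_split S QL dt) => /eqP; rewrite mulf_eq0 (negbTE h2) orbF fin => /eqP h1.
by rewrite -[RHS]h1; apply: eq_bigr => k _; rewrite !shift_arg_line.
Qed.

Definition Zcont s : C := PhiS (mask predT num) s / PhiS (mask predT den) s.

Lemma den_germ p : domain p -> nonzero_germ (PhiS (mask predT den)) p.
Proof.
(* Along (1, 1) the argument of the factor (i, k) has slope 2k + 1, which is never zero. *)
move=> dp h; apply: (@PhiS_line_germ den p (1, 1)) => //; first exact: mask_den.
  move=> [b k] _ /=; rewrite /delta01 /=.
  have -> : coord01 b (1, 1) + k%:R * (1 + 1) = (k * 2).+1%:R :> C.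
    by case: b; rewrite /= -natr1 natrM; ring.
  by rewrite pnatr_eq0.
exact: (line_near (1, 1) h).
Qed.

Lemma polar_equationE j s : polar_equation F j s = (1 - rC q *: 'X : {poly C}).[Y (shift_arg j s)].
Proof.
pose w : C := coord01 j.1 s + j.2%:R * delta01 s.
have sw : shift_arg j s = 2^-1 + w by rewrite /shift_arg -addrA.
rewrite /polar_equation sw -addrA -opprD -/w (cpow_half (q_gt1 R F)).
by move: (Y _) => y; rewrite !hornerE.
Qed.

Lemma den_eq0 j s : (den j).[Y (shift_arg j s)] = 0 -> factor_poly j = 1.
Proof. by rewrite /den /denominator; case: eqP => // _ /eqP; rewrite hornerC oner_eq0. Qed.

Lemma den_polar j s : factor_poly j = 1 -> (den j).[Y (shift_arg j s)] = polar_equation F j s.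
Proof. by move=> j1; rewrite polar_equationE /den /denominator j1 eqxx. Qed.

Lemma Zcont_holomorphic p : domain p -> PhiS (mask predT den) p != 0 -> holomorphic_at Zcont p.
Proof.
move=> dp h; apply: holomorphicM; first exact: (holomorphic_PhiS (mask_num _) dp).
by apply: holomorphicV => //; exact: (holomorphic_PhiS (mask_den _) dp).
Qed.

(* Restrict to the line P_j = 0 through p: the denominator vanishes on it, but
   the numerator is a product of nonzero germs. *)
Lemma Zcont_not_regular p : domain p -> PhiS (mask predT den) p = 0 -> ~ regular_at Zcont p.
Proof.
move=> dp d0 [g [h [hg hh nh fg]]].
have hD := holomorphic_PhiS (mask_den predT) dp.
have hN := holomorphic_PhiS (mask_num predT) dp.
have [j0 jz] : exists j, (den j).[Y (shift_arg j p)] = 0.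
  apply: contrapT => nj; move/eqP: d0; apply/negP; apply: PhiS_neq0 => //; first exact: mask_den.
  by move=> j; rewrite /mask /=; apply/eqP => jz; apply: nj; exists j.
have j1 := den_eq0 jz.
have gE : \forall z \near p, g z * PhiS (mask predT den) z = PhiS (mask predT num) z.
  apply: (@eq_off_zeros _ _ _ _ (fun z => h z * PhiS (mask predT den) z)).
  - exact: holomorphicM.
  - exact: hN.
  - exact: holomorphicM.
  - by apply: nonzero_germM => //; exact: den_germ.
  apply: filterS fg => z fz; rewrite mulf_eq0 negb_or => /andP[/fz <- dz].
  by rewrite /Zcont mulfVK.
(* With j0 = (i0, k0), this direction has delta = 1 and keeps the argument of the factor j0
   constant. The slope at (i, k) is k - k0 if i = i0 and k + k0 + 1 otherwise, nonzero unless j =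
   j0, whose numerator is 1. *)
pose v : V := if j0.1 then (j0.2.+1%:R, - j0.2%:R) else (- j0.2%:R, j0.2.+1%:R).
have dv : delta01 v = 1.
  by rewrite /v /delta01; case: j0.1; rewrite /= -natr1; ring.
have v0 : coord01 j0.1 v + j0.2%:R * delta01 v = 0.
  by rewrite dv /v; case: j0.1; rewrite /= mulr1 addNr.
apply: (@PhiS_line_germ num p v) => //; first exact: mask_num.
  move=> j nj; have jj : j != j0.
    by apply: contraNneq nj => ->; rewrite /num /numerator j1 eqxx.
  rewrite dv mulr1 /v; case: j0 j jj {jz j1 dv v0 v nj} => b0 k0 [b k] /=.
  have p0 n n' : (n.+1%:R + n'%:R : C) != 0 by rewrite -natrD addSn pnatr_eq0.
  have m0 n n' : n' != n -> (- n%:R + n'%:R : C) != 0.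
    by move=> nn; rewrite addrC subr_eq0 eqr_nat.
  case: b0; case: b => /= h0.
  - by apply: m0; apply: contraNneq h0 => ->.
  - exact: p0.
  - exact: p0.
  - by apply: m0; apply: contraNneq h0 => ->.
apply: filterS2 (line_near v gE) (line_near v (domain_near dp)) => t <- dt.
rewrite (@PhiS_eq0 (mask predT den) _ j0) ?mulr0 //; first exact: mask_den.
by rewrite /mask /= shift_arg_line v0 mul0r addr0.
Qed.

Lemma meromorphic_Zcont : meromorphic_on domain Zcont.
Proof.
move=> p dp; split.
  exists (PhiS (mask predT num)), (PhiS (mask predT den)); split.
  - exact: (holomorphic_PhiS (mask_num _) dp).
  - exact: (holomorphic_PhiS (mask_den _) dp).
  - exact: den_germ.
  - exact: filterE.
move=> rp; apply: Zcont_holomorphic => //; apply/eqP => d0.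
exact: Zcont_not_regular rp.
Qed.

Lemma holomorphic_den p : domain p -> holomorphic_at Zcont p ->
  forall j, (den j).[Y (shift_arg j p)] != 0.
Proof.
move=> dp hp j; apply/eqP => jz; apply: (@Zcont_not_regular p dp).
  by apply: (@PhiS_eq0 _ _ j) => //; exact: mask_den.
exists Zcont, (fun=> 1); split=> //; first exact: holomorphic_cst.
  by apply: nonzero_germ_at; exact: oner_neq0.
exact: filterE.
Qed.

Lemma Zcont_entire p : c0 <> 1 -> c1 <> 1 -> domain p -> holomorphic_at Zcont p.
Proof.
move=> /eqP c01 /eqP c11 dp; apply: Zcont_holomorphic => //; apply: PhiS_neq0 => //; first exact: mask_den.
move=> j; rewrite /mask /= /den /denominator /factor_poly.
by case: (_ (+) _); rewrite ?(negbTE c01) ?(negbTE c11) hornerC oner_neq0.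
Qed.

(** J lists the finitely many denominators vanishing at p. Each is exactly its polar equation, taken
    once, and the remaining denominators form a product that is nonzero at p. *)
Lemma Zcont_simple_poles : simple_poles_among (@polar_equation R F) domain Zcont.
Proof.
move=> p dp; have [N hN] := Phi_eventually (Y 2^-1) polys0 (mask_den predT) (domain_lt1 dp).
pose S j := (den j).[Y (shift_arg j p)] == 0.
have SN j : S j -> (j.2 < N)%N.
  by apply: contraTT; rewrite -leqNgt => /hN; rewrite argumentE.
exists [seq j <- fset_boolnat N | S j]; split.
- by rewrite filter_uniq // fset_uniq.
- by move=> j; rewrite mem_filter => /andP[/eqP jz _]; rewrite -den_polar // (den_eq0 jz).
have rest0 : PhiS (mask (predC S) den) p != 0.
  apply: PhiS_neq0 => //; first exact: mask_den.
  by move=> j; rewrite /mask /=; case: ifP => // _; rewrite hornerC oner_neq0.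
exists (fun s => PhiS (mask predT num) s / PhiS (mask (predC S) den) s); split.
  apply: holomorphicM; first exact: (holomorphic_PhiS (mask_num _) dp).
  by apply: holomorphicV => //; exact: (holomorphic_PhiS (mask_den _) dp).
apply: filterS (domain_near dp) => s ds.
suff -> : \prod_(i <- [seq j <- fset_boolnat N | S j]) polar_equation F i s = PhiS (mask S den) s.
  move=> h; rewrite /Zcont (PhiS_split S mask_den ds) invfM mulrA mulrAC.
  by rewrite mulfVK.
rewrite /PhiS (@Phi_finite _ _ _ N); last first.
  by move=> j Nj; rewrite /mask; case: ifP => // /SN; rewrite ltnNge Nj.
rewrite -[RHS](eq_bigr _ (fun (k : 'I_N) _ => esym (euler_factorE (mask S den) k s))).
rewrite -(big_fset_boolnat _ N (fun j => (mask S den j).[Y (shift_arg j s)])) big_filter big_mkcond /=.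
apply: eq_bigr => j _; rewrite /mask; case: ifP => [/eqP jz|_]; last by rewrite hornerC.
by rewrite den_polar // (den_eq0 jz).
Qed.

Section Parts.
Variables (p : V) (T : pred nat).
Hypotheses (dp : domain p) (den0 : forall j, (den j).[Y (shift_arg j p)] != 0).

Lemma part_den0 : PhiS (mask (fun j => T j.2) den) p != 0.
Proof.
apply: PhiS_neq0 => //; first exact: mask_den.
by move=> j; rewrite /mask; case: ifP => // _; rewrite hornerC oner_neq0.
Qed.

Lemma part_cvg :
  (fun n => \prod_(k < n | T k) (Lfun (factor_poly (false, nat_of_ord k)) (shift_arg (false, nat_of_ord k) p) *
     Lfun (factor_poly (true, nat_of_ord k)) (shift_arg (true, nat_of_ord k) p))) @ \oo -->
  PhiS (mask (fun j => T j.2) num) p / PhiS (mask (fun j => T j.2) den) p.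
Proof.
have h1 := Phi_cvg (kappa := Y 2^-1) polys0 (mask_num (fun j => T j.2)) (domain_lt1 dp).
have h2 := Phi_cvg (kappa := Y 2^-1) polys0 (mask_den (fun j => T j.2)) (domain_lt1 dp).
have := cvgnM h1 (cvgnV part_den0 h2); apply: cvg_trans.
apply: near_eq_cvg; apply: filterE => n /=.
rewrite -prodfV -big_split [RHS]big_mkcond /=; apply: eq_bigr => k _.
rewrite !euler_factorE /mask /=; case: ifP => _; last by rewrite !hornerC !mulr1 invr1 mulr1.
by rewrite /Lfun invfM mulrACA.
Qed.

End Parts.

Lemma Zcont_split p (T : pred nat) : domain p ->
  Zcont p = PhiS (mask (fun j => T j.2) num) p / PhiS (mask (fun j => T j.2) den) p *
    (PhiS (mask (fun j => ~~ T j.2) num) p / PhiS (mask (fun j => ~~ T j.2) den) p).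
Proof.
move=> dp; rewrite /Zcont (PhiS_split (fun j => T j.2) mask_num dp).
by rewrite (PhiS_split (fun j => T j.2) mask_den dp) invfM mulrACA.
Qed.

Lemma Lquadratic_factor p j : (den j).[Y (shift_arg j p)] != 0 ->
  Lquadratic (R := R) (factor_poly j) (shift_arg j p) = Lfun (factor_poly j) (shift_arg j p).
Proof. by move=> h; apply: LquadraticE => //; rewrite /factor_poly; case: ifP. Qed.

End Continuation.

(** * The multiple Dirichlet series *)

Section PrimePolynomials.
Variable F : finFieldType.
Implicit Types (c : {poly F}) (m : monic_poly F).

Definition prime_poly : Type := {p : {poly F} | `[< monic_irreducible p >]}.
HB.instance Definition _ := Choice.on prime_poly.

Lemma prime_irr (p : prime_poly) : monic_irreducible (val p).
Proof. exact/asboolP/(valP p). Qed.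

Definition prime_monic (p : prime_poly) : monic_poly F :=
  exist (fun m : {poly F} => m \is monic) (val p) (proj1 (prime_irr p)).

Lemma prime_monic_inj : injective prime_monic.
Proof. by move=> p p' /(congr1 val) e; apply: val_inj. Qed.

Lemma degree_gt0 (p : prime_poly) : (0 < degree (prime_monic p))%N.
Proof. by rewrite /degree /= -ltnS prednK ?irr_size //; [exact: prime_irr|exact: ltnW (irr_size (prime_irr p))]. Qed.

Lemma prime_sum_le (R : realType) (r : R) (A : {fset prime_poly}) : 0 <= r -> #|F|%:R * r < 1 ->
  \sum_(p <- A) r ^+ degree (prime_monic p) <= (1 - #|F|%:R * r)^-1.
Proof.
move=> r0 qr.
have h m : nrm (rC r ^+ degree m : Cplx R) <= r ^+ degree m by rewrite nrmX nrm_pos.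
have := monic_abs_bounded r0 qr h [fset prime_monic p | p in A]%fset.
rewrite big_imfset /=; last by move=> p p' _ _; exact: prime_monic_inj.
by apply: le_trans; apply: ler_sum => p _; rewrite nrmX nrm_pos.
Qed.

Lemma prime_support (m : {poly F}) : m \is monic -> exists S : {fset prime_poly},
  forall p : prime_poly, p \notin S -> vpoly (val p) m = 0%N.
Proof.
move=> mm; have [S [S1 S2]] := irr_divisors mm.
exists [fset p in pmap (insub : {poly F} -> option prime_poly) S]%fset => p.
rewrite inE mem_pmap => pS; apply: vpoly_eq0; [exact: prime_irr|exact: monic_neq0|].
apply: contra pS => /(S2 _ (prime_irr p)) pS; apply/mapP; exists (val p) => //.
by rewrite valK.
Qed.

(** Sets the exponent of p to e whatever it was in m, as the update operation of the abstract Euler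
    product requires. *)
Definition replace_power (p : prime_poly) e (m : monic_poly F) : {poly F} :=
  coprime_part (val p) (val m) * val p ^+ e.

Lemma coprime_part_monic (p : prime_poly) (m : monic_poly F) : coprime_part (val p) (val m) \is monic.
Proof.
have [e _] := vpoly_split (prime_irr p) (monic_neq0 (valP m)).
by have := valP m; rewrite {1}e monicMr // monic_exp //; case: (prime_irr p).
Qed.

Lemma replace_power_monic p e m : replace_power p e m \is monic.
Proof. by rewrite /replace_power monicMl ?coprime_part_monic // monic_exp //; case: (prime_irr p). Qed.

Definition upd_power p e m : monic_poly F :=
  exist (fun m : {poly F} => m \is monic) _ (replace_power_monic p e m).

Lemma vpoly_upd (p : prime_poly) e m (p' : prime_poly) :
  vpoly (val p') (val (upd_power p e m)) = if p' == p then e else vpoly (val p') (val m).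
Proof.
have [eq_m nd] := vpoly_split (prime_irr p) (monic_neq0 (valP m)).
have cn0 := monic_neq0 (coprime_part_monic p m).
case: eqP => [->|pp] /=; first by rewrite /replace_power vpoly_unique //; exact: prime_irr.
have pn0 k : val p ^+ k != 0 by rewrite expf_neq0 // irr_neq0 //; exact: prime_irr.
have v0 k : vpoly (val p') (val p ^+ k) = 0%N.
  have ip' := prime_irr p'; have ip := prime_irr p; elim: k => [|k IH]; first by rewrite expr0 vpoly1.
  rewrite exprS vpolyM ?pn0 ?irr_neq0 // IH vpoly_irr // addn0.
  by case: eqP => // e1; case: pp; apply: val_inj.
rewrite /replace_power vpolyM ?pn0 //; last exact: prime_irr.
rewrite v0 addn0 [in RHS]eq_m vpolyM ?pn0 //; last exact: prime_irr.
by rewrite v0 addn0.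
Qed.

Lemma upd_powerE p e m : vpoly (val p) (val m) = 0%N -> val (upd_power p e m) = val m * val p ^+ e.
Proof. by move=> v0; rewrite /= /replace_power /coprime_part v0 expr0 divp1. Qed.

Lemma degree_upd p e m : vpoly (val p) (val m) = 0%N ->
  degree (upd_power p e m) = (e * degree (prime_monic p) + degree m)%N.
Proof.
move=> v0; rewrite {1}/degree upd_powerE //.
have mm := valP m; have mp : val p \is monic by case: (prime_irr p).
rewrite size_monicM ?monic_neq0 ?monic_exp // /degree /= addnC.
have := size_exp (val p) e; have := size_poly_gt0 (val p ^+ e); have := size_poly_gt0 (val m).
rewrite !monic_neq0 ?monic_exp //.
rewrite -!/(val _); move: (size (val m)) (size (val p ^+ e)) => [|a] // [|b] //= _ _ ->.
by rewrite addnS /= mulnC.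
Qed.

Lemma monic_poly_inj (m m' : monic_poly F) :
  (forall p : prime_poly, vpoly (val p) (val m) = vpoly (val p) (val m')) -> m = m'.
Proof.
move=> h; apply: val_inj; apply: vpoly_inj; [exact: valP|exact: valP|] => p ip.
exact: (h (exist (fun p => is_true `[< _ >]) p (asboolT ip))).
Qed.

Definition monic_one : monic_poly F := exist (fun m : {poly F} => m \is monic) 1 (monic1 _).

Variable R : realType.

Lemma chi_upd c p e m : vpoly (val p) (val m) = 0%N ->
  chi R c (val (upd_power p e m)) = chi R c (val p) ^+ e * chi R c (val m).
Proof.
move=> v0; rewrite upd_powerE // /chi; have mm := valP m; have mp : val p \is monic by case: (prime_irr p).
rewrite residue_symbolM ?monic_exp // intrM mulrC; congr (_ * _).
elim: e => [|e IH]; first by rewrite !expr0 residue_symbol1.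
by rewrite !exprS residue_symbolM ?monic_exp // intrM IH.
Qed.

Lemma chi_exp c (p : prime_poly) e : chi R c (val p ^+ e) = chi R c (val p) ^+ e.
Proof.
have v1 : vpoly (val p) (val monic_one) = 0%N by rewrite vpoly1 //; exact: prime_irr.
have := chi_upd c e v1; rewrite upd_powerE //= mul1r => ->.
by rewrite [chi R c 1]/chi residue_symbol1 mulr1.
Qed.

End PrimePolynomials.

(** * Euler products of the L-functions *)

Section LEuler.
Variables (R : realType) (F : finFieldType).
Local Notation C := (Cplx R).
Local Notation q := (#|F|%:R : R).
Local Notation Y := (@qpow R q).
Hypothesis hq : (#|F| = 1 %[mod 4])%N.

Definition L_term c (w : C) (p : prime_poly F) : C := chi R c (val p) * Y w ^+ degree (prime_monic p).

Lemma nrm_L_term c w p : nrm (L_term c w p) <= nrm (Y w) ^+ degree (prime_monic p).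
Proof. by rewrite nrmM nrmX ler_piMl ?exprn_ge0 ?nrm_ge0 // nrm_chi //; case: (prime_irr p). Qed.

Lemma L_term_half c w p : q * nrm (Y w) < 1 -> nrm (L_term c w p) <= 2^-1.
Proof.
move=> qY; apply: le_trans (nrm_L_term _ _ _) _.
have q2 : 2 <= q by rewrite ler_nat finNzRing_gt1.
have y0 := nrm_ge0 (Y w); have y2 : nrm (Y w) <= 2^-1.
  by move: (nrm (Y w)) y0 qY => y y0; nra.
rewrite -(prednK (degree_gt0 p)) exprS.
have : nrm (Y w) ^+ (degree (prime_monic p)).-1 <= 1 by rewrite exprn_ile1 //; lra.
have : 0 <= nrm (Y w) ^+ (degree (prime_monic p)).-1 by rewrite exprn_ge0.
by move: (_ ^+ _) => z; move: (nrm (Y w)) y0 y2 {qY} => y; nra.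
Qed.

Lemma L_has_prod c (w : C) : c \is monic -> squarefree_poly c -> 1 < complex.Re w ->
  has_prod (fun p => (1 - L_term c w p)^-1) (Lfun c w).
Proof.
move=> cm csq w1; have qY := qY_lt1 F w1; have y0 := nrm_ge0 (Y w).
pose f (m : monic_poly F) := chi R c (val m) * Y w ^+ degree m.
have inj (m m' : monic_poly F) : (forall p : prime_poly F, vpoly (val p) (val m) = vpoly (val p) (val m')) -> m = m'.
  exact: monic_poly_inj.
have one (p : prime_poly F) : vpoly (val p) (val (monic_one F)) = 0%N by rewrite vpoly1 //; exact: prime_irr.
have fin (m : monic_poly F) := prime_support (valP m).
have f1 : f (monic_one F) = 1.
  by rewrite /f /chi residue_symbol1 /degree /= size_poly1 expr0 mulr1.
have fu (p : prime_poly F) e (m : monic_poly F) : vpoly (val p) (val m) = 0%N ->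
    f (upd_power p e m) = L_term c w p ^+ e * f m.
  move=> v0; rewrite /f chi_upd // degree_upd // exprD mulrACA; congr (_ * _).
  by rewrite /L_term exprMn mulnC exprM.
have bd (p : prime_poly F) (A : {fset nat}) : 0%N \notin A ->
    \sum_(e <- A) nrm (L_term c w p ^+ e) <= 2 * nrm (Y w) ^+ degree (prime_monic p).
  move=> A0; under eq_bigr do rewrite nrmX.
  apply: le_trans (geometric_fset_le _ A0) _; first by rewrite nrm_ge0 L_term_half.
  by rewrite ler_pM2l // nrm_L_term.
have bs (A : {fset prime_poly F}) : \sum_(p <- A) 2 * nrm (Y w) ^+ degree (prime_monic p) <= 2 * (1 - q * nrm (Y w))^-1.
  by rewrite -mulr_sumr ler_pM2l //; exact: prime_sum_le.
have hs (p : prime_poly F) := geometric_has_sum (L_term_half c p qY).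
have [l hl1 hl2] := euler_product inj one (@vpoly_upd F) fin f1 fu bd bs hs.
suff <- : l = Lfun c w by [].
apply: has_sum_unique hl1 _; apply: has_sum_ext (L_has_sum hq cm csq w1) => m.
by rewrite cpow_pnorm.
Qed.

End LEuler.

(** The constant coefficient being 1, the rest is at most exp t - 1 <= t exp t with t = 4 (|x_0| +
    |x_1|) <= 2. The bound is linear in the |x_i|, hence summable over the primes. *)
Lemma local_coef_sum_le (R : realType) l (u : Cplx R) (x : Cplx R * Cplx R) (A : {fset nat * nat}) :
  nrm u <= 1 -> admissible l -> nrm x.1 <= 4^-1 -> nrm x.2 <= 4^-1 -> (0, 0)%N \notin A ->
  \sum_(k <- A) nrm (local_coef l u k * (x.1 ^+ k.1 * x.2 ^+ k.2)) <= 4 * expR 2 * (nrm x.1 + nrm x.2).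
Proof.
move=> u1 hl a4 b4 A0; have [ab _] := local_expansion u1 hl a4 b4.
have := ab ((0, 0)%N |` A)%fset; rewrite (big_fsetD1 (0, 0)%N) ?fset1U1 //= fsetU1K //.
rewrite local_coef0 // !expr0 !mulr1 nrm1; move: (\sum_(_ <- _) _) => S hS.
have {}hS : S <= expR (4 * (nrm x.1 + nrm x.2)) - 1 by rewrite lerBrDl.
apply: le_trans hS _; move: (nrm_ge0 x.1) (nrm_ge0 x.2) a4 b4.
move: (nrm x.1) (nrm x.2) => a b a0 b0 a4 b4; have := expR_ge1Dx (- (4 * (a + b))).
have e1 : expR (4 * (a + b)) * expR (- (4 * (a + b))) = 1 by rewrite -expRD subrr expR0.
have e2 : expR (4 * (a + b)) <= expR 2 by rewrite ler_expR; lra.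
move: (expR_gt0 (4 * (a + b))) e1 e2; move: (expR 2) (expR (4 * (a + b))) (expR (- _)) => E y z; nra.
Qed.

(** * The double Dirichlet series as a product over primes *)

Section DirichletSeries.
Variables (R : realType) (F : finFieldType).
Local Notation C := (Cplx R).
Local Notation q := (#|F|%:R : R).
Local Notation Y := (@qpow R q).
Hypothesis hq : (#|F| = 1 %[mod 4])%N.
Variables c0 c1 : {poly F}.
Hypotheses (c0_monic : c0 \is monic) (c1_monic : c1 \is monic).
Hypotheses (c0_sqfree : squarefree_poly c0) (c1_sqfree : squarefree_poly c1).
Hypothesis c01_coprime : coprimep c0 c1.
Implicit Types (p : prime_poly F) (m : monic_poly F * monic_poly F).

Definition local_weight p : nat * nat := (vpoly (val p) c0, vpoly (val p) c1).
Definition local_u p : C := ((pnorm R (val p) `^ (- 2^-1))%:C)%C.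
(** The coprime part is prime to p, so this is 1 or -1 even when p divides the polynomial;
    [chi_general] accounts for the zeros. *)
Definition local_sign (b : bool) p : C := chi R (coprime_part (val p) (if b then c1 else c0)) (val p).

Lemma local_uE p : local_u p = Y 2^-1 ^+ degree (prime_monic p).
Proof.
rewrite -(cpow_pnorm (prime_monic p)) /local_u /powR /cpow /=.
have q0 : 0 < pnorm R (val p) by rewrite /pnorm exprn_gt0 // (lt_trans ltr01) // q_gt1.
rewrite gt_eqF // -[RHS](_ : cexp (rC (- 2^-1 * ln (pnorm R (val p)))) = _); first by rewrite cexp_rC.
by rewrite rCM rCN rCV rCn.
Qed.

Lemma nrm_local_u p : nrm (local_u p) <= 1.
Proof.
rewrite local_uE nrmX exprn_ile1 ?nrm_ge0 // nrm_qpow -[X in _ <= X]expR0 ler_expR.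
have l0 := lnq0 (q_gt1 R F); have -> : complex.Re (2^-1 : C) = 2^-1.
  by rewrite (_ : (2^-1 : C) = rC 2^-1) // rCV rCn.
by move: (ln q) l0 => x; nra.
Qed.

Lemma vpoly_sqfree (c : {poly F}) p : c \is monic -> squarefree_poly c -> (vpoly (val p) c <= 1)%N.
Proof.
move=> cm sq; rewrite leqNgt; apply/negP => v2; have ip := prime_irr p.
have := irr_size ip; rewrite (sq (val p)) //.
by rewrite (vpolyP _ ip) // monic_neq0.
Qed.

Lemma admissible_weight p : admissible (local_weight p).
Proof.
have ip := prime_irr p.
have h : ~ ((0 < vpoly (val p) c0)%N /\ (0 < vpoly (val p) c1)%N).
  rewrite !vpoly_gt0 ?monic_neq0 // => -[p0 p1].
  have := irr_size ip; have : val p %| gcdp c0 c1 by rewrite dvdp_gcd p0 p1.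
  move/dvdp_leq; rewrite -size_poly_gt0 (eqP c01_coprime) => /(_ isT).
  by case: (size (val p)) => [|[]].
have := vpoly_sqfree p c0_monic c0_sqfree; have := vpoly_sqfree p c1_monic c1_sqfree.
rewrite /admissible /local_weight.
move: (vpoly _ c0) (vpoly _ c1) h => [|[|a]] [|[|b]] h //.
by case: h.
Qed.

Lemma coprime_part_ndvd (c : {poly F}) p : c \is monic -> ~~ (val p %| coprime_part (val p) c).
Proof. by move=> cm; have [] := vpoly_split (prime_irr p) (monic_neq0 cm). Qed.

Lemma local_sign_cases b p : local_sign b p = 1 \/ local_sign b p = -1.
Proof.
have ip := prime_irr p; rewrite /local_sign /chi residue_symbol_irr // /legendre.
rewrite (negbTE (coprime_part_ndvd p _)); last by case: b.
by case: ifP => _; [left|right]; rewrite ?mulrNz mulr1z.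
Qed.

Lemma local_sign2 b p : local_sign b p * local_sign b p = 1.
Proof. by case: (local_sign_cases b p) => ->; rewrite ?mulrNN mulr1. Qed.

Lemma nrm_local_sign b p : nrm (local_sign b p) = 1.
Proof. by case: (local_sign_cases b p) => ->; rewrite ?nrmN nrm1. Qed.

Lemma chi_general b p : chi R (if b then c1 else c0) (val p) =
  if general (local_weight p) b then local_sign b p else 0.
Proof.
have ip := prime_irr p; rewrite /general /local_weight /local_sign.
have -> : coord01 b (vpoly (val p) c0, vpoly (val p) c1) = vpoly (val p) (if b then c1 else c0) by case: b.
have : (if b then c1 else c0) \is monic by case: b.
move: (if b then c1 else c0) => c cm; case: eqP => [v0|/eqP].
  by rewrite /coprime_part v0 expr0 divp1.
rewrite -lt0n vpoly_gt0 ?monic_neq0 // => pc.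
by rewrite /chi residue_symbol_irr // /legendre pc.
Qed.

Section Point.
Variable s : C * C.
Hypotheses (s0 : 2 < complex.Re s.1) (s1 : 2 < complex.Re s.2).

Definition local_point p : C * C :=
  (local_sign false p * Y s.1 ^+ degree (prime_monic p), local_sign true p * Y s.2 ^+ degree (prime_monic p)).

Lemma shift_arg_Re j : 1 < complex.Re (shift_arg j s).
Proof.
rewrite /shift_arg /delta01 !cReD cReM Re_nat Im_nat mul0r subr0 cReD.
rewrite (_ : (2^-1 : C) = rC 2^-1); last by rewrite rCV rCn.
have h : 2 < complex.Re (coord01 j.1 s) by case: j.1.
have k0 : 0 <= j.2%:R :> R by [].
rewrite /rC /=; move: (complex.Re _) h (complex.Re s.1) (complex.Re s.2) s0 s1 (j.2%:R) k0 => x hx a b ha hb k k0.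
nra.
Qed.

Lemma L_term_local j p : L_term (factor_poly c0 c1 j) (shift_arg j s) p =
  local_term (local_weight p) (local_u p) (local_point p) j.
Proof.
case: j => b k; rewrite /L_term /factor_poly /= chi_general /local_term /=.
set d := degree _; case: ifP => _; last by rewrite mul0r.
rewrite -argumentE /argument local_uE -/d.
(* For even k the power of e_0 e_1 is 1; for odd k it is e_0 e_1, and e_b e_0 e_1 is the sign of the
   other index. *)
have -> : local_sign (b (+) odd k) p = coord01 b (local_sign false p, local_sign true p) *
    (local_sign false p * local_sign true p) ^+ k.
  have sq : (local_sign false p * local_sign true p) ^+ 2 = 1.
    by rewrite expr2 mulrACA !local_sign2 mulr1.
  rewrite -[in RHS](odd_double_half k) exprD -mul2n exprM sq expr1n mulr1.
  case: (odd k); last by rewrite addbF expr0 mulr1; case: b.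
  rewrite expr1 addbT.
  by case: b => /=; [rewrite mulrCA local_sign2 mulr1|rewrite mulrA local_sign2 mul1r].
rewrite /local_point -/d /coords /=.
move: (Y 2^-1) (Y s.1) (Y s.2) (local_sign false p) (local_sign true p) => y y0 y1 e0 e1.
rewrite !exprMn -!exprM [(k * d)%N]mulnC.
by case: b => /=; rewrite ?exprMn; ring.
Qed.

(** As q >= 2, Re w > 2 gives |q^(-w)| <= q^(-2) <= 1/4: this is where the threshold 2 comes from,
    the local formulas being available on the radius 1/4. *)
Lemma nrm_Y_le w : 2 < complex.Re w -> nrm (Y w) <= 4^-1.
Proof.
move=> w2; have l0 := lnq0 (q_gt1 R F); have q2 : 2 <= q by rewrite ler_nat finNzRing_gt1.
have q0 : 0 < q by lra.
rewrite nrm_qpow; apply: le_trans (_ : expR (- ln q + - ln q) <= _).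
  by rewrite ler_expR; move: (ln q) l0 (complex.Re w) w2 => x x0 y y0; nra.
rewrite expRD expRN lnK ?posrE // -invfM lef_pV2 ?posrE ?mulr_gt0 //.
by move: q q2 q0 => x; nra.
Qed.

Lemma nrm_local_point b p : nrm (coord01 b (local_point p)) = nrm (Y (coord01 b s)) ^+ degree (prime_monic p).
Proof. by case: b; rewrite nrmM nrm_local_sign mul1r nrmX. Qed.

Lemma local_point_le b p : nrm (coord01 b (local_point p)) <= 4^-1.
Proof.
have h : nrm (Y (coord01 b s)) <= 4^-1 by apply: nrm_Y_le; case: b.
rewrite nrm_local_point -(prednK (degree_gt0 p)) exprS; have h0 := nrm_ge0 (Y (coord01 b s)).
have : nrm (Y (coord01 b s)) ^+ (degree (prime_monic p)).-1 <= 1 by rewrite exprn_ile1 //; lra.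
have : 0 <= nrm (Y (coord01 b s)) ^+ (degree (prime_monic p)).-1 by rewrite exprn_ge0.
by move: (_ ^+ _) => z; move: (nrm _) h h0 => y; nra.
Qed.

Definition prime_bound : R := (1 - q * nrm (Y s.1))^-1 + (1 - q * nrm (Y s.2))^-1.

Lemma local_point_sum (A : {fset prime_poly F}) :
  \sum_(p <- A) (nrm (local_point p).1 + nrm (local_point p).2) <= prime_bound.
Proof.
have h b : q * nrm (Y (coord01 b s)) < 1 by apply: qY_lt1; apply: lt_trans (_ : 2 < _); [lra|case: b].
rewrite big_split /=; apply: lerD.
  rewrite (eq_bigr _ (fun p _ => nrm_local_point false p)); exact: prime_sum_le (nrm_ge0 _) (h false).
rewrite (eq_bigr _ (fun p _ => nrm_local_point true p)); exact: prime_sum_le (nrm_ge0 _) (h true).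
Qed.

Definition pair_term (x : prime_poly F * (bool * nat)) : C :=
  local_term (local_weight x.1) (local_u x.1) (local_point x.1) x.2.

Lemma pair_has_prod : exists l, has_prod (fun x => (1 - pair_term x)^-1) l.
Proof.
have [|A|_ [l _ hl]] := @geometric_product R _ pair_term (4 * prime_bound); last by exists l.
  by move=> [p j]; apply: local_term_half; [exact: nrm_local_u|exact: (local_point_le false)|exact: (local_point_le true)].
pose A1 := [fset x.1 | x in A]%fset; pose A2 := [fset x.2 | x in A]%fset.
apply: le_trans (_ : \sum_(x <- [fset ((p, j) : (prime_poly F * (bool * nat))%type) | p in A1, j in A2]%fset) 2 * nrm (pair_term x) <= _).
  apply: ler_sum_fsub => [x|]; first by rewrite mulr_ge0 ?nrm_ge0.
  apply/fsubsetP => -[p j] xA; apply/imfset2P; exists p; first by apply/imfsetP; exists (p, j).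
  by exists j => //; apply/imfsetP; exists (p, j).
rewrite big_imfset2 /=; last by move=> [p j] [p' j'] _ _ /= [-> ->].
apply: le_trans (_ : \sum_(p <- A1) 4 * (nrm (local_point p).1 + nrm (local_point p).2) <= _).
  apply: ler_sum => p _.
  exact: (local_term_sum (local_weight p) (nrm_local_u p) (local_point_le false p) (local_point_le true p) A2).
by rewrite -mulr_sumr ler_pM2l // local_point_sum.
Qed.

Definition local_factor p : C := (local_denominator (local_weight p) (local_u p) (local_point p))^-1.

(** The product over all pairs of a prime and an index (i, k) converges absolutely. Over (i, k)
    first it gives the local factors, over the primes first the L-values. *)
Lemma Zcont_has_prod : has_prod local_factor (Zcont c0 c1 s).
Proof.
have [l hl] := pair_has_prod.
have h1 : has_prod local_factor l.
  apply: has_prod_iterated hl _ => p.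
  have [_ _] := local_product (nrm_local_u p) (admissible_weight p) (local_point_le false p) (local_point_le true p).
  by apply: has_prod_ext.
have h2 : has_prod (fun j => Lfun (factor_poly c0 c1 j) (shift_arg j s)) l.
  apply: has_prod_iterated (has_prod_swap hl) _ => j.
  have cm : factor_poly c0 c1 j \is monic by rewrite /factor_poly; case: ifP.
  have csq : squarefree_poly (factor_poly c0 c1 j) by rewrite /factor_poly; case: ifP.
  by apply: has_prod_ext (L_has_prod hq cm csq (shift_arg_Re j)) => p; rewrite L_term_local.
suff <- : l = Zcont c0 c1 s by [].
have ds : domain s.
  rewrite /domain /= /delta01 cReD.
  by apply: addr_gt0; [exact: lt_trans s0|exact: lt_trans s1].
have := has_prod_exhaust fset_boolnatP h2.
under eq_fun do rewrite big_fset_boolnat.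
move/cvgn_unique; apply.
have den0 j : (den R c0 c1 j).[Y (shift_arg j s)] != 0 by exact: denominator_Re (shift_arg_Re j).
exact: (part_cvg (T := predT) c0_monic c1_monic ds den0).
Qed.

Definition Dirichlet_term m : C :=
  Hcoef R (val m.1) (val m.2) c0 c1 * cpow (pnorm R (val m.1)) (- s.1) * cpow (pnorm R (val m.2)) (- s.2).

Definition local_H p (k : nat * nat) : C :=
  local_coef (local_weight p) (local_u p) k * (local_sign false p ^+ k.1 * local_sign true p ^+ k.2).

(** At primes outside S only the constant local coefficient occurs, and it is 1. *)
Lemma HcoefE m (S : {fset prime_poly F}) :
  (forall p, p \notin S -> vpoly (val p) (val m.1) = 0%N /\ vpoly (val p) (val m.2) = 0%N) ->
  Hcoef R (val m.1) (val m.2) c0 c1 = \prod_(p <- S) local_H p (vpoly (val p) (val m.1), vpoly (val p) (val m.2)).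
Proof.
move=> hS.
have hE p : Hlocal R (val p) (vpoly (val p) (val m.1), vpoly (val p) (val m.2)) c0 c1 *
     chi R (coprime_part (val p) c0) (val p ^+ vpoly (val p) (val m.1)) *
     chi R (coprime_part (val p) c1) (val p ^+ vpoly (val p) (val m.2)) =
     local_H p (vpoly (val p) (val m.1), vpoly (val p) (val m.2)).
  rewrite !chi_exp /Hlocal (expansion_local (admissible_weight p) (nrm_local_u p)) -mulrA.
  by [].
rewrite /Hcoef (@fsbig_on _ _ _ [seq val p | p <- S]).
- by rewrite big_map; apply: eq_bigr => p _; exact: hE.
- by rewrite map_inj_uniq ?fset_uniq //; exact: val_inj.
- by move=> _ /mapP[p _ ->]; exact: prime_irr.
- move=> a ia; pose p : prime_poly F := exist (fun a : {poly F} => is_true `[< _ >]) a (asboolT ia).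
  have [pS|pS _] := boolP (p \in S); first by move/mapP; case; exists p.
  have := hE p; have [-> ->] := hS p pS => ->.
  by rewrite /local_H (local_coef0 (nrm_local_u p) (admissible_weight p)) !expr0 !mulr1.
Qed.

Lemma pair_support m : exists A : {fset prime_poly F},
  forall p, p \notin A -> vpoly (val p) (val m.1) = 0%N /\ vpoly (val p) (val m.2) = 0%N.
Proof.
have [A1 h1] := prime_support (valP m.1); have [A2 h2] := prime_support (valP m.2).
by exists (A1 `|` A2)%fset => p; rewrite in_fsetU negb_or => /andP[/h1 -> /h2 ->].
Qed.

Definition upd_pair p (k : nat * nat) m : monic_poly F * monic_poly F :=
  (upd_power p k.1 m.1, upd_power p k.2 m.2).

Lemma Dirichlet_term_upd p k m : (vpoly (val p) (val m.1), vpoly (val p) (val m.2)) = (0, 0)%N ->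
  Dirichlet_term (upd_pair p k m) =
  local_coef (local_weight p) (local_u p) k * ((local_point p).1 ^+ k.1 * (local_point p).2 ^+ k.2) *
  Dirichlet_term m.
Proof.
move=> [v0 v1]; rewrite /Dirichlet_term !cpow_pnorm !degree_upd // !exprD.
have [A hA] := pair_support m; pose S := (p |` A)%fset.
have hS p' : p' \notin S -> vpoly (val p') (val m.1) = 0%N /\ vpoly (val p') (val m.2) = 0%N.
  by move=> pS; apply: hA; apply: contraNN pS => pA; exact: fset1Ur.
have hS' p' : p' \notin S -> vpoly (val p') (val (upd_pair p k m).1) = 0%N /\
    vpoly (val p') (val (upd_pair p k m).2) = 0%N.
  move=> pS; have pp : (p' == p) = false by apply: contraNF pS => /eqP ->; rewrite fset1U1.
  by rewrite !vpoly_upd pp; exact: hS.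
rewrite (HcoefE hS) (HcoefE hS').
have D (G : prime_poly F -> C) : \prod_(i <- S) G i = G p * \prod_(i <- (S `\ p)%fset) G i.
  by apply: big_fsetD1; exact: fset1U1.
rewrite !D !vpoly_upd eqxx v0 v1 [local_H p (0, 0)%N]/local_H (local_coef0 (nrm_local_u p) (admissible_weight p)) !expr0.
rewrite (_ : \prod_(i <- (S `\ p)%fset) local_H i _ = \prod_(i <- (S `\ p)%fset) local_H i (vpoly (val i) (val m.1), vpoly (val i) (val m.2))); last first.
  rewrite big_seq [RHS]big_seq; apply: eq_bigr => p'; rewrite in_fsetD1 => /andP[/negbTE pp _].
  by rewrite !vpoly_upd pp.
rewrite /local_H /local_point /= -surjective_pairing !mul1r.
set d := degree _; set P := \prod_(_ <- _) _.
move: d P (degree _) (degree _) (local_coef _ _ _) (local_sign _ _) (local_sign _ _) (Y _) (Y _) => d P d0 d1 w e0 e1 y0 y1.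
rewrite !exprMn -!exprM ![(_ * d)%N]mulnC.
ring.
Qed.

(** The series and the continuation are both the limit of the product of the local factors over the
    primes. *)
Lemma Dirichlet_has_sum : has_sum Dirichlet_term (Zcont c0 c1 s).
Proof.
pose v m p := (vpoly (val p) (val m.1), vpoly (val p) (val m.2)).
pose one : monic_poly F * monic_poly F := (monic_one F, monic_one F).
pose h p (k : nat * nat) := local_coef (local_weight p) (local_u p) k * ((local_point p).1 ^+ k.1 * (local_point p).2 ^+ k.2).
have inj m m' : (forall p, v m p = v m' p) -> m = m'.
  case: m m' => [m0 m1] [m0' m1'] e; congr (_, _); apply: monic_poly_inj => p; by case: (e p).
have v1 p : v one p = (0, 0)%N by rewrite /v /= vpoly1 //; exact: prime_irr.
have vu p k m p' : v (upd_pair p k m) p' = if p' == p then k else v m p'.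
  by rewrite /v !vpoly_upd; case: eqP => // _; case: k.
have fin m : exists S : {fset prime_poly F}, forall p, p \notin S -> v m p = (0, 0)%N.
  by have [A hA] := pair_support m; exists A => p /hA[e e']; rewrite /v e e'.
have f1 : Dirichlet_term one = 1.
  have h0 p : p \notin (fset0 : {fset prime_poly F}) ->
      vpoly (val p) (val one.1) = 0%N /\ vpoly (val p) (val one.2) = 0%N.
    by move=> _; have := v1 p; rewrite /v => -[e e']; split.
  by rewrite /Dirichlet_term (HcoefE h0) !cpow_pnorm big_seq_fset0 /degree /= size_poly1 !expr0 !mulr1.
have bd p (A : {fset nat * nat}) : (0, 0)%N \notin A ->
    \sum_(k <- A) nrm (h p k) <= 4 * expR 2 * (nrm (local_point p).1 + nrm (local_point p).2).
  exact: (local_coef_sum_le (nrm_local_u p) (admissible_weight p) (local_point_le false p) (local_point_le true p)).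
have bs (A : {fset prime_poly F}) : \sum_(p <- A) 4 * expR 2 * (nrm (local_point p).1 + nrm (local_point p).2) <=
    4 * expR 2 * prime_bound.
  by rewrite -mulr_sumr ler_pM2l ?local_point_sum // mulr_gt0 // expR_gt0.
have hs p : has_sum (h p) (local_factor p).
  exact: (local_expansion (nrm_local_u p) (admissible_weight p) (local_point_le false p) (local_point_le true p)).2.
have [l hl1 hl2] := euler_product inj v1 vu fin f1 (fun p k m => @Dirichlet_term_upd p k m) bd bs hs.
by rewrite -(has_prod_unique hl2 Zcont_has_prod).
Qed.

End Point.
End DirichletSeries.

Lemma cvgn_lim_mul (R : realType) (f g : nat -> Cplx R) (a b z : Cplx R) :
  f @ \oo --> a -> g @ \oo --> b -> z = a * b -> [/\ cvgn f, cvgn g & z = limn f * limn g].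
Proof.
move=> fa gb ->; split; [exact: (cvgP a fa)|exact: (cvgP b gb)|].
by rewrite (cvg_lim _ fa) // (cvg_lim _ gb).
Qed.

Theorem theorem6p5 (R : realType) (F : finFieldType)
  (hq : (#|F| = 1 %[mod 4])%N) (c0 c1 : {poly F})
  (c0_monic : c0 \is monic) (c1_monic : c1 \is monic)
  (c0_sqfree : squarefree_poly c0) (c1_sqfree : squarefree_poly c1)
  (c01_coprime : coprimep c0 c1) :
  exists Z : Cplx R * Cplx R -> Cplx R,
    let D := [set s : Cplx R * Cplx R | 0 < complex.Re (delta01 s)] in
    let L c (s : Cplx R) (k : nat) (w : Cplx R * Cplx R) : Cplx R :=
      Lquadratic (R := R) c (2^-1 + s + k%:R * delta01 w) in
    let even_part (s : Cplx R * Cplx R) (n : nat) : Cplx R :=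
      \prod_(k < n | ~~ odd k) (L c0 s.1 k s * L c1 s.2 k s) in
    let odd_part (s : Cplx R * Cplx R) (n : nat) : Cplx R :=
      \prod_(k < n | odd k) (L c1 s.1 k s * L c0 s.2 k s) in
    [/\ is_multiple_Dirichlet c0 c1 Z,
        c0 <> 1 -> c1 <> 1 -> forall s, D s -> holomorphic_at Z s,
        c0 = 1 \/ c1 = 1 -> simple_poles_among (polar_equation F) D Z &
        forall s, D s -> holomorphic_at Z s ->
          [/\ cvgn (even_part s), cvgn (odd_part s) &
              Z s = limn (even_part s) * limn (odd_part s)]].
Proof.
exists (Zcont c0 c1) => D L even_part odd_part; split.
- split; first exact: meromorphic_Zcont.
  by exists 2 => s s0 s1; exact: Dirichlet_has_sum.
- by move=> c0n c1n s Ds; exact: Zcont_entire.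
- by move=> _; exact: Zcont_simple_poles.
(* Holomorphy at s excludes the vanishing of any denominator, so each chosen L-value is given by its
   rational formula. *)
move=> s Ds hs; have den0 := holomorphic_den hq c0_monic c1_monic Ds hs.
have LE j : Lquadratic (R := R) (factor_poly c0 c1 j) (shift_arg j s) = Lfun (factor_poly c0 c1 j) (shift_arg j s).
  exact: Lquadratic_factor.
have [le leE he] : exists2 l, l = PhiS F (mask (fun j => ~~ odd j.2) (num R c0 c1)) s /
    PhiS F (mask (fun j => ~~ odd j.2) (den R c0 c1)) s & even_part s @ \oo --> l.
  eexists; first by [].
  apply: cvg_trans (part_cvg (T := fun k => ~~ odd k) c0_monic c1_monic Ds den0).
  apply: near_eq_cvg; apply: filterE => n; apply: eq_bigr => k ek.
  by rewrite -!LE /factor_poly /= (negbTE ek).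
have [lo loE ho] : exists2 l, l = PhiS F (mask (fun j => odd j.2) (num R c0 c1)) s /
    PhiS F (mask (fun j => odd j.2) (den R c0 c1)) s & odd_part s @ \oo --> l.
  eexists; first by [].
  apply: cvg_trans (part_cvg (T := odd) c0_monic c1_monic Ds den0).
  apply: near_eq_cvg; apply: filterE => n; apply: eq_bigr => k ek.
  by rewrite -!LE /factor_poly /= ek.
apply: (cvgn_lim_mul he ho).
by rewrite (Zcont_split c0_monic c1_monic odd Ds) leE loE mulrC.
Qed.
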